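(* Let assumptions (a) and (b) of the context hold and let $L$, $\mu$, $\mathbb{M}$ be as in the context. Suppose that for every compact $V\subset\mathbb{R}^d$ there exist $M_V\ge0$ and $\alpha_V\in(0,1)$ with $|a_{ij}(x)-a_{ij}(y)|\le M_V\|x-y\|^{\alpha_V}$ for all $x,y\in V$, $1\le i,j\le d$. Suppose that $\mu$ is an invariant measure for $\mathbb{M}$, and let $$\widetilde{\mathbb{M}}=(\widetilde\Omega,\widetilde{\mathcal{F}},(\widetilde{\mathcal{F}}_t)_{t\ge0},(\widetilde{X}_t)_{t\ge0},(\widetilde{\mathbb{P}}_x)_{x\in\mathbb{R}^d\cup\{\Delta\}})$$ be a right process with state space $\mathbb{R}^d$ which solves the martingale problem for $(L,C_0^\infty(\mathbb{R}^d))$ with respect to $\mu$, such that $\mu$ is a sub-invariant measure for $\widetilde{\mathbb{M}}$. Assume further that $$\widetilde{\mathbb{E}}_\cdot[f(\widetilde{X}_t)]\in C(\mathbb{R}^d)\qquad\forall f\in C_0^\infty(\mathbb{R}^d),\ t>0.$$ Then $\mu$ is an invariant measure for $\widetilde{\mathbb{M}}$ and $$\widetilde{\mathbb{P}}_x\circ\widetilde{X}^{-1}=\mathbb{P}_x\circ X^{-1}\quad\text{on }\mathcal{B}(C([0,\infty),\mathbb{R}^d))\text{ for all }x\in\mathbb{R}^d,$$ hence $\widetilde{\mathbb{M}}$ inherits all properties of $\mathbb{M}$ that only depend on its law.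
   Context: Let $d\ge2$, $p\in(d,\infty)$, $q=\frac{pd}{p+d}$. For a matrix $B=(b_{ij})$ of functions, $\nabla B$ is the vector field with $i$-th component $\sum_j\partial_jb_{ij}$. Assumption (a): $A=(a_{ij})$ with $a_{ji}=a_{ij}\in H^{1,2}_{loc}(\mathbb{R}^d)\cap C(\mathbb{R}^d)$, such that for every relatively compact $V$ there is $\nu_V>0$ with $\nu_V^{-1}\|\xi\|^2\le\langle A(x)\xi,\xi\rangle\le\nu_V\|\xi\|^2$ for all $\xi\in\mathbb{R}^d$, $x\in V$; $C=(c_{ij})$ with $-c_{ji}=c_{ij}\in H^{1,2}_{loc}(\mathbb{R}^d)\cap C(\mathbb{R}^d)$; $\mathbf{H}\in L^p_{loc}(\mathbb{R}^d,\mathbb{R}^d)$. Put $\mathbf{G}=(g_1,\dots,g_d)=\tfrac12\nabla(A+C^T)+\mathbf{H}$ and $Lf=\tfrac12\sum_{i,j}a_{ij}\partial_{ij}f+\sum_ig_i\partial_if$, $f\in C^2(\mathbb{R}^d)$. Assumption (b): $\mathbf{G}\in L^q_{loc}(\mathbb{R}^d,\mathbb{R}^d)$. Measure: $\mu=\rho\,dx$, where $\rho\in H^{1,p}_{loc}(\mathbb{R}^d)\cap C(\mathbb{R}^d)$, $\rho>0$ everywhere, and $\int Lf\,d\mu=0$ for all $f\in C_0^\infty(\mathbb{R}^d)$ (such $\rho$ exists under (a); one is fixed). Semigroup: put $\beta^{\rho,A}_i=\tfrac12\sum_j(\partial_ja_{ij}+a_{ij}\tfrac{\partial_j\rho}\rho)$,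 $\mathbf{B}=\mathbf{G}-\beta^{\rho,A}$. For relatively compact open $V$ let $(L^{0,V},D(L^{0,V}))$ be the self-adjoint generator on $L^2(V,\mu)$ of the closure of $\tfrac12\int_V\langle A\nabla u,\nabla v\rangle d\mu$, $u,v\in C_0^\infty(V)$. The operator $L^{0,V}u+\langle\mathbf{B},\nabla u\rangle$ on bounded $u\in D(L^{0,V})$ is closable in $L^1(V,\mu)$ and its closure generates a sub-Markovian $C_0$-semigroup of contractions, with resolvent $\overline{G}^V_\alpha$; put $\overline{G}^V_\alpha f:=\overline{G}^V_\alpha(f1_V)$ (zero outside $V$) for $f\in L^1(\mathbb{R}^d,\mu)$. For relatively compact open $V_n\uparrow\mathbb{R}^d$ the limits $\overline{G}_\alpha f=\lim_n\overline{G}^{V_n}_\alpha f$ exist in $L^1(\mathbb{R}^d,\mu)$, do not depend on $(V_n)$, and form the resolvent of a sub-Markovian $C_0$-semigroup of contractions $(\overline{T}_t)_{t>0}$ on $L^1(\mathbb{R}^d,\mu)$, whose generator extends $(L,C_0^\infty(\mathbb{R}^d))$. $(T_t)_{t>0}$ denotes the sub-Markovian semigroup on every $L^s(\mathbb{R}^d,\mu)$, $s\in[1,\infty]$, obtained by restricting $(\overline{T}_t)$ to $L^1\cap L^\infty$ and extending. For $f\in\bigcup_{s\in[1,\infty]}L^s(\mathbb{R}^d,\mu)$ and $t>0$, $T_tf$ has a continuous $\mu$-version, denoted $P_tf$; $P_0=\mathrm{id}$. Process: under (a) and (b), $\mathbb{M}=(\Omega,\mathcal{F},(\mathcal{F}_t)_{t\ge0},(X_t)_{t\ge0},(\mathbb{P}_x)_{x\in\mathbb{R}^d\cup\{\Delta\}})$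 is the Hunt process with state space $\mathbb{R}^d$, with continuous sample paths on the one-point compactification $\mathbb{R}^d_\Delta$ (absorbed at $\Delta$ after the lifetime $\zeta=\inf\{t\ge0:X_t=\Delta\}$), such that $P_tf(x)=\mathbb{E}_x[f(X_t)]$ for all $t\ge0$, $x\in\mathbb{R}^d$, $f$ bounded Borel, with $f(\Delta):=0$. Definitions. A right process with state space $\mathbb{R}^d$ is a normal (i.e. $\widetilde{\mathbb{P}}_x(\widetilde{X}_0=x)=1$ for all $x\in\mathbb{R}^d_\Delta$) strong Markov process with values in $\mathbb{R}^d_\Delta$, right-continuous filtration, shift operators, lifetime $\widetilde\zeta$ with $\widetilde{X}_t=\Delta$ iff $t\ge\widetilde\zeta$, and paths that are right-continuous on $[0,\infty)$. $\widetilde{\mathbb{E}}_x$ is expectation w.r.t. $\widetilde{\mathbb{P}}_x$. For a measure $\nu$, $\widetilde{\mathbb{P}}_\nu(\cdot)=\int\widetilde{\mathbb{P}}_x(\cdot)\nu(dx)$. $\widetilde{\mathbb{M}}$ solves the martingale problem for $(L,C_0^\infty(\mathbb{R}^d))$ with respect to $\mu$ if for all $u\in C_0^\infty(\mathbb{R}^d)$, $u(\widetilde{X}_t)-u(\widetilde{X}_0)-\int_0^tLu(\widetilde{X}_s)ds$, $t\ge0$, is a continuous $(\widetilde{\mathcal{F}}_t)_{t\ge0}$-martingale under $\widetilde{\mathbb{P}}_{v\mu}$ for every bounded Borel $v\ge0$ with $\int v\,d\mu=1$. A $\sigma$-finite measure $\widetilde\mu$ on $\mathcal{B}(\mathbb{R}^d)$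 is invariant for $\widetilde{\mathbb{M}}$ if $\int\widetilde{\mathbb{P}}_x(\widetilde{X}_t\in E)\widetilde\mu(dx)=\widetilde\mu(E)$ for all $t\ge0$, $E\in\mathcal{B}(\mathbb{R}^d)$, and sub-invariant if this holds with $\le$; likewise for $\mathbb{M}$. *)

(* Defs.v *)
From HB Require Import structures.
From mathcomp Require Import all_boot all_order all_algebra.
From mathcomp Require Import all_classical all_reals all_analysis.
From mathcomp Require Import measurable_realfun.

Set Implicit Arguments.
Unset Strict Implicit.
Unset Printing Implicit Defensive.
Import Order.TTheory GRing.Theory Num.Theory.
Import numFieldNormedType.Exports.

Local Open Scope classical_set_scope.
Local Open Scope ring_scope.

(* Both R^d = 'rV[R]_d and its one-point compactification carry their Borel
   sigma-algebra.  In the latter, None is the cemetery Delta. *)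
HB.instance Definition _ (R : realType) (m n : nat) :=
  @isMeasurable.Build (sigma_display (@open 'M[R]_(m, n))) 'M[R]_(m, n)
    <<s (@open 'M[R]_(m, n)) >> (@sigma_algebra0 _ setT _)
    (@sigma_algebraC _ (@open 'M[R]_(m, n)))
    (@sigma_algebra_bigcup _ setT _).

HB.instance Definition _ (X : ptopologicalType) :=
  @isMeasurable.Build (sigma_display (@open (one_point_compactification X)))
    (one_point_compactification X)
    <<s (@open (one_point_compactification X)) >> (@sigma_algebra0 _ setT _)
    (@sigma_algebraC _ (@open (one_point_compactification X)))
    (@sigma_algebra_bigcup _ setT _).

Section Calculus.
Context {R : realType} {d : nat}.
Local Notation E := 'rV[R]_d.

(* The norm of the library on 'rV[R]_d is the sup norm. *)
Definition enorm (x : E) : R := Num.sqrt (\sum_(i < d) x 0 i ^+ 2).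

Definition partial (i : 'I_d) (f : E -> R) : E -> R :=
  fun x => 'D_(delta_mx 0 i) f x.

Definition smooth (f : E -> R) : Prop :=
  forall s : seq 'I_d, continuous (foldr partial f s) /\
    forall (i : 'I_d) (x : E), derivable (foldr partial f s) x (delta_mx 0 i).

(* C_0^infty(U) for an open set U, the functions being extended by zero. *)
Definition test_function (U : set E) (f : E -> R) : Prop :=
  let supp := closure [set x | f x != 0] in
  [/\ smooth f, compact supp & supp `<=` U].

Definition relatively_compact (V : set E) : Prop := compact (closure V).

(* Characterises d-dimensional Lebesgue measure on the Borel sets. *)
Definition is_lebesgue (lam : {measure set E -> \bar R}) : Prop :=
  forall a b : E, (forall i, a 0 i <= b 0 i) ->
    lam [set x | forall i, a 0 i <= x 0 i <= b 0 i] =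
      (\prod_(i < d) (b 0 i - a 0 i))%:E.

Definition has_density (lam mu : {measure set E -> \bar R}) (rho : E -> R) :=
  forall B, measurable B -> mu B = (\int[lam]_(x in B) (rho x)%:E)%E.

(* Zero is the value at the cemetery. *)
Definition ext0 (f : E -> R) (z : one_point_compactification E) : R :=
  if z is Some x then f x else 0.

End Calculus.

Section Sobolev.
Context {R : realType} {d : nat}.
Local Notation E := 'rV[R]_d.
Variable lam : {measure set E -> \bar R}.

Definition Lp_loc (p : R) (f : E -> R) : Prop :=
  measurable_fun setT f /\
  forall K : set E, compact K ->
    (\int[lam]_(x in K) (`|f x| `^ p)%:E < +oo)%E.

Definition weak_partial (U : set E) (i : 'I_d) (f g : E -> R) : Prop :=
  forall phi, test_function U phi ->
    \int[lam]_(x in U) (f x * partial i phi x) =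
      - \int[lam]_(x in U) (g x * phi x).

(* f belongs to H^{1,p}_loc(R^d) and Df is a Borel version of its weak
   gradient. *)
Definition H1p_loc (p : R) (f : E -> R) (Df : 'I_d -> E -> R) : Prop :=
  Lp_loc p f /\
  forall i, Lp_loc p (Df i) /\ weak_partial setT i f (Df i).

End Sobolev.

Section Coefficients.
Context {R : realType} {d : nat}.
Local Notation E := 'rV[R]_d.
Variable lam : {measure set E -> \bar R}.
(* In these definitions DA i j k and DC i j k are versions of the weak
   derivatives of the entries (i, j) of A and C in direction k. *)
Variables (A C : E -> 'M[R]_d) (DA DC : 'I_d -> 'I_d -> 'I_d -> E -> R).
Variables (H : 'I_d -> E -> R).

Definition locally_elliptic : Prop :=
  forall V : set E, relatively_compact V ->
    exists2 nu : R, 0 < nu &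
      forall (xi x : E), V x ->
        nu^-1 * enorm xi ^+ 2 <= \sum_i \sum_j A x i j * xi 0 j * xi 0 i
          <= nu * enorm xi ^+ 2.

Definition assumption_a (p : R) : Prop :=
  [/\ [/\ forall x i j, A x j i = A x i j,
          forall i j, H1p_loc lam 2 (fun x => A x i j) (DA i j),
          forall i j, continuous (fun x => A x i j) &
          locally_elliptic],
      [/\ forall x i j, - C x j i = C x i j,
          forall i j, H1p_loc lam 2 (fun x => C x i j) (DC i j) &
          forall i j, continuous (fun x => C x i j)] &
      forall i, Lp_loc lam p (H i)].

Definition drift : 'I_d -> E -> R :=
  fun i x => 2^-1 * (\sum_j (DA i j j x + DC j i j x)) + H i x.

Definition assumption_b (q : R) : Prop := forall i, Lp_loc lam q (drift i).

Definition locally_hoelder : Prop :=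
  forall V : set E, compact V ->
    exists M al : R, [/\ 0 <= M, 0 < al < 1 &
      forall x y, V x -> V y ->
        forall i j, `|A x i j - A y i j| <= M * enorm (x - y) `^ al].

End Coefficients.

Section Operator.
Context {R : realType} {d : nat}.
Local Notation E := 'rV[R]_d.
Variables (A : E -> 'M[R]_d) (G : 'I_d -> E -> R).

Definition Lop (f : E -> R) : E -> R :=
  fun x => 2^-1 * (\sum_i \sum_j A x i j * partial i (partial j f) x)
           + \sum_i G i x * partial i f x.

Definition inf_invariant_density (lam mu : {measure set E -> \bar R}) (p : R)
    (rho : E -> R) (Drho : 'I_d -> E -> R) : Prop :=
  [/\ H1p_loc lam p rho Drho, continuous rho, forall x, 0 < rho x,
      has_density lam mu rho &
      forall f, test_function setT f -> \int[mu]_x Lop f x = 0].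

(* B = G - beta^{rho, A}; it depends on versions of the weak derivatives. *)
Definition divfree_drift (DA : 'I_d -> 'I_d -> 'I_d -> E -> R)
    (rho : E -> R) (Drho : 'I_d -> E -> R) : 'I_d -> E -> R :=
  fun i x => G i x -
    2^-1 * \sum_j (DA i j j x + A x i j * (Drho j x / rho x)).

End Operator.

Section Resolvent.
Context {R : realType} {d : nat}.
Local Notation E := 'rV[R]_d.
Variables (lam mu : {measure set E -> \bar R}).
Variables (A : E -> 'M[R]_d) (B : 'I_d -> E -> R).

Definition L1 (V : set E) (f : E -> R) : Prop :=
  mu.-integrable V (EFin \o f).

Definition L2 (V : set E) (f : E -> R) : Prop :=
  measurable_fun V f /\ (\int[mu]_(x in V) (f x ^+ 2)%:E < +oo)%E.

Definition L1_cvg (V : set E) (fn : nat -> E -> R) (f : E -> R) : Prop :=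
  (\int[mu]_(x in V) `|fn n x - f x|%:E)%E @[n --> \oo] --> (0 : \bar R).

Definition L2_cvg (V : set E) (fn : nat -> E -> R) (f : E -> R) : Prop :=
  (\int[mu]_(x in V) ((fn n x - f x) ^+ 2)%:E)%E @[n --> \oo]
    --> (0 : \bar R).

Definition form0 (V : set E) (u v : E -> R) : R :=
  2^-1 * \int[mu]_(x in V)
    (\sum_i \sum_j A x i j * partial j u x * partial i v x).

(* u is in the domain of the closure of (form0 V, C_0^infty(V)) and un is an
   approximating sequence; the closure at (u, v) is the limit of form0 V along
   approximating sequences of u and v. *)
Definition form_approx (V : set E) (u : E -> R) (un : nat -> E -> R) : Prop :=
  [/\ L2 V u, forall n, test_function V (un n), L2_cvg V un u &
      forall e : R, 0 < e -> exists N : nat, forall n m : nat,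
        (N <= n)%N -> (N <= m)%N ->
        form0 V (un n \- un m) (un n \- un m) < e].

(* u is in D(L^{0,V}) and L^{0,V} u = f. *)
Definition gen0 (V : set E) (u f : E -> R) : Prop :=
  L2 V f /\
  exists un, form_approx V u un /\
    forall v vn, form_approx V v vn ->
      form0 V (un n) (vn n) @[n --> \oo] --> - \int[mu]_(x in V) (f x * v x).

(* Graph of L^{0,V} u + <B, grad u> on bounded u in D(L^{0,V}). *)
Definition local_op (V : set E) (u g : E -> R) : Prop :=
  exists f (Du : 'I_d -> E -> R),
    [/\ gen0 V u f,
        exists c : R, {ae mu, forall x, V x -> `|u x| <= c},
        forall i, L2 V (Du i) /\ weak_partial lam V i u (Du i) &
        {ae mu, forall x, V x -> g x = f x + \sum_i B i x * Du i x}].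

Definition local_closure (V : set E) (u g : E -> R) : Prop :=
  [/\ L1 V u, L1 V g &
      exists un gn : nat -> E -> R,
        [/\ forall n, L1 V (un n) /\ L1 V (gn n),
            forall n, local_op V (un n) (gn n),
            L1_cvg V un u & L1_cvg V gn g]].

(* u is the resolvent on V, of parameter al, applied to f 1_V. *)
Definition local_resolvent (V : set E) (al : R) (f u : E -> R) : Prop :=
  (forall x, ~ V x -> u x = 0) /\
  exists g, local_closure V u g /\
    {ae mu, forall x, V x -> al * u x - g x = f x}.

Definition exhaustion (Vn : nat -> set E) : Prop :=
  [/\ forall n, open (Vn n) /\ relatively_compact (Vn n),
      forall n, Vn n `<=` Vn n.+1 & \bigcup_n Vn n = setT].

End Resolvent.

Section Semigroup.
Context {R : realType} {d : nat}.
Local Notation E := 'rV[R]_d.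
Variables (lam mu : {measure set E -> \bar R}).
(* Operators on L^1(R^d, mu) act on representatives. *)
Implicit Types (T : R -> (E -> R) -> E -> R).
Local Notation L1 := (L1 mu setT).

Definition subMarkov_C0_contraction_semigroup T : Prop :=
  [/\ forall t f, 0 < t -> L1 f -> L1 (T t f),
      forall t f g (c : R), 0 < t -> L1 f -> L1 g ->
        {ae mu, forall x, T t (fun y => c * f y + g y) x
                          = c * T t f x + T t g x},
      forall t f g, 0 < t -> L1 f -> L1 g -> {ae mu, forall x, f x = g x} ->
        {ae mu, forall x, T t f x = T t g x},
      forall s t f, 0 < s -> 0 < t -> L1 f ->
        {ae mu, forall x, T (s + t) f x = T s (T t f) x} &
      [/\ forall t f, 0 < t -> L1 f ->
            (\int[mu]_x `|T t f x|%:E <= \int[mu]_x `|f x|%:E)%E,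
          forall f, L1 f ->
            (\int[mu]_x `|T t f x - f x|%:E)%E @[t --> 0^'+] --> (0 : \bar R) &
          forall t f, 0 < t -> L1 f -> {ae mu, forall x, 0 <= f x <= 1} ->
            {ae mu, forall x, 0 <= T t f x <= 1}]].

(* u is in the domain of the generator of T, which maps u to g. *)
Definition L1_generator T (u g : E -> R) : Prop :=
  [/\ L1 u, L1 g &
      (\int[mu]_x `|t^-1 * (T t u x - u x) - g x|%:E)%E @[t --> 0^'+]
        --> (0 : \bar R)].

(* T is the semigroup whose resolvent at al is the limit of the resolvents
   of parameter al on relatively compact open sets increasing to R^d:
   (al - generator) u = f says that u is the resolvent of T applied to f. *)
Definition L1_semigroup_of (A : E -> 'M[R]_d) (G B : 'I_d -> E -> R) T :=
  [/\ subMarkov_C0_contraction_semigroup T,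
      forall Vn, exhaustion Vn -> forall al f, 0 < al -> L1 f ->
        exists un u, [/\ forall n, local_resolvent lam mu A B (Vn n) al f (un n),
          L1_cvg mu setT un u & L1_generator T u (fun x => al * u x - f x)] &
      forall f, test_function setT f -> L1_generator T f (Lop A G f)].

Definition Ls (s : \bar R) (f : E -> R) : Prop := f \in Lfun mu s.

Definition L1Linf (f : E -> R) : Prop := Ls 1%E f /\ Ls +oo%E f.

Definition Ls_cvg (s : \bar R) (fn : nat -> E -> R) (f : E -> R) : Prop :=
  Lnorm mu s (EFin \o (fn n \- f)) @[n --> \oo] --> (0 : \bar R).

(* Extension to L^s, s finite, from the dense subspace of L^1 and L^infty. *)
Definition extends_fin T (s : \bar R) (t : R) (f g : E -> R) : Prop :=
  Ls s g /\ exists fn : nat -> E -> R,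
    [/\ forall n, L1Linf (fn n), Ls_cvg s fn f &
        Ls_cvg s (fun n => T t (fn n)) g].

(* Extension to nonnegative elements of L^infty along increasing sequences. *)
Definition extends_nonneg T (t : R) (f g : E -> R) : Prop :=
  exists fn : nat -> E -> R,
    [/\ forall n, L1Linf (fn n), forall n x, 0 <= fn n x <= fn n.+1 x,
        {ae mu, forall x, fn n x @[n --> \oo] --> f x} &
        {ae mu, forall x, T t (fn n) x @[n --> \oo] --> g x}].

Definition extends_to T (s : \bar R) (t : R) (f g : E -> R) : Prop :=
  if s == +oo%E then
    Ls s g /\ exists g1 g2 : E -> R,
      [/\ extends_nonneg T t (fun x => Num.max (f x) 0) g1,
          extends_nonneg T t (fun x => Num.max (- f x) 0) g2 &
          {ae mu, forall x, g x = g1 x - g2 x}]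
  else extends_fin T s t f g.

(* P t f is the continuous version of T_t f. *)
Definition continuous_version T (P : R -> (E -> R) -> E -> R) : Prop :=
  (forall f, P 0 f = f) /\
  forall t s f, 0 < t -> (1%:E <= s)%E -> Ls s f ->
    continuous (P t f) /\ extends_to T s t f (P t f).

End Semigroup.

(* No property is built in; right_process, below, collects the axioms. *)
Record process (R : realType) (d : nat) := Process {
  pr_disp : measure_display;
  pr_Omega : measurableType pr_disp;
  pr_filt : R -> set (set pr_Omega);
  pr_X : R -> pr_Omega -> one_point_compactification 'rV[R]_d;
  pr_shift : R -> pr_Omega -> pr_Omega;
  pr_zeta : pr_Omega -> \bar R;
  pr_P : one_point_compactification 'rV[R]_d -> probability pr_Omega R
}.

Section Process.
Context {R : realType} {d : nat}.
Local Notation E := 'rV[R]_d.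
Local Notation ED := (one_point_compactification 'rV[R]_d).
Variable M : process R d.
Local Notation Omega := (pr_Omega M).
Local Notation F := (@pr_filt R d M).
Local Notation X := (@pr_X R d M).
Local Notation theta := (@pr_shift R d M).
Local Notation zeta := (@pr_zeta R d M).
Local Notation P := (@pr_P R d M).

Definition measurable_wrt {d' : measure_display} {S : measurableType d'}
    (G : set (set Omega)) (f : Omega -> S) : Prop :=
  forall B, measurable B -> G (f @^-1` B).

Definition universally_measurable (f : ED -> \bar R) : Prop :=
  forall nu : probability ED R, exists g : ED -> \bar R,
    measurable_fun setT g /\ {ae nu, forall x, f x = g x}.

(* Q is the measure P_nu. *)
Definition is_mixture (nu : probability ED R) (Q : probability Omega R) :=
  forall B, measurable B -> Q B = (\int[nu]_x P x B)%E.

Definition admissible_filtration : Prop :=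
  [/\ forall t, 0 <= t -> sigma_algebra setT (F t) /\ F t `<=` measurable,
      forall s t, 0 <= s -> s <= t -> F s `<=` F t,
      forall t, 0 <= t -> \bigcap_(s in [set s | t < s]) F s `<=` F t &
      forall t, 0 <= t -> measurable_wrt (F t) (X t)].

Definition is_lifetime : Prop :=
  [/\ measurable_fun setT zeta, forall w, (0 <= zeta w)%E &
      forall t w, 0 <= t -> X t w = None <-> (zeta w <= t%:E)%E].

Definition stopping_time (sigma : Omega -> \bar R) : Prop :=
  (forall w, (0 <= sigma w)%E) /\
  forall t, 0 <= t -> F t [set w | (sigma w <= t%:E)%E].

Definition stopped_sigma_algebra (sigma : Omega -> \bar R) :
    set (set Omega) :=
  [set L | measurable L /\
    forall t, 0 <= t -> F t (L `&` [set w | (sigma w <= t%:E)%E])].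

(* X_infty = Delta *)
Definition X_at (s : \bar R) (w : Omega) : ED :=
  if s is r%:E then X r w else None.

(* h is a version of the conditional probability Q(D | G). *)
Definition cond_prob_version (Q : probability Omega R)
    (G : set (set Omega)) (D : set Omega) (h : Omega -> \bar R) : Prop :=
  exists g : Omega -> \bar R,
    [/\ measurable_wrt G g, {ae Q, forall w, h w = g w} &
        forall L, G L -> (\int[Q]_(w in L) g w)%E = Q (L `&` D)].

Definition strong_markov : Prop :=
  forall (nu : probability ED R) (Q : probability Omega R),
    is_mixture nu Q ->
  forall (sigma : Omega -> \bar R) (t : R) (D : set ED),
    stopping_time sigma -> 0 <= t -> measurable D ->
    cond_prob_version Q (stopped_sigma_algebra sigma)
      [set w | D (X_at (sigma w + t%:E)%E w)]
      (fun w => P (X_at (sigma w) w) (X t @^-1` D)).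

Definition right_process : Prop :=
  [/\ admissible_filtration, is_lifetime,
      forall B, measurable B -> universally_measurable (fun x => P x B),
      forall x, P x [set w | X 0 w = x] = 1%E &
      [/\ forall s t w, 0 <= s -> 0 <= t -> X s (theta t w) = X (s + t) w,
          forall w t, 0 <= t -> X s w @[s --> t^'+] --> X t w &
          strong_markov]].

Definition quasi_left_continuous : Prop :=
  forall (nu : probability ED R) (Q : probability Omega R),
    is_mixture nu Q ->
  forall (sn : nat -> Omega -> \bar R) (sigma : Omega -> \bar R),
    (forall n, stopping_time (sn n)) ->
    (forall n w, (sn n w <= sn n.+1 w)%E) ->
    (forall w, sn n w @[n --> \oo] --> sigma w) ->
    {ae Q, forall w, (sigma w < +oo)%E ->
      X_at (sn n w) w @[n --> \oo] --> X_at (sigma w) w}.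

Definition hunt_process : Prop :=
  [/\ right_process,
      forall x, {ae P x, forall w, forall t, 0 < t ->
        exists l : ED, X s w @[s --> t^'-] --> l} &
      quasi_left_continuous].

Definition continuous_paths : Prop :=
  forall x, {ae P x, forall w,
    {within [set t : R | 0 <= t], continuous (fun t => X t w)}}.

(* E_x[f(X_t)] with f(Delta) = 0. *)
Definition expect (x : E) (t : R) (f : E -> R) : R :=
  \int[P (Some x)]_w ext0 f (X t w).

Definition has_transition (Pt : R -> (E -> R) -> E -> R) : Prop :=
  forall (t : R) (x : E) (f : E -> R), 0 <= t -> measurable_fun setT f ->
    (exists c : R, forall y, `|f y| <= c) ->
    Pt t f x = expect x t f.

Definition invariant_measure (nu : {measure set E -> \bar R}) : Prop :=
  sigma_finite setT nu /\
  forall t B, 0 <= t -> measurable B ->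
    (\int[nu]_x P (Some x) (X t @^-1` (Some @` B)) = nu B)%E.

Definition sub_invariant_measure (nu : {measure set E -> \bar R}) : Prop :=
  sigma_finite setT nu /\
  forall t B, 0 <= t -> measurable B ->
    (\int[nu]_x P (Some x) (X t @^-1` (Some @` B)) <= nu B)%E.

Definition continuous_martingale (Q : probability Omega R)
    (N : R -> Omega -> R) : Prop :=
  [/\ forall t, 0 <= t -> measurable_wrt (F t) (N t),
      forall t, 0 <= t -> Q.-integrable setT (EFin \o N t),
      forall s t L, 0 <= s -> s <= t -> F s L ->
        \int[Q]_(w in L) N t w = \int[Q]_(w in L) N s w &
      {ae Q, forall w,
        {within [set t : R | 0 <= t], continuous (fun t => N t w)}}].

Definition solves_martingale_problem (L : (E -> R) -> E -> R)
    (mu : {measure set E -> \bar R}) : Prop :=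
  forall u : E -> R, test_function setT u ->
  forall v : E -> R, measurable_fun setT v -> (forall x, 0 <= v x) ->
    (exists c : R, forall x, v x <= c) -> (\int[mu]_x (v x)%:E = 1)%E ->
  forall Q : probability Omega R,
    (forall B, measurable B ->
      Q B = (\int[mu]_x ((v x)%:E * P (Some x) B))%E) ->
    continuous_martingale Q (fun t w =>
      ext0 u (X t w) - ext0 u (X 0 w) -
      \int[@lebesgue_measure R]_(s in `[0, t]) ext0 (L u) (X s w)).

End Process.

Section PathSpace.
Context {R : realType} {d : nat}.

Definition nneg_time : Type := [set t : R | 0 <= t].
HB.instance Definition _ := Uniform.on nneg_time.

(* C([0, oo), R^d) as a subspace of the space of all functions with the
   topology of locally uniform convergence. *)
Definition path_space : set {family compact, nneg_time -> 'rV[R]_d} :=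
  [set c | continuous (c : nneg_time -> 'rV[R]_d)].

Definition cpath : Type := path_space.
HB.instance Definition _ := Topological.on cpath.

Definition path_fun (c : cpath) : nneg_time -> 'rV[R]_d := set_val c.

Definition path_borel : set (set cpath) := <<s (@open cpath) >>.

(* The event that X is R^d-valued and continuous on [0, oo) with path in B. *)
Definition path_event (M : process R d) (B : set cpath) : set (pr_Omega M) :=
  [set w | exists c : cpath,
     B c /\ forall t : nneg_time, pr_X (set_val t) w = Some (path_fun c t)].

Arguments path_event M B : clear implicits.

(* P_x o X^{-1} on the Borel sets of C([0, oo), R^d); its total mass may be
   less than one, since X may leave R^d in finite time. *)
Definition path_law (M : process R d) (x : 'rV[R]_d)
    (B : {B : set cpath | path_borel B}) : \bar R :=
  pr_P M (Some x) (path_event M (sval B)).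

End PathSpace.
Arguments path_event {R d} M B.
Arguments path_law {R d} M x B.

(* Main.v *)
(* Invariance of mu for M makes the range of 1 - L on C_0^oo dense in L^1(mu):
   a bounded solution w of the resolvent equation on a large cube is replaced by
   z = w e^{-1/(m|w|)}, which satisfies a global weak equation because the
   truncation is flat at 0.  Mollifying z and controlling the commutator of the
   mollifier with the H^1_loc coefficients (DiPerna-Lions) gives test functions,
   and the L^1 error is at most the mass lost by the resolvent on the cube, which
   tends to 0 as mu is invariant.  So every pair (u, Lu) of the generator of
   T is a limit of pairs taken from C_0^oo.

   For bounded v the law of the other process at time s under P_{v mu} has
   density at most sup v, by sub-invariance, so its martingale identity extends
   to generator pairs.  Telescoping s |-> E_{v mu}[T_s f (X_{t-s})] yields
   E_{v mu}[f (X_t)] = \int v T_t f dmu, hence both processes have the same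
   transition kernels mu-a.e., and everywhere by continuity.  The Markov property
   gives the finite-dimensional distributions, and right-continuous paths are
   determined by their values at rational times. *)
From HB Require Import structures.
Require Import Defs.
From mathcomp Require Import all_boot all_order all_algebra.
From mathcomp Require Import all_classical all_reals all_analysis.
From mathcomp Require Import measurable_realfun.
From mathcomp Require Import ring lra.

Set Implicit Arguments.
Unset Strict Implicit.
Unset Printing Implicit Defensive.
Import Order.TTheory GRing.Theory Num.Theory.
Import numFieldNormedType.Exports.

Local Open Scope classical_set_scope.
Local Open Scope ring_scope.

(** * Convergence in L^1 and L^2 *)

(** Extended by zero, the solution w on the cube does not solve the equation on R^d: its conormal
    derivative leaves a measure on the boundary. Testing the local equation with phi trunc'(w)
    instead of phi removes that measure for every phi in C_0^oo(R^d), as trunc' is smooth with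
    trunc'(0) = 0. The price is the term <rho A grad w, grad w> trunc''(w) / 2, which lives where w
    is small and need not tend to 0 in L^1, since it carries the lost flux. Its norm can be
    computed, however: |trunc''| = strunc', and testing with the regularised sign strunc(w) yields
    int f strunc(w) - int |w| trunc'(w), integrals with respect to mu; the drift contributes nothing
    because rho B is divergence free. Hence the residual is at most ||f|| - ||w|| plus a remainder
    vanishing as m grows. For f >= 0 the full resolvent u of f has int u = int f, its image under
    the generator having mean 0, which makes the defect small on large cubes. All of this takes
    place in L^1, where the product of an L^2 derivative of a coefficient and an L^2 gradient
    belongs; this is why the commutator estimate suits H^1 coefficients. *)

Section L1L2.
Context d (T : measurableType d) (R : realType) (mu : {measure set T -> \bar R}).
Implicit Types f g h : T -> R.

Definition ig f : Prop := mu.-integrable setT (EFin \o f).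
(** Real-valued, so an infinite integral would be read as 0; this is why the estimates of [n1] come
    with [ig] hypotheses. *)
Definition n1 f : R := \int[mu]_x `|f x|.

Lemma ig_meas f : ig f -> measurable_fun setT f.
Proof. by move=> /integrableP[/measurable_EFinP]. Qed.

Lemma ig_le f g : measurable_fun setT f -> (forall x, `|f x| <= `|g x|) ->
  ig g -> ig f.
Proof.
move=> mf fg; apply: le_integrable => //; first exact/measurable_EFinP.
by move=> x _; rewrite lee_fin.
Qed.

Lemma igD f g : ig f -> ig g -> ig (f \+ g).
Proof. by move=> ff gg; apply: eq_integrable (integrableD _ ff gg). Qed.

Lemma igZ c f : ig f -> ig (fun x => c * f x).
Proof. by move=> ff; apply: eq_integrable (integrableZl _ c ff). Qed.

Lemma igN f : ig f -> ig (fun x => - f x).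
Proof. by move=> /(igZ (-1)); under eq_fun do rewrite mulN1r. Qed.

Lemma igB f g : ig f -> ig g -> ig (f \- g).
Proof. by move=> ff /igN; exact: igD. Qed.

Lemma ig0 : ig (fun=> 0).
Proof. exact: integrable0. Qed.

Lemma ig_norm f : ig f -> ig (fun x => `|f x|).
Proof. exact: integrable_norm. Qed.

Lemma ig_sum (I : Type) (s : seq I) (F : I -> T -> R) :
  (forall i, ig (F i)) -> ig (fun x => \sum_(i <- s) F i x).
Proof.
move=> iF; elim: s => [|i s IH]; first by under eq_fun do rewrite big_nil; exact: ig0.
by under eq_fun do rewrite big_cons; exact: igD.
Qed.

Lemma ig_mulb h f c : measurable_fun setT h -> (forall x, `|h x| <= c) ->
  ig f -> ig (fun x => h x * f x).
Proof.
move=> mh hc ff; apply: ig_le (igZ c ff).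
  by apply: measurable_funM => //; exact: ig_meas.
move=> x; rewrite !normrM ler_wpM2r//.
by rewrite (le_trans (hc x))// ler_norm.
Qed.

Lemma n1_ge0 f : 0 <= n1 f.
Proof. by apply: Rintegral_ge0. Qed.

Lemma n1N f : n1 (fun x => - f x) = n1 f.
Proof. by apply: eq_Rintegral => x _; rewrite normrN. Qed.

Lemma n1_le f g : measurable_fun setT f -> (forall x, `|f x| <= `|g x|) ->
  ig g -> n1 f <= n1 g.
Proof.
move=> mf fg gg; apply: le_Rintegral => //; last exact: ig_norm.
by apply: ig_norm; exact: ig_le gg.
Qed.

Lemma n1D f g : ig f -> ig g -> n1 (f \+ g) <= n1 f + n1 g.
Proof.
move=> ff gg; rewrite /n1 -RintegralD//; [|exact: ig_norm..].
apply: le_Rintegral => //; [apply: ig_norm; exact: igD| |].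
  by apply: igD; exact: ig_norm.
by move=> x _; exact: ler_normD.
Qed.

Lemma n1Z c f : ig f -> n1 (fun x => c * f x) = `|c| * n1 f.
Proof.
move=> ff; rewrite /n1 -RintegralZl//; last exact: ig_norm.
by apply: eq_Rintegral => x _; rewrite normrM.
Qed.

Lemma n1B f g : ig f -> ig g -> n1 (f \- g) <= n1 f + n1 g.
Proof. by move=> ff gg; rewrite -[n1 g]n1N; apply: n1D => //; exact: igN. Qed.

Lemma n1_sub f g h : ig f -> ig g -> ig h ->
  n1 (f \- h) <= n1 (f \- g) + n1 (g \- h).
Proof.
move=> ff gg hh; rewrite [X in n1 X <= _](_ : _ = (f \- g) \+ (g \- h)).
  by apply: n1D; exact: igB.
by apply/funext => x /=; rewrite addrA subrK.
Qed.

Lemma n1C f g : n1 (f \- g) = n1 (g \- f).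
Proof. by apply: eq_Rintegral => x _ /=; rewrite distrC. Qed.

Lemma n1_mulb h f c : measurable_fun setT h -> (forall x, `|h x| <= c) ->
  ig f -> n1 (fun x => h x * f x) <= c * n1 f.
Proof.
move=> mh hc ff; rewrite /n1 -RintegralZl//; last exact: ig_norm.
apply: le_Rintegral => //; first by apply: ig_norm; exact: ig_mulb hc ff.
  exact: igZ (ig_norm ff).
by move=> x _; rewrite normrM ler_wpM2r.
Qed.

Lemma norm_Rint_le f : ig f -> `|\int[mu]_x f x| <= n1 f.
Proof. exact: le_normr_Rintegral. Qed.

Lemma Rint_ae f g : measurable_fun setT f -> measurable_fun setT g ->
  {ae mu, forall x, f x = g x} -> \int[mu]_x f x = \int[mu]_x g x.
Proof.
move=> mf mg fg; congr fine; apply: ae_eq_integral => //; [exact/measurable_EFinP..|].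
by apply: filterS fg => x /= ->.
Qed.

Lemma n1_ae f g : measurable_fun setT f -> measurable_fun setT g ->
  {ae mu, forall x, f x = g x} -> n1 f = n1 g.
Proof.
move=> mf mg fg; apply: Rint_ae; [exact: measurableT_comp..|].
by apply: filterS fg => x /= ->.
Qed.

Lemma n1_E f : ig f -> (n1 f)%:E = (\int[mu]_x `|f x|%:E)%E.
Proof.
move=> ff; rewrite /n1 /Rintegral fineK//.
by apply: integrable_fin_num => //; exact: ig_norm.
Qed.

Lemma n1_cvgP (F : nat -> T -> R) : (forall n, ig (F n)) ->
  (\int[mu]_x `|F n x|%:E)%E @[n --> \oo] --> (0 : \bar R) <->
  n1 (F n) @[n --> \oo] --> (0 : R).
Proof.
move=> iF; split => h.
  have /fine_cvg := h.
  by under eq_fun do rewrite -n1_E//=.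
under eq_fun do rewrite -n1_E//=.
by apply: cvg_EFin => //; exact: nearW.
Qed.

Definition L2P f : Prop := measurable_fun setT f /\ ig (fun x => f x ^+ 2).
Definition n2 f : R := Num.sqrt (\int[mu]_x (f x ^+ 2)).

Lemma L2_mul f g : L2P f -> L2P g -> ig (fun x => f x * g x).
Proof.
move=> [mf f2] [mg g2]; apply: ig_le (igD f2 g2); first exact: measurable_funM.
move=> x /=; rewrite normrM [leRHS]ger0_norm ?addr_ge0 ?sqr_ge0//.
rewrite -[f x ^+ 2]real_normK ?num_real// -[g x ^+ 2]real_normK ?num_real//.
have := sqr_ge0 (`|f x| - `|g x|).
have := mulr_ge0 (normr_ge0 (f x)) (normr_ge0 (g x)).
by nra.
Qed.

Lemma L2D f g : L2P f -> L2P g -> L2P (f \+ g).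
Proof.
move=> F G; split; first by apply: measurable_funD; [case: F|case: G].
under eq_fun do rewrite /= sqrrD mulr2n.
have fg := L2_mul F G.
by apply: igD; [apply: igD; [case: F|exact: igD]|case: G].
Qed.

Lemma L2Z c f : L2P f -> L2P (fun x => c * f x).
Proof.
move=> [mf f2]; split; first exact: measurable_funM.
by under eq_fun do rewrite exprMn; exact: igZ.
Qed.

Lemma L2N f : L2P f -> L2P (fun x => - f x).
Proof. by move=> /(L2Z (-1)); under eq_fun do rewrite mulN1r. Qed.

Lemma L2B f g : L2P f -> L2P g -> L2P (f \- g).
Proof. by move=> ff /L2N; exact: L2D. Qed.

Lemma L2_0 : L2P (fun=> 0).
Proof. by split => //; under eq_fun do rewrite expr0n; exact: ig0. Qed.

Lemma L2_sum (I : Type) (s : seq I) (F : I -> T -> R) :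
  (forall i, L2P (F i)) -> L2P (fun x => \sum_(i <- s) F i x).
Proof.
move=> iF; elim: s => [|i s IH]; first by under eq_fun do rewrite big_nil; exact: L2_0.
by under eq_fun do rewrite big_cons; exact: L2D.
Qed.

Lemma L2_mulb h f c : measurable_fun setT h -> (forall x, `|h x| <= c) ->
  L2P f -> L2P (fun x => h x * f x).
Proof.
move=> mh hc [mf f2]; split; first exact: measurable_funM.
under eq_fun do rewrite exprMn.
apply: (ig_mulb (c := c ^+ 2)) => //; first exact: measurable_funX.
move=> x; rewrite normrX lerXn2r ?nnegrE//.
exact: le_trans (normr_ge0 _) (hc x).
Qed.

Lemma L2_le f g : measurable_fun setT f -> (forall x, `|f x| <= `|g x|) ->
  L2P g -> L2P f.
Proof.
move=> mf fg [mg g2]; split => //; apply: ig_le g2; first exact: measurable_funX.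
by move=> x; rewrite !normrX lerXn2r ?nnegrE.
Qed.

Lemma n2_ge0 f : 0 <= n2 f. Proof. exact: sqrtr_ge0. Qed.

Lemma n2_sqr f : n2 f ^+ 2 = \int[mu]_x (f x ^+ 2).
Proof. by rewrite sqr_sqrtr// Rintegral_ge0// => x _; exact: sqr_ge0. Qed.

(** Cauchy-Schwarz from the weighted Young inequality 2|fg| <= l f^2 + g^2 / l; the optimal weight
    [l] is the ratio of the two norms. *)
Lemma n1M_n2 f g : L2P f -> L2P g ->
  n1 (fun x => f x * g x) <= n2 f * n2 g.
Proof.
move=> F G; have fg := L2_mul F G.
have key l : 0 < l -> n1 (fun x => f x * g x) <=
    (l * n2 f ^+ 2 + l^-1 * n2 g ^+ 2) / 2.
  move=> l0; rewrite !n2_sqr; case: (F) => mf f2; case: (G) => mg g2.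
  rewrite -RintegralZl// -[X in _ + X]RintegralZl// -RintegralD//; [|exact: igZ..].
  rewrite -RintegralZr//; last by apply: igD; exact: igZ.
  apply: le_Rintegral => //; first exact: ig_norm.
    under [X in mu.-integrable _ X]eq_fun do rewrite /= mulrC.
    by apply: igZ; apply: igD; exact: igZ.
  move=> x _; rewrite normrM ler_pdivlMr//.
  rewrite -[f x ^+ 2]real_normK ?num_real// -[g x ^+ 2]real_normK ?num_real//.
  have := sqr_ge0 (l * `|f x| - `|g x|).
  have li : l^-1 * l = 1 by rewrite mulVf// gt_eqF.
  rewrite -(ler_pM2l (_ : 0 < l^-1)) ?invr_gt0// mulr0.
  set a := `|f x|; set b := `|g x| => h.
  suff: l^-1 * (l * a - b) ^+ 2 = l * a ^+ 2 + l^-1 * b ^+ 2 - a * b * 2 by lra.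
  rewrite sqrrB mulrDr mulrBr exprMn -mulr_natr.
  rewrite (_ : l^-1 * (l * a * b * 2) = (l^-1 * l) * (a * b * 2)); last by ring.
  rewrite (_ : l^-1 * (l ^+ 2 * a ^+ 2) = (l^-1 * l) * (l * a ^+ 2)); last by ring.
  by rewrite li; ring.
set a := n2 f; set b := n2 g; set X := n1 _ in key *.
have a0 : 0 <= a by exact: n2_ge0.
have b0 : 0 <= b by exact: n2_ge0.
apply/ler_addgt0Pr => e e0.
(* Shifting both norms by [r] keeps the weight finite and positive when one of them vanishes; this
   value of [r] costs at most [e]. *)
pose r := e / (a + b + 1).
have r0 : 0 < r by rewrite divr_gt0//; lra.
have /key : 0 < (b + r) / (a + r) by rewrite divr_gt0//; lra.
rewrite -/a -/b invf_div.
have ra : 0 < a + r by lra.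
have rb : 0 < b + r by lra.
have h1 : (b + r) / (a + r) * a ^+ 2 <= (b + r) * a.
  rewrite -mulrA; apply: ler_wpM2l; first exact: ltW.
  rewrite mulrC ler_pdivrMr//; nra.
have h2 : (a + r) / (b + r) * b ^+ 2 <= (a + r) * b.
  rewrite -mulrA; apply: ler_wpM2l; first exact: ltW.
  rewrite mulrC ler_pdivrMr//; nra.
have h3 : r * (a + b + 1) = e by rewrite /r divfK// gt_eqF//; lra.
by move=> h; nra.
Qed.

Lemma n2_eq f g : f =1 g -> n2 f = n2 g.
Proof. by move=> /funext ->. Qed.

Lemma CS f g : L2P f -> L2P g -> `|\int[mu]_x (f x * g x)| <= n2 f * n2 g.
Proof.
move=> F G; apply: le_trans (n1M_n2 F G).
exact: norm_Rint_le (L2_mul F G).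
Qed.

Lemma n2_le f g : measurable_fun setT f -> (forall x, `|f x| <= `|g x|) ->
  L2P g -> n2 f <= n2 g.
Proof.
move=> mf fg G; rewrite ler_wsqrtr//; apply: le_Rintegral => //.
- by case: (L2_le mf fg G).
- by case: G.
- move=> x _; rewrite -[f x ^+ 2]real_normK ?num_real//.
  by rewrite -[g x ^+ 2]real_normK ?num_real// lerXn2r ?nnegrE.
Qed.

Lemma n2Z c f : L2P f -> n2 (fun x => c * f x) = `|c| * n2 f.
Proof.
move=> [mf f2]; rewrite /n2.
under eq_Rintegral do rewrite exprMn.
by rewrite RintegralZl// sqrtrM ?sqr_ge0// sqrtr_sqr.
Qed.

Lemma n2N f : n2 (fun x => - f x) = n2 f.
Proof. by rewrite /n2; under eq_Rintegral do rewrite sqrrN. Qed.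

Lemma n2C f g : n2 (f \- g) = n2 (g \- f).
Proof. by rewrite -n2N; apply: n2_eq => x /=; rewrite opprB. Qed.

Lemma n2D f g : L2P f -> L2P g -> n2 (f \+ g) <= n2 f + n2 g.
Proof.
move=> F G; rewrite -(@ler_pXn2r _ 2) ?nnegrE ?addr_ge0 ?n2_ge0//.
have fg := L2_mul F G.
case: (F) => mf f2; case: (G) => mg g2.
rewrite n2_sqr sqrrD !n2_sqr.
under eq_Rintegral do rewrite sqrrD mulr2n.
rewrite !RintegralD//; [|exact: (igD fg fg)|exact: (igD f2 (igD fg fg))].
rewrite lerD2r lerD2l mulr2n.
by rewrite lerD// (le_trans (ler_norm _))//; exact: CS.
Qed.

Lemma n2B f g : L2P f -> L2P g -> n2 (f \- g) <= n2 f + n2 g.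
Proof. by move=> F G; rewrite -(n2N g); apply: n2D => //; exact: L2N. Qed.

Lemma n2_sub f g h : L2P f -> L2P g -> L2P h ->
  n2 (f \- h) <= n2 (f \- g) + n2 (g \- h).
Proof.
move=> ff gg hh; rewrite [X in n2 X <= _](_ : _ = (f \- g) \+ (g \- h)).
  by apply: n2D; exact: L2B.
by apply/funext => x /=; rewrite addrA subrK.
Qed.

Lemma n2_0 : n2 (fun=> 0) = 0.
Proof.
rewrite /n2; under eq_Rintegral do rewrite expr0n.
by rewrite Rintegral_cst// mul0r sqrtr0.
Qed.

Lemma n2_mulb h f c : 0 <= c -> measurable_fun setT h ->
  (forall x, `|h x| <= c) -> L2P f -> n2 (fun x => h x * f x) <= c * n2 f.
Proof.
move=> c0 mh hc ff; rewrite -[X in X * _]ger0_norm// -n2Z//.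
apply: n2_le; last exact: L2Z.
  by apply: measurable_funM => //; case: ff.
by move=> x; rewrite !normrM (ger0_norm c0) ler_wpM2r.
Qed.

Lemma n1_mul_cvg (F G : nat -> T -> R) f g :
  (forall n, L2P (F n)) -> (forall n, L2P (G n)) -> L2P f -> L2P g ->
  n2 (F n \- f) @[n --> \oo] --> (0 : R) ->
  n2 (G n \- g) @[n --> \oo] --> (0 : R) ->
  n1 (fun x => F n x * G n x - f x * g x) @[n --> \oo] --> (0 : R).
Proof.
move=> LF LG Lf Lg cF cG.
apply: (@squeeze_cvgr _ _ _ _ (cst 0)
  (fun n => n2 (F n \- f) * n2 (G n \- g) + (n2 (F n \- f) * n2 g + n2 f * n2 (G n \- g)))).
- apply: nearW => n; rewrite n1_ge0/=.
  rewrite [X in n1 X](_ : _ = (fun x => (F n \- f) x * (G n \- g) x) \+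
    ((fun x => (F n \- f) x * g x) \+ (fun x => f x * (G n \- g) x))); last first.
    by apply/funext => x /=; ring.
  have B1 := L2B (LF n) Lf; have B2 := L2B (LG n) Lg.
  apply: le_trans (n1D _ _) _; [exact: L2_mul|by apply: igD; exact: L2_mul|].
  apply: lerD; first exact: n1M_n2.
  apply: le_trans (n1D _ _) _; [exact: L2_mul..|].
  by apply: lerD; exact: n1M_n2.
- exact: cvg_cst.
- rewrite -[X in _ --> X](_ : 0 * 0 + (0 * n2 g + n2 f * 0) = 0); last by ring.
  by apply: cvgD; [exact: cvgM|apply: cvgD; apply: cvgM => //; exact: cvg_cst].
Qed.

Lemma Rint_n1_cvg (F : nat -> T -> R) f : (forall n, ig (F n)) -> ig f ->
  n1 (F n \- f) @[n --> \oo] --> (0 : R) ->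
  \int[mu]_x F n x @[n --> \oo] --> \int[mu]_x f x.
Proof.
move=> iF fi h; apply/cvgrPdist_le => e e0.
move/cvgrPdist_le: h => /(_ e e0); apply: filterS => n.
rewrite sub0r normrN ger0_norm ?n1_ge0// => h; apply: le_trans h.
rewrite distrC -RintegralB//; last exact: iF.
by apply: norm_Rint_le; exact: igB.
Qed.

End L1L2.

(** * Smooth functions and truncations *)

Section Smooth.
Context {R : realType} {d : nat}.
Local Notation E := 'rV[R]_d.
Local Notation e_ i := (delta_mx 0 i : E).
Implicit Types (f g w : E -> R) (i : 'I_d) (x : E).

(** Reduces directional derivatives to functions of one real variable, for which the chain rule and
    the mean value theorem are at hand. *)
Lemma is_derive_line f (x v : E) (t : R) : derivable f (x + t *: v) v ->
  is_derive t 1 (fun s => f (x + s *: v)) ('D_v f (x + t *: v)).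
Proof.
move=> h.
have -> : (fun s => f (x + s *: v)) =
    (fun s => f (s *: v + (x + t *: v))) \o (fun s => s - t).
  by apply/funext => s /=; rewrite addrCA -scalerDl subrK.
have /derivable1P h1 := h.
have h2 : is_derive ((fun s => s - t) t) 1
    (fun s => f (s *: v + (x + t *: v))) ('D_v f (x + t *: v)).
  rewrite subrr; split => //; rewrite /derive.
  rewrite (_ : (fun h0 : R => h0^-1 *: _) = (fun h0 : R => h0^-1 *:
    ((f \o shift (x + t *: v)) (h0 *: v) - f (x + t *: v))))//.
  by apply/funext => s /=; rewrite addr0 scale0r add0r [_%:A]mulr1.
have h3 : is_derive t 1 (fun s : R => s - t) 1.
  by apply: is_derive_eq; rewrite subr0.
by rewrite -[X in is_derive _ _ _ X]mulr1; exact: (@is_derive1_comp _ (fun s => f (s *: v + (x + t *: v))) (fun s => s - t) t _ 1 h2 h3).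
Qed.

Lemma is_derive_line0 f (x v : E) (a : R) :
  is_derive (0 : R) 1 (fun s => f (x + s *: v)) a -> is_derive x v f a.
Proof.
move=> [h1 h2]; have eqf : (fun s : R => s^-1 *: (f (s *: v + x) - f x)) =
   (fun s : R => s^-1 *: (f (x + (s *: 1 + 0) *: v) - f (x + 0 *: v))).
  apply/funext => s; congr (_ *: (f _ - f _)); first by rewrite addr0 [_%:A]mulr1 addrC.
  by rewrite scale0r addr0.
split; first by move: h1; rewrite /derivable -eqf.
by rewrite -h2; exact: (congr1 (fun F : R -> R => lim (F @ 0^')) eqf).
Qed.

(** C^n by recursion on the order, the form in which closure under sums, products and compositions
    goes by induction. In [foldr partial f s] the last entry of [s] is differentiated first, so one
    unfolding of [sm] corresponds to an [rcons]. *)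
Fixpoint sm (n : nat) (f : E -> R) : Prop := match n with
  | 0%N => continuous f
  | n'.+1 => [/\ continuous f, forall i x, derivable f x (e_ i) &
      forall i, sm n' (partial i f)] end.

Lemma smS n f : sm n.+1 f <-> [/\ continuous f,
  forall i x, derivable f x (e_ i) & forall i, sm n (partial i f)].
Proof. by []. Qed.

Lemma smoothP f : smooth f <-> forall n, sm n f.
Proof.
split=> [sf n|h s].
  elim: n f sf => [|n IH] f sf; first by case: (sf [::]).
  split=> [|i x|i]; [by case: (sf [::])|by case: (sf [::])|].
  apply: IH => s; have := sf (rcons s i); by rewrite foldr_rcons.
elim/last_ind: s f h => [|s i IH] f h /=.
  by split=> [|i x]; [exact: (h 0%N)|case: (h 1%N)].
by rewrite foldr_rcons; apply: IH => n; case: (h n.+1) => _ _ /(_ i).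
Qed.

Lemma smW n f : sm n.+1 f -> sm n f.
Proof.
elim: n f => [|n IH] f; first by case.
by move=> [cf df pf]; split => // i; apply: IH.
Qed.

Lemma smooth_cont f : smooth f -> continuous f.
Proof. by move=> /(_ [::]) []. Qed.

Lemma smooth_derivable f i x : smooth f -> derivable f x (e_ i).
Proof. by move=> /(_ [::]) []. Qed.

Lemma smooth_partial i f : smooth f -> smooth (partial i f).
Proof. by move=> /smoothP h; apply/smoothP => n; case: (h n.+1) => _ _ /(_ i). Qed.

Lemma partialD i f g x : derivable f x (e_ i) -> derivable g x (e_ i) ->
  partial i (f \+ g) x = partial i f x + partial i g x.
Proof. exact: deriveD. Qed.

Lemma partialM i f g x : derivable f x (e_ i) -> derivable g x (e_ i) ->
  partial i (fun y => f y * g y) x = partial i f x * g x + f x * partial i g x.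
Proof.
move=> df dg; etransitivity; first exact: (deriveM df dg).
by rewrite addrC; congr (_ + _); exact: mulrC.
Qed.

Lemma partial_cst i (c : R) x : partial i (fun=> c) x = 0.
Proof. exact: derive_cst. Qed.

Lemma sm_cst n (c : R) : sm n (fun=> c).
Proof.
elim: n c => [|n IH] c /=; first exact: cst_continuous.
split; [exact: cst_continuous|by move=> i x; exact: derivable_cst|move=> i].
by rewrite (_ : partial i _ = fun=> 0) //; apply/funext => x; exact: partial_cst.
Qed.

Lemma smD n f g : sm n f -> sm n g -> sm n (f \+ g).
Proof.
elim: n f g => [|n IH] f g /=; first by move=> cf cg x; apply: (continuousD (cf x) (cg x)).
move=> [cf df pf] [cg dg pg]; split.
- by move=> x; apply: (continuousD (cf x) (cg x)).
- by move=> i x; exact: derivableD.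
- move=> i; rewrite (_ : partial i _ = partial i f \+ partial i g); first exact: IH.
  by apply/funext => x; rewrite partialD.
Qed.

Lemma smM n f g : sm n f -> sm n g -> sm n (fun x => f x * g x).
Proof.
elim: n f g => [|n IH] f g; first by move=> cf cg x; apply: (continuousM (cf x) (cg x)).
move=> F G; have /smS[cf df pf] := F; have /smS[cg dg pg] := G; apply/smS; split.
- by move=> x; apply: (continuousM (cf x) (cg x)).
- by move=> i x; exact: (derivableM (df i x) (dg i x)).
- move=> i; rewrite (_ : partial i _ =
    (fun x => partial i f x * g x) \+ (fun x => f x * partial i g x)).
    exact: (smD (IH _ _ (pf i) (smW G)) (IH _ _ (smW F) (pg i))).
  by apply/funext => x; rewrite partialM.
Qed.

Lemma smooth_cst (c : R) : smooth (fun _ : E => c).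
Proof. by apply/smoothP => n; exact: sm_cst. Qed.

Lemma smoothD f g : smooth f -> smooth g -> smooth (f \+ g).
Proof. by move=> /smoothP F /smoothP G; apply/smoothP => n; exact: smD. Qed.

Lemma smoothM f g : smooth f -> smooth g -> smooth (fun x => f x * g x).
Proof. by move=> /smoothP F /smoothP G; apply/smoothP => n; exact: smM. Qed.

Lemma smoothZ (c : R) f : smooth f -> smooth (fun x => c * f x).
Proof. by move=> F; apply: smoothM => //; exact: smooth_cst. Qed.

Lemma smoothB f g : smooth f -> smooth g -> smooth (f \- g).
Proof.
move=> F /(smoothZ (-1)) G; have := smoothD F G.
by rewrite (_ : _ \+ _ = f \- g)//; apply/funext => x /=; rewrite mulN1r.
Qed.

Lemma smooth_prod (I : Type) (s : seq I) (F : I -> E -> R) :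
  (forall k, smooth (F k)) -> smooth (fun x => \prod_(k <- s) F k x).
Proof.
move=> h; elim: s => [|k s IH]; first by under eq_fun do rewrite big_nil; exact: smooth_cst.
by under eq_fun do rewrite big_cons; exact: smoothM.
Qed.

Lemma partialZ i (c : R) f x : derivable f x (e_ i) ->
  partial i (fun y => c * f y) x = c * partial i f x.
Proof.
by move=> df; rewrite partialM//; rewrite partial_cst mul0r add0r.
Qed.

Lemma partialB i f g x : derivable f x (e_ i) -> derivable g x (e_ i) ->
  partial i (f \- g) x = partial i f x - partial i g x.
Proof. exact: deriveB. Qed.

(** Smoothness on the line, witnessed by the sequence of all derivatives; the shifted sequence is a
    witness for the derivative. *)
Definition rsm (F : R -> R) : Prop := exists D : nat -> R -> R,
  D 0%N = F /\ forall n (y : R), is_derive y 1 (D n) (D n.+1 y).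

Lemma is_derive_comp1 (F : R -> R) (a : R) w (x v : E) :
  derivable w x v -> is_derive (w x) 1 F a ->
  is_derive x v (F \o w) (a * 'D_v w x).
Proof.
move=> dw dF; apply: is_derive_line0.
have h : is_derive (0 : R) 1 (fun s => w (x + s *: v)) ('D_v w x).
  have := @is_derive_line w x v 0; rewrite scale0r addr0; exact.
by apply: (@is_derive1_comp _ F (fun s => w (x + s *: v))) => //;
  rewrite scale0r addr0.
Qed.

Lemma rsm_derive (F : R -> R) : rsm F -> exists F', rsm F' /\
  forall y : R, is_derive y 1 F (F' y).
Proof.
move=> [D [<- h]]; exists (D 1%N); split; last exact: h.
by exists (fun n => D n.+1).
Qed.

Lemma is_derive_cont (F : R -> R) (F' : R -> R) :
  (forall y : R, is_derive y 1 F (F' y)) -> continuous F.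
Proof.
move=> h x; apply: differentiable_continuous; apply/derivable1_diffP.
exact: ex_derive.
Qed.

Lemma sm_comp n (F : R -> R) w : rsm F -> sm n w -> sm n (F \o w).
Proof.
elim: n F w => [|n IH] F w rF.
  have [F' [_ dF]] := rsm_derive rF => cw x.
  by apply: continuous_comp; [exact: cw|exact: is_derive_cont dF _].
have [F' [rF' dF]] := rsm_derive rF => W; have /smS[cw dw pw] := W; apply/smS; split.
- by move=> x; apply: continuous_comp; [exact: cw|exact: is_derive_cont dF _].
- by move=> i x; have [] := is_derive_comp1 (dw i x) (dF (w x)).
- move=> i; rewrite (_ : partial i _ = (fun x => (F' \o w) x * partial i w x)).
    by apply: smM => //; apply: IH => //; exact: (smW W).
  apply/funext => x; have [_] := is_derive_comp1 (dw i x) (dF (w x)).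
  exact.
Qed.

Lemma smooth_comp (F : R -> R) w : rsm F -> smooth w -> smooth (F \o w).
Proof. by move=> rF /smoothP W; apply/smoothP => n; exact: sm_comp. Qed.

Lemma partial_comp i (F F' : R -> R) w x :
  (forall y : R, is_derive y 1 F (F' y)) -> smooth w ->
  partial i (F \o w) x = F' (w x) * partial i w x.
Proof.
by move=> dF sw; rewrite /partial; have [_ ->] := @is_derive_comp1 F _ w x (e_ i) (smooth_derivable sw) (dF (w x)).
Qed.

Lemma is_derive_affine w (c : R) (h x v : E) : derivable w (c *: x + h) v ->
  is_derive x v (fun y => w (c *: y + h)) (c * 'D_v w (c *: x + h)).
Proof.
move=> dw; apply: is_derive_line0.
pose l := fun s : R => w ((c *: x + h) + s *: v).
have -> : (fun s : R => w (c *: (x + s *: v) + h)) = l \o (fun s => c * s).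
  apply/funext => s /=; rewrite /l; congr w.
  by rewrite scalerDr scalerA addrAC.
rewrite mulrC; apply: (@is_derive1_comp _ l).
  have := @is_derive_line w (c *: x + h) v 0.
  by rewrite scale0r addr0 mulr0; exact.
by apply: is_derive_eq; rewrite [_%:A]mulr1.
Qed.

Lemma affine_cont (c : R) (h : E) : continuous (fun x : E => c *: x + h).
Proof.
move=> x; apply: (@continuousD _ _ _ (fun y : E => c *: y) (fun=> h)).
  exact: scaler_continuous.
exact: cst_continuous.
Qed.

Lemma comp_affine_cont w (c : R) (h : E) : continuous w ->
  continuous (fun x : E => w (c *: x + h)).
Proof.
move=> cw x; apply: (@continuous_comp E E R (fun y => c *: y + h) w x).
  exact: affine_cont.
exact: cw.
Qed.

Lemma partial_affine i w (c : R) (h x : E) : smooth w ->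
  partial i (fun y => w (c *: y + h)) x = c * partial i w (c *: x + h).
Proof.
move=> sw; rewrite /partial; have [_ ->//] := @is_derive_affine w c h x (e_ i) (smooth_derivable sw).
Qed.

Lemma smooth_affine w (c : R) (h : E) : smooth w ->
  smooth (fun x => w (c *: x + h)).
Proof.
move=> sw; apply/smoothP => n; elim: n w sw => [|n IH] w sw /=.
  exact: comp_affine_cont (smooth_cont sw).
split.
- exact: comp_affine_cont (smooth_cont sw).
- move=> i x.
  by have [] := @is_derive_affine w c h x (e_ i) (smooth_derivable sw).
- move=> i; rewrite (_ : partial i _ =
    (fun x => c * partial i w (c *: x + h))); last first.
    by apply/funext => x; rewrite partial_affine.
  by apply: smM; [exact: sm_cst|apply: IH; exact: smooth_partial].
Qed.

Lemma smooth_coord (F : R -> R) (j : 'I_d) : rsm F ->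
  smooth (fun x : E => F (x 0 j)).
Proof.
move=> rF; apply: (@smooth_comp F (fun x => x 0 j)) => //.
apply/smoothP => n; case: n => [|n]; first exact: coord_continuous.
have h i x : is_derive x (e_ i) (fun y : E => y 0 j) (i == j)%:R.
  apply: is_derive_line0.
  rewrite (_ : (fun s : R => _) = (fun s : R => s * (i == j)%:R + x 0 j)).
    by apply: is_derive_eq; rewrite scaler0 add0r addr0 [_%:A]mulr1.
  by apply/funext => s; rewrite !mxE eqxx andTb addrC eq_sym.
split; first exact: coord_continuous.
- by move=> i x; have [] := h i x.
- move=> i; rewrite (_ : partial i _ = fun=> (i == j)%:R); first exact: sm_cst.
  by apply/funext => x; have [] := h i x.
Qed.

End Smooth.

Section Flat.
Context {R : realType}.
Implicit Types (p : {poly R}) (s x : R).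

(** The functions p(1/s) e^{-1/s}, extended by zero to s <= 0. The class is closed under
    differentiation, which sends p to X^2 (p - p'), so all of its members are smooth. *)
Definition flat p s : R := if 0 < s then p.[s^-1] * expR (- s^-1) else 0.

(** For x >= 0 one has x^i e^{-x} <= i!; this is applied to each monomial of [p] with x = 1/s. *)
Lemma flat_bound p : exists2 C, 0 <= C & forall s, `|flat p s| <= C.
Proof.
have pw i (x : R) : 0 <= x -> x ^+ i * expR (- x) <= i`!%:R.
  move=> x0; rewrite expRN ler_pdivrMr ?expR_gt0//.
  have f0 : (0 : R) < i`!%:R by rewrite ltr0n fact_gt0.
  rewrite -ler_pdivrMl// mulrC; case: i f0 => [|i] f0.
    by rewrite expr0 divr1 -expR0 ler_expR.
  by apply: le_trans (expR_ge1Dxn i x0); rewrite lerDr.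
exists (\sum_(i < size p) `|p`_i| * i`!%:R).
  by apply: sumr_ge0 => i _; rewrite mulr_ge0.
move=> s; rewrite /flat; case: ifPn => s0; last first.
  by rewrite normr0; apply: sumr_ge0 => i _; rewrite mulr_ge0.
have x0 : 0 <= s^-1 by rewrite invr_ge0 ltW.
rewrite horner_coef mulr_suml; apply: le_trans (ler_norm_sum _ _ _) _.
apply: ler_sum => i _; rewrite -mulrA normrM ler_wpM2l// ger0_norm ?pw//.
by rewrite mulr_ge0 ?exprn_ge0// expR_ge0.
Qed.

(** Each factor [s] taken out raises the degree of the polynomial by one and leaves a bounded
    function. Two of them show that [flat p s] is O(s^2), hence that its derivative at 0
    vanishes. *)
Lemma flatM p s : flat p s = s * flat ('X * p) s.
Proof.
rewrite /flat; case: ifPn => s0; last by rewrite mulr0.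
by rewrite hornerM hornerX !mulrA divff ?gt_eqF// mul1r.
Qed.

Lemma is_derive_flat p s : is_derive s 1 (flat p) (flat ('X^2 * (p - p^`())) s).
Proof.
have [s0|s0|->] := ltgtP s 0.
- rewrite {2}/flat ltNge (ltW s0)/=.
  have hd : is_derive s 1 (cst (0 : R)) (0 : R).
    by split; [exact: derivable_cst|exact: derive_cst].
  apply: near_eq_is_derive hd; near=> y; rewrite /flat ltNge.
  have /ltW -> // : y < 0 by near: y; exact: lt_nbhsl.
- rewrite {2}/flat s0.
  have sn0 : s != 0 by rewrite gt_eqF.
  have h1 : is_derive s 1 (fun y : R => y^-1) (- s ^- 2).
    have := @is_deriveV R id s 1 1 sn0 (is_derive_id _ _).
    by rewrite [_ *: 1]mulr1.
  have h2 := @is_derive1_comp R (horner p) (fun y => y^-1) s _ _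
    (is_derive_poly p s^-1) h1.
  have h3 : is_derive s 1 (fun y : R => - y^-1) (s ^- 2).
    by rewrite -[X in is_derive _ _ _ X]opprK; exact: is_deriveN.
  have h4 := @is_derive1_comp R expR (fun y => - y^-1) s _ _
    (is_derive_expR (- s^-1)) h3.
  have h5 : is_derive s 1 (fun y => p.[y^-1] * expR (- y^-1))
      (('X^2 * (p - p^`())).[s^-1] * expR (- s^-1)).
    apply: is_derive_eq (is_deriveM h2 h4) _ => /=.
    rewrite /GRing.scale/= hornerM hornerXn hornerD hornerN exprVn.
    by ring.
  apply: near_eq_is_derive h5; near=> y; rewrite /flat.
  have -> // : 0 < y by near: y; exact: lt_nbhsr.
- rewrite [X in is_derive _ _ _ X](_ : _ = 0); last by rewrite /flat ltxx.
  have [C C0 hC] := flat_bound ('X * ('X * p)).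
  have h : (h^-1 *: ((flat p \o shift 0) (h *: 1) - flat p 0)) @[h --> (0:R)^'] --> (0 : R).
    apply/cvgrPdist_le => e e0; near=> h.
    have hn0 : h != 0 by near: h; exact: nbhs_dnbhs_neq.
    rewrite sub0r normrN /= addr0 [_%:A]mulr1 {2}/flat ltxx subr0 flatM flatM.
    rewrite [_ *: _]mulrA mulVf// mul1r normrM.
    have hh : `|h| <= e / (C + 1).
      by near: h; apply: dnbhs0_le; rewrite divr_gt0// ltr_wpDl.
    apply: (@le_trans _ _ (e / (C + 1) * C)).
      by rewrite ler_pM.
    by rewrite mulrAC ler_pdivrMr ?ltr_wpDl// ler_pM2l// lerDl.
  split; [exact: cvgP h|exact: cvg_lim h].
Unshelve. all: by end_near. Qed.

Lemma rsm_flat p : rsm (flat p).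
Proof.
exists (fun n => flat (iter n (fun q => 'X^2 * (q - q^`())) p)); split => //.
by move=> n y; exact: is_derive_flat.
Qed.

Lemma rsmD (F G : R -> R) : rsm F -> rsm G -> rsm (fun s => F s + G s).
Proof.
move=> [D [<- hD]] [D' [<- hD']]; exists (fun n s => D n s + D' n s); split => // n y.
exact: is_deriveD (hD n y) (hD' n y).
Qed.

Lemma rsmZ c (F : R -> R) : rsm F -> rsm (fun s => c * F s).
Proof.
move=> [D [<- hD]]; exists (fun n s => c * D n s); split => // n y.
exact: is_deriveZ (hD n y).
Qed.

Lemma is_derive_scale_arg (c : R) (F : R -> R) (y a : R) :
  is_derive (c * y) 1 F a -> is_derive y 1 (fun s => F (c * s)) (c * a).
Proof.
move=> h; rewrite mulrC; apply: (@is_derive1_comp _ F (fun s => c * s)) => //.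
by apply: is_derive_eq; rewrite [_ *: 1]mulr1.
Qed.

Lemma rsm_scale_arg c (F : R -> R) : rsm F -> rsm (fun s => F (c * s)).
Proof.
move=> [D [<- hD]]; exists (fun n s => c ^+ n * D n (c * s)); split.
  by apply/funext => s; rewrite expr0 mul1r.
move=> n y; have h := is_deriveZ (c ^+ n) (is_derive_scale_arg (hD n (c * y))).
by apply: is_derive_eq h _; rewrite exprS [_ *: _]mulrA [c ^+ n * c]mulrC.
Qed.

Lemma rsm_primitive (F F' : R -> R) : (forall y : R, is_derive y 1 F (F' y)) ->
  rsm F' -> rsm F.
Proof.
move=> h [D [D0 hD]]; exists (fun n => if n is m.+1 then D m else F); split => //.
by case=> [|n] y //; rewrite D0.
Qed.

Lemma flat1_ge0 s : 0 <= flat 1 s.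
Proof.
by rewrite /flat; case: ifP => // _; rewrite hornerC mul1r expR_ge0.
Qed.

Lemma flat1_le1 s : flat 1 s <= 1.
Proof.
rewrite /flat; case: ifPn => // s0; rewrite hornerC mul1r -expR0 ler_expR.
by rewrite oppr_le0 invr_ge0 ltW.
Qed.

Lemma flat1_gt0 s : 0 < s -> 0 < flat 1 s.
Proof. by move=> s0; rewrite /flat s0 hornerC mul1r expR_gt0. Qed.

Lemma flat1_cvg s : 0 < s -> flat 1 (n.+1%:R * s) @[n --> \oo] --> (1 : R).
Proof.
move=> s0; rewrite -[X in _ --> X]expR0.
apply: (@cvg_trans _ (expR (- (n.+1%:R^-1 * s^-1)) @[n --> \oo])).
  apply: near_eq_cvg; apply: nearW => n.
  by rewrite /flat mulr_gt0// hornerC mul1r invfM.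
apply: (@cvg_comp _ _ _ _ expR _ (nbhs (0 : R))); last exact: continuous_expR.
rewrite -oppr0 -(mul0r s^-1); apply: cvgN; apply: cvgM; last exact: cvg_cst.
exact: cvg_harmonic.
Qed.

(* [trunc m s = s e^{-1/(m|s|)}] is smooth, vanishes to infinite order at 0 and
   tends to s as m grows; [strunc m s = sgn(s) trunc' m s]. *)
Definition trunc (m s : R) := s * (flat 1 (m * s) + flat 1 (- m * s)).
(** For m > 0 this is |s| e^{-1/(m|s|)}, the primitive of [strunc m] vanishing at 0; it makes
    strunc(w) grad w the gradient of a function of w. *)
Definition ptrunc (m s : R) := s * (flat 1 (m * s) - flat 1 (- m * s)).
Definition trunc' (m s : R) := flat (1 + 'X) (m * s) + flat (1 + 'X) (- m * s).
Definition strunc (m s : R) := flat (1 + 'X) (m * s) - flat (1 + 'X) (- m * s).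
Definition trunc'' (m s : R) :=
  m * (flat 'X^3 (m * s) - flat 'X^3 (- m * s)).
Definition strunc' (m s : R) :=
  m * (flat 'X^3 (m * s) + flat 'X^3 (- m * s)).

Lemma flat_id_derive c s : is_derive s 1 (fun s => s * flat 1 (c * s))
  (flat (1 + 'X) (c * s)).
Proof.
have h := is_derive_scale_arg (is_derive_flat 1 (c * s)).
apply: is_derive_eq (is_deriveM (is_derive_id s (1 : R)) h) _ => /=.
rewrite /GRing.scale/= derivC subr0 mulr1 mulrA [s * c]mulrC -/(1%:P).
rewrite /flat; case: ifPn => cs0; last by rewrite !(mulr0, mul0r, addr0).
rewrite mulr1 hornerXn hornerC mul1r hornerD hornerX hornerC expr2 !mulrA divff ?gt_eqF//.
by rewrite mul1r; ring.
Qed.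

Lemma flat1X_derive c s : is_derive s 1 (fun s => flat (1 + 'X) (c * s))
  (c * flat 'X^3 (c * s)).
Proof.
have h := is_derive_scale_arg (is_derive_flat (1 + 'X) (c * s)).
apply: is_derive_eq h _; congr (c * flat _ _).
by rewrite derivD derivC derivX add0r addrAC subrr add0r -exprSr.
Qed.

Lemma trunc_derive m s : is_derive s 1 (trunc m) (trunc' m s).
Proof.
rewrite (_ : trunc m = (fun s => s * flat 1 (m * s)) + (fun s => s * flat 1 (- m * s))).
  exact: is_deriveD (flat_id_derive m s) (flat_id_derive (- m) s).
by apply/funext => x; rewrite /trunc mulrDr.
Qed.

Lemma ptrunc_derive m s : is_derive s 1 (ptrunc m) (strunc m s).
Proof.
rewrite (_ : ptrunc m = (fun s => s * flat 1 (m * s)) - (fun s => s * flat 1 (- m * s))).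
  exact: is_deriveB (flat_id_derive m s) (flat_id_derive (- m) s).
by apply/funext => x; rewrite /ptrunc mulrBr.
Qed.

Lemma trunc'_derive m s : is_derive s 1 (trunc' m) (trunc'' m s).
Proof.
rewrite (_ : trunc'' m s = m * flat 'X^3 (m * s) + - m * flat 'X^3 (- m * s)).
  exact: is_deriveD (flat1X_derive m s) (flat1X_derive (- m) s).
by rewrite /trunc'' mulrBr [- m * flat _ _]mulNr.
Qed.

Lemma strunc_derive m s : is_derive s 1 (strunc m) (strunc' m s).
Proof.
rewrite (_ : strunc' m s = m * flat 'X^3 (m * s) - - m * flat 'X^3 (- m * s)).
  exact: is_deriveB (flat1X_derive m s) (flat1X_derive (- m) s).
by rewrite /strunc' mulrDr [- m * flat _ _]mulNr opprK.
Qed.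

Lemma rsm_trunc' m : rsm (trunc' m).
Proof. by apply: rsmD; apply: rsm_scale_arg; exact: rsm_flat. Qed.

Lemma rsm_strunc m : rsm (strunc m).
Proof.
have := rsmD (rsm_scale_arg m (rsm_flat (1 + 'X)))
  (rsmZ (-1) (rsm_scale_arg (- m) (rsm_flat (1 + 'X)))).
by under eq_fun do rewrite mulN1r.
Qed.

Lemma rsm_trunc m : rsm (trunc m).
Proof. exact: rsm_primitive (trunc_derive m) (rsm_trunc' m). Qed.

Lemma rsm_ptrunc m : rsm (ptrunc m).
Proof. exact: rsm_primitive (ptrunc_derive m) (rsm_strunc m). Qed.

Lemma rsm_bounded_derive (F F' : R -> R) (C : R) : (forall y : R, is_derive y 1 F (F' y)) ->
  (forall y, `|F' y| <= C) -> forall x y, `|F x - F y| <= C * `|x - y|.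
Proof.
move=> dF bF x y; wlog xy : x y / y <= x.
  move=> H; case/orP: (le_total x y) => h; last exact: H.
  by rewrite distrC [`|x - y|]distrC; exact: H.
have h1 z : z \in `]y, x[ -> is_derive z 1 F (F' z) by [].
have h2 : {within `[y, x], continuous F}.
  by apply: continuous_subspaceT; exact: is_derive_cont dF.
by have [c _ ->] := MVT_segment xy h1 h2; rewrite normrM ler_wpM2r.
Qed.

Lemma flat1X_bnd s : 0 <= flat (1 + 'X) s <= 1.
Proof.
rewrite /flat; case: ifPn => s0; last by rewrite lexx ler01.
rewrite hornerD hornerX hornerC.
have x0 : 0 <= s^-1 by rewrite invr_ge0 ltW.
rewrite mulr_ge0 ?expR_ge0 ?addr_ge0//= expRN ler_pdivrMr ?expR_gt0// mul1r.
exact: expR_ge1Dx.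
Qed.

Lemma flatX3_ge0 s : 0 <= flat 'X^3 s.
Proof.
rewrite /flat; case: ifPn => s0//.
by rewrite hornerXn mulr_ge0 ?expR_ge0 ?exprn_ge0// invr_ge0 ltW.
Qed.

Lemma flat_neg p s : s <= 0 -> flat p s = 0.
Proof. by move=> s0; rewrite /flat ltNge s0. Qed.

Lemma trunc0 m : trunc m 0 = 0. Proof. by rewrite /trunc mul0r. Qed.
Lemma ptrunc0 m : ptrunc m 0 = 0. Proof. by rewrite /ptrunc mul0r. Qed.
Lemma trunc'0 m : trunc' m 0 = 0.
Proof. by rewrite /trunc' !mulr0 !flat_neg// addr0. Qed.
Lemma strunc0 m : strunc m 0 = 0.
Proof. by rewrite /strunc !mulr0 !flat_neg// subrr. Qed.

(** The two arguments have opposite signs, so at most one summand of each truncation is active at a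
    time; bounds and absolute values are read off that one. *)
Lemma flat_disj m s p q : flat p (m * s) = 0 \/ flat q (- m * s) = 0.
Proof.
have [h|h] := leP (m * s) 0; [left|right]; apply: flat_neg => //.
by rewrite mulNr oppr_le0 ltW.
Qed.

Lemma trunc'_bnd m s : 0 <= trunc' m s <= 1.
Proof.
by rewrite /trunc'; case: (flat_disj m s (1 + 'X) (1 + 'X)) => ->;
  rewrite ?add0r ?addr0; exact: flat1X_bnd.
Qed.

Lemma norm_strunc m s : `|strunc m s| = trunc' m s.
Proof.
rewrite /strunc /trunc'.
by case: (flat_disj m s (1 + 'X) (1 + 'X)) => ->;
  rewrite ?add0r ?addr0 ?sub0r ?subr0 ?normrN ger0_norm//;
  case/andP: (flat1X_bnd (m * s)); case/andP: (flat1X_bnd (- m * s)).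
Qed.

Lemma norm_trunc'' m s : 0 < m -> `|trunc'' m s| = strunc' m s.
Proof.
move=> m0; rewrite /strunc' /trunc'' normrM gtr0_norm//.
by case: (flat_disj m s 'X^3 'X^3) => ->;
  rewrite ?add0r ?addr0 ?sub0r ?subr0 ?normrN ger0_norm// ?flatX3_ge0.
Qed.

Lemma mul_strunc m s : 0 < m -> s * strunc m s = `|s| * trunc' m s.
Proof.
move=> m0; rewrite /strunc /trunc'; have [s0|s0] := leP s 0.
  rewrite (@flat_neg _ (m * s)) ?pmulr_rle0// ler0_norm// sub0r add0r.
  by rewrite mulrN [RHS]mulNr.
by rewrite (@flat_neg _ (- m * s)) ?subr0 ?addr0 ?gtr0_norm// mulNr oppr_le0 ltW// mulr_gt0.
Qed.

Lemma norm_trunc_le m s : `|trunc m s| <= `|s|.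
Proof.
rewrite /trunc normrM -[leRHS]mulr1 ler_wpM2l//.
by case: (flat_disj m s 1 1) => ->; rewrite ?add0r ?addr0 ger0_norm ?flat1_ge0 ?flat1_le1.
Qed.

Lemma bounded_trunc'' m : exists2 C, 0 <= C & forall s, `|trunc'' m s| <= C.
Proof.
have [C C0 hC] := flat_bound 'X^3; exists (`|m| * (C + C)).
  by rewrite mulr_ge0// addr_ge0.
by move=> s; rewrite /trunc'' normrM ler_wpM2l// (le_trans (ler_normB _ _))// lerD.
Qed.

Lemma bounded_strunc' m : exists2 C, 0 <= C & forall s, `|strunc' m s| <= C.
Proof.
have [C C0 hC] := flat_bound 'X^3; exists (`|m| * (C + C)).
  by rewrite mulr_ge0// addr_ge0.
by move=> s; rewrite /strunc' normrM ler_wpM2l// (le_trans (ler_normD _ _))// lerD.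
Qed.

Lemma flat1X_ge s : flat 1 s <= flat (1 + 'X) s.
Proof.
rewrite /flat; case: ifPn => s0//.
by rewrite ler_wpM2r ?expR_ge0// hornerD hornerX hornerC lerDl invr_ge0 ltW.
Qed.

(** The limit at 0 would be 0; in the remainders [trunc'] is always accompanied by a factor [w],
    which hides this exception. *)
Lemma cvg_trunc' s : s != 0 -> trunc' n.+1%:R s @[n --> \oo] --> (1 : R).
Proof.
move=> sn0; apply: (@squeeze_cvgr _ _ _ _ (fun n => flat 1 (n.+1%:R * `|s|)) (cst 1)).
- apply: nearW => n; have /andP[_ ->] := trunc'_bnd n.+1%:R s; rewrite andbT.
  rewrite /trunc'; have [s0|s0] := ger0P s.
    by apply: le_trans (flat1X_ge _) _; rewrite lerDl; case/andP: (flat1X_bnd (- n.+1%:R * s)).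
  rewrite mulrN -mulNr; apply: le_trans (flat1X_ge _) _.
  by rewrite lerDr; case/andP: (flat1X_bnd (n.+1%:R * s)).
- by apply: flat1_cvg; rewrite normr_gt0.
- exact: cvg_cst.
Qed.

Lemma cvg_trunc s : trunc n.+1%:R s @[n --> \oo] --> s.
Proof.
have [->|sn0] := eqVneq s 0.
  by under eq_fun do rewrite trunc0; exact: cvg_cst.
rewrite -[X in _ --> X]mulr1 /trunc; apply: cvgM; first exact: cvg_cst.
have [s0|s0] := ltP 0 s.
  under eq_fun do rewrite (@flat_neg _ (- _ * s)) ?addr0 ?mulNr ?oppr_le0 ?mulr_ge0 ?(ltW s0)//.
  exact: flat1_cvg.
have s1 : 0 < - s by rewrite oppr_gt0 lt_neqAle sn0.
under eq_fun do rewrite (@flat_neg _ (_ * s)) ?add0r ?mulNr -?mulrN ?pmulr_rle0//.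
exact: flat1_cvg.
Qed.

End Flat.

(** * Lebesgue measure and test functions *)

Section EuclidMeasure.
Context {R : realType} {d : nat}.
Local Notation E := 'rV[R]_d.
Implicit Types (x y a b h : E) (i : 'I_d).

Lemma norm_leP x (r : R) : 0 <= r -> `|x| <= r <-> forall i, `|x 0 i| <= r.
Proof.
move=> r0; rewrite [`|x|]mx_normrE; split.
  by move=> /bigmax_leP[_ H] i; exact: (H (0, i)).
by move=> H; apply/bigmax_leP; split => // -[j i] _ /=; rewrite (ord1 j).
Qed.

Lemma norm_ltP x (r : R) : 0 < r -> `|x| < r <-> forall i, `|x 0 i| < r.
Proof.
move=> r0; rewrite [`|x|]mx_normrE; split.
  by move=> /bigmax_ltP[_ H] i; exact: (H (0, i)).
by move=> H; apply/bigmax_ltP; split => // -[j i] _ /=; rewrite (ord1 j).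
Qed.

Lemma norm_coord x i : `|x 0 i| <= `|x|.
Proof. by have [h _] := norm_leP x (normr_ge0 x); exact: h. Qed.

Definition obox a b : set E := [set x | forall i, a 0 i < x 0 i < b 0 i].
Definition cbox a b : set E := [set x | forall i, a 0 i <= x 0 i <= b 0 i].

Lemma open_measE (U : set E) : open U -> measurable U.
Proof. by move=> oU; apply: sub_sigma_algebra. Qed.

Lemma closed_measE (U : set E) : closed U -> measurable U.
Proof. by move=> cU; rewrite -[U]setCK; apply: measurableC; apply: open_measE; exact: closed_openC. Qed.

Lemma cont_meas (f : E -> R) : continuous f -> measurable_fun setT f.
Proof.
move=> /continuousP cf; apply: (measurability _ (RGenOInfty.measurableE R)).
move=> _ [_ [r ->] <-]; rewrite setTI; apply: open_measE.
by apply: cf; exact: rray_open.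
Qed.

Lemma coord_meas i : measurable_fun setT (fun x : E => x 0 i).
Proof. by apply: cont_meas; exact: coord_continuous. Qed.

Lemma obox_meas a b : measurable (obox a b).
Proof.
rewrite (_ : obox a b = \bigcap_(i : 'I_d) ((fun x => x 0 i) @^-1` `]a 0 i, b 0 i[%classic)).
  apply: fin_bigcap_measurable => [|i _]; first exact: finite_finset.
  by rewrite -[X in measurable X]setTI; apply: coord_meas.
apply/seteqP; split=> x /=; first by move=> H i _ /=; rewrite in_itv/=; exact: H.
by move=> H i; have := H i I; rewrite /= in_itv.
Qed.

Lemma cbox_meas a b : measurable (cbox a b).
Proof.
rewrite (_ : cbox a b = \bigcap_(i : 'I_d) ((fun x => x 0 i) @^-1` `[a 0 i, b 0 i]%classic)).
  apply: fin_bigcap_measurable => [|i _]; first exact: finite_finset.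
  by rewrite -[X in measurable X]setTI; apply: coord_meas.
apply/seteqP; split=> x /=; first by move=> H i _ /=; rewrite in_itv/=; exact: H.
by move=> H i; have := H i I; rewrite /= in_itv.
Qed.

Lemma obox_cbox a b : obox a b `<=` cbox a b.
Proof. by move=> x H i; have /andP[/ltW-> /ltW->] := H i. Qed.

Definition ratv (q : 'rV[rat]_d) : E := map_mx ratr q.

Lemma rat_box (U : set E) x : open U -> U x ->
  exists q : 'rV[rat]_d * 'rV[rat]_d,
    obox (ratv q.1) (ratv q.2) x /\ cbox (ratv q.1) (ratv q.2) `<=` U.
Proof.
move=> oU Ux; have /nbhs_ballP[e /= e0 eU] : nbhs x U by exact: open_nbhs_nbhs.
have h i : exists q : rat * rat, (x 0 i - e / 2 < ratr q.1 < x 0 i) /\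
    (x 0 i < ratr q.2 < x 0 i + e / 2).
  have h1 : x 0 i - e / 2 < x 0 i by rewrite ltrBlDr ltrDl divr_gt0.
  have h2 : x 0 i < x 0 i + e / 2 by rewrite ltrDl divr_gt0.
  have [q1 q1P] := rat_in_itvoo h1; have [q2 q2P] := rat_in_itvoo h2.
  by exists (q1, q2); move: q1P q2P; rewrite !in_itv.
have [q qP] := choice h.
exists (\row_i (q i).1, \row_i (q i).2); split.
  by move=> i; rewrite !mxE; case: (qP i) => /andP[_ ->] /andP[->].
move=> y H; apply: eU; rewrite -ball_normE/=; apply/norm_ltP => // i.
have := H i; rewrite !mxE => /andP[h1 h2].
have [/andP[h3 h4] /andP[h5 h6]] := qP i.
by rewrite ltr_norml; lra.
Qed.

(** An open set is the union of the boxes with rational corners that belong to the family and lie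
    inside it, which is a countable union; boxes that do not qualify are replaced by the empty
    set. *)
Lemma sigma_gen (G : set (set E)) : G `<=` measurable ->
  (forall U, open U -> forall x, U x -> exists q : 'rV[rat]_d * 'rV[rat]_d,
    exists2 B, G B & B x /\ B `<=` U /\
    (B = obox (ratv q.1) (ratv q.2) \/ B = cbox (ratv q.1) (ratv q.2))) ->
  @measurable _ E = <<s G >>.
Proof.
move=> Gm H; apply/seteqP; split; last first.
  by apply: smallest_sub => //; exact: sigma_algebra_measurable.
apply: smallest_sub; first exact: smallest_sigma_algebra.
move=> U oU.
pose F (q : 'rV[rat]_d * 'rV[rat]_d) (o : bool) :=
  if o then obox (ratv q.1) (ratv q.2) else cbox (ratv q.1) (ratv q.2).
pose F' (k : 'rV[rat]_d * 'rV[rat]_d * bool) : set E :=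
  if `[< G (F k.1 k.2) /\ F k.1 k.2 `<=` U >] then F k.1 k.2 else set0.
have -> : U = \bigcup_k F' k.
  apply/seteqP; split=> [x Ux|x [k _]]; last first.
    by rewrite /F'; case: asboolP => // -[_ h] /h.
  have [q [B GB [Bx [BU Bq]]]] := H U oU x Ux.
  case: Bq => BE; [exists (q, true)|exists (q, false)] => //; rewrite /F'/= -BE;
  by case: asboolP => // h; exfalso; apply: h.
rewrite -[X in <<s _ >> X]bigcup_set0 || idtac.
apply: (@countable_bigcupT_measurable _ (g_sigma_algebraType G)) => //.
move=> k; rewrite /F'; case: asboolP => [[h _]|_]; last exact: measurable0.
exact: sub_sigma_algebra.
Qed.

Lemma measE_obox : @measurable _ E = <<s [set B | exists a b, B = obox a b] >>.
Proof.
apply: sigma_gen => [_ [a [b ->]]|U oU x Ux]; first exact: obox_meas.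
have [q [h1 h2]] := rat_box oU Ux; exists q; exists (obox (ratv q.1) (ratv q.2)).
  by exists (ratv q.1), (ratv q.2).
split=> //; split; last by left.
by apply: subset_trans h2; exact: obox_cbox.
Qed.

Lemma measE_cbox : @measurable _ E = <<s [set B | exists a b, B = cbox a b] >>.
Proof.
apply: sigma_gen => [_ [a [b ->]]|U oU x Ux]; first exact: cbox_meas.
have [q [h1 h2]] := rat_box oU Ux; exists q; exists (cbox (ratv q.1) (ratv q.2)).
  by exists (ratv q.1), (ratv q.2).
split; first exact: obox_cbox.
by split; last by right.
Qed.

Definition maxv x y : E := \row_i Num.max (x 0 i) (y 0 i).
Definition minv x y : E := \row_i Num.min (x 0 i) (y 0 i).

Lemma oboxI a b a' b' : obox a b `&` obox a' b' = obox (maxv a a') (minv b b').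
Proof.
apply/seteqP; split => x /=.
  by move=> [h1 h2] i; rewrite !mxE gt_max lt_min; case/andP: (h1 i) => -> ->; case/andP: (h2 i) => -> ->.
move=> H; split=> i; have := H i; rewrite !mxE gt_max lt_min => /andP[/andP[h1 h2] /andP[h3 h4]];
by rewrite ?h1 ?h2 ?h3 ?h4.
Qed.

Lemma cboxI a b a' b' : cbox a b `&` cbox a' b' = cbox (maxv a a') (minv b b').
Proof.
apply/seteqP; split => x /=.
  by move=> [h1 h2] i; rewrite !mxE ge_max le_min; case/andP: (h1 i) => -> ->; case/andP: (h2 i) => -> ->.
move=> H; split=> i; have := H i; rewrite !mxE ge_max le_min => /andP[/andP[h1 h2] /andP[h3 h4]];
by rewrite ?h1 ?h2 ?h3 ?h4.
Qed.

Definition cube (r : R) : set E := [set x | `|x| < r].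

Lemma cube_obox r : 0 < r -> cube r = obox (const_mx (- r)) (const_mx r).
Proof.
move=> r0; apply/seteqP; split=> x /=.
  by move=> /(norm_ltP _ r0) H i; rewrite !mxE -ltr_norml.
by move=> H; apply/norm_ltP => // i; have := H i; rewrite !mxE ltr_norml.
Qed.

Lemma ball_cbox r : 0 <= r -> [set x : E | `|x| <= r] = cbox (const_mx (- r)) (const_mx r).
Proof.
move=> r0; apply/seteqP; split=> x /=.
  by move=> /(norm_leP _ r0) H i; rewrite !mxE -ler_norml.
by move=> H; apply/norm_leP => // i; have := H i; rewrite !mxE ler_norml.
Qed.

Lemma open_cube r : open (cube r).
Proof.
rewrite (_ : cube r = (fun x : E => `|x|) @^-1` [set y | y < r])//.
by apply: open_comp => [x _|]; [exact: norm_continuous|exact: open_lt].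
Qed.

Lemma closed_ball_E r : closed [set x : E | `|x| <= r].
Proof.
rewrite (_ : [set x : E | _] = (fun x : E => `|x|) @^-1` [set y | y <= r])//.
by apply: closed_comp => [x _|]; [exact: norm_continuous|exact: closed_le].
Qed.

Lemma compact_ball_E r : compact [set x : E | `|x| <= r].
Proof.
apply: bounded_closed_compact; last exact: closed_ball_E.
exists r; split; first exact: num_real.
by move=> s rs x /= /le_trans; apply; exact: ltW.
Qed.

Lemma meas_cube r : measurable (cube r).
Proof. by apply: open_measE; exact: open_cube. Qed.

Lemma meas_to_E (d' : measure_display) (T : measurableType d') (f : T -> E) :
  (forall i, measurable_fun setT (fun t => f t 0 i)) -> measurable_fun setT f.
Proof.
move=> mf; apply: (measurability _ measE_obox) => _ [_ [a [b ->]] <-].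
rewrite setTI (_ : _ @^-1` _ =
  \bigcap_(i : 'I_d) ((fun t => f t 0 i) @^-1` `]a 0 i, b 0 i[%classic)).
  apply: fin_bigcap_measurable => [|i _]; first exact: finite_finset.
  by rewrite -[X in measurable X]setTI; apply: mf.
apply/seteqP; split=> x /=; first by move=> H i _ /=; rewrite in_itv/=; exact: H.
by move=> H i; have := H i I; rewrite /= in_itv.
Qed.

Lemma meas_affine (c : R) h : measurable_fun setT (fun x : E => c *: x + h).
Proof.
apply: meas_to_E => i; under eq_fun do rewrite !mxE.
by apply: measurable_funD => //; apply: measurable_funM => //; exact: coord_meas.
Qed.

Definition prod_coord_meas (c : R) (d' : measure_display) (T : measurableType d')
    (f g : T -> E) : measurable_fun setT f -> measurable_fun setT g ->
  measurable_fun setT (fun t => f t + c *: g t).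
Proof.
move=> mf mg; apply: meas_to_E => i; under eq_fun do rewrite !mxE.
apply: measurable_funD; first exact: (measurableT_comp (coord_meas i) mf).
by apply: measurable_funM => //; exact: (measurableT_comp (coord_meas i) mg).
Qed.

Section Lebesgue.
Variable lam : {measure set E -> \bar R}.
Hypothesis lamL : is_lebesgue lam.

Lemma lam_cbox_lty a b : (lam (cbox a b) < +oo)%E.
Proof.
have [ab|/existsNP[i /negP]] := pselect (forall i, a 0 i <= b 0 i).
  by rewrite (lamL ab) ltry.
rewrite -ltNge => ba; rewrite (_ : cbox a b = set0) ?measure0//.
by apply/seteqP; split => // x /(_ i) /andP[/le_trans h /h]; rewrite leNgt ba.
Qed.

Lemma lam_ball_lty (r : R) : (lam [set x : E | (`|x| <= r)%R] < +oo)%E.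
Proof.
have [r0|r0] := leP 0 r; first by rewrite ball_cbox// lam_cbox_lty.
rewrite (_ : [set x : E | _] = set0) ?measure0//.
by apply/seteqP; split => // x /=; rewrite leNgt (lt_le_trans r0).
Qed.

Lemma lam_cube_lty r : (lam (cube r) < +oo)%E.
Proof.
apply: le_lt_trans (lam_ball_lty r); apply: le_measure; rewrite ?inE.
- exact: meas_cube.
- by apply: closed_measE; exact: closed_ball_E.
- by move=> x /= /ltW.
Qed.

(** The open box contains the closed box of the middle thirds, whose measure is prescribed. *)
Lemma lam_obox_gt0 a b : (forall i, a 0 i < b 0 i) -> (0 < lam (obox a b))%E.
Proof.
move=> ab; pose a' : E := \row_i (a 0 i + (b 0 i - a 0 i) / 3).
pose b' : E := \row_i (b 0 i - (b 0 i - a 0 i) / 3).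
apply: (@lt_le_trans _ _ (lam (cbox a' b'))).
  rewrite lamL.
    by rewrite lte_fin prodr_gt0// => i _; rewrite !mxE; have := ab i; lra.
  by move=> i; rewrite !mxE; have := ab i; lra.
apply: le_measure; rewrite ?inE; [exact: cbox_meas|exact: obox_meas|].
by move=> x H i; have := H i; rewrite !mxE; have := ab i; lra.
Qed.

Lemma lam_cover : \bigcup_n cbox (const_mx (- n%:R)) (const_mx n%:R) = [set: E].
Proof.
apply/seteqP; split => // x _; exists (Num.bound `|x|) => //.
rewrite -ball_cbox//= ltW//.
by apply: le_lt_trans (archi_boundP _).
Qed.

Lemma lam_sigma_finite : sigma_finite setT lam.
Proof.
exists (fun n => cbox (const_mx (- n%:R)) (const_mx n%:R)); first by rewrite lam_cover.
by move=> n; split; [exact: cbox_meas|exact: lam_cbox_lty].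
Qed.

(** Closed boxes form a pi-system that generates the Borel sets and exhausts the space by sets of
    finite measure. The image of [lam] and its multiple agree on them, hence everywhere. *)
Lemma lam_affine (c : R) h (B : set E) : 0 < c -> measurable B ->
  lam ((fun x => c *: x + h) @^-1` B) = ((c^-1 ^+ d)%:E * lam B)%E.
Proof.
move=> c0 mB.
pose phi : {mfun E >-> E} := HB.pack (fun x : E => c *: x + h)
  (isMeasurableFun.Build _ _ _ _ _ (meas_affine c h)).
have k0 : 0 <= c^-1 ^+ d by rewrite exprn_ge0// invr_ge0 ltW.
pose k : {nonneg R} := NngNum k0.
have := @measure_unique _ R E [set B | exists a b, B = cbox a b]
  (fun n => cbox (const_mx (- n%:R)) (const_mx n%:R)) measE_cbox _ _ lam_cover
  (pushforward lam phi) (mscale k lam) _ _ B mB.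
apply.
- by move=> _ _ [a [b ->]] [a' [b' ->]]; exists (maxv a a'), (minv b b'); rewrite cboxI.
- by move=> n; exists (const_mx (- n%:R)), (const_mx n%:R).
- move=> _ [a [b ->]]; change (lam ((fun x : E => c *: x + h) @^-1` cbox a b) =
    ((c^-1 ^+ d)%:E * lam (cbox a b))%E).
  have -> : (fun x : E => c *: x + h) @^-1` cbox a b =
      cbox (c^-1 *: (a - h)) (c^-1 *: (b - h)).
    apply/seteqP; split=> x /= H i; have := H i; rewrite !mxE.
      by rewrite ler_pdivrMl// ler_pdivlMl// lerBlDr lerBrDr.
    by rewrite ler_pdivrMl// ler_pdivlMl// lerBlDr lerBrDr.
  (* [is_lebesgue] is silent on boxes with a reversed pair of corners; these are empty on both
     sides. *)
  have [ab|/existsNP[i /negP]] := pselect (forall i, a 0 i <= b 0 i); last first.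
    rewrite -ltNge => ba.
    have e1 (u v : E) : v 0 i < u 0 i -> cbox u v = set0.
      move=> uv; apply/seteqP; split => // x /(_ i) /andP[/le_trans H /H].
      by rewrite leNgt uv.
    rewrite (e1 a b)// e1 ?measure0 ?mule0//.
    by rewrite !mxE ltr_pM2l ?invr_gt0// ltrD2r.
  rewrite [X in _ = (_ * X)%E]lamL// lamL; last first.
    by move=> i; rewrite !mxE ler_pM2l ?invr_gt0// lerD2r.
  rewrite -EFinM; congr EFin.
  rewrite -[in X in X * _](card_ord d) -prodr_const -big_split/=.
  by apply: eq_bigr => i _; rewrite !mxE; ring.
- move=> n; change (lam ((fun x : E => c *: x + h)%R @^-1`
    cbox (const_mx (- n%:R)%R) (const_mx n%:R)) < +oo)%E.
  have -> : (fun x : E => c *: x + h) @^-1` cbox (const_mx (- n%:R)) (const_mx n%:R) =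
      cbox (c^-1 *: (const_mx (- n%:R) - h)) (c^-1 *: (const_mx n%:R - h)).
    apply/seteqP; split=> x /= H i; have := H i; rewrite !mxE;
    by rewrite ler_pdivrMl// ler_pdivlMl// lerBlDr lerBrDr.
  exact: lam_cbox_lty.
Qed.

Lemma ge0_integral_affine (c : R) h (f : E -> \bar R) : 0 < c ->
  measurable_fun setT f -> (forall x, 0 <= f x)%E ->
  (\int[lam]_x f (c *: x + h)%R = (c^-1 ^+ d)%:E * \int[lam]_x f x)%E.
Proof.
move=> c0 mf f0.
have k0 : 0 <= c^-1 ^+ d by rewrite exprn_ge0// invr_ge0 ltW.
pose k : {nonneg R} := NngNum k0.
pose phi : {mfun E >-> E} := HB.pack (fun x : E => c *: x + h)
  (isMeasurableFun.Build _ _ _ _ _ (meas_affine c h)).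
have := @ge0_integral_pushforward _ _ _ _ _ phi (meas_affine c h) lam setT f measurableT mf
  (fun x _ => f0 x).
rewrite preimage_setT => <-.
rewrite -[(c^-1 ^+ d)]/(k%:num) -ge0_integral_mscale//.
by apply: eq_measure_integral => A mA _; exact: lam_affine.
Qed.

Lemma integral_affine (c : R) h (f : E -> R) : 0 < c -> ig lam f ->
  ig lam (fun x => f (c *: x + h)) /\
  \int[lam]_x f (c *: x + h) = c^-1 ^+ d * \int[lam]_x f x.
Proof.
move=> c0 ff.
have mf := ig_meas ff.
have mfc : measurable_fun setT (fun x => f (c *: x + h)).
  exact: measurableT_comp mf (meas_affine c h).
have nn (g : E -> \bar R) : measurable_fun setT g -> (forall x, 0 <= g x)%E ->
  (\int[lam]_x g (c *: x + h)%R = (c^-1 ^+ d)%:E * \int[lam]_x g x)%E.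
  exact: ge0_integral_affine.
have mfE : measurable_fun setT (EFin \o f) by exact/measurable_EFinP.
have k0 : 0 <= c^-1 ^+ d by rewrite exprn_ge0// invr_ge0 ltW.
have Ig : ig lam (fun x => f (c *: x + h)).
  apply/integrableP; split; first exact/measurable_EFinP.
  rewrite (nn (fun x => `|(f x)%:E|%E))//; last first.
    by apply: measurableT_comp => //; exact/measurable_EFinP.
  by apply: lte_mul_pinfty => //; case/integrableP : ff.
split=> //; rewrite /Rintegral integralE [in RHS]integralE.
have h1 : (\int[lam]_x (fun x => (f (c *: x + h))%:E)^\+ x =
   (c^-1 ^+ d)%:E * \int[lam]_x (fun x => (f x)%:E)^\+ x)%E.
  rewrite -(nn _ (measurable_funepos mfE) (fun x => funepos_ge0 _ x)).
  by apply: eq_integral => x _; rewrite !funeposE.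
have h2 : (\int[lam]_x (fun x => (f (c *: x + h))%:E)^\- x =
   (c^-1 ^+ d)%:E * \int[lam]_x (fun x => (f x)%:E)^\- x)%E.
  rewrite -(nn _ (measurable_funeneg mfE) (fun x => funeneg_ge0 _ x)).
  by apply: eq_integral => x _; rewrite !funenegE.
rewrite h1 h2.
have f1 := integrable_pos_fin_num measurableT ff.
have f2 := integrable_neg_fin_num measurableT ff.
by rewrite fineB ?fin_numM// [in RHS]fineB// !fineM// mulrBr.
Qed.

End Lebesgue.
End EuclidMeasure.

Section DCT.
Context dd (T : measurableType dd) (R : realType) (mu : {measure set T -> \bar R}).

Lemma n1_dct (F : nat -> T -> R) (f g : T -> R) :
  (forall n, measurable_fun setT (F n)) -> measurable_fun setT f ->
  (forall x, F n x @[n --> \oo] --> f x) ->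
  (forall n x, `|F n x - f x| <= g x) -> ig mu g ->
  n1 mu (F n \- f) @[n --> \oo] --> (0 : R).
Proof.
move=> mF mf Ff Fg gi.
have mFf n : measurable_fun setT (fun x => `|F n x - f x|).
  by apply: measurableT_comp => //; exact: measurable_funB.
have [] := @dominated_convergence _ _ _ mu setT measurableT
  (fun n x => (`|F n x - f x|)%:E) (fun=> 0%E) (EFin \o g) _ _ _ gi.
- by move=> n; exact/measurable_EFinP.
- exact: measurable_cst.
- apply: aeW => x _; apply: cvg_EFin; first exact: nearW.
  rewrite -[X in _ --> X](normr0 R) -[X in `|X|](subrr (f x)).
  by apply: cvg_norm; apply: cvgB; [exact: Ff|exact: cvg_cst].
- by apply: aeW => x n _; rewrite /= lee_fin ger0_norm.
- move=> _ _; rewrite integral0 => h.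
  have /fine_cvg := h; exact.
Qed.

Lemma n2_dct (F : nat -> T -> R) (f g : T -> R) :
  (forall n, measurable_fun setT (F n)) -> measurable_fun setT f ->
  (forall x, F n x @[n --> \oo] --> f x) ->
  (forall n x, `|F n x - f x| <= g x) -> L2P mu g ->
  n2 mu (F n \- f) @[n --> \oo] --> (0 : R).
Proof.
move=> mF mf Ff Fg [mg gi].
have h := @n1_dct (fun n x => (F n x - f x) ^+ 2) (fun=> 0) (fun x => g x ^+ 2).
rewrite -sqrtr0 /n2; apply: (@cvg_comp _ _ _ _ Num.sqrt _ (nbhs (0 : R))); last first.
  exact: sqrt_continuous.
apply: cvg_trans (h _ _ _ _ gi).
- apply: near_eq_cvg; apply: nearW => n; apply: eq_Rintegral => x _ /=.
  by rewrite subr0 ger0_norm// sqr_ge0.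
- by move=> n; apply: measurable_funX; exact: measurable_funB.
- exact: measurable_cst.
- move=> x; rewrite -[X in _ --> X](mulr0 (0 : R)) -(subrr (f x)).
  under eq_fun do rewrite expr2.
  by apply: cvgM; apply: cvgB; [exact: Ff|exact: cvg_cst|exact: Ff|exact: cvg_cst].
- move=> n x; rewrite subr0 ger0_norm ?sqr_ge0//.
  rewrite -[leLHS]real_normK ?num_real// lerXn2r ?nnegrE//.
  exact: le_trans (Fg n x).
Qed.

Lemma ig_indic (B : set T) : measurable B -> (mu B < +oo)%E ->
  ig mu (\1_B : T -> R).
Proof.
move=> mB muB; apply/integrableP; split; first exact/measurable_EFinP/measurable_indic.
under eq_integral => x _ do rewrite /= ger0_norm//.
by rewrite integral_indic// setIT.
Qed.

Lemma L2_ig_finite (f : T -> R) (B : set T) : measurable B -> (mu B < +oo)%E ->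
  L2P mu f -> (forall x, ~ B x -> f x = 0) -> ig mu f /\
  n1 mu f <= Num.sqrt (fine (mu B)) * n2 mu f.
Proof.
move=> mB muB Lf f0.
have L1 : L2P mu (\1_B : T -> R).
  split; first exact: measurable_indic.
  rewrite (_ : (fun x => _) = \1_B); first exact: ig_indic.
  by apply/funext => x; rewrite indicE; case: (_ \in _); rewrite ?expr1n ?expr0n.
have E : f = (fun x => \1_B x * f x).
  apply/funext => x; rewrite indicE; have [xB|xB] := pselect (B x).
    by rewrite mem_set// mul1r.
  by rewrite memNset// mul0r f0.
split; first by rewrite E; exact: L2_mul.
rewrite {1}E; apply: le_trans (n1M_n2 L1 Lf) _.
suff -> : n2 mu (\1_B : T -> R) = Num.sqrt (fine (mu B)) by [].
rewrite /n2; congr Num.sqrt; rewrite /Rintegral; congr fine.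
transitivity (\int[mu]_x (\1_B x)%:E)%E; last by rewrite integral_indic// setIT.
apply: eq_integral => x _; rewrite indicE.
by case: (_ \in _); rewrite ?expr1n ?expr0n.
Qed.

End DCT.

Section Test.
Context {R : realType} {d : nat}.
Local Notation E := 'rV[R]_d.
Local Notation e_ i := (delta_mx 0 i : E).
Implicit Types (f g w phi : E -> R) (x y h : E) (i : 'I_d) (r : R).

(** Compact support with an explicit radius in the sup norm, as needed to follow supports through
    mollification. A negative radius is allowed and forces f = 0. *)
Definition vanish r f := forall x, r < `|x| -> f x = 0.
Definition tst f := smooth f /\ exists r, vanish r f.

Lemma meas_ball r : measurable [set x : E | `|x| <= r].
Proof. by apply: closed_measE; exact: closed_ball_E. Qed.

Lemma vanishW r r' f : r <= r' -> vanish r f -> vanish r' f.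
Proof. by move=> rr v x rx; apply: v; exact: le_lt_trans rx. Qed.

Lemma vanish_supp r f : vanish r f -> closure [set x | f x != 0] `<=` [set x | `|x| <= r].
Proof.
move=> v x Hx; suff : closure [set x : E | `|x| <= r] x.
  by rewrite -(closure_id _).1//; exact: closed_ball_E.
apply: closureS Hx => {}x /= fx; rewrite leNgt; apply/negP => /v fx0.
by rewrite fx0 eqxx in fx.
Qed.

Lemma test_setTP f : test_function setT f <-> tst f.
Proof.
split=> [[sf cf _]|[sf [r v]]]; last first.
  split => //.
  apply: (subclosed_compact _ (@compact_ball_E R d r) (vanish_supp v)); exact: closed_closure.
split => //; have [M [Mr HM]] := compact_bounded cf.
exists (M + 1) => x Mx; apply/eqP; apply: contraTT Mx => fx.
by rewrite -leNgt; apply: (HM (M + 1)); [rewrite ltrDl|exact: subset_closure].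
Qed.

(** The norm attains its maximum on the compact support, which yields a radius strictly below
    [r]. *)
Lemma test_cubeP r f : test_function (cube r) f <->
  smooth f /\ exists2 r', r' < r & vanish r' f.
Proof.
split=> [[sf cf fr]|[sf [r' rr v]]]; last first.
  split => //; last by move=> x /(vanish_supp v) /=; rewrite /cube/= => /le_lt_trans; apply.
  apply: (subclosed_compact _ (@compact_ball_E R d r') (vanish_supp v)); exact: closed_closure.
split => //.
have [K0|K0] := pselect (closure [set x | f x != 0] !=set0); last first.
  (* The support is empty, so any radius below [r] serves. *)
  exists (r - 1); first by rewrite ltrBlDr ltrDl.
  move=> x _; apply/eqP; apply: contra_notT K0 => fx.
  by exists x; exact: subset_closure.
have [c cK H] := @compact_EVT_max E R (fun x => `|x|) _ K0 cf
  (continuous_subspaceT (@norm_continuous _ _)).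
exists `|c|; first by apply: fr; exact: set_mem.
move=> x cx; apply/eqP; apply: contraTT cx => fx; rewrite -leNgt.
by apply: H; apply/mem_set/subset_closure.
Qed.

Lemma tstD f g : tst f -> tst g -> tst (f \+ g).
Proof.
move=> [sf [r vf]] [sg [s vg]]; split; first exact: smoothD.
exists (Num.max r s) => x; rewrite gt_max => /andP[h1 h2] /=.
by rewrite vf// vg// addr0.
Qed.

Lemma tstMr f g : tst f -> smooth g -> tst (fun x => f x * g x).
Proof.
move=> [sf [r vf]] sg; split; first exact: smoothM.
by exists r => x /vf ->; rewrite mul0r.
Qed.

Lemma tstMl f g : smooth f -> tst g -> tst (fun x => f x * g x).
Proof.
by move=> sf tg; under eq_fun do rewrite mulrC; exact: tstMr.
Qed.

Lemma tstZ c f : tst f -> tst (fun x => c * f x).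
Proof. by apply: tstMl; exact: smooth_cst. Qed.

Lemma tst0 : tst (fun=> 0).
Proof. by split; [exact: smooth_cst|exists 0]. Qed.

Lemma tstB f g : tst f -> tst g -> tst (f \- g).
Proof.
move=> tf /(tstZ (-1)) tg; have := tstD tf tg.
by rewrite (_ : _ \+ _ = f \- g)//; apply/funext => x /=; rewrite mulN1r.
Qed.

Lemma vanish_partial r i f : vanish r f -> vanish r (partial i f).
Proof.
move=> v x rx; rewrite -(partial_cst i (0 : R) x); apply: near_eq_derive.
have : open [set y : E | r < `|y|].
  rewrite (_ : [set y | _] = (fun y : E => `|y|) @^-1` [set y | y > r])//.
  by apply: open_comp => [y _|]; [exact: norm_continuous|exact: open_gt].
move=> oU.
have : nbhs x [set y : E | r < `|y|] by apply: open_nbhs_nbhs; split.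
by apply: filterS => y /v ->.
Qed.

Lemma tst_partial i f : tst f -> tst (partial i f).
Proof.
by move=> [sf [r v]]; split; [exact: smooth_partial|exists r; exact: vanish_partial].
Qed.

Lemma tst_affine (c : R) h f : c != 0 -> tst f -> tst (fun x => f (c *: x + h)).
Proof.
move=> c0 [sf [r v]]; split; first exact: smooth_affine.
exists ((r + `|h|) / `|c|) => x; rewrite ltr_pdivrMr ?normr_gt0// => H.
apply: v; rewrite -(ltrD2r `|h|); apply: lt_le_trans H _.
rewrite mulrC -normrZ -[in leLHS](addrK h (c *: x)).
exact: ler_normB.
Qed.

Lemma cont_vanish_bounded r f : continuous f -> vanish r f ->
  exists2 C, 0 <= C & forall x, `|f x| <= C.
Proof.
move=> cf v.
have cK : compact (f @` [set x : E | `|x| <= r]).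
  apply: continuous_compact; last exact: compact_ball_E.
  exact: continuous_subspaceT.
have [M [Mr HM]] := compact_bounded cK.
exists (`|M| + 1); first by rewrite addr_ge0.
move=> x; have [xr|/v ->] := leP `|x| r; last by rewrite normr0 addr_ge0.
by apply: (HM (`|M| + 1)); [rewrite ltr_pwDr// ler_norm|exists x].
Qed.

Lemma tst_bounded f : tst f -> exists2 C, 0 <= C & forall x, `|f x| <= C.
Proof. by move=> [sf [r v]]; exact: cont_vanish_bounded (smooth_cont sf) v. Qed.

Lemma smooth_meas f : smooth f -> measurable_fun setT f.
Proof. by move=> /smooth_cont; exact: cont_meas. Qed.

Lemma tst_meas f : tst f -> measurable_fun setT f.
Proof. by case=> /smooth_meas. Qed.

Lemma mvt0 (F F' : R -> R) (t : R) : (forall s : R, is_derive s 1 F (F' s)) ->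
  exists2 c, `|c| <= `|t| & F t - F 0 = t * F' c.
Proof.
move=> dF.
have pos (G G' : R -> R) (s : R) : 0 <= s -> (forall u : R, is_derive u 1 G (G' u)) ->
    exists2 c, `|c| <= `|s| & G s - G 0 = s * G' c.
  move=> s0 dG.
  have h1 z : z \in `]0, s[ -> is_derive z 1 G (G' z) by [].
  have h2 : {within `[0, s], continuous G}.
    by apply: continuous_subspaceT; exact: is_derive_cont dG.
  have [c cs ->] := MVT_segment s0 h1 h2; exists c; last by rewrite subr0 mulrC.
  by move: cs; rewrite in_itv/= => /andP[c0 cs]; rewrite !ger0_norm.
have [t0|t0] := leP 0 t; first exact: pos.
have dG (u : R) : is_derive u 1 (fun s => F (-1 * s)) (-1 * F' (-1 * u)).
  exact: is_derive_scale_arg.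
have [|c ct E] := pos _ _ (- t) _ dG; first by rewrite oppr_ge0 ltW.
exists (-1 * c); first by rewrite mulN1r normrN -[leRHS]normrN.
by move: E; rewrite mulN1r opprK mulr0 => ->; rewrite mulN1r mulrNN.
Qed.

Lemma smooth_line i f x (s : R) : smooth f ->
  is_derive s 1 (fun t => f (x + t *: e_ i)) (partial i f (x + s *: e_ i)).
Proof. by move=> sf; apply: is_derive_line; exact: smooth_derivable. Qed.

Lemma lip_dir i f C : smooth f -> (forall x, `|partial i f x| <= C) ->
  forall x (t : R), `|f (x + t *: e_ i) - f x| <= C * `|t|.
Proof.
move=> sf bf x t.
have [c _] := @mvt0 _ _ t (fun s => smooth_line i x s sf).
by rewrite scale0r addr0 => ->; rewrite normrM mulrC ler_wpM2r.
Qed.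

(** The mean value theorem used twice, with [C] in place of the optimal C / 2. *)
Lemma taylor_dir i f C : smooth f -> (forall x, `|partial i (partial i f) x| <= C) ->
  forall x (t : R), `|f (x + t *: e_ i) - f x - t * partial i f x| <= C * t ^+ 2.
Proof.
move=> sf bf x t.
have [c ct] := @mvt0 _ _ t (fun s => smooth_line i x s sf).
rewrite scale0r addr0 => ->; rewrite -mulrBr normrM.
have h := lip_dir (smooth_partial i sf) bf x c.
rewrite -[t ^+ 2]real_normK ?num_real// expr2 mulrCA ler_wpM2l//.
apply: le_trans h _; rewrite ler_wpM2l//.
exact: le_trans (normr_ge0 _) (bf x).
Qed.

Lemma dir_decomp x : x = \sum_(i < d) x 0 i *: e_ i.
Proof. by rewrite [LHS]row_sum_delta. Qed.

Lemma tst_lip f : tst f -> exists2 C, 0 <= C & forall x h, `|f (x + h) - f x| <= C * `|h|.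
Proof.
move=> tf.
have /choice[C HC] : forall i, exists C, 0 <= C /\ forall x, `|partial i f x| <= C.
  by move=> i; have [C C0 h] := tst_bounded (tst_partial i tf); exists C.
exists (\sum_i C i); first by apply: sumr_ge0 => i _; case: (HC i).
move=> x h; rewrite {1}(dir_decomp h).
apply: (@le_trans _ _ (\sum_i C i * `|h 0 i|)); last first.
  rewrite mulr_suml; apply: ler_sum => i _; apply: ler_wpM2l; first by case: (HC i).
  exact: norm_coord.
(* Quantifying over the base point lets the increments along the axes be added one after the
   other. *)
pose P (u : E) (c : R) := forall y, `|f (y + u) - f y| <= c.
suff : P (\sum_i h 0 i *: e_ i) (\sum_i C i * `|h 0 i|) by apply.
apply: (big_rec2 P); first by move=> y; rewrite addr0 subrr normr0.
move=> i u c _ IH y.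
have -> : f (y + (h 0 i *: e_ i + u)) - f y =
    (f (y + h 0 i *: e_ i) - f y) +
    (f (y + h 0 i *: e_ i + u) - f (y + h 0 i *: e_ i)) by rewrite addrA; ring.
apply: le_trans (ler_normD _ _) _; rewrite lerD//.
by apply: lip_dir; [case: tf|case: (HC i)].
Qed.

Section Leb.
Variable lam : {measure set E -> \bar R}.
Hypothesis lamL : is_lebesgue lam.

Lemma bounded_vanish_L2 r f C : measurable_fun setT f -> (forall x, `|f x| <= C) ->
  vanish r f -> L2P lam f.
Proof.
move=> mf fC v; split => //.
have mb := @meas_ball r.
rewrite (_ : (fun x => _) = (fun x => (f x ^+ 2) * \1_[set x : E | `|x| <= r] x)).
  apply: (@ig_mulb _ _ _ _ _ _ (C ^+ 2)); first exact: measurable_funX.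
    move=> x; rewrite normrX lerXn2r ?nnegrE//.
    exact: le_trans (normr_ge0 _) (fC x).
  by apply: ig_indic => //; exact: lam_ball_lty.
apply/funext => x; rewrite indicE.
have [xr|xr] := leP `|x| r; first by rewrite mem_set ?mulr1.
by rewrite v// expr0n mul0r.
Qed.

Lemma vanish_ig r f : L2P lam f -> vanish r f -> ig lam f.
Proof.
move=> Lf v; have mb := @meas_ball r.
have hf x : ~ [set x : E | `|x| <= r] x -> f x = 0 by move=> /negP; rewrite -ltNge => /v.
by have [] := L2_ig_finite mb (lam_ball_lty lamL r) Lf hf.
Qed.

Lemma vanish_n1 r f : L2P lam f -> vanish r f ->
  n1 lam f <= Num.sqrt (fine (lam [set x : E | (`|x| <= r)%R])) * n2 lam f.
Proof.
move=> Lf v; have mb := @meas_ball r.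
have hf x : ~ [set x : E | `|x| <= r] x -> f x = 0 by move=> /negP; rewrite -ltNge => /v.
by have [] := L2_ig_finite mb (lam_ball_lty lamL r) Lf hf.
Qed.

Lemma tst_L2 f : tst f -> L2P lam f.
Proof.
move=> tf; have [C C0 h] := tst_bounded tf; case: (tf) => sf [r v].
exact: bounded_vanish_L2 (smooth_meas sf) h v.
Qed.

Lemma tst_ig f : tst f -> ig lam f.
Proof. by move=> tf; case: (tf) => _ [r v]; exact: vanish_ig (tst_L2 tf) v. Qed.

Lemma translate h f : ig lam f -> ig lam (fun x => f (x + h)) /\
  \int[lam]_x f (x + h) = \int[lam]_x f x.
Proof.
move=> ff; have := integral_affine lamL h (ltr01 : (0 : R) < 1) ff.
by under eq_fun do rewrite scale1r; rewrite invr1 expr1n mul1r.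
Qed.

Lemma translate_L2 h f : L2P lam f -> L2P lam (fun x => f (x + h)) /\
  n2 lam (fun x => f (x + h)) = n2 lam f.
Proof.
move=> [mf f2]; have [h1 h2] := translate h f2; split; last by rewrite /n2 h2.
split => //; have := measurableT_comp mf (meas_affine 1 h).
by rewrite (_ : _ \o _ = (fun x => f (x + h)))//; apply/funext => x /=; rewrite scale1r.
Qed.

(** The difference quotient has integral 0 by translation invariance, and it differs from the
    derivative by O(t), uniformly and inside a fixed ball. *)
Lemma int_partial_tst i f : tst f -> \int[lam]_x partial i f x = 0.
Proof.
move=> tf; have [C C0 HC] := tst_bounded (tst_partial i (tst_partial i tf)).
case: (tf) => sf [r0 v0].
pose r := Num.max r0 0; have v : vanish r f by apply: vanishW v0; rewrite le_max lexx.
have r_ge0 : 0 <= r by rewrite le_max lexx orbT.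
have fi := tst_ig tf; have pfi := tst_ig (tst_partial i tf).
pose V := fine (lam [set x : E | (`|x| <= r + 1)%R]).
apply/eqP; rewrite -normr_le0; apply/ler_addgt0Pr => e e0; rewrite add0r.
(* [t <= 1] keeps the supports inside the ball of radius [r + 1], of measure [V]; the other bound
   makes the error C t V at most [e]. *)
pose t : R := Num.min 1 (e / (C * V + 1)).
have V0 : 0 <= V by rewrite fine_ge0.
have CV : 0 < C * V + 1 by rewrite ltr_wpDl// mulr_ge0.
have t0 : 0 < t by rewrite lt_min ltr01 divr_gt0.
have t1 : t <= 1 by rewrite ge_min lexx.
have te : t <= e / (C * V + 1) by rewrite ge_min lexx orbT.
have [gi gE] := translate (t *: e_ i) fi.
pose D := fun x => partial i f x - t^-1 * (f (x + t *: e_ i) - f x).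
have Di : ig lam D by apply: igB pfi (igZ _ (igB gi fi)).
have -> : \int[lam]_x partial i f x = \int[lam]_x D x.
  rewrite RintegralB//; last exact: (igZ _ (igB gi fi)).
  rewrite RintegralZl//; last exact: (igB gi fi).
  by rewrite RintegralB// gE subrr mulr0 subr0.
have Db x : `|D x| <= C * t.
  have := taylor_dir sf HC x t; rewrite /D.
  rewrite -(ler_pM2l (_ : 0 < t^-1)) ?invr_gt0//.
  rewrite (_ : t^-1 * (C * t ^+ 2) = C * t * (t^-1 * t)); last by ring.
  rewrite mulVf ?gt_eqF// mulr1 -[X in X * _](gtr0_norm (_ : 0 < t^-1)) ?invr_gt0//.
  by rewrite -normrM distrC mulrBr mulrA mulVf ?gt_eqF// mul1r.
have Dv : vanish (r + 1) D.
  move=> x xr; rewrite /D (vanish_partial i v)//; last first.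
    by apply: le_lt_trans xr; rewrite lerDl.
  rewrite (v x); last by apply: le_lt_trans xr; rewrite lerDl.
  suff : r < `|x + t *: e_ i| by move=> /v ->; rewrite subr0 mulr0 subr0.
  have := ler_normB (x + t *: e_ i) (t *: e_ i); rewrite addrK.
  have : `|t *: e_ i| <= 1.
    rewrite normrZ gtr0_norm//; apply: mulr_ile1 => //; first exact: ltW.
    by apply/norm_leP => // j; rewrite mxE; case: (_ && _); rewrite ?normr1 ?normr0.
  by move=> h1 h2; lra.
have mb := @meas_ball (r + 1).
have ii : ig lam (\1_[set x : E | `|x| <= r + 1] : E -> R).
  by apply: ig_indic => //; exact: lam_ball_lty.
apply: le_trans (norm_Rint_le Di) _.
apply: (@le_trans _ _ (\int[lam]_x (C * t * \1_[set x : E | `|x| <= r + 1] x))).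
  apply: le_Rintegral => //; [exact: ig_norm|exact: igZ|].
  move=> x _; rewrite indicE; have [xr|xr] := leP `|x| (r + 1).
    by rewrite mem_set// mulr1.
  by rewrite Dv// normr0 mulr_ge0// mulr_ge0// ltW.
rewrite RintegralZl//.
have -> : \int[lam]_x \1_[set x : E | `|x| <= r + 1] x = V.
  by rewrite /Rintegral integral_indic// setIT.
rewrite mulrAC; apply: (@le_trans _ _ ((C * V) * (e / (C * V + 1)))).
  by rewrite ler_wpM2l// mulr_ge0.
rewrite mulrA ler_pdivrMr// mulrC ler_wpM2l ?(ltW e0)//.
by rewrite lerDl.
Qed.

Lemma int_by_parts i f g : tst f -> smooth g ->
  \int[lam]_x (g x * partial i f x) = - \int[lam]_x (partial i g x * f x).
Proof.
move=> tf sg; have := int_partial_tst i (tstMl sg tf).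
under eq_Rintegral => x _.
  rewrite partialM; [|exact: (smooth_derivable sg)|exact: (smooth_derivable tf.1)].
  over.
have t1 := tst_ig (tstMl (smooth_partial i sg) tf).
have t2 := tst_ig (tstMl sg (tst_partial i tf)).
by rewrite RintegralD// addrC => /eqP; rewrite addr_eq0 => /eqP.
Qed.

End Leb.
End Test.

(** * Density of test functions in L^1 and L^2, and continuity of translations *)

Section Density.
Context {R : realType} {d : nat}.
Local Notation E := 'rV[R]_d.
Implicit Types (f g w phi : E -> R) (x y h a b : E) (i : 'I_d) (r : R).
Variable lam : {measure set E -> \bar R}.
Hypothesis lamL : is_lebesgue lam.

Definition tstin r phi := smooth phi /\ exists2 r', r' < r & vanish r' phi.

Lemma tstin_tst r phi : tstin r phi -> tst phi.
Proof. by move=> [sp [r' _ v]]; split => //; exists r'. Qed.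

Lemma tstinD r f g : tstin r f -> tstin r g -> tstin r (f \+ g).
Proof.
move=> [sf [r1 h1 vf]] [sg [r2 h2 vg]]; split; first exact: smoothD.
exists (Num.max r1 r2); first by rewrite gt_max h1.
by move=> x; rewrite gt_max => /andP[a1 a2] /=; rewrite vf// vg// addr0.
Qed.

Lemma tstinZ r c f : tstin r f -> tstin r (fun x => c * f x).
Proof.
move=> [sf [r1 h1 vf]]; split; first exact: smoothZ.
by exists r1 => // x /vf ->; rewrite mulr0.
Qed.

Lemma tstin0 r : tstin r (fun=> 0).
Proof. by split; [exact: smooth_cst|exists (r - 1) => //; rewrite ltrBlDr ltrDl]. Qed.

(** Smooth bumps that are positive exactly on the open box when m > 0 and tend to its indicator as m
    grows. *)
Definition boxf a b (m : R) : E -> R := fun x =>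
  \prod_(i < d) (flat 1 (m * (x 0 i - a 0 i)) * flat 1 (m * (b 0 i - x 0 i))).

Lemma smooth_coord_id i : smooth (fun x : E => x 0 i).
Proof.
apply: (@smooth_coord R d id).
exists (fun n => match n with 0%N => id | 1%N => cst 1 | _ => cst 0 end); split => //.
case=> [|[|n]] y /=; first exact: is_derive_id.
  by split; [exact: derivable_cst|exact: derive_cst].
by split; [exact: derivable_cst|exact: derive_cst].
Qed.

Lemma boxf_smooth a b m : smooth (boxf a b m).
Proof.
apply: smooth_prod => i; apply: smoothM.
  apply: (@smooth_comp R d (fun s => flat 1 (m * s)) (fun x => x 0 i - a 0 i)).
    by apply: rsm_scale_arg; exact: rsm_flat.
  by apply: smoothB; [exact: smooth_coord_id|exact: smooth_cst].
apply: (@smooth_comp R d (fun s => flat 1 (m * s)) (fun x => b 0 i - x 0 i)).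
  by apply: rsm_scale_arg; exact: rsm_flat.
by apply: smoothB; [exact: smooth_cst|exact: smooth_coord_id].
Qed.

Lemma boxf_out a b m x : 0 < m -> ~ obox a b x -> boxf a b m x = 0.
Proof.
move=> m0 /existsNP[i /negP H]; rewrite /boxf (bigD1 i)//=.
move: H; rewrite negb_and -!leNgt => /orP[h|h].
  by rewrite flat_neg ?mul0r// pmulr_rle0// subr_le0.
by rewrite [X in _ * X * _]flat_neg ?mulr0 ?mul0r// pmulr_rle0// subr_le0.
Qed.

Lemma boxf_bnd a b m x : 0 <= boxf a b m x <= 1.
Proof.
apply/andP; split; first by apply: prodr_ge0 => i _; rewrite mulr_ge0// flat1_ge0.
apply: prodr_ile1 => i _; rewrite mulr_ge0 ?flat1_ge0//=.
by apply: mulr_ile1; rewrite ?flat1_ge0 ?flat1_le1.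
Qed.

Lemma cvg_prod_fin (I : finType) (F : I -> nat -> R) (l : I -> R) :
  (forall k, F k n @[n --> \oo] --> l k) ->
  \prod_k F k n @[n --> \oo] --> \prod_k l k.
Proof.
move=> h; elim: (index_enum I) => [|i s IH].
  rewrite big_nil; under eq_fun do rewrite big_nil; exact: cvg_cst.
by rewrite big_cons; under eq_fun do rewrite big_cons; apply: cvgM.
Qed.

Lemma boxf_cvg a b x : boxf a b n.+1%:R x @[n --> \oo] --> (\1_(obox a b) x : R).
Proof.
rewrite indicE; have [xB|xB] := pselect (obox a b x); last first.
  rewrite memNset//=; under eq_fun do rewrite boxf_out//.
  exact: cvg_cst.
rewrite mem_set//= [X in _ --> X](_ : _ = \prod_(i < d) (1 : R)); last by rewrite big1.
apply: cvg_prod_fin => i; rewrite -[X in _ --> X]mulr1.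
have /andP[h1 h2] := xB i.
by apply: cvgM; apply: flat1_cvg; rewrite subr_gt0.
Qed.

(** Membership in the L^2 closure of C_0^oo of the open cube of half-side [r]. *)
Definition dens r g := forall e, 0 < e -> exists2 phi, tstin r phi & n2 lam (g \- phi) < e.

Lemma densD r f g : L2P lam f -> L2P lam g -> dens r f -> dens r g -> dens r (f \+ g).
Proof.
move=> Lf Lg df dg e e0.
have e2 : 0 < e / 2 by rewrite divr_gt0.
have [p tp hp] := df _ e2; have [q tq hq] := dg _ e2.
exists (p \+ q); first exact: tstinD.
rewrite [X in n2 _ X](_ : _ = (f \- p) \+ (g \- q)); last first.
  by apply/funext => x /=; ring.
have Lp := tst_L2 lamL (tstin_tst tp); have Lq := tst_L2 lamL (tstin_tst tq).
by apply: le_lt_trans (n2D (L2B Lf Lp) (L2B Lg Lq)) _; rewrite [ltRHS]splitr ltrD.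
Qed.

Lemma densZ r c f : L2P lam f -> dens r f -> dens r (fun x => c * f x).
Proof.
move=> Lf df e e0.
have c1 : 0 < `|c| + 1 by rewrite ltr_wpDl.
have [p tp hp] := df (e / (`|c| + 1)) (divr_gt0 e0 c1).
exists (fun x => c * p x); first exact: tstinZ.
have Lp := tst_L2 lamL (tstin_tst tp).
rewrite [X in n2 _ X](_ : _ = (fun x => c * (f \- p) x)); last first.
  by apply/funext => x /=; ring.
rewrite n2Z; last exact: L2B.
apply: (@le_lt_trans _ _ ((`|c| + 1) * n2 lam (f \- p))).
  by rewrite ler_wpM2r ?n2_ge0// lerDl.
by rewrite mulrC -ltr_pdivlMr.
Qed.

Lemma dens0 r : dens r (fun=> 0).
Proof.
move=> e e0; exists (fun=> 0); first exact: tstin0.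
by rewrite [X in n2 _ X](_ : _ = fun=> 0) ?n2_0//; apply/funext => x /=; rewrite subr0.
Qed.

Lemma dens_lim r (F : nat -> E -> R) g : (forall n, L2P lam (F n)) -> L2P lam g ->
  (forall n, dens r (F n)) -> n2 lam (F n \- g) @[n --> \oo] --> (0 : R) -> dens r g.
Proof.
move=> LF Lg dF h e e0.
have e2 : 0 < e / 2 by rewrite divr_gt0.
move/cvgrPdist_lt: h => /(_ _ e2) [N _ /(_ N (leqnn N))].
rewrite /= sub0r normrN ger0_norm ?n2_ge0// => hN.
have [p tp hp] := dF N _ e2; exists p => //.
have Lp := tst_L2 lamL (tstin_tst tp).
apply: le_lt_trans (n2_sub Lg (LF N) Lp) _; rewrite [ltRHS]splitr ltrD//.
by rewrite n2C.
Qed.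

Lemma dens_sum (I : Type) (s : seq I) r (F : I -> E -> R) :
  (forall k, L2P lam (F k)) -> (forall k, dens r (F k)) ->
  dens r (fun x => \sum_(k <- s) F k x).
Proof.
move=> LF dF; elim: s => [|k s IH]; first by under eq_fun do rewrite big_nil; exact: dens0.
by under eq_fun do rewrite big_cons; apply: densD => //; exact: L2_sum.
Qed.

Lemma L2_indic_cube r (B : set E) : measurable B -> L2P lam (\1_(B `&` cube r) : E -> R).
Proof.
move=> mB; apply: (@bounded_vanish_L2 R d lam lamL r _ 1).
- by apply: measurable_indic; apply: measurableI => //; exact: meas_cube.
- by move=> x; rewrite indicE ger0_norm//; case: (_ \in _).
- move=> x xr; rewrite indicE memNset// => -[_]; rewrite /cube/= => /ltW.
  by rewrite leNgt xr.
Qed.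

Lemma norm_restr (f : E -> R) (B : set E) x : `|f x * \1_B x| <= `|f x|.
Proof. by rewrite indicE; case: (_ \in _); rewrite ?mulr1 ?mulr0 ?normr0. Qed.

Lemma L2_restr f (B : set E) : measurable B -> L2P lam f ->
  L2P lam (fun x => f x * \1_B x).
Proof.
move=> mB Lf; apply: (L2_le _ (norm_restr f B) Lf).
by apply: measurable_funM; [case: Lf|exact: measurable_indic].
Qed.

Lemma cube_box a b r x : 0 < r ->
  obox (maxv a (const_mx (- r))) (minv b (const_mx r)) x -> cube r x.
Proof.
move=> r0 H; rewrite cube_obox// => i; have := H i.
by rewrite !mxE gt_max lt_min => /andP[/andP[_ ->] /andP[_ ->]].
Qed.

Lemma dens_obox r r' a b : 0 < r' -> r' < r ->
  dens r (\1_(obox a b `&` cube r') : E -> R).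
Proof.
move=> r'0 rr; have := L2_indic_cube r' (obox_meas a b).
rewrite cube_obox// oboxI; set a' := maxv _ _; set b' := minv _ _ => LB.
have vb n : vanish r' (boxf a' b' n.+1%:R).
  move=> x xr; apply: boxf_out => // /(cube_box r'0).
  by rewrite /cube/= ltNge (ltW xr).
have Lb n : L2P lam (boxf a' b' n.+1%:R).
  apply: (@bounded_vanish_L2 R d lam lamL r' _ 1) => //.
    by apply: smooth_meas; exact: boxf_smooth.
  by move=> x; have /andP[h1 h2] := boxf_bnd a' b' n.+1%:R x; rewrite ger0_norm.
apply: (dens_lim Lb LB).
  move=> n e e0; exists (boxf a' b' n.+1%:R).
    by split; [exact: boxf_smooth|exists r'].
  rewrite [X in n2 _ X](_ : _ = fun=> 0) ?n2_0//.
  by apply/funext => x /=; rewrite subrr.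
apply: (@n2_dct _ _ _ _ _ _ (\1_(obox a' b') : E -> R)) => //.
- by move=> n; case: (Lb n).
- by case: LB.
- exact: boxf_cvg.
- move=> n x; rewrite indicE; have [xB|xB] := pselect (obox a' b' x).
    rewrite mem_set//= ler_norml; have /andP[h1 h2] := boxf_bnd a' b' n.+1%:R x.
    by lra.
  by rewrite memNset// boxf_out// subrr normr0.
Qed.

(** Dynkin's lemma on the pi-system of open boxes. The intersection with a smaller cube keeps the
    measures finite and leaves room for the supports of the approximations. *)
Lemma dens_indic r r' (B : set E) : 0 < r' -> r' < r -> measurable B ->
  dens r (\1_(B `&` cube r') : E -> R).
Proof.
move=> r'0 rr; rewrite measE_obox; move: B.
have Lc := L2_indic_cube r' (@measurableT _ E); rewrite setTI in Lc.
have dc : dens r (\1_(cube r') : E -> R).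
  have := dens_obox (const_mx (- r')) (const_mx r') r'0 rr.
  by rewrite -cube_obox// setIid.
apply: (@dynkin_induction _ E [set B | exists a b, B = obox a b]).
- exact: measE_obox.
- by move=> _ _ [a [b ->]] [a' [b' ->]]; exists (maxv a a'), (minv b b'); rewrite oboxI.
- by rewrite setTI.
- by move=> _ [a [b ->]]; exact: dens_obox.
- move=> S mS dS.
  rewrite (_ : \1_(~` S `&` cube r') = \1_(cube r') \+ (fun x => -1 * \1_(S `&` cube r') x)).
    apply: densD => //; [apply: L2Z; exact: L2_indic_cube|].
    by apply: densZ => //; exact: L2_indic_cube.
  apply/funext => x /=; rewrite !indicE !in_setI in_setC.
  by case: (x \in S); case: (x \in cube r'); rewrite /=; ring.
- move=> F mF tF dF.
  pose S n x := \sum_(k < n) (\1_(F k `&` cube r') x : R).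
  have LS n : L2P lam (S n) by apply: L2_sum => k; exact: L2_indic_cube.
  have LU := L2_indic_cube r' (bigcupT_measurable F mF).
  have SE x k n : F k x -> cube r' x -> S n x = (k < n)%:R.
    move=> Fx cx; have ne j : j != k -> (\1_(F j `&` cube r') x : R) = 0.
      move=> jk; rewrite indicE memNset// => -[Fj _].
      by move/eqP : jk; apply; apply: tF => //; exists x.
    have [kn|kn] := ltnP k n.
      rewrite /S (bigD1 (Ordinal kn))//= big1.
        by rewrite addr0 indicE mem_set.
      by move=> j jk; apply: ne; apply: contra jk => /eqP jk; apply/eqP/val_inj.
    by rewrite /S big1// => j _; apply: ne; rewrite neq_ltn (leq_trans (ltn_ord j) kn).
  have S0 x n : ~ (\bigcup_k F k `&` cube r') x -> S n x = 0.
    move=> H; rewrite /S big1// => j _; rewrite indicE memNset// => -[Fj cx].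
    by apply: H; split => //; exists j.
  apply: (dens_lim LS LU).
    by move=> n; apply: dens_sum => k //; exact: L2_indic_cube.
  apply: (@n2_dct _ _ _ _ _ _ (\1_(cube r') : E -> R)) => //.
  + by move=> n; case: (LS n).
  + by case: LU.
  + move=> x; have [[[k _ Fk] cx]|H] := pselect ((\bigcup_k F k `&` cube r') x).
      rewrite indicE mem_set; last by split => //; exists k.
      apply/cvgrPdist_le => e e0; exists k.+1 => // n /= kn.
      by rewrite (SE _ k)// kn subrr normr0 ltW.
    under eq_fun do rewrite S0//; rewrite indicE memNset//; exact: cvg_cst.
  + move=> n x; have [[[k _ Fk] cx]|H] := pselect ((\bigcup_k F k `&` cube r') x).
      rewrite (SE _ k)// !indicE !mem_set//; last by split => //; exists k.
      by case: (k < n)%N; rewrite ?subrr ?normr0// sub0r normrN normr1.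
    by rewrite S0// indicE memNset// subrr normr0.
Qed.

Import HBNNSimple.

Lemma dens_nnsfun r r' (g : {nnsfun E >-> R}) : 0 < r' -> r' < r ->
  dens r (fun x => g x * \1_(cube r') x).
Proof.
move=> r'0 rr.
have -> : (fun x => g x * \1_(cube r') x) =
    (fun x => \sum_(y <- finmap.enum_fset (fset_set (range g))) y * \1_((g @^-1` [set y]) `&` cube r') x).
  apply/funext => x; rewrite fimfunE fsbig_finite//= mulr_suml.
  by apply: eq_bigr => y _; rewrite -mulrA indicI.
apply: dens_sum => y.
  by apply: L2Z; apply: L2_indic_cube.
by apply: densZ; [exact: L2_indic_cube|exact: dens_indic].
Qed.

(** Nonnegative functions are approximated from below by simple ones on smaller cubes; then the open
    cube is exhausted by these. *)
Lemma dens_L2 r g : L2P lam g -> (forall x, ~ cube r x -> g x = 0) -> dens r g.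
Proof.
move=> Lg g0.
have [r0|r0] := leP r 0.
  rewrite (_ : g = fun=> 0); first exact: dens0.
  apply/funext => x; apply: g0; rewrite /cube/= => xr.
  by have := normr_ge0 x; rewrite leNgt (lt_le_trans xr).
have step1 r' (f : E -> R) : 0 < r' -> r' < r -> (forall x, 0 <= f x) -> L2P lam f ->
    dens r (fun x => f x * \1_(cube r') x).
  move=> r'0 rr f0 Lf.
  have mf : measurable_fun setT (EFin \o f) by apply/measurable_EFinP; case: Lf.
  pose F n := nnsfun_approx measurableT mf n : {nnsfun E >-> R}.
  have Fle n x : 0 <= F n x <= f x.
    rewrite fun_ge0/= /F nnsfun_approxE -lee_fin; apply: le_approx => //.
    by move=> y _; rewrite /= lee_fin.
  have Fc x : F n x @[n --> \oo] --> f x.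
    have h : EFin (F k x) @[k --> \oo] --> (f x)%:E.
      by apply: (@cvg_nnsfun_approx _ _ _ _ measurableT _ mf) => // y _; rewrite lee_fin.
    by have /fine_cvg := h.
  have Lfc : L2P lam (fun x => f x * \1_(cube r') x) by exact: L2_restr (meas_cube _) Lf.
  have LF n : L2P lam (fun x => F n x * \1_(cube r') x).
    apply: L2_restr; first exact: meas_cube.
    apply: (L2_le _ _ Lf) => // x; have /andP[h1 h2] := Fle n x.
    by rewrite !ger0_norm.
  apply: (dens_lim LF Lfc); first by move=> n; exact: dens_nnsfun.
  apply: (n2_dct _ _ _ _ Lf).
  - by move=> n; case: (LF n).
  - by case: Lfc.
  - by move=> x; apply: cvgM => //; exact: cvg_cst.
  - move=> n x; have /andP[h1 h2] := Fle n x; rewrite indicE.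
    case: (_ \in _); rewrite ?mulr1 ?mulr0 ?subrr ?normr0//.
    by rewrite distrC ger0_norm ?subr_ge0// lerBlDr lerDl.
pose gp x := Num.max (g x) 0; pose gm x := Num.max (- g x) 0.
have gE x : g x = gp x - gm x.
  rewrite /gp /gm; have [h|h] := leP 0 (g x).
    by rewrite max_r ?oppr_le0// subr0.
  by rewrite max_l ?oppr_ge0 ?ltW// sub0r opprK.
have mg : measurable_fun setT g by case: Lg.
have Lp : L2P lam gp.
  apply: (L2_le _ _ Lg); first exact: measurable_maxr.
  by move=> x; rewrite /gp; have [h|h] := leP 0 (g x); rewrite ?normr0.
have Lm : L2P lam gm.
  apply: (L2_le _ _ Lg); first by apply: measurable_maxr => //; exact: measurableT_comp.
  move=> x; rewrite /gm; have [h|h] := leP 0 (- g x); rewrite ?normr0 ?normrN//.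
(* Radii increasing to [r]; the shift by 2 makes already the first of them positive. *)
pose rn n : R := r * (1 - n.+2%:R^-1).
have rn0 n : 0 < rn n.
  by rewrite /rn mulr_gt0// subr_gt0 invf_lt1 ?ltr1n ?ltr0n.
have rnr n : rn n < r by rewrite /rn gtr_pMr// ltrBlDr ltrDl invr_gt0 ltr0n.
have Lgc n : L2P lam (fun x => g x * \1_(cube (rn n)) x) by exact: L2_restr (meas_cube _) Lg.
apply: (dens_lim Lgc Lg).
  move=> n; rewrite (_ : (fun x => _) = (fun x => gp x * \1_(cube (rn n)) x) \+
    (fun x => -1 * (gm x * \1_(cube (rn n)) x))); last first.
    by apply/funext => x /=; rewrite {1}gE; ring.
  have h1 : dens r (fun x => gp x * \1_(cube (rn n)) x).
    by apply: step1 => // x; rewrite le_max lexx orbT.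
  have h2 : dens r (fun x => gm x * \1_(cube (rn n)) x).
    by apply: step1 => // x; rewrite le_max lexx orbT.
  have Lb (f : E -> R) : L2P lam f -> L2P lam (fun x => f x * \1_(cube (rn n)) x).
    exact: L2_restr (meas_cube _).
  apply: densD => //; [exact: Lb|by apply: L2Z; exact: Lb|].
  by apply: densZ => //; exact: Lb.
have Lna : L2P lam (fun x => `|g x|).
  by apply: (L2_le _ _ Lg) => [|x]; [exact: measurableT_comp|rewrite normr_id].
apply: (n2_dct _ _ _ _ Lna).
- by move=> n; case: (Lgc n).
- by [].
- move=> x; have [xr|xr] := pselect (cube r x); last first.
    by rewrite g0//; under eq_fun do rewrite mul0r; exact: cvg_cst.
  have h : rn n @[n --> \oo] --> r.
    rewrite -[X in _ --> X]mulr1 -[X in _ * X]subr0; apply: cvgM; first exact: cvg_cst.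
    apply: cvgB; first exact: cvg_cst.
    by have := @cvg_harmonic R; rewrite -cvg_shiftS.
  have : \forall n \near \oo, `|x| < rn n by exact: (cvgr_gt r h).
  move=> H; apply: cvg_near_cst; apply: filterS H => n hn.
  by rewrite indicE mem_set// mulr1.
- move=> n x; rewrite indicE; case: (_ \in _); rewrite ?mulr1 ?mulr0 ?subrr ?normr0//.
  by rewrite sub0r normrN.
Qed.

Lemma cvg_below (F : nat -> R) (e : R) : 0 < e -> F n @[n --> \oo] --> (0 : R) ->
  exists n, F n < e.
Proof.
by move=> e0 /cvgr_lt => /(_ e e0) [N _ /(_ N (leqnn N))]; exists N.
Qed.

(** Truncation at height [m], the passage from L^1 to L^2 on bounded sets. *)
Definition clamp (m s : R) := Num.max (- m) (Num.min m s).

Lemma clamp_le m s : 0 <= m -> `|clamp m s| <= m.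
Proof.
by move=> m0; rewrite /clamp ler_norml ge_max ge_min lexx le_max lexx/= andbT; lra.
Qed.

Lemma clamp_norm m s : 0 <= m -> `|clamp m s| <= `|s|.
Proof.
move=> m0; rewrite /clamp; have [h1|h1] := leP m s; have [h2|h2] := leP (- m) _.
- by rewrite !ger0_norm//; apply: le_trans h1.
- lra.
- by [].
- by rewrite normrN ger0_norm// ler0_norm; lra.
Qed.

Lemma clamp_id m s : `|s| <= m -> clamp m s = s.
Proof. by rewrite ler_norml => /andP[h1 h2]; rewrite /clamp min_r// max_r. Qed.

Lemma clamp_meas m f : measurable_fun setT f -> measurable_fun setT (fun x => clamp m (f x)).
Proof. by move=> mf; apply: measurable_maxr => //; exact: measurable_minr. Qed.

Lemma clamp_cvg s : clamp n%:R s @[n --> \oo] --> s.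
Proof.
apply: cvg_near_cst; have [N sN] : exists N, `|s| < N%:R.
  by exists (Num.bound `|s|); exact: archi_boundP.
exists N => // n /= Nn; apply: clamp_id; apply: ltW; apply: lt_le_trans sN _.
by rewrite ler_nat.
Qed.

Lemma n1_clamp (mu : {measure set E -> \bar R}) f : ig mu f ->
  n1 mu ((fun x => clamp n%:R (f x)) \- f) @[n --> \oo] --> (0 : R).
Proof.
move=> fi; have mf := ig_meas fi.
apply: (@n1_dct _ _ _ _ (fun n x => clamp n%:R (f x)) f (fun x => 2 * `|f x|)) => //.
- by move=> n; exact: clamp_meas.
- by move=> x; exact: clamp_cvg.
- move=> n x; apply: le_trans (ler_normB _ _) _.
  by have := @clamp_norm n%:R (f x) (ler0n _ _); lra.
- by apply: igZ; exact: ig_norm.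
Qed.

Lemma dens1 r f e : 0 < e -> ig lam f -> (forall x, ~ cube r x -> f x = 0) ->
  exists2 phi, tstin r phi & n1 lam (f \- phi) < e.
Proof.
move=> e0 fi f0; have e2 : 0 < e / 2 by rewrite divr_gt0.
have mf := ig_meas fi.
have [n hn] := cvg_below e2 (n1_clamp fi).
pose g x := clamp n%:R (f x).
have vg : vanish r g.
  move=> x xr; rewrite /g f0; last by rewrite /cube/= => /ltW; rewrite leNgt xr.
  by rewrite clamp_id// normr0.
have Lg : L2P lam g.
  apply: (bounded_vanish_L2 lamL (clamp_meas _ mf) _ vg) => x.
  exact: clamp_le.
have gi := vanish_ig lamL Lg vg.
pose V := Num.sqrt (fine (lam [set x : E | (`|x| <= r)%R])).
have V1 : 0 < V + 1 by rewrite ltr_wpDl// sqrtr_ge0.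
have g0 x : ~ cube r x -> g x = 0.
  by move=> /f0 fx; rewrite /g fx clamp_id// normr0.
have [phi tphi hphi] := dens_L2 Lg g0 (divr_gt0 e2 V1).
exists phi => //; have ti := tst_ig lamL (tstin_tst tphi).
apply: le_lt_trans (n1_sub fi gi ti) _; rewrite [ltRHS]splitr ltrD//.
  by rewrite n1C.
have vd : vanish r (g \- phi).
  case: tphi => _ [r' r'r v] x xr /=; rewrite vg// v ?subr0//.
  exact: lt_trans xr.
apply: le_lt_trans (vanish_n1 lamL (L2B Lg (tst_L2 lamL (tstin_tst tphi))) vd) _.
apply: (@le_lt_trans _ _ ((V + 1) * n2 lam (g \- phi))).
  by rewrite ler_wpM2r ?n2_ge0// lerDl.
by rewrite mulrC -ltr_pdivlMr.
Qed.

Lemma cube_cover x : exists N, forall n, (N <= n)%N -> cube n%:R x.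
Proof.
exists (Num.bound `|x|) => n Nn; rewrite /cube/=.
by apply: lt_le_trans (archi_boundP _) _; rewrite ?ler_nat.
Qed.

Lemma n1_cube (mu : {measure set E -> \bar R}) f : ig mu f ->
  n1 mu ((fun x => f x * \1_(cube n%:R) x) \- f) @[n --> \oo] --> (0 : R).
Proof.
move=> fi; have mf := ig_meas fi.
apply: (@n1_dct _ _ _ _ (fun n x => f x * \1_(cube n%:R) x) f (fun x => 2 * `|f x|)) => //.
- by move=> n; apply: measurable_funM => //; exact: measurable_indic (meas_cube _).
- move=> x; apply: cvg_near_cst; have [N HN] := cube_cover x.
  by exists N => // n /= /HN hn; rewrite indicE mem_set// mulr1.
- move=> n x; apply: le_trans (ler_normB _ _) _.
  by have := norm_restr f (cube n%:R) x; lra.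
- by apply: igZ; exact: ig_norm.
Qed.

Lemma tst_dense1 f e : 0 < e -> ig lam f -> exists2 phi, tst phi & n1 lam (f \- phi) < e.
Proof.
move=> e0 fi; have e2 : 0 < e / 2 by rewrite divr_gt0.
have [n hn] := cvg_below e2 (n1_cube fi).
have gi : ig lam (fun x => f x * \1_(cube n%:R) x).
  apply: (ig_le _ (norm_restr f _) fi).
  by apply: measurable_funM (ig_meas fi) _; exact: measurable_indic (meas_cube _).
have [|phi tphi hphi] := @dens1 n%:R _ _ e2 gi.
  by move=> x xr; rewrite indicE memNset// mulr0.
exists phi; first exact: tstin_tst tphi.
apply: le_lt_trans (n1_sub fi gi (tst_ig lamL (tstin_tst tphi))) _.
by rewrite [ltRHS]splitr ltrD// n1C.
Qed.

Lemma tst_translate phi h : tst phi -> exists C V, [/\ 0 <= C, 0 <= V &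
  forall h, `|h| <= 1 ->
  n1 lam (fun x => phi (x + h) - phi x) <= V * (C * `|h|) /\
  n2 lam (fun x => phi (x + h) - phi x) <= V * (C * `|h|)].
Proof.
move=> tp; have [C C0 HC] := tst_lip tp; case: (tp) => sp [r v].
pose B := [set x : E | `|x| <= r + 1].
have mB : measurable B by exact: meas_ball.
have lB : (lam B < +oo)%E by exact: lam_ball_lty.
have Bi := ig_indic mB lB.
pose V1 := n1 lam (\1_B : E -> R); pose V2 := n2 lam (\1_B : E -> R).
have L2B1 : L2P lam (\1_B : E -> R).
  apply: (@bounded_vanish_L2 R d lam lamL (r + 1) _ 1).
  - exact: measurable_indic.
  - by move=> x; rewrite indicE; case: (_ \in _); rewrite ?normr1 ?normr0.
  - by move=> x xr; rewrite indicE memNset// /B/= => /le_lt_trans/(_ xr); rewrite ltxx.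
exists C, (V1 + V2); split => //; first by rewrite addr_ge0 ?n1_ge0 ?n2_ge0.
move=> {}h h1.
have mD : measurable_fun setT (fun x => phi (x + h) - phi x).
  apply: measurable_funB; last exact: tst_meas.
  have := measurableT_comp (tst_meas tp) (meas_affine 1 h).
  by rewrite (_ : _ \o _ = (fun x => phi (x + h)))//; apply/funext => x /=; rewrite scale1r.
have Hb x : `|phi (x + h) - phi x| <= `|C * `|h| * \1_B x|.
  rewrite indicE; have [xB|xB] := pselect (B x).
    rewrite mem_set// mulr1 [leRHS]ger0_norm ?mulr_ge0//; exact: HC.
  move: (xB); rewrite /B/= => /negP; rewrite -ltNge => xr.
  have h2 := ler_normB (x + h) h; rewrite addrK in h2.
  rewrite v; last by move: (normr_ge0 (x + h)); lra.
  by rewrite v ?subrr ?normr0//; lra.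
have n1le : n1 lam (fun x => phi (x + h) - phi x) <= C * `|h| * V1.
  apply: le_trans (n1_le mD Hb (igZ _ Bi)) _.
  by rewrite n1Z// ger0_norm ?mulr_ge0.
have n2le' : n2 lam (fun x => phi (x + h) - phi x) <= C * `|h| * V2.
  apply: le_trans (n2_le mD Hb (L2Z _ L2B1)) _.
  by rewrite n2Z// ger0_norm ?mulr_ge0.
have Ch : 0 <= C * `|h| by rewrite mulr_ge0.
split; [apply: le_trans n1le _|apply: le_trans n2le' _]; rewrite mulrC ler_wpM2r//.
  by rewrite lerDl n2_ge0.
by rewrite lerDr n1_ge0.
Qed.

Lemma small_translate phi e : tst phi -> 0 < e -> exists2 del, 0 < del &
  forall h, `|h| <= del ->
  n1 lam (fun x => phi (x + h) - phi x) <= e /\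
  n2 lam (fun x => phi (x + h) - phi x) <= e.
Proof.
move=> tp e0; have [C [V [C0 V0 H]]] := tst_translate 0 tp.
have VC : 0 < V * C + 1 by rewrite ltr_wpDl// mulr_ge0.
exists (Num.min 1 (e / (V * C + 1))); first by rewrite lt_min ltr01 divr_gt0.
move=> h; rewrite le_min => /andP[h1 he].
have [H1 H2] := H h h1.
have : V * (C * `|h|) <= e.
  by move: he; rewrite ler_pdivlMr// mulrA => he; have := normr_ge0 h; lra.
by move=> le; split; apply: le_trans le.
Qed.

Lemma translate1 u e : ig lam u -> 0 < e -> exists2 del, 0 < del &
  forall h, `|h| <= del -> n1 lam (fun x => u (x + h) - u x) <= e.
Proof.
move=> ui e0; have e3 : 0 < e / 3 by rewrite divr_gt0.
have [phi tp hp] := tst_dense1 e3 ui.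
have [del del0 H] := small_translate tp e3; exists del => // h /H[h1 _].
have pi := tst_ig lamL tp.
have di := igB ui pi.
have [di' dE] := translate lamL h di.
have [pi' _] := translate lamL h pi.
rewrite [X in n1 _ X](_ : _ = (fun x => (u \- phi) (x + h)) \+
  ((fun x => phi (x + h) - phi x) \- (u \- phi))); last first.
  by apply/funext => x /=; ring.
have -> : e = e / 3 + (e / 3 + e / 3) by lra.
have pd := igB pi' pi.
apply: le_trans (n1D di' (igB pd di)) _; apply: lerD.
  have [_ nE] := translate lamL h (ig_norm di).
  by rewrite /n1 nE; exact: ltW.
apply: le_trans (n1B pd di) _; apply: lerD => //; exact: ltW.
Qed.

Lemma tst_dense2 r f e : 0 < e -> L2P lam f -> vanish r f ->
  exists2 phi, tstin (r + 1) phi & n2 lam (f \- phi) < e.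
Proof.
move=> e0 Lf v; apply: dens_L2 => // x; rewrite /cube/= => /negP; rewrite -leNgt => h.
by apply: v; lra.
Qed.

Lemma translate2 r u e : L2P lam u -> vanish r u -> 0 < e -> exists2 del, 0 < del &
  forall h, `|h| <= del -> n2 lam (fun x => u (x + h) - u x) <= e.
Proof.
move=> Lu v e0; have e3 : 0 < e / 3 by rewrite divr_gt0.
have [phi /tstin_tst tp hp] := tst_dense2 e3 Lu v.
have [del del0 H] := small_translate tp e3; exists del => // h /H[_ h1].
have Lp := tst_L2 lamL tp.
have Ld := L2B Lu Lp.
have [Ld' dE] := translate_L2 lamL h Ld.
have [Lp' _] := translate_L2 lamL h Lp.
rewrite [X in n2 _ X](_ : _ = (fun x => (u \- phi) (x + h)) \+
  ((fun x => phi (x + h) - phi x) \- (u \- phi))); last first.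
  by apply/funext => x /=; ring.
have -> : e = e / 3 + (e / 3 + e / 3) by lra.
have pd := L2B Lp' Lp.
apply: le_trans (n2D Ld' (L2B pd Ld)) _; apply: lerD.
  by rewrite dE; exact: ltW.
apply: le_trans (n2B pd Ld) _; apply: lerD => //; exact: ltW.
Qed.

End Density.

(** * Averages of functions, by Tonelli's theorem and Jensen's inequality *)

Section SigmaFinite.
Context dd (T : measurableType dd) (R : realType) (mu : {measure set T -> \bar R}).
Hypothesis sfin : sigma_finite setT mu.

(** A copy of [mu] that carries the proof of sigma-finiteness, so that the Tonelli theorems, which
    ask for this structure, apply. *)
Definition sfm & sigma_finite setT mu : set T -> \bar R := mu.
Let m := sfm sfin.
HB.instance Definition _ := Measure.copy m mu.
HB.instance Definition _ := Measure_isSigmaFinite.Build _ _ _ m sfin.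
Definition sfmeasure : {sigma_finite_measure set T -> \bar R} := m.

End SigmaFinite.

Section Averaging.
Context {R : realType} {d : nat}.
Local Notation E := 'rV[R]_d.
Variable lam : {measure set E -> \bar R}.
Hypothesis lamL : is_lebesgue lam.

Local Notation sf_leb := (sfmeasure (lam_sigma_finite lamL)).

Lemma measurable_section (a : E -> E -> R) z :
  measurable_fun setT (fun p : E * E => a p.1 p.2) -> measurable_fun setT (fun x => a x z).
Proof.
move=> ma; have h : measurable_fun setT (fun x : E => (x, z)).
  by apply: measurable_fun_pair => //; exact: measurable_id.
exact: (measurableT_comp ma h).
Qed.

(** Minkowski's integral inequality in L^1, by Tonelli: only the z with kap z != 0 contribute, and
    for these the L^1 norm of a(., z) is at most [M]. It serves mollification, its error and the
    commutator; in the last case [kap] is a derivative of the mollifier. *)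
Lemma average_n1 (kap F : E -> R) (a : E -> E -> R) (M : R) : 0 <= M ->
  ig lam kap -> measurable_fun setT (fun p : E * E => a p.1 p.2) ->
  measurable_fun setT F ->
  (forall x, (`|F x|%:E <= \int[lam]_z `|(kap z * a x z)%R|%:E)%E) ->
  (forall z, kap z != 0 -> (\int[lam]_x `|a x z|%:E <= M%:E)%E) ->
  ig lam F /\ n1 lam F <= M * n1 lam kap.
Proof.
move=> M0 ki ma mF HF Ha.
have mk := ig_meas ki.
pose f (p : E * E) := (`|kap p.2 * a p.1 p.2|%R%:E)%E.
have mf : measurable_fun setT f.
  apply/measurable_EFinP; apply: measurableT_comp => //.
  by apply: measurable_funM => //; exact: (measurableT_comp mk measurable_snd).
have f0 p : (0 <= f p)%E by rewrite lee_fin.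
have mk' : measurable_fun setT (fun z => `|kap z|%:E).
  by apply/measurable_EFinP; exact: measurableT_comp.
have key : (\int[lam]_x `|F x|%:E <= M%:E * \int[lam]_z `|kap z|%:E)%E.
  apply: (@le_trans _ _ (\int[lam]_x \int[lam]_z f (x, z))%E).
    apply: ge0_le_integral => //.
    - by apply/measurable_EFinP; exact: measurableT_comp.
    - exact: (@measurable_fun_fubini_tonelli_F _ _ _ _ _ sf_leb f mf f0).
  rewrite (@fubini_tonelli _ _ _ _ _ sf_leb sf_leb f mf f0).
  have -> : (M%:E * \int[lam]_z `|kap z|%:E = \int[lam]_z (M%:E * `|kap z|%:E))%E.
    by rewrite ge0_integralZl.
  apply: ge0_le_integral => //.
  - by move=> z _; apply: integral_ge0 => x _.
  - exact: (@measurable_fun_fubini_tonelli_G _ _ _ _ _ sf_leb f mf f0).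
  - exact: measurable_funeM.
  - move=> z _; rewrite /f/=.
    under eq_integral do rewrite normrM EFinM.
    rewrite ge0_integralZl//; last first.
      by apply/measurable_EFinP; apply: measurableT_comp => //; exact: measurable_section.
    have [->|kz] := eqVneq (kap z) 0; first by rewrite normr0 mule0 mul0e.
    by rewrite muleC lee_wpmul2r// Ha.
have iF : ig lam F.
  apply/integrableP; split; first exact/measurable_EFinP.
  apply: le_lt_trans key _; rewrite -n1_E// -EFinM; exact: ltry.
split => //; rewrite -lee_fin n1_E//; apply: le_trans key _.
by rewrite EFinM n1_E.
Qed.

Lemma norm_Rint_lee (f : E -> R) : measurable_fun setT f ->
  (`|\int[lam]_x f x|%:E <= \int[lam]_x `|f x|%:E)%E.
Proof.
move=> mf; have h0 : (0 <= \int[lam]_x `|f x|%:E)%E by apply: integral_ge0.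
have [/eqP ->|] := boolP ((\int[lam]_x `|f x|%:E)%E == +oo%E); first exact: leey.
rewrite -ltey => hy.
have fi : ig lam f by apply/integrableP; split => //; exact/measurable_EFinP.
by rewrite -n1_E// lee_fin; exact: norm_Rint_le.
Qed.

(** The variance of [a] under the probability density [eta] is nonnegative. An infinite right-hand
    side is treated apart, as real-valued integrals cannot express it. *)
Lemma jensen_sqr (eta a : E -> R) : (forall z, 0 <= eta z) -> ig lam eta ->
  \int[lam]_z eta z = 1 -> measurable_fun setT a ->
  (((\int[lam]_z (eta z * a z)) ^+ 2)%:E <= \int[lam]_z `|(eta z * a z ^+ 2)%R|%:E)%E.
Proof.
move=> e0 ei e1 ma; have me := ig_meas ei.
have m2 : measurable_fun setT (fun z => eta z * a z ^+ 2).
  by apply: measurable_funM => //; exact: measurable_funX.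
have [/eqP ->|] := boolP ((\int[lam]_z `|(eta z * a z ^+ 2)%R|%:E)%E == +oo%E).
  exact: leey.
rewrite -ltey => hy.
have i2 : ig lam (fun z => eta z * a z ^+ 2).
  by apply/integrableP; split => //; exact/measurable_EFinP.
have i1 : ig lam (fun z => eta z * a z).
  apply: ig_le (igD ei i2); first exact: measurable_funM.
  move=> z /=; rewrite -[X in X + _]mulr1 -mulrDr !normrM ler_wpM2l//.
  rewrite [leRHS]ger0_norm ?addr_ge0 ?sqr_ge0// -[a z ^+ 2]real_normK ?num_real//.
  by have := sqr_ge0 (`|a z| - 1); have := normr_ge0 (a z); nra.
rewrite -n1_E// lee_fin; set m := \int[lam]_z (eta z * a z).
have : 0 <= \int[lam]_z (eta z * (a z - m) ^+ 2).
  by apply: Rintegral_ge0 => z _; rewrite mulr_ge0// sqr_ge0.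
have -> : \int[lam]_z (eta z * (a z - m) ^+ 2) =
    \int[lam]_z ((eta z * a z ^+ 2) + ((-2 * m) * (eta z * a z) + m ^+ 2 * eta z)).
  by apply: eq_Rintegral => z _; ring.
rewrite RintegralD//; last by apply: igD; exact: igZ.
rewrite RintegralD//; [|exact: igZ..].
rewrite !RintegralZl// e1 -/m.
have : \int[lam]_z (eta z * a z ^+ 2) <= n1 lam (fun z => eta z * a z ^+ 2).
  by apply: le_trans (ler_norm _) _; exact: norm_Rint_le.
by nra.
Qed.

End Averaging.

(** * Mollification and the commutator estimate *)

Section Convolution.
Context {R : realType} {d : nat}.
Local Notation E := 'rV[R]_d.
Local Notation e_ i := (delta_mx 0 i : E).
Implicit Types (f g u eta : E -> R) (x y h : E) (i : 'I_d) (r : R).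
Variable lam : {measure set E -> \bar R}.
Hypothesis lamL : is_lebesgue lam.

(** Convolution with the reflection of [eta]. As a function of [y] the kernel is a translated test
    function and can be inserted directly into a weak equation; the price is a sign whenever [cv] is
    differentiated. *)
Definition cv eta u x : R := \int[lam]_y (eta (y - x) * u y).

Lemma tst_shift eta x : tst eta -> tst (fun y => eta (y - x)).
Proof.
move=> /(tst_affine (- x) (oner_neq0 R)).
by under eq_fun do rewrite scale1r.
Qed.

Lemma cv_ig eta u x : tst eta -> ig lam u -> ig lam (fun y => eta (y - x) * u y).
Proof.
move=> te ui; have [C C0 HC] := tst_bounded te.
apply: (@ig_mulb _ _ _ _ _ _ C) => //.
by apply: tst_meas; exact: tst_shift.
Qed.

Lemma cvB eta u v x : tst eta -> ig lam u -> ig lam v ->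
  cv eta (u \- v) x = cv eta u x - cv eta v x.
Proof.
move=> te ui vi; rewrite /cv -RintegralB//; [|exact: cv_ig..].
by apply: eq_Rintegral => y _ /=; rewrite mulrBr.
Qed.

Lemma cvNl eta u x : tst eta -> ig lam u -> cv (fun y => - eta y) u x = - cv eta u x.
Proof.
move=> te ui; rewrite /cv -[RHS]mulN1r -RintegralZl//; last exact: cv_ig.
by apply: eq_Rintegral => y _; rewrite mulN1r mulNr.
Qed.

Lemma cv_lip eta u : tst eta -> ig lam u -> exists C, forall x h,
  `|cv eta u (x + h) - cv eta u x| <= C * `|h|.
Proof.
move=> te ui; have [C C0 HC] := tst_lip te; exists (C * n1 lam u) => x h.
have i1 := cv_ig (x + h) te ui; have i2 := cv_ig x te ui.
rewrite /cv -RintegralB//; apply: le_trans (norm_Rint_le (igB i1 i2)) _.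
rewrite mulrAC.
have -> : C * `|h| * n1 lam u = n1 lam (fun y => C * `|h| * u y).
  by rewrite n1Z// ger0_norm// mulr_ge0.
apply: n1_le; [exact: (ig_meas (igB i1 i2))| |exact: igZ].
move=> y /=; rewrite -mulrBl !normrM ler_wpM2r// [X in _ <= X * _]ger0_norm// normr_id.
have := HC (y - (x + h)) h; rewrite distrC.
by rewrite (_ : y - (x + h) + h = y - x)//; rewrite opprD addrA subrK.
Qed.

Lemma lip_cont f (C : R) : (forall x h, `|f (x + h) - f x| <= C * `|h|) -> continuous f.
Proof.
move=> HC; move=> x; apply/(@cvgrPdist_le _ _ _ (nbhs x) (nbhs_filter x)) => e e0.
have C1 : 0 < `|C| + 1 by rewrite ltr_wpDl.
near=> y; rewrite distrC -[X in f X - _](subrK x) addrC.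
rewrite (addrC (- _)) (addrC (y - x)); apply: le_trans (HC x (y - x)) _.
have h : `|y - x| <= e / (`|C| + 1).
  rewrite distrC; near: y.
  by apply: (@cvgr_dist_le _ _ _ (nbhs x) (nbhs_filter x) id x) => //; rewrite divr_gt0.
apply: (@le_trans _ _ ((`|C| + 1) * (e / (`|C| + 1)))); last first.
  by rewrite mulrC divfK// gt_eqF.
apply: (@le_trans _ _ (`|C| * `|y - x|)); first by rewrite ler_wpM2r// ler_norm.
by apply: ler_pM => //; rewrite lerDl.
Unshelve. all: by end_near. Qed.

Lemma cv_cont eta u : tst eta -> ig lam u -> continuous (cv eta u).
Proof. by move=> te ui; have [C HC] := cv_lip te ui; exact: lip_cont HC. Qed.

Lemma quad_derive f x i (a C : R) :
  (forall t, `|f (x + t *: e_ i) - f x - t * a| <= C * t ^+ 2) ->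
  is_derive x (e_ i) f a.
Proof.
move=> H; apply: is_derive_line0.
set g := fun s : R => _.
have h : (fun s : R => s^-1 *: ((g \o shift 0) (s *: 1) - g 0)) @ 0^' --> a.
  apply/cvgrPdist_le => e e0; near=> s.
  have sn0 : s != 0 by near: s; exact: nbhs_dnbhs_neq.
  rewrite /g /= addr0 [_%:A]mulr1 scale0r addr0.
  rewrite -normrN opprB [_ *: _]/(_ * _).
  have -> : s^-1 * (f (x + s *: e_ i) - f x) - a = s^-1 * (f (x + s *: e_ i) - f x - s * a).
    by rewrite [RHS]mulrBr mulrA mulVf// mul1r.
  rewrite normrM; apply: (@le_trans _ _ (`|s^-1| * (C * s ^+ 2))).
    by rewrite ler_wpM2l.
  have -> : `|s^-1| * (C * s ^+ 2) = C * `|s|.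
    rewrite -[s ^+ 2]real_normK ?num_real// normfV.
    have : `|s| != 0 by rewrite normr_eq0.
    by set q := `|s| => q0; field.
  have C1 : 0 < `|C| + 1 by rewrite ltr_wpDl.
  have h : `|s| <= e / (`|C| + 1).
    by near: s; apply: dnbhs0_le; rewrite divr_gt0.
  apply: (@le_trans _ _ ((`|C| + 1) * (e / (`|C| + 1)))); last first.
    by rewrite mulrC divfK// gt_eqF.
  apply: (@le_trans _ _ (`|C| * `|s|)); first by rewrite ler_wpM2r// ler_norm.
  by apply: ler_pM => //; rewrite lerDl.
split; [exact: cvgP h|exact: cvg_lim h].
Unshelve. all: by end_near. Qed.

(** The Taylor error of the kernel is quadratic in the increment, uniformly in [y], which justifies
    differentiation under the integral. *)
Lemma cv_derive eta u i x : tst eta -> ig lam u ->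
  is_derive x (e_ i) (cv eta u) (cv (fun y => - partial i eta y) u x).
Proof.
move=> te ui; have [C C0 HC] := tst_bounded (tst_partial i (tst_partial i te)).
rewrite cvNl//; last exact: tst_partial.
apply: (@quad_derive _ _ _ _ (C * n1 lam u)) => t.
have i1 := cv_ig (x + t *: e_ i) te ui; have i2 := cv_ig x te ui.
have i3 := cv_ig x (tst_partial i te) ui.
rewrite mulrN opprK /cv -RintegralB// -RintegralZl// -RintegralD//; last 2 first.
- exact: (igB i1 i2).
- exact: (igZ t i3).
apply: le_trans (norm_Rint_le (igD (igB i1 i2) (igZ t i3))) _.
have -> : C * n1 lam u * t ^+ 2 = n1 lam (fun y => C * t ^+ 2 * u y).
  have h : 0 <= C * t ^+ 2 by rewrite mulr_ge0 ?sqr_ge0.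
  by rewrite n1Z// ger0_norm// mulrAC.
apply: n1_le; [exact: (ig_meas (igD (igB i1 i2) (igZ t i3)))| |exact: igZ].
move=> y /=.
have -> : eta (y - (x + t *: e_ i)) * u y - eta (y - x) * u y + t * (partial i eta (y - x) * u y)
   = (eta (y - x + (- t) *: e_ i) - eta (y - x) - (- t) * partial i eta (y - x)) * u y.
  by rewrite scaleNr opprD addrA; ring.
have h : 0 <= C * t ^+ 2 by rewrite mulr_ge0 ?sqr_ge0.
rewrite normrM [leRHS]normrM ler_wpM2r// (ger0_norm h) -[t ^+ 2]sqrrN.
by apply: taylor_dir => //; case: te.
Qed.

Lemma tstN eta : tst eta -> tst (fun y => - eta y).
Proof. by move=> /(tstZ (-1)); under eq_fun do rewrite mulN1r. Qed.

Lemma partial_cv eta u i : tst eta -> ig lam u ->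
  partial i (cv eta u) = cv (fun y => - partial i eta y) u.
Proof. by move=> te ui; apply/funext => x; have [] := cv_derive i x te ui. Qed.

Lemma cv_smooth eta u : tst eta -> ig lam u -> smooth (cv eta u).
Proof.
move=> te ui; apply/smoothP => n; elim: n eta te => [|n IH] eta te.
  exact: cv_cont.
split; first exact: cv_cont.
  by move=> i x; have [] := cv_derive i x te ui.
by move=> i; rewrite partial_cv//; apply: IH; apply: tstN; exact: tst_partial.
Qed.

Lemma cv_vanish eta u r s : vanish s eta -> vanish r u -> vanish (r + s) (cv eta u).
Proof.
move=> ve vu x xr; rewrite /cv.
transitivity (\int[lam]_y (0 : R)); last by rewrite Rintegral_cst// mul0r.
apply: eq_Rintegral => y _; have [yr|yr] := leP `|y| r; last by rewrite vu// mulr0.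
rewrite ve ?mul0r//; have := ler_normB y (y - x).
by rewrite opprB addrC subrK; lra.
Qed.

End Convolution.

Section Mollifier.
Context {R : realType} {d : nat}.
Local Notation E := 'rV[R]_d.
Local Notation e_ i := (delta_mx 0 i : E).
Implicit Types (f g u : E -> R) (x y h : E) (i : 'I_d) (r : R).
Variable lam : {measure set E -> \bar R}.
Hypothesis lamL : is_lebesgue lam.

Definition mollifier (eta : E -> R) :=
  [/\ tst eta, vanish 1 eta, forall x, 0 <= eta x & \int[lam]_x eta x = 1].

Lemma mollifier_exists : exists eta, mollifier eta.
Proof.
pose a : E := const_mx (-1); pose b : E := const_mx 1.
pose f := boxf a b 1.
have f0 x : 0 <= f x by have /andP[] := boxf_bnd a b 1 x.
have vf : vanish 1 f.
  move=> x x1; apply: boxf_out => //; rewrite -cube_obox// /cube/= => /(lt_trans x1).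
  by rewrite ltxx.
have tf : tst f by split; [exact: boxf_smooth|exists 1].
have fi := tst_ig lamL tf.
(* Were the integral 0, the nonnegative function [f] would vanish almost everywhere, yet it is
   positive on an open box, which has positive measure. *)
have I0 : 0 < \int[lam]_x f x.
  rewrite lt_neqAle Rintegral_ge0 ?andbT//.
  apply/negP => /eqP I0.
  have h : (\int[lam]_x `|(EFin \o f) x| = 0)%E.
    have <- : (\int[lam]_x f x)%:E = 0%E by rewrite -I0.
    rewrite /Rintegral fineK; last exact: integrable_fin_num.
    by apply: eq_integral => x _ /=; rewrite ger0_norm.
  have mf : measurable_fun setT (EFin \o f) by apply/measurable_EFinP; exact: ig_meas fi.
  have [N [mN N0 HN]] := (ae_eq_integral_abs lam measurableT mf).1 h.
  have ab k : a 0 k < b 0 k by rewrite !mxE; lra.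
  have : (0 < lam (obox a b))%E by exact: lam_obox_gt0.
  apply/negP; rewrite -leNgt -N0; apply: le_measure; rewrite ?inE//.
    exact: obox_meas.
  move=> x ox; apply: HN => /= /(_ Logic.I) /= [fx0].
  have : 0 < f x.
    apply: prodr_gt0 => k _; have /andP[ak kb] := ox k.
    by rewrite !mul1r mulr_gt0// flat1_gt0// subr_gt0.
  by rewrite fx0 ltxx.
exists (fun x => (\int[lam]_x f x)^-1 * f x); split.
- exact: tstZ.
- by move=> x /vf ->; rewrite mulr0.
- by move=> x; rewrite mulr_ge0// invr_ge0 ltW.
- by rewrite RintegralZl// mulVf// gt_eqF.
Qed.

Definition ker (kap : E -> R) (e : R) : E -> R := fun y => e^-1 ^+ d * kap (e^-1 *: y).

(** The convolution with [ker kap e] after the substitution y = x + e z. The kernel no longer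
    depends on [e], which suits estimates uniform in the scale. *)
Definition Av (kap : E -> R) (e : R) u x := \int[lam]_z (kap z * u (x + e *: z)).

Lemma tst_ker kap e : 0 < e -> tst kap -> tst (ker kap e).
Proof.
move=> e0 tk; apply: tstZ.
have := tst_affine 0 (_ : e^-1 != 0) tk.
by under eq_fun do rewrite addr0; apply; rewrite invr_eq0 gt_eqF.
Qed.

Lemma vanish_ker kap e r : 0 < e -> vanish r kap -> vanish (e * r) (ker kap e).
Proof.
move=> e0 vk y ye; rewrite /ker vk ?mulr0// normrZ gtr0_norm ?invr_gt0//.
by rewrite ltr_pdivlMl.
Qed.

Lemma partial_ker i kap e : tst kap ->
  partial i (ker kap e) = fun y => e^-1 * ker (partial i kap) e y.
Proof.
move=> tk; apply/funext => y; rewrite /ker.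
have := partial_affine i e^-1 0 y tk.1.
have sk : smooth (fun y : E => kap (e^-1 *: y + 0)) by apply: smooth_affine; case: tk.
under eq_fun do rewrite addr0.
have sk' : smooth (fun y : E => kap (e^-1 *: y)) by under eq_fun do rewrite -[_ *: _]addr0.
rewrite addr0 => H; rewrite partialZ; last exact: (smooth_derivable sk').
by rewrite H mulrCA.
Qed.

Lemma ig_shift e u x : 0 < e -> ig lam u -> ig lam (fun z => u (x + e *: z)).
Proof.
move=> e0 ui; have [h _] := integral_affine lamL x e0 ui.
by under eq_fun do rewrite addrC.
Qed.

Lemma Av_ig kap e u x : 0 < e -> tst kap -> ig lam u ->
  ig lam (fun z => kap z * u (x + e *: z)).
Proof.
move=> e0 tk ui; have [C C0 HC] := tst_bounded tk.
by apply: (@ig_mulb _ _ _ _ _ _ C) => //; [exact: tst_meas|exact: ig_shift].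
Qed.

Lemma cvE kap e u x : 0 < e -> tst kap -> ig lam u -> cv lam (ker kap e) u x = Av kap e u x.
Proof.
move=> e0 tk ui; have Fi := cv_ig x (tst_ker e0 tk) ui.
have [_] := integral_affine lamL x e0 Fi.
have -> : \int[lam]_x0 (ker kap e (e *: x0 + x - x) * u (e *: x0 + x)) =
   \int[lam]_z (e^-1 ^+ d * (kap z * u (x + e *: z))).
  apply: eq_Rintegral => z _; rewrite addrK /ker scalerA mulVf ?gt_eqF// scale1r.
  by rewrite addrC mulrA.
rewrite RintegralZl//; last exact: Av_ig.
by move/mulfI => h; rewrite /cv -h// expf_neq0// invr_eq0 gt_eqF.
Qed.

Lemma meas_shift2 e u : measurable_fun setT u ->
  measurable_fun setT (fun p : E * E => u (p.1 + e *: p.2)).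
Proof.
move=> mu; apply: (measurableT_comp mu).
by apply: prod_coord_meas; [exact: measurable_fst|exact: measurable_snd].
Qed.

Variable eta : E -> R.
Hypothesis etaM : mollifier eta.
Let te : tst eta. Proof. by case: etaM. Qed.
Let ei : ig lam eta. Proof. exact: tst_ig. Qed.
Let n1e : n1 lam eta = 1.
Proof. by case: etaM => _ _ e0 <-; apply: eq_Rintegral => x _; rewrite ger0_norm. Qed.

Definition mo (e : R) u := cv lam (ker eta e) u.

Lemma moE e u x : 0 < e -> ig lam u -> mo e u x = Av eta e u x.
Proof. by move=> e0 ui; exact: cvE. Qed.

Lemma mo_smooth e u : 0 < e -> ig lam u -> smooth (mo e u).
Proof. by move=> e0 ui; apply: cv_smooth => //; exact: tst_ker. Qed.

Lemma mo_vanish e u r : 0 < e -> vanish r u -> vanish (r + e) (mo e u).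
Proof.
move=> e0 vu; apply: cv_vanish => //; rewrite -[X in vanish X](mulr1 e).
by apply: vanish_ker; case: etaM.
Qed.

Lemma mo_tst e u r : 0 < e -> ig lam u -> vanish r u -> tst (mo e u).
Proof.
by move=> e0 ui vu; split; [exact: mo_smooth|exists (r + e); exact: mo_vanish].
Qed.

Lemma moB e u v x : 0 < e -> ig lam u -> ig lam v -> mo e (u \- v) x = mo e u x - mo e v x.
Proof. by move=> e0 ui vi; apply: cvB => //; exact: tst_ker. Qed.

Lemma partial_mo i e u x : 0 < e -> ig lam u ->
  partial i (mo e u) x = - (e^-1 * Av (partial i eta) e u x).
Proof.
move=> e0 ui; have tk := tst_ker e0 te.
rewrite /mo partial_cv// cvNl//; last exact: tst_partial.
congr (- _); rewrite -cvE//; last exact: tst_partial.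
rewrite partial_ker// /cv -RintegralZl//; last first.
  by apply: cv_ig => //; apply: tst_ker => //; exact: tst_partial.
by apply: eq_Rintegral => y _; rewrite mulrA.
Qed.

(** The translated kernel is an admissible test function in the definition of the weak
    derivative. *)
Lemma partial_mo_weak i e f g : 0 < e -> ig lam f -> weak_partial lam setT i f g ->
  partial i (mo e f) = mo e g.
Proof.
move=> e0 fi w; have tk := tst_ker e0 te.
apply/funext => x; rewrite /mo partial_cv// cvNl//; last exact: tst_partial.
have := w _ ((test_setTP _).2 (tst_shift x tk)).
have -> : partial i (fun y => ker eta e (y - x)) = fun y => partial i (ker eta e) (y - x).
  apply/funext => y; have := partial_affine i 1 (- x) y tk.1.
  by under eq_fun do rewrite scale1r; rewrite scale1r mul1r.
rewrite /cv => H; under eq_Rintegral do rewrite mulrC.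
by rewrite H opprK; apply: eq_Rintegral => y _; rewrite mulrC.
Qed.

Lemma mo_diff e u x : 0 < e -> ig lam u ->
  mo e u x - u x = \int[lam]_z (eta z * (u (x + e *: z) - u x)).
Proof.
move=> e0 ui; rewrite moE//.
have {1}-> : u x = \int[lam]_z (u x * eta z).
  by rewrite RintegralZl//; case: etaM => _ _ _ ->; rewrite mulr1.
rewrite -RintegralB//; [|exact: Av_ig|exact: igZ].
by apply: eq_Rintegral => z _; rewrite mulrBr [u x * _]mulrC.
Qed.

Lemma eta_supp z : eta z != 0 -> `|z| <= 1.
Proof. by case: etaM => _ v _ _; apply: contra_neqT; rewrite -ltNge => /v. Qed.

Lemma mo_meas e u : 0 < e -> ig lam u -> measurable_fun setT (mo e u).
Proof. by move=> e0 ui; exact: smooth_meas (mo_smooth e0 ui). Qed.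

Lemma mo_n1 e u : 0 < e -> ig lam u -> ig lam (mo e u) /\ n1 lam (mo e u) <= n1 lam u.
Proof.
move=> e0 ui; have mu := ig_meas ui.
have := @average_n1 _ _ _ lamL eta (mo e u) (fun x z => u (x + e *: z)) (n1 lam u)
   (n1_ge0 _ _) ei (meas_shift2 e mu) (mo_meas e0 ui).
rewrite n1e mulr1; apply.
- move=> x; rewrite moE//; apply: norm_Rint_lee.
  exact: (ig_meas (Av_ig x e0 te ui)).
- move=> z _; have [h1 h2] := translate lamL (e *: z) (ig_norm ui).
  by rewrite -n1_E ?lee_fin; [rewrite /n1 h2|exact: (translate lamL (e *: z) ui).1].
Qed.

(** The mollifier lives in the unit ball, so the mollification error is an average of the errors of
    translations by at most [e]. *)
Lemma mo_n1_diff e u (c : R) : 0 < e -> ig lam u ->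
  (forall h, `|h| <= e -> n1 lam (fun x => u (x + h) - u x) <= c) ->
  n1 lam (mo e u \- u) <= c.
Proof.
move=> e0 ui Hc; have mu := ig_meas ui.
have c0 : 0 <= c by apply: le_trans (Hc 0 _); rewrite ?n1_ge0// normr0 ltW.
have ma : measurable_fun setT (fun p : E * E => u (p.1 + e *: p.2) - u p.1).
  apply: measurable_funB; first exact: meas_shift2.
  exact: (measurableT_comp mu measurable_fst).
have := @average_n1 _ _ _ lamL eta (mo e u \- u) (fun x z => u (x + e *: z) - u x) c
   c0 ei ma.
rewrite n1e mulr1 => H; apply: (proj2 (H _ _ _)).
- by apply: measurable_funB => //; exact: mo_meas.
- move=> x; rewrite /= mo_diff//; apply: norm_Rint_lee.
  apply: measurable_funM; first exact: ig_meas ei.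
  by apply: measurable_funB => //; exact: (ig_meas (ig_shift x e0 ui)).
- move=> z /eta_supp z1; have hh := igB (translate lamL (e *: z) ui).1 ui.
  rewrite -n1_E ?lee_fin//; apply: Hc.
  by rewrite normrZ gtr0_norm// -[leRHS]mulr1 ler_pM2l.
Qed.

Lemma mo_n2 e u : 0 < e -> ig lam u -> L2P lam u ->
  L2P lam (mo e u) /\ n2 lam (mo e u) <= n2 lam u.
Proof.
move=> e0 ui Lu; have mu := ig_meas ui; have [_ u2] := Lu.
have m2 : measurable_fun setT (fun x => mo e u x ^+ 2) by apply: measurable_funX; exact: mo_meas.
have := @average_n1 _ _ _ lamL eta (fun x => mo e u x ^+ 2) (fun x z => u (x + e *: z) ^+ 2)
  (n1 lam (fun x => u x ^+ 2)) (n1_ge0 _ _) ei (measurable_funX 2 (meas_shift2 e mu)) m2.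
rewrite n1e mulr1 => /(_ _ _)[].
- move=> x; rewrite moE// ger0_norm ?sqr_ge0//.
  apply: jensen_sqr => //; [by case: etaM|by case: etaM|exact: (ig_meas (ig_shift x e0 ui))].
- move=> z _; have [h1 h2] := translate lamL (e *: z) (ig_norm u2).
  by rewrite -n1_E ?lee_fin; [rewrite /n1 h2|exact: (translate lamL (e *: z) u2).1].
- move=> h1 h2; split; first by split => //; exact: mo_meas.
  have e1 f : n1 lam (fun x => f x ^+ 2) = \int[lam]_x (f x ^+ 2).
    by apply: eq_Rintegral => x _; rewrite ger0_norm// sqr_ge0.
  by rewrite /n2 ler_wsqrtr// -!e1.
Qed.

Lemma mo_n2_diff e u (c : R) : 0 <= c -> 0 < e -> ig lam u -> L2P lam u ->
  (forall h, `|h| <= e -> n2 lam (fun x => u (x + h) - u x) <= c) ->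
  n2 lam (mo e u \- u) <= c.
Proof.
move=> c0 e0 ui Lu Hc; have mu := ig_meas ui.
have ma : measurable_fun setT (fun p : E * E => u (p.1 + e *: p.2) - u p.1).
  apply: measurable_funB; first exact: meas_shift2.
  exact: (measurableT_comp mu measurable_fst).
have m2 : measurable_fun setT (fun x => (mo e u x - u x) ^+ 2).
  by apply: measurable_funX; apply: measurable_funB => //; exact: mo_meas.
have := @average_n1 _ _ _ lamL eta (fun x => (mo e u x - u x) ^+ 2)
  (fun x z => (u (x + e *: z) - u x) ^+ 2)
  (c ^+ 2) (sqr_ge0 _) ei (measurable_funX 2 ma) m2.
rewrite n1e mulr1 => /(_ _ _)[].
- move=> x; rewrite mo_diff// ger0_norm ?sqr_ge0//.
  apply: jensen_sqr => //; [by case: etaM|by case: etaM|].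
  by apply: measurable_funB => //; exact: (ig_meas (ig_shift x e0 ui)).
- move=> z /eta_supp z1.
  have Lh : L2P lam (fun x => u (x + e *: z) - u x).
    exact: (L2B (translate_L2 lamL (e *: z) Lu).1 Lu).
  rewrite -n1_E ?lee_fin; last by case: Lh.
  have <- : n2 lam (fun x => u (x + e *: z) - u x) ^+ 2 = n1 lam (fun x => (u (x + e *: z) - u x) ^+ 2).
    by rewrite n2_sqr; apply: eq_Rintegral => x _; rewrite ger0_norm// sqr_ge0.
  rewrite ler_sqr ?nnegrE ?n2_ge0//; apply: Hc.
  by rewrite normrZ gtr0_norm// -[leRHS]mulr1 ler_pM2l.
- move=> h1 h2; rewrite -(ger0_norm c0) -sqrtr_sqr /n2 ler_wsqrtr//.
  apply: le_trans h2; rewrite le_eqVlt; apply/orP; left; apply/eqP.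
  by apply: eq_Rintegral => x _; rewrite ger0_norm// sqr_ge0.
Qed.

Definition en (n : nat) : R := n.+1%:R^-1.

Lemma en_gt0 n : 0 < en n. Proof. by rewrite /en invr_gt0. Qed.

Lemma en_le1 n : en n <= 1.
Proof. by rewrite /en invf_le1 ?ler1n. Qed.

Lemma en_cvg : en n @[n --> \oo] --> (0 : R).
Proof. exact: cvg_harmonic. Qed.

Lemma mo_cvg1 u : ig lam u -> n1 lam (mo (en n) u \- u) @[n --> \oo] --> (0 : R).
Proof.
move=> ui; apply/cvgr0Pnorm_le => e e0.
have [del del0 H] := translate1 lamL ui e0.
near=> n; rewrite ger0_norm ?n1_ge0//; apply: mo_n1_diff; [exact: en_gt0|by []|].
move=> h hn; apply: H; apply: le_trans hn _.
near: n; have := cvgr_le 0 en_cvg del del0; exact.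
Unshelve. all: by end_near. Qed.

Lemma mo_cvg2 r u : L2P lam u -> vanish r u -> n2 lam (mo (en n) u \- u) @[n --> \oo] --> (0 : R).
Proof.
move=> Lu v; have ui := vanish_ig lamL Lu v; apply/cvgr0Pnorm_le => e e0.
have [del del0 H] := translate2 lamL Lu v e0.
near=> n; rewrite ger0_norm ?n2_ge0//; apply: mo_n2_diff; [exact: ltW|exact: en_gt0|by []|by []|].
move=> h hn; apply: H; apply: le_trans hn _.
near: n; have := cvgr_le 0 en_cvg del del0; exact.
Unshelve. all: by end_near. Qed.

End Mollifier.

Section Commutator.
Context {R : realType} {d : nat}.
Local Notation E := 'rV[R]_d.
Local Notation e_ i := (delta_mx 0 i : E).
Implicit Types (f g u v k : E -> R) (x y h : E) (i j : 'I_d) (r : R).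
Variable lam : {measure set E -> \bar R}.
Hypothesis lamL : is_lebesgue lam.

Lemma cvg_sum_fin (I : finType) (F : I -> nat -> R) (l : I -> R) :
  (forall a, F a n @[n --> \oo] --> l a) ->
  \sum_a F a n @[n --> \oo] --> \sum_a l a.
Proof.
move=> H; elim: (index_enum I) => [|a s IH].
  rewrite big_nil; under eq_fun do rewrite big_nil; exact: cvg_cst.
by rewrite big_cons; under eq_fun do rewrite big_cons; apply: cvgD.
Qed.

Definition H1c r k (Dk : 'I_d -> E -> R) :=
  [/\ L2P lam k, vanish r k, forall i, L2P lam (Dk i) /\ vanish r (Dk i) &
      forall i, weak_partial lam setT i k (Dk i)].

Lemma small_slope (a b K : R) (N0 : nat) :
  (forall N : nat, (N0 <= N)%N -> a <= b + K / N.+1%:R) -> a <= b.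
Proof.
move=> H; have h : b + K / n.+1%:R @[n --> \oo] --> b.
  rewrite -[X in _ --> X]addr0; apply: cvgD; first exact: cvg_cst.
  by rewrite -[X in _ --> X](mulr0 K); apply: cvgMr; exact: cvg_harmonic.
rewrite -(cvg_lim _ h)//; apply: limr_ge; first exact: cvgP h.
by exists N0 => // N; exact: H.
Qed.

Lemma weak_partialB i k k' g g' : L2P lam k -> L2P lam k' -> L2P lam g -> L2P lam g' ->
  weak_partial lam setT i k g -> weak_partial lam setT i k' g' ->
  weak_partial lam setT i (k \- k') (g \- g').
Proof.
move=> Lk Lk' Lg Lg' w w' phi tp.
have tp' := (test_setTP phi).1 tp.
have Lp := tst_L2 lamL tp'; have Ldp := tst_L2 lamL (tst_partial i tp').
under eq_Rintegral do rewrite mulrBl.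
under [in RHS]eq_Rintegral do rewrite mulrBl.
rewrite !RintegralB//; [|exact: L2_mul..].
by rewrite w// w'// opprB opprK addrC.
Qed.

Lemma H1cB r k k' Dk Dk' : H1c r k Dk -> H1c r k' Dk' ->
  H1c r (k \- k') (fun i => Dk i \- Dk' i).
Proof.
move=> [Lk vk Dk1 Dk2] [Lk' vk' Dk1' Dk2']; split.
- exact: L2B.
- by move=> x rx; rewrite /= vk// vk'// subr0.
- move=> i; have [a b] := Dk1 i; have [a' b'] := Dk1' i.
  split; first exact: L2B.
  by move=> x rx; rewrite /= b// b'// subr0.
- move=> i; have [a b] := Dk1 i; have [a' b'] := Dk1' i.
  exact: weak_partialB.
Qed.

Lemma H1cW r r' k Dk : r <= r' -> H1c r k Dk -> H1c r' k Dk.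
Proof.
move=> rr [Lk vk Dk1 Dk2]; split => //; first exact: vanishW vk.
by move=> i; have [a b] := Dk1 i; split => //; exact: vanishW b.
Qed.

Lemma tst_weak i f : smooth f -> weak_partial lam setT i f (partial i f).
Proof. by move=> sf phi /test_setTP tp; exact: int_by_parts. Qed.

Lemma dq_small i k t (C r : R) : tst k -> vanish r k -> 0 <= C ->
  (forall x, `|partial i (partial i k) x| <= C) -> `|t| <= 1 ->
  n2 lam (fun x => k (x + t *: e_ i) - k x) <= `|t| * n2 lam (partial i k) +
    t ^+ 2 * n2 lam (fun x => C * \1_[set y : E | `|y| <= r + 1] x).
Proof.
move=> tk vk C0 HC t1.
have Lp := tst_L2 lamL (tst_partial i tk).
have Lk := tst_L2 lamL tk.
have [Ls _] := translate_L2 lamL (t *: e_ i) Lk.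
pose q x := k (x + t *: e_ i) - k x - t * partial i k x.
have Lq : L2P lam q by apply: L2B; [exact: L2B|exact: L2Z].
pose b x : R := C * \1_[set y : E | `|y| <= r + 1] x.
have mb := @meas_ball R d (r + 1).
have Lb : L2P lam b.
  apply: (@bounded_vanish_L2 _ _ _ lamL (r + 1) _ C).
  - by apply: measurable_funM => //; exact: measurable_indic.
  - by move=> x; rewrite ger0_norm ?mulr_ge0// /b indicE; case: (_ \in _); rewrite ?mulr1 ?mulr0.
  - by move=> x rx; rewrite /b indicE memNset ?mulr0//= leNgt rx.
have b0 x : 0 <= b x by rewrite /b mulr_ge0// indicE; case: (_ \in _).
have tb x : 0 <= t ^+ 2 * b x by apply: mulr_ge0 => //; exact: sqr_ge0.
have hq : n2 lam q <= t ^+ 2 * n2 lam b.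
  rewrite -[X in X * _]ger0_norm ?sqr_ge0// -n2Z//.
  apply: n2_le; [by case: Lq| |exact: L2Z].
  move=> x; rewrite [leRHS]ger0_norm ?tb//; have [xr|xr] := leP `|x| (r + 1).
    rewrite /b indicE mem_set// mulr1 mulrC; apply: taylor_dir => //; by case: tk.
  have xr' : r < `|x| by apply: lt_trans xr; rewrite ltrDl.
  rewrite /q vk ?(vk x xr') ?(vanish_partial i vk xr').
    by rewrite mulr0 !subr0 normr0 tb.
  have := lerB_dist x (- (t *: e_ i)); rewrite opprK normrN normrZ => h.
  have e1 : `|e_ i : E| <= 1.
    by apply/norm_leP => // l; rewrite mxE eqxx/=; case: eqP; rewrite ?normr1 ?normr0.
  have : `|t| * `|e_ i : E| <= 1 by rewrite mulr_ile1.
  lra.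
rewrite (_ : (fun x => _) = (fun x => t * partial i k x) \+ q); last first.
  by apply/funext => x /=; rewrite /q; ring.
apply: le_trans (n2D (L2Z t Lp) Lq) _; rewrite n2Z//.
by rewrite lerD2l.
Qed.

Lemma dq_mul i k (t : R) (N : nat) : L2P lam k ->
  n2 lam (fun x => k (x + (N%:R * t) *: e_ i) - k x) <=
  N%:R * n2 lam (fun x => k (x + t *: e_ i) - k x).
Proof.
move=> Lk; elim: N => [|N IH].
  rewrite !mul0r scale0r le_eqVlt; apply/orP; left; apply/eqP.
  rewrite -[RHS](@n2_0 _ _ _ lam); apply: n2_eq => x; by rewrite addr0 subrr.
have Lt h := (translate_L2 lamL h Lk).1.
pose g x := k (x + t *: e_ i) - k x.
have Lg : L2P lam g by exact: L2B.
have [Lg' ng] := translate_L2 lamL ((N%:R * t) *: e_ i) Lg.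
rewrite (_ : (fun x => _) = (fun x => g (x + (N%:R * t) *: e_ i)) \+
    (fun x => k (x + (N%:R * t) *: e_ i) - k x)); last first.
  apply/funext => x; rewrite /g /= -natr1 mulrDl mul1r scalerDl addrA.
  by rewrite addrA subrK.
apply: le_trans (n2D Lg' (L2B (Lt _) Lk)) _.
by rewrite ng -natr1 mulrDl mul1r addrC lerD2r.
Qed.

(** The displacement is cut into N + 1 equal steps: the linear parts of the Taylor expansions add up
    to the right-hand side, and the quadratic remainders to a multiple of 1/(N + 1). This replaces
    the integral formula along the segment. *)
Lemma dq_dir i k t : tst k ->
  n2 lam (fun x => k (x + t *: e_ i) - k x) <= `|t| * n2 lam (partial i k).
Proof.
move=> tk; have [C C0 HC] := tst_bounded (tst_partial i (tst_partial i tk)).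
have [r vk] := tk.2; have Lk := tst_L2 lamL tk.
set b := n2 lam (partial i k).
pose K := n2 lam (fun x => C * \1_[set y : E | `|y| <= r + 1] x).
have [N0 HN0] : exists N0 : nat, `|t| <= N0%:R.
  by exists (Num.truncn `|t|).+1; rewrite ltW// truncnS_gt.
apply: (@small_slope _ _ (t ^+ 2 * K) N0) => N HN.
have Np : (0 : R) < N.+1%:R by [].
have tN : `|t / N.+1%:R| <= 1.
  rewrite normrM normfV [`|N.+1%:R|]ger0_norm// ler_pdivrMr// mul1r (le_trans HN0)//.
  by rewrite ler_nat ltnW.
have := dq_mul i (t / N.+1%:R) N.+1 Lk.
rewrite mulrC divfK ?gt_eqF// => H; apply: le_trans H _.
have := dq_small tk vk C0 HC tN.
rewrite -/b -/K => H; apply: (@le_trans _ _ (N.+1%:R * (`|t / N.+1%:R| * b + (t / N.+1%:R) ^+ 2 * K))).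
  by rewrite ler_pM2l.
rewrite normrM normfV [`|N.+1%:R|]ger0_norm// le_eqVlt; apply/orP; left; apply/eqP.
by move: Np; set c := _%:R => Np; field; rewrite gt_eqF.
Qed.

Lemma dq_tst k h : tst k ->
  n2 lam (fun x => k (x + h) - k x) <= `|h| * \sum_i n2 lam (partial i k).
Proof.
move=> tk; have Lk := tst_L2 lamL tk.
have Lt h' := (translate_L2 lamL h' Lk).1.
have H (s : seq 'I_d) : n2 lam (fun x => k (x + \sum_(i <- s) h 0 i *: e_ i) - k x) <=
    \sum_(i <- s) `|h 0 i| * n2 lam (partial i k).
  elim: s => [|i s IH].
    rewrite !big_nil le_eqVlt; apply/orP; left; apply/eqP.
    by rewrite -[RHS](@n2_0 _ _ _ lam); apply: n2_eq => x; rewrite addr0 subrr.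
  rewrite !big_cons; set w := \sum_(l <- s) _.
  pose g x := k (x + h 0 i *: e_ i) - k x.
  have Lg : L2P lam g by exact: L2B.
  have [Lg' ng] := translate_L2 lamL w Lg.
  rewrite (_ : (fun x => _) = (fun x => g (x + w)) \+ (fun x => k (x + w) - k x)); last first.
    by apply/funext => x /=; rewrite /g [_ + w]addrC [x + (_ + _)]addrA addrA subrK.
  apply: le_trans (n2D Lg' (L2B (Lt _) Lk)) _.
  by rewrite ng; apply: lerD => //; exact: dq_dir.
rewrite {1}(dir_decomp h); apply: le_trans (H _) _.
rewrite mulr_sumr; apply: ler_sum => i _.
by rewrite ler_wpM2r ?n2_ge0// norm_coord.
Qed.

Variable eta : E -> R.
Hypothesis etaM : mollifier lam eta.
Local Notation mo := (mo lam eta).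

Lemma H1c_mo r k Dk n : H1c r k Dk ->
  H1c (r + 1) (mo (en n : R) k) (fun i => mo (en n : R) (Dk i)).
Proof.
move=> [Lk vk Dk1 Dk2].
have ki := vanish_ig lamL Lk vk; have e0 := @en_gt0 R n.
have er : r + (en n : R) <= r + 1 by rewrite lerD2l en_le1.
split.
- exact: (mo_n2 lamL etaM e0 ki Lk).1.
- exact: vanishW er (mo_vanish etaM e0 vk).
- move=> i; have [a b] := Dk1 i; have ai := vanish_ig lamL a b.
  split; first exact: (mo_n2 lamL etaM e0 ai a).1.
  exact: vanishW er (mo_vanish etaM e0 b).
- move=> i; rewrite -(partial_mo_weak etaM e0 ki (Dk2 i)).
  by apply: tst_weak; exact: mo_smooth.
Qed.

(** Mollification does not increase the norms of the weak derivatives, so the bound for test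
    functions passes to the limit. *)
Lemma dq_H1c r k Dk h : H1c r k Dk ->
  n2 lam (fun x => k (x + h) - k x) <= `|h| * \sum_i n2 lam (Dk i).
Proof.
move=> Hk; have [Lk vk Dk1 Dk2] := Hk.
have ki := vanish_ig lamL Lk vk.
have Lt h' := (translate_L2 lamL h' Lk).1.
pose m n := mo (en n : R) k.
have Lm n : L2P lam (m n) by have [] := H1c_mo n Hk.
have tm n : tst (m n) by exact: (mo_tst etaM (@en_gt0 R n) ki vk).
have cm := mo_cvg2 lamL etaM Lk vk.
apply/ler_addgt0Pr => e e0.
have [n hn] := cvg_below (divr_gt0 e0 (ltr0Sn _ 1)) cm.
have h1 : n2 lam (fun x => m n (x + h) - m n x) <= `|h| * \sum_i n2 lam (Dk i).
  apply: le_trans (dq_tst h (tm n)) _; rewrite ler_wpM2l//; apply: ler_sum => i _.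
  rewrite (partial_mo_weak etaM (@en_gt0 R n) ki (Dk2 i)).
  have [a b] := Dk1 i; have ai := vanish_ig lamL a b.
  exact: (mo_n2 lamL etaM (@en_gt0 R n) ai a).2.
have Lmk : L2P lam (m n \- k) by exact: L2B.
have [Lmk' nmk] := translate_L2 lamL h Lmk.
have Lq : L2P lam (fun x => m n (x + h) - m n x).
  exact: (L2B (translate_L2 lamL h (Lm n)).1 (Lm n)).
rewrite (_ : (fun x => _) = (fun x => m n (x + h) - m n x) \-
   ((fun x => (m n \- k) (x + h)) \- (m n \- k))); last first.
  by apply/funext => x /=; ring.
apply: le_trans (n2B Lq (L2B Lmk' Lmk)) _; apply: lerD h1 _.
apply: le_trans (n2B Lmk' Lmk) _; rewrite nmk.
by move: hn; rewrite -/(m n) ltr_pdivlMr// => hn; lra.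
Qed.

(** The commutator d_j(k v_e) - d_j((k v)_e), where v_e is the mollification of [v]. The derivative
    of [k] is a separate argument because it is only a weak one. *)
Definition com (e : R) k (Dkj : E -> R) v j x :=
  mo e v x * Dkj x + k x * partial j (mo e v) x - partial j (mo e (fun y => k y * v y)) x.

(** Apart from the term with the derivative of [k], the commutator is the average, with weight d_j
    eta(z), of e^{-1} (k(x + e z) - k(x)) v(x + e z). The translation estimate for [k] absorbs the
    factor 1/e, so the bound is uniform in the scale. *)
Lemma com_bound j : exists2 C, 0 <= C & forall e r r' k Dk v, 0 < e ->
  H1c r k Dk -> L2P lam v -> vanish r' v ->
  ig lam (com e k (Dk j) v j) /\
  n1 lam (com e k (Dk j) v j) <= C * (\sum_i n2 lam (Dk i)) * n2 lam v.
Proof.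
have te : tst eta by case: etaM.
have tp := tst_partial j te.
have pi := tst_ig lamL tp.
(* The 1 accounts for the term with the derivative of [k], the other summand for the difference
   quotient. *)
exists (1 + n1 lam (partial j eta)); first by rewrite addr_ge0 ?n1_ge0.
move=> e r r' k Dk v e0 Hk Lv vv; have [Lk vk Dk1 Dk2] := Hk.
have vi := vanish_ig lamL Lv vv; have kvi := L2_mul Lk Lv.
set S := \sum_i _; have S0 : 0 <= S by apply: sumr_ge0 => i _; exact: n2_ge0.
have [Lmv nmv] := mo_n2 lamL etaM e0 vi Lv.
have mk : measurable_fun setT k by case: Lk.
have mv : measurable_fun setT v by case: Lv.
pose F x := k x * partial j (mo e v) x - partial j (mo e (fun y => k y * v y)) x.
have mF : measurable_fun setT F.
  apply: measurable_funB; last first.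
    by apply: smooth_meas; apply: smooth_partial; exact: mo_smooth.
  apply: measurable_funM => //.
  by apply: smooth_meas; apply: smooth_partial; exact: mo_smooth.
pose a x z := e^-1 * (k (x + e *: z) - k x) * v (x + e *: z).
have ma : measurable_fun setT (fun p : E * E => a p.1 p.2).
  apply: measurable_funM; last exact: meas_shift2.
  apply: measurable_funM => //; apply: measurable_funB; first exact: meas_shift2.
  exact: (measurableT_comp mk measurable_fst).
have FE x : F x = \int[lam]_z (partial j eta z * a x z).
  rewrite /F !(partial_mo lamL etaM)// mulrN opprK addrC mulrCA -mulrBr -[k x * _]RintegralZl//; last first.
    exact: (Av_ig lamL x e0 tp vi).
  rewrite -RintegralB//; [|exact: (Av_ig lamL x e0 tp kvi)|]; last first.
    by apply: igZ; exact: (Av_ig lamL x e0 tp vi).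
  rewrite -RintegralZl//; last first.
    apply: igB; first exact: (Av_ig lamL x e0 tp kvi).
    by apply: igZ; exact: (Av_ig lamL x e0 tp vi).
  by apply: eq_Rintegral => z _; rewrite /a; ring.
have [iF nF] : ig lam F /\ n1 lam F <= (S * n2 lam v) * n1 lam (partial j eta).
  apply: (average_n1 lamL _ pi ma mF); first by rewrite mulr_ge0 ?n2_ge0.
    move=> x; rewrite FE; apply: norm_Rint_lee; apply: measurable_funM; first exact: (ig_meas pi).
    by have := measurableT_comp ma (pair1_measurable x).
  move=> z z0; have z1 : `|z| <= 1.
    move: z0; apply: contra_neqT; rewrite -ltNge => /vanish_partial; apply.
    by case: etaM.
  have Lq : L2P lam (fun x => k (x + e *: z) - k x).
    exact: (L2B (translate_L2 lamL _ Lk).1 Lk).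
  have [Lvt nvt] := translate_L2 lamL (e *: z) Lv.
  rewrite -n1_E; last by apply: L2_mul => //; exact: L2Z.
  rewrite lee_fin; apply: le_trans (n1M_n2 (L2Z _ Lq) Lvt) _.
  rewrite nvt ler_wpM2r ?n2_ge0// n2Z// ger0_norm ?invr_ge0 ?(ltW e0)//.
  apply: (@le_trans _ _ (e^-1 * (e * S))); last by rewrite mulKf// gt_eqF.
  rewrite ler_pM2l ?invr_gt0//; apply: le_trans (dq_H1c _ Hk) _.
  rewrite normrZ gtr0_norm// ler_wpM2r// -[leRHS]mulr1.
  by rewrite ler_pM2l.
have iD : ig lam (fun x => mo e v x * Dk j x) by apply: L2_mul => //; case: (Dk1 j).
have cE : com e k (Dk j) v j = (fun x => mo e v x * Dk j x) \+ F.
  by apply/funext => x; rewrite /com/= /F addrA.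
rewrite cE; split; first exact: igD.
apply: le_trans (n1D iD iF) _.
rewrite -mulrA mulrDl mul1r [n1 lam (partial j eta) * _]mulrC; apply: lerD nF.
apply: le_trans (n1M_n2 Lmv (Dk1 j).1) _; rewrite mulrC; apply: ler_pM => //; try exact: n2_ge0.
rewrite /S (bigD1 j)//= lerDl; apply: sumr_ge0 => l _; exact: n2_ge0.
Qed.

(** For smooth data each of the three terms converges, and the limits cancel by the product rule. *)
Lemma com_tst k v j : tst k -> tst v ->
  n1 lam (com (en n : R) k (partial j k) v j) @[n --> \oo] --> (0 : R).
Proof.
move=> tk tv; have [sk [r vk]] := tk; have [sv [r' vv]] := tv.
have tkv : tst (fun x => k x * v x) by exact: tstMr.
have vi := tst_ig lamL tv; have kvi := tst_ig lamL tkv.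
have dvi := tst_ig lamL (tst_partial j tv).
have dkvi := tst_ig lamL (tst_partial j tkv).
have [C1 C10 H1] := tst_bounded (tst_partial j tk).
have [C2 C20 H2] := tst_bounded tk.
have c1 := mo_cvg1 lamL etaM vi.
have c2 := mo_cvg1 lamL etaM dvi.
have c3 := mo_cvg1 lamL etaM dkvi.
pose b n := C1 * n1 lam (mo (en n : R) v \- v)
  + C2 * n1 lam (mo (en n : R) (partial j v) \- partial j v)
  + n1 lam (mo (en n : R) (partial j (fun x => k x * v x)) \- partial j (fun x => k x * v x)).
have cb : b n @[n --> \oo] --> (0 : R).
  rewrite -[X in _ --> X](_ : C1 * 0 + C2 * 0 + 0 = 0 :> R); last by rewrite !mulr0 !addr0.
  by apply: cvgD c3; apply: cvgD; [exact: cvgMr c1|exact: cvgMr c2].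
apply: (@squeeze_cvgr _ _ _ _ (fun=> 0) b) => //; last exact: cvg_cst.
near=> n; rewrite n1_ge0/=; have e0 := @en_gt0 R n.
have i1 := igB (mo_n1 lamL etaM e0 vi).1 vi.
have i2 := igB (mo_n1 lamL etaM e0 dvi).1 dvi.
have i3 := igB (mo_n1 lamL etaM e0 dkvi).1 dkvi.
have mp1 := tst_meas (tst_partial j tk); have mk := tst_meas tk.
have j1 := ig_mulb mp1 H1 i1; have j2 := ig_mulb mk H2 i2.
have -> : com (en n : R) k (partial j k) v j =
  ((fun x => partial j k x * (mo (en n : R) v \- v) x)
  \+ (fun x => k x * (mo (en n : R) (partial j v) \- partial j v) x))
  \- (mo (en n : R) (partial j (fun x => k x * v x)) \- partial j (fun x => k x * v x)).
  apply/funext => x; rewrite /com.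
  rewrite (partial_mo_weak etaM e0 vi (tst_weak j sv)).
  rewrite (partial_mo_weak etaM e0 kvi (tst_weak j tkv.1)) /=.
  rewrite [partial j (fun x0 => k x0 * v x0) x]partialM//; last 2 first.
  - exact: smooth_derivable sk.
  - exact: smooth_derivable sv.
  set a := mo _ _ x; set b' := mo _ _ x; set c := mo _ _ x.
  by move: (k x) (v x) (partial j k x) (partial j v x) a b' c; clear; move=> *; ring.
apply: le_trans (n1B (igD j1 j2) i3) _; rewrite /b lerD2r.
apply: le_trans (n1D j1 j2) _; apply: lerD; exact: n1_mulb.
Unshelve. all: by end_near. Qed.

Lemma com_subk e k k' Dk Dk' v j x : 0 < e -> L2P lam k -> L2P lam k' -> L2P lam v ->
  com e (k \- k') (Dk \- Dk') v j x = com e k Dk v j x - com e k' Dk' v j x.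
Proof.
move=> e0 Lk Lk' Lv; rewrite /com /=.
have -> : mo e (fun y => (k y - k' y) * v y) = mo e (fun y => k y * v y) \- mo e (fun y => k' y * v y).
  apply/funext => y /=; rewrite -(moB etaM)//; [|exact: L2_mul..].
  by congr (cv _ _ _ _); apply/funext => z /=; rewrite mulrBl.
rewrite partialB.
- set a := partial _ _ x; set b := partial _ _ x; set c := partial _ _ x; set f := mo _ _ x.
  by move: (k x) (k' x) (Dk x) (Dk' x) a b c f; clear; move=> *; ring.
- by apply: smooth_derivable; apply: mo_smooth => //; exact: L2_mul.
- by apply: smooth_derivable; apply: mo_smooth => //; exact: L2_mul.
Qed.

Lemma com_subv e k Dk v v' j x : 0 < e -> L2P lam k -> L2P lam v -> L2P lam v' ->
  ig lam v -> ig lam v' ->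
  com e k Dk (v \- v') j x = com e k Dk v j x - com e k Dk v' j x.
Proof.
move=> e0 Lk Lv Lv' vi vi'; rewrite /com /=.
have -> : mo e (fun y => k y * (v y - v' y)) = mo e (fun y => k y * v y) \- mo e (fun y => k y * v' y).
  apply/funext => y /=; rewrite -(moB etaM)//; [|exact: L2_mul..].
  by congr (cv _ _ _ _); apply/funext => z /=; rewrite mulrBr.
have -> : mo e (v \- v') = mo e v \- mo e v' by apply/funext => y /=; exact: moB.
rewrite !partialB /=.
- set a := partial _ _ x; set b := partial _ _ x; set c := partial _ _ x; set l := partial _ _ x.
  set f := mo _ _ x; set f' := mo _ _ x.
  by move: (k x) (Dk x) a b c l f f'; clear; move=> *; ring.
all: by apply: smooth_derivable; apply: mo_smooth => //; exact: L2_mul.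
Qed.

(** The commutator is bilinear in [k] and [v] and bounded uniformly in the scale, so smooth data
    suffice: [v] is replaced by a test function and [k] by one of its own mollifications. *)
Theorem com_cvg r r' k Dk v j : H1c r k Dk -> L2P lam v -> vanish r' v ->
  n1 lam (com (en n : R) k (Dk j) v j) @[n --> \oo] --> (0 : R).
Proof.
move=> Hk Lv vv; have [C C0 HC] := com_bound j.
have [Lk vk Dk1 Dk2] := Hk.
have vi := vanish_ig lamL Lv vv.
apply/cvgr0Pnorm_le => e e0; have e3 : 0 < e / 3 by rewrite divr_gt0.
have e33 : e / 3 + (e / 3 + e / 3) = e by lra.
pose S := \sum_i n2 lam (Dk i).
have S0 : 0 <= S by apply: sumr_ge0 => i _; exact: n2_ge0.
have CS1 : 0 < C * S + 1 by rewrite ltr_wpDl// mulr_ge0.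
have [v' tv' hv'] := tst_dense2 lamL (divr_gt0 e3 CS1) Lv vv.
have {}tv' := tstin_tst tv'; have [sv' [r'' vv']] := tv'.
have Lv' := tst_L2 lamL tv'; have vi' := tst_ig lamL tv'.
pose m n := mo (en n : R) k; pose Dm n i := mo (en n : R) (Dk i).
have Hm n : H1c (r + 1) (m n) (Dm n) by exact: H1c_mo.
have Hk1 : H1c (r + 1) k Dk by apply: H1cW Hk; rewrite lerDl.
have cS : \sum_i n2 lam (Dm n i \- Dk i) @[n --> \oo] --> (0 : R).
  rewrite -[X in _ --> X](_ : \sum_(i < d) (0 : R) = 0); last by rewrite big1.
  apply: cvg_sum_fin => i; have [a b] := Dk1 i; exact: (mo_cvg2 lamL etaM a b).
have CV1 : 0 < C * n2 lam v' + 1 by rewrite ltr_wpDl// mulr_ge0// n2_ge0.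
have [N hN] := cvg_below (divr_gt0 e3 CV1) cS.
have [Lm vm Dm1 Dm2] := Hm N.
have tm : tst (m N).
  by apply: (@mo_tst _ _ _ _ etaM _ _ r) => //; [exact: en_gt0|exact: vanish_ig vk].
have c0 := com_tst j tm tv'.
near=> n; rewrite ger0_norm ?n1_ge0//.
have en0 := @en_gt0 R n.
have vvv : vanish (Num.max r' r'') (v \- v').
  move=> x; rewrite gt_max => /andP[h1 h2]; by rewrite /= vv// vv'// subr0.
have [i1 b1] := HC (en n : R) _ _ _ _ _ en0 Hk (L2B Lv Lv') vvv.
have HD := H1cB Hk1 (Hm N).
have [i2 b2] := HC (en n : R) _ _ _ _ _ en0 HD Lv' vv'.
have dmE : partial j (m N) = Dm N j.
  by apply: (partial_mo_weak etaM) => //; [exact: en_gt0|exact: vanish_ig vk].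
have [i3 _] := HC (en n : R) _ _ _ _ _ en0 (Hm N) Lv' vv'.
have -> : com (en n : R) k (Dk j) v j = com (en n : R) k (Dk j) (v \- v') j
   \+ (com (en n : R) (k \- m N) (Dk j \- Dm N j) v' j \+ com (en n : R) (m N) (Dm N j) v' j).
  by apply/funext => x /=; rewrite com_subv// com_subk// subrK subrK.
apply: le_trans (n1D i1 (igD i2 i3)) _.
rewrite -[leRHS]e33.
apply: lerD; last first.
  apply: le_trans (n1D i2 i3) _; apply: lerD.
    apply: le_trans b2 _.
    have hN' : \sum_i n2 lam (Dk i \- Dm N i) < (e / 3) / (C * n2 lam v' + 1).
      by apply: le_lt_trans hN; apply: ler_sum => i _; rewrite n2C.
    rewrite mulrAC; apply: (@le_trans _ _ ((C * n2 lam v' + 1) * ((e / 3) / (C * n2 lam v' + 1)))).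
      apply: ler_pM; rewrite ?mulr_ge0 ?n2_ge0 ?lerDl//; last exact: ltW.
      by apply: sumr_ge0 => i _; exact: n2_ge0.
    by rewrite mulrC divfK// gt_eqF.
  rewrite -dmE; near: n; have := cvgr_le 0 c0 _ e3; exact.
apply: le_trans b1 _.
apply: (@le_trans _ _ ((C * S + 1) * ((e / 3) / (C * S + 1)))).
  by apply: ler_pM; rewrite ?mulr_ge0 ?n2_ge0 ?lerDl//; exact: ltW.
by rewrite mulrC divfK// gt_eqF.
Unshelve. all: by end_near. Qed.

End Commutator.

Section Convergence.
Context dd (T : measurableType dd) {R : realType} (mu : {measure set T -> \bar R}).
Implicit Types (F G H : nat -> T -> R) (f g h : T -> R).

Definition c1 F f := [/\ forall n, ig mu (F n), ig mu f &
  n1 mu (F n \- f) @[n --> \oo] --> (0 : R)].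
Definition c2 F f := [/\ forall n, L2P mu (F n), L2P mu f &
  n2 mu (F n \- f) @[n --> \oo] --> (0 : R)].

Lemma c2_mul F G f g : c2 F f -> c2 G g -> c1 (fun n x => F n x * G n x) (fun x => f x * g x).
Proof.
move=> [LF Lf cF] [LG Lg cG]; split; [by move=> n; exact: L2_mul|exact: L2_mul|].
exact: n1_mul_cvg.
Qed.

Lemma c1_int F f : c1 F f -> \int[mu]_x F n x @[n --> \oo] --> \int[mu]_x f x.
Proof. by move=> [iF fi cF]; exact: Rint_n1_cvg. Qed.

Lemma c1_cst f : ig mu f -> c1 (fun=> f) f.
Proof.
move=> fi; split => //; rewrite (_ : n1 mu _ = 0); first exact: cvg_cst.
by rewrite /n1; under eq_Rintegral do rewrite /= subrr normr0; rewrite Rintegral_cst// mul0r.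
Qed.

Lemma c2_cst f : L2P mu f -> c2 (fun=> f) f.
Proof.
move=> fi; split => //; rewrite (_ : n2 mu _ = 0); first exact: cvg_cst.
by rewrite -[RHS](@n2_0 _ _ _ mu); apply: n2_eq => x /=; rewrite subrr.
Qed.

Lemma c1D F G f g : c1 F f -> c1 G g -> c1 (fun n => F n \+ G n) (f \+ g).
Proof.
move=> [iF fi cF] [iG gi cG]; split; [by move=> n; exact: igD|exact: igD|].
apply: (@squeeze_cvgr _ _ _ _ (fun=> 0) (fun n => n1 mu (F n \- f) + n1 mu (G n \- g))).
- apply: nearW => n; rewrite n1_ge0/=.
  rewrite (_ : _ \- _ = (F n \- f) \+ (G n \- g)).
    by apply: n1D; exact: igB.
  by apply/funext => x /=; rewrite opprD addrACA.
- exact: cvg_cst.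
- by rewrite -[X in _ --> X](addr0 0); exact: cvgD.
Qed.

Lemma c1Z (c : R) F f : c1 F f -> c1 (fun n x => c * F n x) (fun x => c * f x).
Proof.
move=> [iF fi cF]; split; [by move=> n; exact: igZ|exact: igZ|].
have e n : n1 mu ((fun x => c * F n x) \- (fun x => c * f x)) = `|c| * n1 mu (F n \- f).
  rewrite -n1Z; last exact: igB.
  by congr n1; apply/funext => x /=; rewrite mulrBr.
rewrite (_ : (fun n => _) = (fun n => `|c| * n1 mu (F n \- f))); last exact/funext.
by rewrite -[X in _ --> X](mulr0 `|c|); exact: cvgMr.
Qed.

Lemma c1_sum (I : finType) (F : I -> nat -> T -> R) (f : I -> T -> R) :
  (forall a, c1 (F a) (f a)) ->
  c1 (fun n x => \sum_a F a n x) (fun x => \sum_a f a x).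
Proof.
move=> H; elim: (index_enum I) => [|a s IH].
  rewrite (_ : (fun=> _) = (fun=> fun=> 0)) ?[X in c1 _ X](_ : _ = (fun=> 0)).
  - exact: c1_cst (ig0 _).
  - by apply/funext => x; rewrite big_nil.
  - by apply/funext => n; apply/funext => x; rewrite big_nil.
rewrite (_ : (fun=> _) = (fun n => F a n \+ (fun x => \sum_(a0 <- s) F a0 n x))).
  rewrite [X in c1 _ X](_ : _ = f a \+ (fun x => \sum_(a0 <- s) f a0 x)).
    exact: c1D.
  by apply/funext => x; rewrite big_cons.
by apply/funext => n; apply/funext => x; rewrite big_cons.
Qed.

Lemma c2_mulb (h : T -> R) (C : R) F f : measurable_fun setT h -> (forall x, `|h x| <= C) ->
  c2 F f -> c2 (fun n x => h x * F n x) (fun x => h x * f x).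
Proof.
move=> mh hC [LF Lf cF]; split; [by move=> n; exact: L2_mulb hC _|exact: L2_mulb hC _|].
apply: (@squeeze_cvgr _ _ _ _ (fun=> 0) (fun n => `|C| * n2 mu (F n \- f))).
- apply: nearW => n; rewrite n2_ge0/=.
  rewrite (_ : _ \- _ = (fun x => h x * (F n \- f) x)).
    apply: n2_mulb => //; last exact: L2B.
    by move=> x; apply: le_trans (hC x) (ler_norm _).
  by apply/funext => x /=; rewrite mulrBr.
- exact: cvg_cst.
- by rewrite -[X in _ --> X](mulr0 `|C|); exact: cvgMr.
Qed.

Lemma lip_meas (th : R -> R) (C : R) : (forall s t, `|th s - th t| <= C * `|s - t|) ->
  measurable_fun setT th.
Proof.
move=> H; apply: continuous_measurable_fun => s; apply/cvgrPdist_le => e e0.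
have C1 : 0 < `|C| + 1 by rewrite ltr_wpDl.
near=> t; apply: le_trans (H s t) _.
have h : `|s - t| <= e / (`|C| + 1).
  by near: t; apply: cvgr_dist_le => //; rewrite divr_gt0.
apply: (@le_trans _ _ ((`|C| + 1) * (e / (`|C| + 1)))); last first.
  by rewrite mulrC divfK// gt_eqF.
apply: (@le_trans _ _ (`|C| * `|s - t|)); first by rewrite ler_wpM2r// ler_norm.
by apply: ler_pM => //; rewrite lerDl.
Unshelve. all: by end_near. Qed.

Lemma c2_lip (th : R -> R) (C : R) F f : th 0 = 0 ->
  (forall s t, `|th s - th t| <= C * `|s - t|) ->
  c2 F f -> c2 (fun n x => th (F n x)) (fun x => th (f x)).
Proof.
move=> th0 lip [LF Lf cF]; have mth := lip_meas lip.
have lip' s t : `|th s - th t| <= `| `|C| * (s - t)|.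
  by rewrite normrM normr_id; apply: le_trans (lip s t) _; rewrite ler_wpM2r// ler_norm.
have Lth g : L2P mu g -> L2P mu (fun x => th (g x)).
  move=> Lg; apply: (@L2_le _ _ _ _ _ (fun x => `|C| * g x)); last exact: L2Z.
    by case: Lg => mg _; exact: (measurableT_comp mth mg).
  by move=> x; rewrite -[th _]subr0 -th0 -[X in _ * X]subr0; exact: lip'.
split; [by move=> n; exact: Lth|exact: Lth|].
apply: (@squeeze_cvgr _ _ _ _ (fun=> 0) (fun n => `|C| * n2 mu (F n \- f))).
- apply: nearW => n; rewrite n2_ge0/= -[X in X * _]normr_id -n2Z; last exact: L2B.
  apply: n2_le; last by apply: L2Z; exact: L2B.
    by case: (L2B (Lth _ (LF n)) (Lth _ Lf)).
  by move=> x /=; exact: lip'.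
- exact: cvg_cst.
- by rewrite -[X in _ --> X](mulr0 `|C|); exact: cvgMr.
Qed.

End Convergence.

(** * The truncated resolvent equation *)

Section Bounded.
Context {R : realType} {d : nat}.
Local Notation E := 'rV[R]_d.
Variable lam : {measure set E -> \bar R}.
Implicit Types (F G H : nat -> E -> R) (f g h : E -> R).

(* The limit factor is truncated, so that it lies in L^2 as well as in L^1. *)
Lemma c1_c2_mulb F H f h (C : R) : c1 lam F f -> c2 lam H h ->
  (forall n x, `|H n x| <= C) -> (forall x, `|h x| <= C) ->
  c1 lam (fun n x => F n x * H n x) (fun x => f x * h x).
Proof.
move=> [iF fi cF] [LH Lh cH] HC hC.
have C0 : 0 <= C by apply: le_trans (hC 0).
have mH n : measurable_fun setT (H n) by case: (LH n).
have mh : measurable_fun setT h by case: Lh.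
have FHi n : ig lam (fun x => F n x * H n x).
  by under eq_fun do rewrite mulrC; exact: ig_mulb (HC n) (iF n).
have fhi : ig lam (fun x => f x * h x).
  by under eq_fun do rewrite mulrC; exact: ig_mulb hC fi.
split => //; apply/cvgr0Pnorm_le => e e0.
have e3 : 0 < e / 3 by rewrite divr_gt0.
have e33 : e / 3 + (e / 3 + e / 3) = e by lra.
have D0 : 0 < C + C + 1 by rewrite ltr_wpDl// addr_ge0.
have [N hN] := cvg_below (divr_gt0 e3 D0) (n1_clamp fi).
pose fc x := clamp N%:R (f x).
have mfc : measurable_fun setT fc by apply: clamp_meas; exact: ig_meas fi.
have fci : ig lam fc.
  by apply: ig_le fi => // x; apply: clamp_norm.
have Lfc : L2P lam fc.
  split => //; apply: (ig_le _ _ (igZ N%:R fi)); first exact: measurable_funX.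
  move=> x; rewrite expr2 !normrM; apply: ler_pM => //; last exact: clamp_norm.
  by rewrite [leRHS]ger0_norm//; exact: clamp_le.
have N0 : 0 < n2 lam fc + 1 by rewrite ltr_wpDl// n2_ge0.
near=> n; rewrite ger0_norm ?n1_ge0//.
have i1 : ig lam (fun x => H n x * (F n \- f) x) by exact: ig_mulb (HC n) (igB (iF n) fi).
have i2 : ig lam (fun x => (H n \- h) x * (f \- fc) x).
  apply: (@ig_mulb _ _ _ _ _ _ (C + C)); last exact: igB.
    exact: measurable_funB.
  by move=> x /=; apply: le_trans (ler_normB _ _) (lerD (HC n x) (hC x)).
have i3 : ig lam (fun x => fc x * (H n \- h) x) by apply: L2_mul => //; exact: L2B.
have -> : (fun x => F n x * H n x) \- (fun x => f x * h x) =
  (fun x => H n x * (F n \- f) x) \+ ((fun x => (H n \- h) x * (f \- fc) x)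
     \+ (fun x => fc x * (H n \- h) x)).
  by apply/funext => x /=; move: (F n x) (H n x) (f x) (h x) (fc x); clear; move=> *; ring.
apply: le_trans (n1D i1 (igD i2 i3)) _; rewrite -[leRHS]e33; apply: lerD.
  apply: (@le_trans _ _ (C * n1 lam (F n \- f))); first exact: n1_mulb (HC n) (igB (iF n) fi).
  apply: (@le_trans _ _ ((C + C + 1) * (e / 3 / (C + C + 1)))).
    apply: ler_pM => //; first exact: n1_ge0.
      by rewrite -addrA lerDl addr_ge0.
    near: n; have := cvgr_le 0 cF _ (divr_gt0 e3 D0); exact.
  by rewrite mulrC divfK// gt_eqF.
apply: le_trans (n1D i2 i3) _; apply: lerD.
  apply: (@le_trans _ _ ((C + C) * n1 lam (f \- fc))).
    apply: n1_mulb; [exact: measurable_funB| |exact: igB].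
    by move=> x /=; apply: le_trans (ler_normB _ _) (lerD (HC n x) (hC x)).
  apply: (@le_trans _ _ ((C + C + 1) * (e / 3 / (C + C + 1)))).
    apply: ler_pM => //; [exact: addr_ge0|exact: n1_ge0|by rewrite lerDl|].
    by rewrite n1C; exact: ltW.
  by rewrite mulrC divfK// gt_eqF.
apply: le_trans (n1M_n2 Lfc (L2B (LH n) Lh)) _.
apply: (@le_trans _ _ ((n2 lam fc + 1) * (e / 3 / (n2 lam fc + 1)))).
  apply: ler_pM; [exact: n2_ge0|exact: n2_ge0|by rewrite lerDl|].
  near: n; have := cvgr_le 0 cH _ (divr_gt0 e3 N0); exact.
by rewrite mulrC divfK// gt_eqF.
Unshelve. all: by end_near. Qed.

End Bounded.

Section TruncLip.
Context {R : realType}.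
Implicit Types (m s t : R).

Lemma flat_lip (p : {poly R}) (c : R) : exists C, forall s t,
  `|flat p (c * s) - flat p (c * t)| <= C * `|s - t|.
Proof.
have [C C0 HC] := flat_bound ('X^2 * (p - p^`())); exists (C * `|c|) => s t.
apply: le_trans (rsm_bounded_derive (is_derive_flat p) HC _ _) _.
by rewrite -mulrBr normrM mulrA.
Qed.

Lemma lip_pm (a : R) (F G : R -> R) :
  (exists C, forall s t, `|F s - F t| <= C * `|s - t|) ->
  (exists C, forall s t, `|G s - G t| <= C * `|s - t|) ->
  exists C, forall s t, `|(F s + a * G s) - (F t + a * G t)| <= C * `|s - t|.
Proof.
move=> [C HC] [D HD]; exists (C + `|a| * D) => s t.
have -> : F s + a * G s - (F t + a * G t) = (F s - F t) + a * (G s - G t) by ring.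
rewrite mulrDl; apply: le_trans (ler_normD _ _) _; apply: lerD => //.
by rewrite normrM -mulrA ler_wpM2l.
Qed.

Lemma trunc'_lip m : exists C, forall s t, `|trunc' m s - trunc' m t| <= C * `|s - t|.
Proof.
have [C HC] := lip_pm 1 (flat_lip (1 + 'X) m) (flat_lip (1 + 'X) (- m)).
by exists C => s t; have := HC s t; rewrite !mul1r.
Qed.

Lemma strunc_lip m : exists C, forall s t, `|strunc m s - strunc m t| <= C * `|s - t|.
Proof.
have [C HC] := lip_pm (-1) (flat_lip (1 + 'X) m) (flat_lip (1 + 'X) (- m)).
by exists C => s t; have := HC s t; rewrite !mulN1r.
Qed.

Lemma lipZ (a : R) (F : R -> R) :
  (exists C, forall s t, `|F s - F t| <= C * `|s - t|) ->
  exists C, forall s t, `|a * F s - a * F t| <= C * `|s - t|.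
Proof.
move=> [C HC]; exists (`|a| * C) => s t.
by rewrite -mulrBr normrM -mulrA ler_wpM2l.
Qed.

Lemma trunc''_lip m : exists C, forall s t, `|trunc'' m s - trunc'' m t| <= C * `|s - t|.
Proof.
apply: lipZ; have [C HC] := lip_pm (-1) (flat_lip 'X^3 m) (flat_lip 'X^3 (- m)).
by exists C => s t; have := HC s t; rewrite !mulN1r.
Qed.

Lemma strunc'_lip m : exists C, forall s t, `|strunc' m s - strunc' m t| <= C * `|s - t|.
Proof.
apply: lipZ; have [C HC] := lip_pm 1 (flat_lip 'X^3 m) (flat_lip 'X^3 (- m)).
by exists C => s t; have := HC s t; rewrite !mul1r.
Qed.

Lemma trunc_lip m s t : `|trunc m s - trunc m t| <= 1 * `|s - t|.
Proof.
apply: (rsm_bounded_derive (trunc_derive m)) => y.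
by have /andP[a b] := trunc'_bnd m y; rewrite ger0_norm.
Qed.

Lemma trunc''0 m : trunc'' m 0 = 0.
Proof. by rewrite /trunc'' !mulr0 subrr mulr0. Qed.

Lemma strunc'0 m : strunc' m 0 = 0.
Proof. by rewrite /strunc' !mulr0 !flat_neg ?addr0 ?mulr0. Qed.

Lemma norm_trunc'_le1 m s : `|trunc' m s| <= 1.
Proof. by have /andP[a b] := trunc'_bnd m s; rewrite ger0_norm. Qed.

Lemma norm_strunc_le1 m s : `|strunc m s| <= 1.
Proof. by rewrite norm_strunc; have /andP[] := trunc'_bnd m s. Qed.

End TruncLip.

Lemma half_alg (R : realType) (a1 a2 a3 a4 : R) : 2^-1 * a1 + 2^-1 * a2 = - a3 ->
  2^-1 * a1 - a4 = - (a3 + (a4 + 2^-1 * a2)).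
Proof. lra. Qed.

Lemma residual_alg (R : realType) (a b c e w u v : R) : a <= b + (c - e) -> u <= e ->
  a + (u - v) <= c - w + (b + (w - v)).
Proof. lra. Qed.

Section LocalEstimate.
Context {R : realType} {d : nat}.
Local Notation E := 'rV[R]_d.
Implicit Types (i j : 'I_d) (x : E).
Variable lam : {measure set E -> \bar R}.
Hypothesis lamL : is_lebesgue lam.
(** In the application [K] is rho A and [b] is rho B, both set to zero outside the cube; [w] is a
    bounded function of the local domain extended by zero, [Dw] its gradient, and [wn] the sequence
    of test functions that places [w] in the form domain. *)
Variables (r : R) (K : 'I_d -> 'I_d -> E -> R) (MK : R) (b : 'I_d -> E -> R).
Hypotheses (mK : forall i j, measurable_fun setT (K i j))
  (bK : forall i j x, `|K i j x| <= MK)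
  (K0 : forall x (v : 'I_d -> R), 0 <= \sum_i \sum_j K i j x * v j * v i)
  (Lb : forall i, L2P lam (b i)).
Variables (w f0 : E -> R) (Dw : 'I_d -> E -> R) (wn : nat -> E -> R).
Hypotheses (Lf0 : L2P lam f0) (twn : forall n, tstin r (wn n))
  (cw : c2 lam wn w) (cDw : forall i, c2 lam (fun n => partial i (wn n)) (Dw i)).
Hypotheses (eqw : forall v, tstin r v ->
    2^-1 * \int[lam]_x (\sum_i \sum_j K i j x * Dw j x * partial i v x) =
    - \int[lam]_x (f0 x * v x))
  (eqb : forall v, tstin r v -> \int[lam]_x (\sum_i b i x * partial i v x) = 0).

(** [f0] is rho times the image of [w] under the symmetric generator, so [g] is rho times its image
    under the full local operator; [q] is the energy density without the factor 1/2 of the form. *)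
Let g x := f0 x + \sum_i b i x * Dw i x.
Let q x := \sum_i \sum_j K i j x * Dw j x * Dw i x.

Let LDw i : L2P lam (Dw i). Proof. by case: (cDw i). Qed.
Let Lw : L2P lam w. Proof. by case: cw. Qed.
Let mw : measurable_fun setT w. Proof. by case: Lw. Qed.

Let LKD i j : L2P lam (fun x => K i j x * Dw j x).
Proof. exact: L2_mulb (bK i j) (LDw j). Qed.

Lemma energy_ig : ig lam q.
Proof. by apply: ig_sum => i; apply: ig_sum => j; exact: L2_mul. Qed.

Lemma drift_ig : ig lam (fun x => \sum_i b i x * Dw i x).
Proof. by apply: ig_sum => i; exact: L2_mul. Qed.

Let cq : c1 lam (fun n x => \sum_i \sum_j K i j x * Dw j x * partial i (wn n) x) q.
Proof.
apply: c1_sum => i; apply: c1_sum => j; apply: c2_mul => //.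
exact: c2_cst.
Qed.

Let cb : c1 lam (fun n x => \sum_i b i x * partial i (wn n) x) (fun x => \sum_i b i x * Dw i x).
Proof. by apply: c1_sum => i; apply: c2_mul => //; exact: c2_cst. Qed.

Let vanish_comp (th : R -> R) s (u : E -> R) : th 0 = 0 -> vanish s u -> vanish s (th \o u).
Proof. by move=> th0 vu x xs; rewrite /= vu. Qed.

Let tstin_comp (th : R -> R) (u : E -> R) : rsm th -> th 0 = 0 -> tstin r u -> tstin r (th \o u).
Proof.
move=> rt t0 [su [s sr vu]]; split; first exact: smooth_comp.
by exists s => //; exact: vanish_comp.
Qed.

Let cvg_same (F : nat -> R) (l l' : R) : F n @[n --> \oo] --> l -> F n @[n --> \oo] --> l' -> l = l'.
Proof. by move=> h h'; rewrite -(cvg_lim _ h)// -(cvg_lim _ h'). Qed.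

Let cvg_half (F : nat -> R) (l : R) : F n @[n --> \oo] --> l ->
  2^-1 * F n @[n --> \oo] --> 2^-1 * l.
Proof. by move=> h; exact: cvgMr. Qed.

(** The test function is the regularised sign strunc(w). The drift then appears as the pairing of
    [b] with the gradient of ptrunc(w), which is 0 by [eqb]. Both tests are made with [wn], whose
    compositions are admissible, before passing to the limit. *)
Lemma energy_identity m : 2^-1 * \int[lam]_x (q x * strunc' m (w x)) =
  - \int[lam]_x (g x * strunc m (w x)).
Proof.
have [C1 lip1] := strunc_lip m; have [C2 lip2] := strunc'_lip m.
have [D D0 bD] := bounded_strunc' m.
have cs := c2_lip (strunc0 m) lip1 cw; have cs' := c2_lip (strunc'0 m) lip2 cw.
have dn i n x : partial i (strunc m \o wn n) x = strunc' m (wn n x) * partial i (wn n) x.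
  by apply: partial_comp => //; [exact: strunc_derive|case: (twn n)].
have dp i n x : partial i (ptrunc m \o wn n) x = strunc m (wn n x) * partial i (wn n) x.
  by apply: partial_comp => //; [exact: ptrunc_derive|case: (twn n)].
have h1 := cvg_half (c1_int (c1_c2_mulb cq cs' (C := D) (fun n x => bD _) (fun x => bD _))).
have h2 := cvgN (c1_int (c2_mul (c2_cst Lf0) cs)).
have h3 := c1_int (c1_c2_mulb cb cs (C := 1) (fun n x => norm_strunc_le1 m _) (fun x => norm_strunc_le1 m _)).
have e1 n : 2^-1 * \int[lam]_x ((\sum_i \sum_j K i j x * Dw j x * partial i (wn n) x) *
     strunc' m (wn n x)) = - \int[lam]_x (f0 x * strunc m (wn n x)).
  rewrite -(eqw (tstin_comp (rsm_strunc m) (strunc0 m) (twn n))); congr (_ * _).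
  apply: eq_Rintegral => x _; rewrite mulr_suml; apply: eq_bigr => i _.
  rewrite mulr_suml; apply: eq_bigr => j _; rewrite dn.
  by move: (strunc' _ _) (partial i _ x) => S P; rewrite -!mulrA [P * S]mulrC.
have e3 n : \int[lam]_x ((\sum_i b i x * partial i (wn n) x) * strunc m (wn n x)) = 0.
  rewrite -[RHS](eqb (tstin_comp (rsm_ptrunc m) (ptrunc0 m) (twn n))).
  apply: eq_Rintegral => x _; rewrite mulr_suml; apply: eq_bigr => i _.
  by rewrite dp -mulrA; congr (_ * _); exact: mulrC.
have {}h3 : \int[lam]_x ((\sum_i b i x * Dw i x) * strunc m (w x)) = 0.
  by apply: (cvg_same h3); under eq_fun do rewrite e3; exact: cvg_cst.
have {}h1 : 2^-1 * \int[lam]_x (q x * strunc' m (w x)) = - \int[lam]_x (f0 x * strunc m (w x)).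
  by apply: (cvg_same h1); under eq_fun do rewrite e1; exact: h2.
have ms : measurable_fun setT (fun x => strunc m (w x)) by have [_ [? _] _] := cs.
rewrite h1 /g; under [in RHS]eq_Rintegral do rewrite mulrDl.
rewrite RintegralD//; first by rewrite h3 addr0.
- by have [_ ? _] := cs; exact: L2_mul.
- under eq_fun do rewrite mulrC.
  by apply: (ig_mulb _ _ drift_ig) => // x; exact: norm_strunc_le1.
Qed.

Lemma truncated_gradient m i : weak_partial lam setT i (trunc m \o w)
  (fun x => trunc' m (w x) * Dw i x).
Proof.
move=> phi /test_setTP tp.
have [C1 lip1] := trunc'_lip m.
have cs' := c2_lip (trunc'0 m) lip1 cw.
have [C2 lip2] : exists C, forall s t, `|trunc m s - trunc m t| <= C * `|s - t|.
  by exists 1; exact: trunc_lip.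
have t0 : trunc m 0 = 0 by rewrite /trunc mul0r.
have cs := c2_lip t0 lip2 cw.
have [C C0 bp] := tst_bounded tp; have mp := tst_meas tp.
have h1 := c1_int (c2_mul cs (c2_cst (tst_L2 lamL (tst_partial i tp)))).
have h2 := cvgN (c1_int (c2_mul (c2_mulb mp bp (cDw i)) cs')).
have e n : \int[lam]_x (trunc m (wn n x) * partial i phi x) =
    - \int[lam]_x (phi x * partial i (wn n) x * trunc' m (wn n x)).
  have := tst_weak lamL i (_ : smooth (trunc m \o wn n)) (proj2 (test_setTP phi) tp).
  have sw : smooth (wn n) by case: (twn n).
  move=> ->; last by apply: smooth_comp => //; exact: rsm_trunc.
  congr (- _); apply: eq_Rintegral => x _.
  rewrite (partial_comp i x (trunc_derive m) sw); move: (phi x) => a.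
  by move: (trunc' _ _) (partial i _ x) => S P; rewrite mulrC [RHS]mulrC mulrCA.
have -> : \int[lam]_x ((trunc m \o w) x * partial i phi x) =
    - \int[lam]_x (phi x * Dw i x * trunc' m (w x)).
  by apply: (cvg_same h1); under eq_fun do rewrite e; exact: h2.
congr (- _); apply: eq_Rintegral => x _.
by move: (trunc' _ _) (Dw i x) => S P; rewrite mulrC [RHS]mulrC mulrCA.
Qed.

(** Although [eqw] only admits test functions of the cube, [phi] is arbitrary: phi trunc'(wn)
    vanishes wherever [wn] does, because trunc'(0) = 0. This is where the boundary term
    disappears. *)
Lemma truncated_equation m phi : tst phi ->
  2^-1 * \int[lam]_x (\sum_i \sum_j K i j x * (trunc' m (w x) * Dw j x) * partial i phi x)
  - \int[lam]_x (\sum_i b i x * (trunc' m (w x) * Dw i x) * phi x) =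
  - \int[lam]_x ((g x * trunc' m (w x) + 2^-1 * (q x * trunc'' m (w x))) * phi x).
Proof.
move=> tp.
have [C1 lip1] := trunc'_lip m; have [C2 lip2] := trunc''_lip m.
have [D D0 bD] := bounded_trunc'' m.
have [C C0 bp] := tst_bounded tp; have mp := tst_meas tp.
have cs := c2_lip (trunc'0 m) lip1 cw; have cs' := c2_lip (trunc''0 m) lip2 cw.
have tv n : tstin r (fun x => phi x * trunc' m (wn n x)).
  have [sw [s sr vw]] := tstin_comp (rsm_trunc' m) (trunc'0 m) (twn n).
  split; first by apply: smoothM => //; case: tp.
  by exists s => // x xs; rewrite [trunc' m _](vw x xs) mulr0.
have dn i n x : partial i (fun y => phi y * trunc' m (wn n y)) x =
    partial i phi x * trunc' m (wn n x) + phi x * trunc'' m (wn n x) * partial i (wn n) x.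
  have sw : smooth (wn n) by case: (twn n).
  have sc : smooth (trunc' m \o wn n) by apply: smooth_comp => //; exact: rsm_trunc'.
  rewrite partialM; [|by apply: smooth_derivable; case: tp|exact: (smooth_derivable sc)].
  by rewrite -mulrA; congr (_ + _ * _); apply: partial_comp => //; exact: trunc'_derive.
have Ldp i : L2P lam (partial i phi) by apply: tst_L2 => //; exact: tst_partial.
have ca : c1 lam (fun n x => (\sum_i \sum_j K i j x * Dw j x * partial i phi x) * trunc' m (wn n x))
   (fun x => (\sum_i \sum_j K i j x * Dw j x * partial i phi x) * trunc' m (w x)).
  apply: c1_c2_mulb => //.
  - by apply: c1_cst; apply: ig_sum => i; apply: ig_sum => j; exact: L2_mul.
  - by move=> n x; exact: norm_trunc'_le1.
  - by move=> x; exact: norm_trunc'_le1.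
have cc : c1 lam (fun n x => (\sum_i \sum_j K i j x * Dw j x * partial i (wn n) x) * (phi x * trunc'' m (wn n x)))
   (fun x => q x * (phi x * trunc'' m (w x))).
  apply: (c1_c2_mulb cq (c2_mulb mp bp cs') (C := C * D)).
  - by move=> n x; rewrite normrM ler_pM.
  - by move=> x; rewrite normrM ler_pM.
have h1 := cvg_half (c1_int (c1D ca cc)).
have h2 := cvgN (c1_int (c2_mul (c2_cst Lf0) (c2_mulb mp bp cs))).
have e1 n : 2^-1 * \int[lam]_x (((fun x => (\sum_i \sum_j K i j x * Dw j x * partial i phi x) *
      trunc' m (wn n x)) \+ (fun x => (\sum_i \sum_j K i j x * Dw j x * partial i (wn n) x) *
      (phi x * trunc'' m (wn n x)))) x) = - \int[lam]_x (f0 x * (phi x * trunc' m (wn n x))).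
  rewrite -(eqw (tv n)); congr (_ * _); apply: eq_Rintegral => x _ /=.
  rewrite !mulr_suml -big_split/=; apply: eq_bigr => i _.
  rewrite !mulr_suml -big_split/=; apply: eq_bigr => j _.
  rewrite dn; move: (K i j x) (Dw j x) (partial i phi x) (trunc' m (wn n x))
    (partial i (wn n) x) (phi x) (trunc'' m (wn n x)); clear; move=> *; ring.
have H : 2^-1 * \int[lam]_x (((fun x => (\sum_i \sum_j K i j x * Dw j x * partial i phi x) * trunc' m (w x))
   \+ (fun x => q x * (phi x * trunc'' m (w x)))) x) = - \int[lam]_x (f0 x * (phi x * trunc' m (w x))).
  by apply: (cvg_same h1); under eq_fun do rewrite e1; exact: h2.
move: H; have [_ ia _] := ca; have [_ ic _] := cc; rewrite RintegralD// mulrDr => H.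
have mt : measurable_fun setT (fun x => trunc' m (w x)) by have [_ [? _] _] := cs.
have mt2 : measurable_fun setT (fun x => trunc'' m (w x)) by have [_ [? _] _] := cs'.
have mtp : measurable_fun setT (fun x => trunc' m (w x) * phi x) by exact: measurable_funM.
have btp x : `|trunc' m (w x) * phi x| <= 1 * C.
  by rewrite normrM ler_pM// norm_trunc'_le1.
have ib : ig lam (fun x => (\sum_i b i x * Dw i x) * (trunc' m (w x) * phi x)).
  by under eq_fun do rewrite mulrC; exact: (ig_mulb mtp btp drift_ig).
have if0 : ig lam (fun x => f0 x * (trunc' m (w x) * phi x)).
  apply: L2_mul => //; under eq_fun do rewrite mulrC.
  by have [_ Lt _] := cs; exact: L2_mulb bp Lt.
have -> : \int[lam]_x ((g x * trunc' m (w x) + 2^-1 * (q x * trunc'' m (w x))) * phi x) =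
   \int[lam]_x (f0 x * (trunc' m (w x) * phi x)) +
   (\int[lam]_x ((\sum_i b i x * Dw i x) * (trunc' m (w x) * phi x)) +
    2^-1 * \int[lam]_x (q x * (phi x * trunc'' m (w x)))).
  rewrite -RintegralZl// -RintegralD//; last exact: igZ.
  rewrite -RintegralD//; last by apply: igD => //; exact: igZ.
  apply: eq_Rintegral => x _ /=; rewrite /g.
  by move: (f0 x) (\sum_i _) (trunc' m (w x)) (phi x) (q x) (trunc'' m (w x)); clear; move=> *; ring.
have -> : \int[lam]_x (\sum_i \sum_j K i j x * (trunc' m (w x) * Dw j x) * partial i phi x) =
   \int[lam]_x ((\sum_i \sum_j K i j x * Dw j x * partial i phi x) * trunc' m (w x)).
  apply: eq_Rintegral => x _; rewrite mulr_suml; apply: eq_bigr => i _.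
  by rewrite mulr_suml; apply: eq_bigr => j _; rewrite mulrA -!mulrA; congr (_ * _);
    rewrite mulrCA; congr (_ * _); rewrite mulrC.
have -> : \int[lam]_x (\sum_i b i x * (trunc' m (w x) * Dw i x) * phi x) =
   \int[lam]_x ((\sum_i b i x * Dw i x) * (trunc' m (w x) * phi x)).
  apply: eq_Rintegral => x _; rewrite mulr_suml; apply: eq_bigr => i _.
  by rewrite -!mulrA; congr (_ * _); rewrite mulrCA.
have e4 : \int[lam]_x (f0 x * (phi x * trunc' m (w x))) = \int[lam]_x (f0 x * (trunc' m (w x) * phi x)).
  by apply: eq_Rintegral => x _; rewrite [phi x * _]mulrC.
by apply: half_alg; rewrite H e4.
Qed.

(* The terms of order trunc'' are controlled by the energy identity, as
   |trunc''| = strunc'. *)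
Variable ro : E -> R.
Hypotheses (mro : measurable_fun setT ro) (ro_ge0 : forall x, 0 <= ro x)
  (wi : ig lam (fun x => ro x * w x)).

(** With f = rho w - g the function to be estimated is (rho trunc(w) - rho w trunc'(w)) + (f
    trunc'(w) - f) - q trunc''(w)/2. As 0 <= trunc' <= 1, the second bracket has norm ||f|| - int
    |f| trunc'(w). As q >= 0, the last term has norm (1/2) int q strunc'(w), which the energy
    identity turns into int f strunc(w) - int rho |w| trunc'(w), at most int |f| trunc'(w) - int rho
    |w| trunc'(w). The integrals of |f| trunc'(w) cancel, and int rho |w| trunc'(w) is ||rho w||
    minus the last remainder. *)
Lemma truncated_residual m : 0 < m -> ig lam f0 ->
  let gm x := g x * trunc' m (w x) + 2^-1 * (q x * trunc'' m (w x)) in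
  ig lam gm /\
  n1 lam (fun x => ro x * trunc m (w x) - gm x - (ro x * w x - g x)) <=
  n1 lam (fun x => ro x * w x - g x) - n1 lam (fun x => ro x * w x) +
   (n1 lam (fun x => ro x * trunc m (w x) - ro x * w x * trunc' m (w x)) +
    n1 lam (fun x => ro x * w x * (1 - trunc' m (w x)))).
Proof.
move=> m0 f0i gm; set f := fun x => ro x * w x - g x.
have [D D0 bD] := bounded_trunc'' m.
have cm (th : R -> R) : (exists C, forall s t, `|th s - th t| <= C * `|s - t|) ->
    measurable_fun setT (fun x => th (w x)).
  by move=> [C HC]; exact: (measurableT_comp (lip_meas HC) mw).
have m1 := cm _ (trunc'_lip m); have m2 := cm _ (trunc''_lip m).
have m3 := cm _ (strunc_lip m).
have m4 : measurable_fun setT (fun x => trunc m (w x)).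
  by apply: cm; exists 1; exact: trunc_lip.
have gi : ig lam g by apply: igD => //; exact: drift_ig.
have fi : ig lam f by exact: igB.
have qi := energy_ig.
have i1 : ig lam (fun x => g x * trunc' m (w x)).
  by under eq_fun do rewrite mulrC; apply: (ig_mulb m1) gi => x; exact: norm_trunc'_le1.
have i2 : ig lam (fun x => 2^-1 * (q x * trunc'' m (w x))).
  by apply: igZ; under eq_fun do rewrite mulrC; exact: (ig_mulb m2 _ qi).
have ti : ig lam (fun x => ro x * trunc m (w x)).
  apply: (ig_le (measurable_funM mro m4) _ wi) => x.
  by rewrite /= normrM [leRHS]normrM ler_wpM2l// norm_trunc_le.
have wti : ig lam (fun x => ro x * w x * trunc' m (w x)).
  by under eq_fun do rewrite mulrC; apply: (ig_mulb m1) wi => x; exact: norm_trunc'_le1.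
have gmi : ig lam gm by exact: igD.
split => //.
have fti : ig lam (fun x => f x * trunc' m (w x)).
  by under eq_fun do rewrite mulrC; apply: (ig_mulb m1) fi => x; exact: norm_trunc'_le1.
have a1i : ig lam (fun x => ro x * trunc m (w x) - ro x * w x * trunc' m (w x)) by exact: igB.
have a2i : ig lam (fun x => f x * trunc' m (w x) - f x) by exact: igB.
have -> : (fun x => ro x * trunc m (w x) - gm x - f x) =
    ((fun x => ro x * trunc m (w x) - ro x * w x * trunc' m (w x)) \+
    (fun x => f x * trunc' m (w x) - f x)) \- (fun x => 2^-1 * (q x * trunc'' m (w x))).
  by apply/funext => x; rewrite /gm /f/=; move: (trunc m (w x)) (trunc' m (w x)) (trunc'' m (w x))
    (w x) (g x) (q x) (ro x); clear; move=> *; ring.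
apply: le_trans (n1B (igD a1i a2i) i2) _.
have H1 := n1D a1i a2i.
have q0 x : 0 <= q x by exact: K0.
have e2 : n1 lam (fun x => 2^-1 * (q x * trunc'' m (w x))) =
    2^-1 * \int[lam]_x (q x * strunc' m (w x)).
  rewrite -RintegralZl//; last first.
    apply: ig_le (igZ 2 i2).
      apply: measurable_funM; first exact: ig_meas qi.
      exact: cm _ (strunc'_lip m).
    move=> x; rewrite mulVKf ?pnatr_eq0// normrM [leRHS]normrM norm_trunc''//.
    by rewrite [`|strunc' _ _|]ger0_norm// -norm_trunc''.
  apply: eq_Rintegral => x _; rewrite normrM [`|q x * _|]normrM norm_trunc''//.
  by rewrite [`|2^-1|]ger0_norm ?invr_ge0// [`|q x|]ger0_norm.
have si : ig lam (fun x => f x * strunc m (w x)).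
  by under eq_fun do rewrite mulrC; apply: (ig_mulb m3) fi => x; exact: norm_strunc_le1.
have wsi : ig lam (fun x => ro x * w x * strunc m (w x)).
  by under eq_fun do rewrite mulrC; apply: (ig_mulb m3) wi => x; exact: norm_strunc_le1.
have e3 : 2^-1 * \int[lam]_x (q x * strunc' m (w x)) =
   \int[lam]_x (f x * strunc m (w x)) - \int[lam]_x (`|ro x * w x| * trunc' m (w x)).
  rewrite energy_identity.
  have -> : \int[lam]_x (`|ro x * w x| * trunc' m (w x)) =
      \int[lam]_x (ro x * w x * strunc m (w x)).
    apply: eq_Rintegral => x _; rewrite normrM ger0_norm//.
    have := mul_strunc (w x) m0; move: (strunc _ _) (trunc' _ _) => S S' e.
    by rewrite -!mulrA; congr (_ * _); exact: esym e.
  rewrite -RintegralB// -[LHS]mulN1r -RintegralZl//.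
    by apply: eq_Rintegral => x _; rewrite /f; ring.
  by under eq_fun do rewrite mulrC; apply: (ig_mulb m3) gi => x; exact: norm_strunc_le1.
have b1 : \int[lam]_x (f x * strunc m (w x)) <= \int[lam]_x (`|f x| * trunc' m (w x)).
  apply: le_Rintegral => //.
    by under eq_fun do rewrite mulrC; apply: (ig_mulb m1) (ig_norm fi) => x; exact: norm_trunc'_le1.
  by move=> x _; apply: le_trans (ler_norm _) _; rewrite normrM norm_strunc.
have nfi := ig_norm fi; have nwi := ig_norm wi.
have nft : ig lam (fun x => `|f x| * trunc' m (w x)).
  by under eq_fun do rewrite mulrC; apply: (ig_mulb m1) nfi => x; exact: norm_trunc'_le1.
have nwt : ig lam (fun x => `|ro x * w x| * trunc' m (w x)).
  by under eq_fun do rewrite mulrC; apply: (ig_mulb m1) nwi => x; exact: norm_trunc'_le1.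
have b2 : n1 lam (fun x => f x * trunc' m (w x) - f x) = n1 lam f - \int[lam]_x (`|f x| * trunc' m (w x)).
  rewrite /n1 -RintegralB//; apply: eq_Rintegral => x _.
  have /andP[a a'] := trunc'_bnd m (w x).
  have -> : f x * trunc' m (w x) - f x = f x * (trunc' m (w x) - 1) by rewrite mulrBr mulr1.
  rewrite normrM [`|trunc' _ _ - _|]ler0_norm; last by rewrite subr_le0.
  by rewrite opprB mulrBr mulr1.
have b3 : n1 lam (fun x => ro x * w x * (1 - trunc' m (w x))) =
    n1 lam (fun x => ro x * w x) - \int[lam]_x (`|ro x * w x| * trunc' m (w x)).
  rewrite /n1 -RintegralB//; apply: eq_Rintegral => x _.
  have /andP[a a'] := trunc'_bnd m (w x).
  rewrite [LHS]normrM [`|1 - _|]ger0_norm ?subr_ge0//.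
  by rewrite mulrBr mulr1.
move: H1; rewrite b2 b3 e2 e3 => H1.
exact: residual_alg H1 b1.
Qed.

Lemma residual_remainder :
  n1 lam (fun x => ro x * trunc n.+1%:R (w x) - ro x * w x * trunc' n.+1%:R (w x)) +
    n1 lam (fun x => ro x * w x * (1 - trunc' n.+1%:R (w x))) @[n --> \oo] --> (0 : R).
Proof.
have cm (th : R -> R) : (exists C, forall s t, `|th s - th t| <= C * `|s - t|) ->
    measurable_fun setT (fun x => th (w x)).
  by move=> [C HC]; exact: (measurableT_comp (lip_meas HC) mw).
have m1 m := cm _ (trunc'_lip m).
have m4 m : measurable_fun setT (fun x => trunc m (w x)).
  by apply: cm; exists 1; exact: trunc_lip.
(* Where [w] vanishes trunc'(w) does not tend to 1, but the product is 0 anyway. *)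
have c0 (x : E) : w x * trunc' n.+1%:R (w x) @[n --> \oo] --> w x.
  have [->|w0] := eqVneq (w x) 0.
    by under eq_fun do rewrite mul0r; exact: cvg_cst.
  by rewrite -[X in _ --> X]mulr1; apply: cvgMr; exact: cvg_trunc'.
have h1 : n1 lam ((fun x => ro x * trunc n.+1%:R (w x) - ro x * w x * trunc' n.+1%:R (w x)) \- (fun=> 0))
    @[n --> \oo] --> (0 : R).
  apply: (@n1_dct _ _ _ _ (fun n x => ro x * trunc n.+1%:R (w x) - ro x * w x * trunc' n.+1%:R (w x)) (fun=> 0)
    (fun x => 2 * `|ro x * w x|)).
  - move=> n; apply: measurable_funB; first exact: measurable_funM.
    by apply: measurable_funM => //; exact: measurable_funM.
  - by [].
  - move=> x; rewrite -[X in _ --> X](subrr (ro x * w x)); apply: cvgB => //.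
      by apply: cvgMr; exact: cvg_trunc.
    by under eq_fun do rewrite -mulrA; apply: cvgMr.
  - move=> n x; rewrite subr0; apply: le_trans (ler_normB _ _) _.
    have h1 : `|ro x * trunc n.+1%:R (w x)| <= `|ro x * w x|.
      by rewrite /= normrM [leRHS]normrM ler_wpM2l// norm_trunc_le.
    have : `|ro x * w x| * `|trunc' n.+1%:R (w x)| <= `|ro x * w x|.
      by rewrite -[leRHS]mulr1 ler_wpM2l// norm_trunc'_le1.
    by rewrite -normrM; lra.
  - by apply: igZ; exact: ig_norm.
have h2 : n1 lam ((fun x => ro x * w x * (1 - trunc' n.+1%:R (w x))) \- (fun=> 0))
    @[n --> \oo] --> (0 : R).
  apply: (@n1_dct _ _ _ _ (fun n x => ro x * w x * (1 - trunc' n.+1%:R (w x))) (fun=> 0)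
    (fun x => 2 * `|ro x * w x|)).
  - move=> n; apply: measurable_funM; first exact: measurable_funM.
    exact: measurable_funB.
  - by [].
  - move=> x; rewrite -[X in _ --> X](subrr (ro x * w x)).
    under eq_fun do rewrite mulrBr mulr1 -mulrA.
    by apply: cvgB; [exact: cvg_cst|apply: cvgMr].
  - move=> n x; rewrite subr0 normrM mulrC ler_wpM2r//; apply: le_trans (ler_normB _ _) _.
    by rewrite normr1; have := norm_trunc'_le1 n.+1%:R (w x); lra.
  - by apply: igZ; exact: ig_norm.
rewrite -[X in _ --> X](addr0 0); apply: cvgD.
  rewrite (_ : (fun n : nat => _) = (fun n : nat => n1 lam ((fun x => ro x * trunc n.+1%:R (w x) - ro x * w x * trunc' n.+1%:R (w x)) \- (fun=> 0))))//.
  by apply/funext => n; congr n1; apply/funext => x /=; rewrite subr0.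
rewrite (_ : (fun n : nat => _) = (fun n : nat => n1 lam ((fun x => ro x * w x * (1 - trunc' n.+1%:R (w x))) \- (fun=> 0))))//.
by apply/funext => n; congr n1; apply/funext => x /=; rewrite subr0.
Qed.

End LocalEstimate.

(** * Local Sobolev spaces and mollification of a weak equation *)

Section LocalSpaces.
Context {R : realType} {d : nat}.
Local Notation E := 'rV[R]_d.
Implicit Types (f g k : E -> R) (x y h : E) (i j : 'I_d) (r : R).
Variable lam : {measure set E -> \bar R}.
Hypothesis lamL : is_lebesgue lam.

Lemma Rintegral_sum_fin dd (T : measurableType dd) (mu : {measure set T -> \bar R})
    (I : finType) (F : I -> T -> R) : (forall a, ig mu (F a)) ->
  \int[mu]_x (\sum_a F a x) = \sum_a \int[mu]_x F a x.
Proof.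
move=> H; elim: (index_enum I) => [|a s IH].
  by rewrite big_nil; under eq_Rintegral do rewrite big_nil; rewrite Rintegral_cst// mul0r.
rewrite big_cons -IH -RintegralD//; [|exact: H|exact: ig_sum].
by apply: eq_Rintegral => x _; rewrite big_cons.
Qed.

Lemma mean_alg (a b c : R) : 2^-1 * - a - b = - c -> 2^-1 * a = c - b.
Proof. lra. Qed.

Lemma commutator_alg (a1 a2 a3 a4 a5 a6 : R) : 2^-1 * a3 = a5 - a6 ->
  2^-1 * (a1 + a2 - a3) + (a5 + (a4 + -1 * a6)) = 2^-1 * a1 + (2^-1 * a2 + a4).
Proof. lra. Qed.

Lemma ball_cst_partial i r f (c : R) : (forall x, `|x| < r -> f x = c) ->
  forall x, `|x| < r -> partial i f x = 0.
Proof.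
move=> v x rx; rewrite -(partial_cst i c x); apply: near_eq_derive.
have oU : open (cube r : set E) by exact: open_cube.
by move: (oU); rewrite openE => /(_ x rx); apply: filterS => y /v.
Qed.

Variable eta : E -> R.
Hypothesis etaM : mollifier lam eta.
Local Notation mo := (mo lam eta).

(** The indicator of the cube of half-side [r + 2], mollified at scale 1. *)
Lemma cutoff r : exists chi : E -> R, tst chi /\ forall x, `|x| <= r -> chi x = 1.
Proof.
pose u : E -> R := \1_(cube (r + 2)).
have mc := @meas_cube R d (r + 2).
have ui : ig lam u by apply: ig_indic => //; exact: lam_cube_lty.
have vu : vanish (r + 2) u.
  by move=> x xr; rewrite /u indicE memNset// /cube/= => /(lt_trans xr); rewrite ltxx.
exists (mo 1 u); split; first exact: (mo_tst etaM ltr01 ui vu).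
move=> x xr; rewrite (moE lamL etaM _ ltr01 ui) /Av.
case: etaM => te ve e0 e1; rewrite -[RHS]e1; apply: eq_Rintegral => z _.
have [z1|z1] := leP `|z| 1; last by rewrite ve// mul0r.
rewrite /u indicE mem_set ?mulr1// scale1r /cube/=.
by apply: le_lt_trans (ler_normD _ _) _; lra.
Qed.

Definition L2l f := measurable_fun setT f /\ forall r, L2P lam (fun x => f x * \1_(cube r) x).
Definition H1l f (Df : 'I_d -> E -> R) :=
  L2l f /\ forall i, L2l (Df i) /\ weak_partial lam setT i f (Df i).

Lemma L2l_mulb f g (C : R) r : L2l f -> measurable_fun setT g -> (forall x, `|g x| <= C) ->
  vanish r g -> L2P lam (fun x => g x * f x).
Proof.
move=> [mf Lf] mg gC vg; have := L2_mulb mg gC (Lf (r + 1)).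
congr L2P; apply/funext => x; have [xr|xr] := leP `|x| r; last by rewrite vg// !mul0r.
rewrite indicE mem_set ?mulr1// /cube/=; apply: le_lt_trans xr _; by rewrite ltrDl.
Qed.

Lemma L2lD f g : L2l f -> L2l g -> L2l (f \+ g).
Proof.
move=> [mf Lf] [mg Lg]; split; first exact: measurable_funD.
by move=> r; under eq_fun do rewrite /= mulrDl; exact: L2D.
Qed.

Lemma L2lZ (c : R) f : L2l f -> L2l (fun x => c * f x).
Proof.
move=> [mf Lf]; split; first exact: measurable_funM.
by move=> r; under eq_fun do rewrite -mulrA; exact: L2Z.
Qed.

Lemma L2l_sum (I : finType) (F : I -> E -> R) : (forall a, L2l (F a)) ->
  L2l (fun x => \sum_a F a x).
Proof.
move=> H; split; first by apply: measurable_sum => a; case: (H a).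
move=> r; under eq_fun do rewrite mulr_suml; apply: L2_sum => a; by case: (H a) => _; exact.
Qed.

Lemma cont_ball_bounded f r : continuous f -> exists2 C, 0 <= C &
  forall x, `|x| <= r -> `|f x| <= C.
Proof.
move=> cf; have cK : compact (f @` [set x : E | `|x| <= r]).
  by apply: continuous_compact; [exact: continuous_subspaceT|exact: compact_ball_E].
have [M [Mr HM]] := compact_bounded cK.
exists (`|M| + 1); first by rewrite addr_ge0.
move=> x xr; apply: (HM (`|M| + 1)); first by rewrite ltr_pwDr// ler_norm.
by exists x.
Qed.

Lemma L2l_contM f g : continuous f -> L2l g -> L2l (fun x => f x * g x).
Proof.
move=> cf [mg Lg]; have mf := cont_meas cf; split; first exact: measurable_funM.
move=> r; have [C C0 HC] := cont_ball_bounded r cf.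
have mi : measurable_fun setT (\1_(cube r) : E -> R) by apply: measurable_indic; exact: meas_cube.
have := @L2_mulb _ _ _ lam (fun x => f x * \1_(cube r) x) _ C _ _ (Lg r).
rewrite (_ : (fun x => _ * _ * (_ * _)) = (fun x => f x * g x * \1_(cube r) x)).
  apply; first exact: measurable_funM.
  move=> x; rewrite indicE; have [xr|xr] := pselect (cube r x).
    by rewrite mem_set// mulr1; apply: HC; exact: ltW.
  by rewrite memNset// mulr0 normr0.
apply/funext => x; rewrite indicE; case: (_ \in _); rewrite ?mulr1 ?mulr0 ?mul0r//.
Qed.

Lemma L2l_cont f : continuous f -> L2l f.
Proof.
move=> cf; rewrite (_ : f = (fun x => f x * 1)); last by apply/funext => x; rewrite mulr1.
apply: L2l_contM => //; split => // r.
under eq_fun do rewrite mul1r.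
have mc := @meas_cube R d r.
apply: (@bounded_vanish_L2 _ _ _ lamL r _ 1); first exact: measurable_indic.
  by move=> x; rewrite indicE; case: (_ \in _); rewrite ?normr1 ?normr0.
by move=> x xr; rewrite indicE memNset// /cube/= => /(lt_trans xr); rewrite ltxx.
Qed.

Lemma weak_mul_smooth i f g (Df : E -> R) : L2l f -> L2l Df -> smooth g ->
  weak_partial lam setT i f Df ->
  weak_partial lam setT i (fun x => f x * g x) (fun x => Df x * g x + f x * partial i g x).
Proof.
move=> Lf LDf sg w phi /test_setTP tp.
have tgp : tst (fun x => g x * phi x) by exact: tstMl.
have tdgp : tst (fun x => partial i g x * phi x) by exact: (tstMl (smooth_partial i sg) tp).
have := w _ ((test_setTP _).2 tgp).
have igt F u : L2l F -> tst u -> ig lam (fun x => F x * u x).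
  move=> LF tu; have [C C0 bu] := tst_bounded tu; have [su [r vu]] := tu.
  under eq_fun do rewrite mulrC.
  apply: (vanish_ig lamL (r := r)); first exact: (L2l_mulb LF (tst_meas tu) bu vu).
  by move=> x xr; rewrite vu// mul0r.
have e1 : \int[lam]_x (f x * partial i (fun x => g x * phi x) x) =
  \int[lam]_x (f x * partial i g x * phi x) + \int[lam]_x (f x * g x * partial i phi x).
  rewrite -RintegralD//; last 2 first.
  - by under eq_fun do rewrite -mulrA; exact: igt.
  - by under eq_fun do rewrite -mulrA; exact: (igt _ _ Lf (tstMl sg (tst_partial i tp))).
  apply: eq_Rintegral => x _; rewrite partialM; first by rewrite mulrDr !mulrA.
  - exact: smooth_derivable sg.
  - by apply: smooth_derivable; case: tp.
rewrite e1 => h.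
have e2 : \int[lam]_x ((Df x * g x + f x * partial i g x) * phi x) =
   \int[lam]_x (Df x * (g x * phi x)) + \int[lam]_x (f x * partial i g x * phi x).
  rewrite -RintegralD//; first by apply: eq_Rintegral => x _; rewrite mulrDl mulrA.
  - exact: igt.
  - by under eq_fun do rewrite -mulrA; exact: igt.
rewrite e2; move: h; move: (\int[lam]_x _) (\int[lam]_x _) (\int[lam]_x _) => a b c h.
by rewrite opprD -h addrC addKr.
Qed.

Lemma H1l_cut f Df chi r : H1l f Df -> tst chi -> vanish r chi ->
  H1c lam r (fun x => f x * chi x) (fun i x => Df i x * chi x + f x * partial i chi x).
Proof.
move=> [Lf HD] tc vc.
have LM F u : L2l F -> tst u -> vanish r u -> L2P lam (fun x => F x * u x).
  move=> LF tu vu; have [C C0 bu] := tst_bounded tu; under eq_fun do rewrite mulrC.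
  exact: (L2l_mulb LF (tst_meas tu) bu vu).
have vp i : vanish r (partial i chi) by exact: vanish_partial.
split.
- exact: LM.
- by move=> x xr; rewrite vc// mulr0.
- move=> i; have [LDi _] := HD i; split.
    by apply: L2D; apply: LM => //; exact: tst_partial.
  by move=> x xr; rewrite vc// vp// !mulr0 addr0.
- move=> i; have [LDi w] := HD i; apply: weak_mul_smooth => //; by case: tc.
Qed.

Lemma mo_c2 r f : L2P lam f -> vanish r f -> c2 lam (fun n => mo (en n) f) f.
Proof.
move=> Lf vf; have fi := vanish_ig lamL Lf vf; split => //.
- by move=> n; exact: (mo_n2 lamL etaM (en_gt0 n) fi Lf).1.
- exact: mo_cvg2 vf.
Qed.

Lemma mo_c1 f : ig lam f -> c1 lam (fun n => mo (en n) f) f.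
Proof.
move=> fi; split => //; last exact: mo_cvg1.
by move=> n; exact: (mo_n1 lamL etaM (en_gt0 n) fi).1.
Qed.

Lemma vanish_L2l r f : L2P lam f -> vanish r f -> L2l f.
Proof.
move=> Lf vf; split; first by case: Lf.
by move=> s; apply: L2_restr => //; exact: meas_cube.
Qed.

(** Only the second factor is mollified. The product rule with a smooth factor then applies, and
    every term converges as a product of two L^2 sequences. *)
Lemma H1c_mul i r f g Df Dg : H1c lam r f Df -> H1c lam r g Dg ->
  weak_partial lam setT i (fun x => f x * g x) (fun x => Df i x * g x + f x * Dg i x).
Proof.
move=> [Lf vf Df1 Df2] [Lg vg Dg1 Dg2] phi /[dup] /test_setTP tp tp'.
have gi := vanish_ig lamL Lg vg.
have [LDf vDf] := Df1 i; have [LDg vDg] := Dg1 i.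
have [C C0 bp] := tst_bounded tp; have mp := tst_meas tp.
have [C' C'0 bp'] := tst_bounded (tst_partial i tp); have mp' := tst_meas (tst_partial i tp).
have h1 := c1_int (c2_mul (c2_mulb mp' bp' (c2_cst Lf)) (mo_c2 Lg vg)).
have h2 := c1_int (c1D (c2_mul (c2_mulb mp bp (c2_cst LDf)) (mo_c2 Lg vg))
   (c2_mul (c2_mulb mp bp (c2_cst Lf)) (mo_c2 LDg vDg))).
have e n : \int[lam]_x (partial i phi x * f x * mo (en n) g x) =
  - \int[lam]_x ((fun x => phi x * Df i x * mo (en n) g x) \+
       (fun x => phi x * f x * mo (en n) (Dg i) x)) x.
  have sm : smooth (mo (en n) g) by apply: mo_smooth => //; exact: en_gt0.
  have := weak_mul_smooth (vanish_L2l Lf vf) (vanish_L2l LDf vDf) sm (Df2 i) tp'.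
  rewrite (partial_mo_weak etaM (@en_gt0 R n) gi (Dg2 i)) => h.
  transitivity (\int[lam]_x (f x * mo (en n) g x * partial i phi x)).
    by apply: eq_Rintegral => x _; rewrite [RHS]mulrC mulrA.
  rewrite h; congr (- _); apply: eq_Rintegral => x _ /=.
  by rewrite mulrC mulrDr !mulrA.
have E1 : \int[lam]_x (partial i phi x * f x * g x) =
  - \int[lam]_x ((fun x => phi x * Df i x * g x) \+ (fun x => phi x * f x * Dg i x)) x.
  have := cvgN h2; rewrite -(cvg_lim _ h1)//.
  under [in lim _]eq_fun do rewrite e.
  by move=> h3; rewrite (cvg_lim _ (h3 _)).
transitivity (\int[lam]_x (partial i phi x * f x * g x)).
  by apply: eq_Rintegral => x _; rewrite mulrC mulrA.
rewrite E1; congr (- _); apply: eq_Rintegral => x _ /=.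
by rewrite [RHS]mulrC mulrDr !mulrA.
Qed.

(** Both factors are multiplied by a function equal to 1 in a neighbourhood of the support of the
    test function; continuity makes the products locally square integrable. *)
Lemma H1l_mul f g Df Dg : continuous f -> continuous g -> H1l f Df -> H1l g Dg ->
  H1l (fun x => f x * g x) (fun i x => Df i x * g x + f x * Dg i x).
Proof.
move=> cf cg Hf Hg.
split; first by apply: L2l_cont => x; apply: continuousM; [exact: cf|exact: cg].
move=> i; split.
  apply: L2lD; last by apply: L2l_contM => //; case: (Hg.2 i).
  by under eq_fun do rewrite mulrC; apply: L2l_contM => //; case: (Hf.2 i).
move=> phi /[dup] /test_setTP tp tp'; have [sp [r vp]] := tp.
have [chi [tc hc]] := cutoff (r + 1); have [sc [s vc]] := tc.
have vdp : vanish r (partial i phi) by exact: vanish_partial.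
have dc x : `|x| <= r -> partial i chi x = 0.
  move=> xr; apply: (@ball_cst_partial i (r + 1) chi 1) => [y /ltW /hc//|].
  by apply: le_lt_trans xr _; rewrite ltrDl.
have c1' x : `|x| <= r -> chi x = 1 by move=> xr; apply: hc; apply: le_trans xr _; rewrite lerDl.
have := H1c_mul i (H1l_cut Hf tc vc) (H1l_cut Hg tc vc) tp'.
have -> : \int[lam]_x (f x * chi x * (g x * chi x) * partial i phi x) =
   \int[lam]_x (f x * g x * partial i phi x).
  apply: eq_Rintegral => x _; have [xr|xr] := leP `|x| r; last by rewrite vdp// !mulr0.
  by rewrite c1'// !mulr1.
move=> ->; congr (- _); apply: eq_Rintegral => x _.
have [xr|xr] := leP `|x| r; last by rewrite vp// !mulr0.
by rewrite c1'// dc// !mulr0 !addr0 !mulr1.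
Qed.

(** Mollifying the weak equation gives (1/2) sum d_i (K_ij Z_j)_e = g_e - (b Z)_e. The operator
    applied to the mollified [z], in nondivergence form, differs from g_e by the commutators of
    mollification with [K] and by b Z_e - (b Z)_e; all of these tend to 0 in L^1. *)
Theorem mollified_equation (K : 'I_d -> 'I_d -> E -> R) (DK : 'I_d -> 'I_d -> 'I_d -> E -> R)
    (b : 'I_d -> E -> R) r z (Z : 'I_d -> E -> R) g :
  (forall i j, H1l (K i j) (DK i j)) -> (forall i, L2l (b i)) ->
  L2P lam z -> vanish r z -> (forall i, L2P lam (Z i) /\ vanish r (Z i)) ->
  ig lam g -> (forall i, weak_partial lam setT i z (Z i)) ->
  (forall phi, tst phi ->
    2^-1 * \int[lam]_x (\sum_i \sum_j K i j x * Z j x * partial i phi x)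
    - \int[lam]_x (\sum_i b i x * Z i x * phi x) = - \int[lam]_x (g x * phi x)) ->
  c1 lam (fun n x =>
    2^-1 * (\sum_i \sum_j K i j x * partial i (partial j (mo (en n) z)) x) +
    \sum_j (2^-1 * (\sum_i DK i j i x) + b j x) * partial j (mo (en n) z) x) g.
Proof.
move=> HK Lb Lz vz HZ gi wz weq.
have zi := vanish_ig lamL Lz vz.
have [chi [tc hc]] := cutoff (r + 2); have [sc [s vc]] := tc.
have LZ j : L2P lam (Z j) by case: (HZ j).
have vZ j : vanish r (Z j) by case: (HZ j).
have Zi j := vanish_ig lamL (LZ j) (vZ j).
have hc1 x : `|x| <= r + 1 -> chi x = 1 by move=> xr; apply: hc; apply: le_trans xr _; lra.
have dc i x : `|x| <= r + 1 -> partial i chi x = 0.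
  move=> xr; apply: (@ball_cst_partial i (r + 2) chi 1) => [y /ltW /hc//|].
  by apply: le_lt_trans xr _; lra.
(* The commutator theorem asks for coefficients of compact support. The cut-off changes nothing,
   since [Z] and its mollifications live in the ball of radius [r + 1], where it equals 1. *)
pose k i j x := K i j x * chi x.
pose Dk i j l x := DK i j l x * chi x + K i j x * partial l chi x.
have Hk i j : H1c lam s (k i j) (Dk i j) by exact: H1l_cut.
have kZ i j : (fun y => k i j y * Z j y) = (fun y => K i j y * Z j y).
  apply/funext => y; have [yr|yr] := leP `|y| r; last by rewrite vZ// !mulr0.
  by rewrite /k hc1 ?mulr1//; lra.
have KZi i j : ig lam (fun y => K i j y * Z j y).
  by rewrite -kZ; apply: L2_mul => //; case: (Hk i j).
have en0 n := @en_gt0 R n.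
have vmo n j : vanish (r + 1) (mo (en n) (Z j)).
  apply: vanishW (mo_vanish etaM (en0 n) (vZ j)); by rewrite lerD2l en_le1.
have dz n j : partial j (mo (en n) z) = mo (en n) (Z j).
  exact: (partial_mo_weak etaM (en0 n) zi (wz j)).
have comE n i j x : com lam eta (en n) (k i j) (Dk i j i) (Z j) i x =
   mo (en n) (Z j) x * DK i j i x + K i j x * partial i (mo (en n) (Z j)) x -
   partial i (mo (en n) (fun y => K i j y * Z j y)) x.
  rewrite /com kZ; have [xr|xr] := leP `|x| (r + 1).
    by rewrite /Dk /k hc1// dc// mulr0 addr0 !mulr1.
  by rewrite vmo// (vanish_partial i (@vmo n j)) ?mul0r ?mulr0.
have ccom i j : c1 lam (fun n => com lam eta (en n) (k i j) (Dk i j i) (Z j) i) (fun=> 0).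
  split; last 1 first.
  - rewrite (_ : (fun n => _) = (fun n => n1 lam (com lam eta (en n) (k i j) (Dk i j i) (Z j) i))).
      exact: (com_cvg lamL etaM i (Hk i j) (LZ j) (vZ j)).
    by apply/funext => n; congr n1; apply/funext => x /=; rewrite subr0.
  - move=> n; have [C C0 H] := com_bound lamL etaM i.
    by have [] := H (en n) _ _ _ _ _ (en0 n) (Hk i j) (LZ j) (vZ j).
  - exact: ig0.
pose h x := \sum_j b j x * Z j x.
pose bb j x := b j x * \1_(cube (r + 2)) x.
have Lbb j : L2P lam (bb j) by case: (Lb j) => _; exact.
have bbE j x : `|x| <= r + 1 -> bb j x = b j x.
  by move=> xr; rewrite /bb indicE mem_set ?mulr1// /cube/=; lra.
have cbZ : c1 lam (fun n x => \sum_j bb j x * mo (en n) (Z j) x) (fun x => \sum_j bb j x * Z j x).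
  by apply: c1_sum => j; apply: c2_mul; [exact: c2_cst|exact: mo_c2 (vZ j)].
have hE : (fun x => \sum_j bb j x * Z j x) = h.
  apply/funext => x; apply: eq_bigr => j _.
  have [xr|xr] := leP `|x| r; last by rewrite vZ// !mulr0.
  by rewrite bbE//; lra.
have bZE n : (fun x => \sum_j bb j x * mo (en n) (Z j) x) = (fun x => \sum_j b j x * mo (en n) (Z j) x).
  apply/funext => x; apply: eq_bigr => j _.
  have [xr|xr] := leP `|x| (r + 1); last by rewrite vmo// !mulr0.
  by rewrite bbE.
have hi : ig lam h by rewrite -hE; case: cbZ.
(* The weak equation tested with the translated kernel. *)
have divE n x : 2^-1 * (\sum_i \sum_j partial i (mo (en n) (fun y => K i j y * Z j y)) x) =
    mo (en n) g x - mo (en n) h x.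
  have tk := tst_ker (en0 n) (let: And4 te _ _ _ := etaM in te).
  have tph := tst_shift x tk.
  have := weq _ tph.
  have pE i : partial i (fun y => ker eta (en n) (y - x)) = fun y => partial i (ker eta (en n)) (y - x).
    apply/funext => y; have := partial_affine i 1 (- x) y tk.1.
    by under eq_fun do rewrite scale1r; rewrite scale1r mul1r.
  have -> : \int[lam]_x0 (\sum_i \sum_j K i j x0 * Z j x0 * partial i (fun y => ker eta (en n) (y - x)) x0) =
     - (\sum_i \sum_j partial i (mo (en n) (fun y => K i j y * Z j y)) x).
    have cvi i j : ig lam (fun y => partial i (ker eta (en n)) (y - x) * (K i j y * Z j y)).
      exact: (cv_ig x (tst_partial i tk) (KZi i j)).
    rewrite -sumrN.
    transitivity (\sum_i \int[lam]_x0 (\sum_j K i j x0 * Z j x0 * partial i (ker eta (en n)) (x0 - x))).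
      rewrite -Rintegral_sum_fin.
        by apply: eq_Rintegral => y _; apply: eq_bigr => i _; apply: eq_bigr => j _; rewrite pE.
      move=> i; apply: ig_sum => j; under eq_fun do rewrite mulrC; exact: cvi.
    apply: eq_bigr => i _; rewrite -sumrN Rintegral_sum_fin; last first.
      by move=> j; under eq_fun do rewrite mulrC; exact: cvi.
    apply: eq_bigr => j _; rewrite (partial_cv i tk (KZi i j)) (cvNl x (tst_partial i tk) (KZi i j)) opprK.
    by apply: eq_Rintegral => y _; rewrite mulrC.
  have e1 u : \int[lam]_y (u y * ker eta (en n) (y - x)) = mo (en n) u x.
    by apply: eq_Rintegral => y _; rewrite mulrC.
  have -> : \int[lam]_y (\sum_i b i y * Z i y * ker eta (en n) (y - x)) = mo (en n) h x.
    by rewrite -e1; apply: eq_Rintegral => y _; rewrite mulr_suml.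
  by rewrite e1 => H; exact: mean_alg.
have cA : c1 lam (fun n x => 2^-1 * \sum_i \sum_j com lam eta (en n) (k i j) (Dk i j i) (Z j) i x)
     (fun x => 2^-1 * \sum_(i < d) \sum_(j < d) 0).
  by apply: c1Z; apply: c1_sum => i; apply: c1_sum => j.
have cB : c1 lam (fun n => (fun x => \sum_j bb j x * mo (en n) (Z j) x) \+ (fun x => -1 * mo (en n) h x))
    ((fun x => \sum_j bb j x * Z j x) \+ (fun x => -1 * h x)).
  by apply: c1D => //; apply: c1Z; exact: mo_c1.
have cC := c1D cA (c1D (mo_c1 gi) cB).
have -> : g = (fun x => 2^-1 * \sum_(i < d) \sum_(j < d) 0) \+
    (g \+ ((fun x => \sum_j bb j x * Z j x) \+ (fun x => -1 * h x))).
  apply/funext => x /=.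
  rewrite [X in 2^-1 * X]big1 ?mulr0 ?add0r; last by move=> i _; rewrite big1.
  have -> : \sum_j bb j x * Z j x = h x by rewrite -hE.
  by rewrite mulN1r subrr addr0.
move: cC; congr (c1 lam _ _); apply/funext => n; apply/funext => x /=.
have -> : \sum_j bb j x * mo (en n) (Z j) x = \sum_j b j x * mo (en n) (Z j) x.
  by have := congr1 (fun f => f x) (bZE n).
have := divE n x.
have -> : \sum_i \sum_j com lam eta (en n) (k i j) (Dk i j i) (Z j) i x =
  \sum_i \sum_j (K i j x * partial i (partial j (mo (en n) z)) x) +
  \sum_j ((\sum_i DK i j i x) * partial j (mo (en n) z) x) -
  \sum_i \sum_j partial i (mo (en n) (fun y => K i j y * Z j y)) x.
  have -> : \sum_j (\sum_i DK i j i x) * partial j (mo (en n) z) x =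
      \sum_i \sum_j (DK i j i x * partial j (mo (en n) z) x).
    by rewrite exchange_big/=; apply: eq_bigr => j _; rewrite mulr_suml.
  rewrite -big_split -sumrB/=; apply: eq_bigr => i _.
  rewrite -big_split -sumrB/=; apply: eq_bigr => j _.
  by rewrite comE dz [mo _ _ _ * _]mulrC; congr (_ - _); exact: addrC.
have -> : \sum_j (2^-1 * (\sum_i DK i j i x) + b j x) * partial j (mo (en n) z) x =
  2^-1 * \sum_j ((\sum_i DK i j i x) * partial j (mo (en n) z) x) + \sum_j b j x * mo (en n) (Z j) x.
  rewrite mulr_sumr -big_split/=; apply: eq_bigr => j _.
  by rewrite mulrDl dz mulrA.
exact: commutator_alg.
Qed.

End LocalSpaces.

(** * Integration against a measure with a density *)

Section Density.
Context dd (T : measurableType dd) (R : realType) (lam mu : {measure set T -> \bar R}).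
Variable rho : T -> R.
Hypotheses (mrho : measurable_fun setT rho) (rho_ge0 : forall x, 0 <= rho x).
Hypothesis dens : forall B, measurable B -> mu B = (\int[lam]_(x in B) (rho x)%:E)%E.
Import HBNNSimple.

Lemma ge0_integral_density (f : T -> \bar R) : measurable_fun setT f ->
  (forall x, 0 <= f x)%E -> (\int[mu]_x f x = \int[lam]_x (f x * (rho x)%:E))%E.
Proof.
move=> mf f0; have mE : measurable [set: T] by exact: measurableT.
pose h := nnsfun_approx mE mf.
have mre : measurable_fun setT (EFin \o rho) by exact/measurable_EFinP.
have -> : (\int[mu]_x f x = lim (\int[mu]_x (EFin \o h n) x @[n --> \oo]))%E.
  have fE x : f x = lim ((EFin \o h n) x @[n --> \oo]).
    by apply/esym/cvg_lim => //; exact: cvg_nnsfun_approx.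
  under eq_integral => x _ do rewrite fE.
  apply: monotone_convergence => //.
  - by move=> n; apply/measurable_EFinP.
  - by move=> n x Ex //=; rewrite lee_fin.
  - by move=> x Ex a b ab; rewrite lee_fin; exact/lefP/nd_nnsfun_approx.
have -> : (\int[lam]_x (f x * (rho x)%:E) =
    lim (\int[lam]_x ((h n x)%:E * (rho x)%:E) @[n --> \oo]))%E.
  have fg x : (f x * (rho x)%:E)%E = lim (((h n x)%:E * (rho x)%:E)%E @[n --> \oo]).
    by apply/esym/cvg_lim => //; apply: cvgeZr => //; exact: cvg_nnsfun_approx.
  under eq_integral => x _ do rewrite fg.
  apply: monotone_convergence => //.
  - by move=> n; apply: emeasurable_funM => //; exact/measurable_EFinP.
  - by move=> n x Ex /=; rewrite mule_ge0 ?lee_fin.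
  - move=> x Ex a b ab/=; rewrite lee_wpmul2r ?lee_fin//; exact/lefP/nd_nnsfun_approx.
suff suf n : (\int[lam]_x ((h n x)%:E * (rho x)%:E) = \int[mu]_x (EFin \o h n) x)%E.
  by congr (limn _); apply/funext => n; rewrite suf.
have indich r : measurable_fun setT (fun x => (r * \1_(h n @^-1` [set r]) x)%:E).
  by apply/measurable_EFinP; exact: measurable_funM.
transitivity (\int[mu]_x (\sum_(y \in range (h n)) (y * \1_(h n @^-1` [set y]) x)%:E))%E; last first.
  by apply: eq_integral => t tE; rewrite /= fimfunE -fsumEFin.
rewrite ge0_integral_fsum//; last by move=> m y Ey; exact: nnfun_muleindic_ge0.
transitivity (\int[lam]_x (\sum_(y \in range (h n))
    (y * \1_(h n @^-1` [set y]) x)%:E * (rho x)%:E))%E.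
  apply: eq_integral => x _; rewrite -ge0_mule_fsuml => [|y]; last exact: nnfun_muleindic_ge0.
  by rewrite fsumEFin // -(fimfunE _ x).
rewrite ge0_integral_fsum//; last 2 first.
  - by move=> y; apply: emeasurable_funM.
  - by move=> m y Ey; rewrite mule_ge0 ?lee_fin// -lee_fin nnfun_muleindic_ge0.
apply: eq_fsbigr => r rhn.
have r0 : 0 <= r by move: rhn; rewrite inE => -[x _ <-].
have mB : measurable (h n @^-1` [set r]) by exact: measurable_sfunP.
transitivity (\int[lam]_x (r%:E * ((\1_(h n @^-1` [set r]) x)%:E * (rho x)%:E)))%E.
  by apply: eq_integral => x _; rewrite EFinM muleA.
rewrite ge0_integralZl//; last first.
- by move=> x _; rewrite mule_ge0 ?lee_fin.
- by apply: emeasurable_funM => //; apply/measurable_EFinP; exact: measurable_indic.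
under [RHS]eq_integral do rewrite EFinM.
rewrite ge0_integralZl//; last by apply/measurable_EFinP; exact: measurable_indic.
congr (_ * _)%E; rewrite integral_indic// setIT dens// [RHS]integral_mkcond.
apply: eq_integral => x _; rewrite patchE indicE; case: (_ \in _) => /=; rewrite ?mul1e ?mul0e//.
Qed.

Lemma ig_density f : measurable_fun setT f -> ig mu f <-> ig lam (fun x => rho x * f x).
Proof.
move=> mf.
have e : (\int[mu]_x `|f x|%:E = \int[lam]_x `|rho x * f x|%:E)%E.
  rewrite ge0_integral_density//.
    by apply: eq_integral => x _; rewrite normrM ger0_norm// mulrC EFinM.
  by apply/measurable_EFinP; exact: measurableT_comp.
split=> /integrableP[_ h]; apply/integrableP; split.
- by apply/measurable_EFinP; exact: measurable_funM.
- by move: h; rewrite [X in (X < _)%E -> _]e.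
- exact/measurable_EFinP.
- by move: h; rewrite -[X in (X < _)%E -> _]e.
Qed.

Lemma n1_density f : measurable_fun setT f -> n1 mu f = n1 lam (fun x => rho x * f x).
Proof.
move=> mf; congr fine; rewrite ge0_integral_density//.
  by apply: eq_integral => x _; rewrite normrM ger0_norm// mulrC EFinM.
by apply/measurable_EFinP; exact: measurableT_comp.
Qed.

Lemma Rint_density f : ig mu f -> \int[mu]_x f x = \int[lam]_x (rho x * f x).
Proof.
move=> fi; have mf := ig_meas fi; have := (ig_density mf).1 fi => fi'.
have pos (g : T -> R) : measurable_fun setT g -> (forall x, 0 <= g x) ->
    \int[mu]_x g x = \int[lam]_x (rho x * g x).
  move=> mg g0; congr fine; rewrite ge0_integral_density//.
  - by apply: eq_integral => x _; rewrite mulrC EFinM.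
  - exact/measurable_EFinP.
pose p x := Num.max (f x) 0; pose q x := Num.max (- f x) 0.
have fE : f = p \- q.
  by apply/funext => x; rewrite /p /q/=; have [h|h] := leP (f x) 0; have [h'|h'] := leP (- f x) 0; lra.
have mp : measurable_fun setT p by apply: measurable_maxr.
have mq : measurable_fun setT q by apply: measurable_maxr => //; exact: measurable_funN.
have p0 x : 0 <= p x by rewrite /p le_max lexx orbT.
have q0 x : 0 <= q x by rewrite /q le_max lexx orbT.
have pf x : `|p x| <= `|f x|.
  by rewrite ger0_norm// ge_max ler_norm normr_ge0.
have qf x : `|q x| <= `|f x|.
  by rewrite ger0_norm// ge_max normr_ge0 -normrN ler_norm.
have ip := ig_le mp pf fi; have iq := ig_le mq qf fi.
have ip' := (ig_density mp).1 ip; have iq' := (ig_density mq).1 iq.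
transitivity (\int[mu]_x p x - \int[mu]_x q x).
  by rewrite -RintegralB//; apply: eq_Rintegral => x _; rewrite {1}fE.
rewrite !pos// -RintegralB//; apply: eq_Rintegral => x _.
by rewrite -mulrBr -[p x - q x]/((p \- q) x) -fE.
Qed.

End Density.

Section LocalRestriction.
Context {R : realType} {d : nat}.
Local Notation E := 'rV[R]_d.
Implicit Types (f g u v phi : E -> R) (x : E) (i j : 'I_d) (r s : R) (V : set E).
Variable lam : {measure set E -> \bar R}.
Hypothesis lamL : is_lebesgue lam.

Lemma patch_indic f V x : (f \_ V) x = f x * \1_V x.
Proof. by rewrite patchE indicE; case: (_ \in _); rewrite ?mulr1 ?mulr0. Qed.

Lemma patch_indicE f V : (EFin \o f) \_ V = (fun x => (f x * \1_V x)%:E).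
Proof. by apply/funext => x; rewrite -patch_indic !patchE; case: (_ \in _). Qed.

Lemma restr_meas f V : measurable V -> measurable_fun V f ->
  measurable_fun setT (fun x => f x * \1_V x).
Proof.
move=> mV mf; rewrite (_ : (fun x => _) = f \_ V); last first.
  by apply/funext => x; rewrite patch_indic.
by apply/(measurable_restrict f mV measurableT); rewrite setTI.
Qed.

(** On a bounded set, |f|^2 <= 1 + |f|^s for s >= 2. *)
Lemma Lploc_L2l s f : 2 <= s -> Lp_loc lam s f -> L2l lam f.
Proof.
move=> s2 [mf Hf]; split => // r.
pose K : set E := [set x | `|x| <= r].
have mK : measurable K by exact: meas_ball.
have mc := @meas_cube R d r.
have mfc : measurable_fun setT (fun x => f x * \1_(cube r) x).
  by apply: measurable_funM => //; exact: measurable_indic.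
split => //; apply/integrableP; split.
  by apply/measurable_EFinP; exact: measurable_funX.
have mp : measurable_fun setT (fun x => (`|f x| `^ s)%:E).
  apply/measurable_EFinP; apply: (measurableT_comp (measurable_powR s)).
  exact: measurableT_comp.
apply: (@le_lt_trans _ _ (\int[lam]_(x in K) (1 + (`|f x| `^ s)%:E))%E).
  rewrite [leRHS]integral_mkcond; apply: ge0_le_integral => //.
  - apply/measurable_EFinP; apply: measurableT_comp => //; exact: measurable_funX.
  - apply/(measurable_restrict _ mK measurableT); rewrite setTI.
    by apply: emeasurable_funD => //; exact: measurable_funTS.
  - move=> x _; rewrite /= patchE indicE; case: ifPn => xK.
      have [xV|xV] := boolP (x \in cube r); last first.
        by rewrite mulr0 expr0n normr0 -EFinD lee_fin addr_ge0// powR_ge0.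
      rewrite mulr1 -EFinD lee_fin normrX; have [f1|f1] := leP `|f x| 1.
        apply: (@le_trans _ _ 1); first by rewrite expr_le1.
        by rewrite lerDl powR_ge0.
      rewrite -powR_mulrn//; apply: le_trans (_ : `|f x| `^ s <= _); last by rewrite lerDr.
      by apply: ler_powR => //; exact: ltW.
    rewrite (_ : (x \in cube r) = false) ?mulr0 ?expr0n ?normr0//.
    apply/negbTE; apply: contra xK; rewrite !inE => xr; exact: ltW.
rewrite ge0_integralD//; last exact: measurable_funTS.
rewrite integral_cst// mul1e; apply: lte_add_pinfty; first exact: lam_ball_lty.
by apply: Hf; exact: compact_ball_E.
Qed.

Lemma H1p_H1l s f Df : 2 <= s -> H1p_loc lam s f Df -> H1l lam f Df.
Proof.
move=> s2 [Hf HD]; split; first exact: Lploc_L2l Hf.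
by move=> i; have [h w] := HD i; split => //; exact: Lploc_L2l h.
Qed.

Lemma L2l_tst_ig f phi : L2l lam f -> tst phi -> ig lam (fun x => f x * phi x).
Proof.
move=> Lf tp; have [C C0 bu] := tst_bounded tp; have [su [r vu]] := tp.
under eq_fun do rewrite mulrC.
apply: (vanish_ig lamL (r := r)); first exact: (L2l_mulb Lf (tst_meas tp) bu vu).
by move=> x xr; rewrite vu// mul0r.
Qed.

Lemma cube_relatively_compact r : relatively_compact (cube r : set E).
Proof.
apply: (subclosed_compact _ (@compact_ball_E R d r)); first exact: closed_closure.
rewrite [X in _ `<=` X](closure_id _).1; last exact: closed_ball_E.
by apply: closure_subset => x /ltW.
Qed.

Lemma tstin_test r phi : test_function (cube r) phi <-> tstin r phi.
Proof. exact: test_cubeP. Qed.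

End LocalRestriction.

(** * The weighted coefficients, and the operator in divergence form *)

Section Coefficients.
Context {R : realType} {d : nat}.
Local Notation E := 'rV[R]_d.
Implicit Types (f g u v phi : E -> R) (x : E) (i j l : 'I_d) (r s : R) (V : set E).
Variables (p : R) (lam mu : {measure set E -> \bar R}).
Variables (A C : E -> 'M[R]_d) (DA DC : 'I_d -> 'I_d -> 'I_d -> E -> R)
  (H : 'I_d -> E -> R) (rho : E -> R) (Drho : 'I_d -> E -> R).
Hypotheses (d2 : (2 <= d)%N) (dp : d%:R < p) (lamL : is_lebesgue lam).
Let G := drift DA DC H.
Let B := divfree_drift A G DA rho Drho.
Hypotheses (aa : assumption_a lam A C DA DC H p)
  (inv : inf_invariant_density A G lam mu p rho Drho).

Let p2 : 2 <= p.
Proof. by apply: ltW; apply: le_lt_trans dp; rewrite ler_nat. Qed.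

(** The entry of [A] is transposed so that [wcoefD i j i] contains [DA j i i], the version of the
    derivative that enters component [j] of [drift]; the versions [DA i j] and [DA j i] need not
    agree pointwise. *)
Definition wcoef i j x := rho x * A x j i.
Definition wcoefD i j l x := Drho l x * A x j i + rho x * DA j i l x.
(** The field rho B = rho (G - beta), written without division by rho: rho beta_j is half of the
    divergence of row [j] of rho A. *)
Definition wdrift j x := rho x * drift DA DC H j x - 2^-1 * \sum_i wcoefD i j i x.
Local Notation K := wcoef.
Local Notation DK := wcoefD.
Local Notation b := wdrift.

Lemma rho_cont : continuous rho. Proof. by case: inv. Qed.
Lemma rho_gt0 x : 0 < rho x. Proof. by case: inv. Qed.
Lemma rho_ge0 x : 0 <= rho x. Proof. exact: ltW (rho_gt0 x). Qed.
Lemma rho_meas : measurable_fun setT rho. Proof. by apply: cont_meas; exact: rho_cont. Qed.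
Lemma mu_density : has_density lam mu rho. Proof. by case: inv. Qed.
Lemma A_cont i j : continuous (fun x => A x i j). Proof. by case: aa => -[]. Qed.
Lemma A_sym i j x : A x j i = A x i j. Proof. by case: aa => -[]. Qed.

Lemma rho_H1l : H1l lam rho Drho.
Proof. by case: inv => h *; exact: H1p_H1l h. Qed.

Lemma A_H1l i j : H1l lam (fun x => A x i j) (DA i j).
Proof. by case: aa => -[_ h _ _] _ _; exact: H1p_H1l (h i j). Qed.

Lemma wcoef_H1l i j : H1l lam (K i j) (DK i j).
Proof.
have [eta etaM] := mollifier_exists lamL.
exact: (H1l_mul lamL etaM rho_cont (@A_cont j i) rho_H1l (A_H1l j i)).
Qed.

Lemma wdrift_L2l j : L2l lam (b j).
Proof.
have LG : L2l lam (G j).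
  apply: (@L2lD _ _ _ (fun x => 2^-1 * _)).
    apply: L2lZ; apply: L2l_sum => i; apply: (@L2lD _ _ _ (DA j i i)); first by case: ((A_H1l j i).2 i).
    by case: aa => _ [_ h _] _; case: ((h i j).2 i) => h' _; exact: (Lploc_L2l lamL (lexx _) h').
  by case: aa => _ _ /(_ j)/(Lploc_L2l lamL p2).
apply: (@L2lD _ _ _ (fun x => rho x * G j x) (fun x => - _)).
  by apply: L2l_contM => //; exact: rho_cont.
under eq_fun do rewrite -mulN1r mulrA; apply: L2lZ; apply: L2l_sum => i.
by case: ((wcoef_H1l i j).2 i).
Qed.

Lemma wdriftE j x : rho x * B j x = b j x.
Proof.
rewrite /B /divfree_drift mulrBr /wdrift mulrCA mulr_sumr; congr (_ - _ * _).
apply: eq_bigr => i _; rewrite /wcoefD mulrDr addrC mulrCA [A x j i * _]mulrC.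
by congr (_ * _ + _); rewrite mulrC divfK// gt_eqF// rho_gt0.
Qed.

Lemma LopE f x : rho x * Lop A G f x =
  2^-1 * (\sum_i \sum_j K i j x * partial i (partial j f) x) +
  \sum_j (2^-1 * (\sum_i DK i j i x) + b j x) * partial j f x.
Proof.
rewrite /Lop mulrDr; congr (_ + _).
  rewrite mulrCA mulr_sumr; congr (_ * _); apply: eq_bigr => i _.
  by rewrite mulr_sumr; apply: eq_bigr => j _; rewrite mulrA /wcoef A_sym.
rewrite mulr_sumr; apply: eq_bigr => j _; rewrite mulrA; congr (_ * _).
by rewrite /wdrift addrC subrK.
Qed.

Let ig_term f phi : L2l lam f -> tst phi -> ig lam (fun x => f x * phi x).
Proof. exact: L2l_tst_ig. Qed.

(** Integrating the second-order term by parts produces the divergence of rho A, which cancels the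
    corresponding part of the drift and leaves the field [b]. Infinitesimal invariance of [mu]
    therefore says that [b] is divergence free. *)
Lemma Lop_parts phi : tst phi -> ig lam (fun x => rho x * Lop A G phi x) /\
  \int[lam]_x (rho x * Lop A G phi x) = \int[lam]_x (\sum_j b j x * partial j phi x).
Proof.
move=> tp; have tpp i := tst_partial i tp.
have i1 i j : ig lam (fun x => K i j x * partial i (partial j phi) x).
  by apply: ig_term; [case: (wcoef_H1l i j)|exact: tst_partial].
have i2 i j : ig lam (fun x => DK i j i x * partial j phi x).
  by apply: ig_term => //; case: ((wcoef_H1l i j).2 i).
have i3 j : ig lam (fun x => b j x * partial j phi x).
  by apply: ig_term => //; exact: wdrift_L2l.
have e : (fun x => rho x * Lop A G phi x) =
    ((fun x => 2^-1 * (\sum_i \sum_j K i j x * partial i (partial j phi) x)) \+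
    (fun x => 2^-1 * (\sum_i \sum_j DK i j i x * partial j phi x))) \+
    (fun x => \sum_j b j x * partial j phi x).
  apply/funext => x; rewrite LopE /= -addrA; congr (_ + _).
  rewrite exchange_big/= mulr_sumr -big_split/=; apply: eq_bigr => j _.
  by rewrite mulrDl -mulrA mulr_suml.
have I1 : ig lam (fun x => \sum_i \sum_j K i j x * partial i (partial j phi) x).
  by apply: ig_sum => i; exact: ig_sum.
have I2 : ig lam (fun x => \sum_i \sum_j DK i j i x * partial j phi x).
  by apply: ig_sum => i; apply: ig_sum => j; exact: i2.
have I3 : ig lam (fun x => \sum_j b j x * partial j phi x) by exact: ig_sum.
have I12 := igD (igZ 2^-1 I1) (igZ 2^-1 I2).
rewrite e; split; first exact: (igD I12 I3).
rewrite RintegralD// RintegralD//; [|exact: igZ..].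
rewrite !RintegralZl// -mulrDr.
have -> : \int[lam]_x (\sum_i \sum_j K i j x * partial i (partial j phi) x) =
   - \int[lam]_x (\sum_i \sum_j DK i j i x * partial j phi x).
  rewrite Rintegral_sum_fin; last by move=> i; exact: ig_sum.
  rewrite Rintegral_sum_fin; last by move=> i; apply: ig_sum => j; exact: i2.
  rewrite -sumrN; apply: eq_bigr => i _.
  rewrite Rintegral_sum_fin// Rintegral_sum_fin; last by move=> j; exact: i2.
  rewrite -sumrN; apply: eq_bigr => j _.
  by have [_ w] := (wcoef_H1l i j).2 i; apply: w; apply/test_setTP.
by rewrite addNr mulr0 add0r.
Qed.

Lemma Lop_ig phi : tst phi -> ig mu (Lop A G phi).
Proof.
move=> tp; have [h _] := Lop_parts tp.
have mL : measurable_fun setT (Lop A G phi).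
  rewrite (_ : Lop A G phi = (fun x => (rho x)^-1 * (rho x * Lop A G phi x))); last first.
    by apply/funext => x; rewrite mulKf// gt_eqF// rho_gt0.
  apply: measurable_funM; last exact: ig_meas h.
  apply: cont_meas => x; apply: continuousV; last exact: rho_cont.
  by rewrite gt_eqF// rho_gt0.
apply/(ig_density rho_meas rho_ge0 mu_density mL) => //.
Qed.

Lemma wdrift_divfree phi : tst phi -> \int[lam]_x (\sum_j b j x * partial j phi x) = 0.
Proof.
move=> tp; have [_ <-] := Lop_parts tp.
rewrite -(Rint_density rho_meas rho_ge0 mu_density (Lop_ig tp)).
by case: inv => _ _ _ _; apply; apply/test_setTP.
Qed.

End Coefficients.

Lemma cvg_opp_seq (R : realType) (F : nat -> R) (l : R) : F n @[n --> \oo] --> l ->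
  - F n @[n --> \oo] --> - l.
Proof. by move=> h; exact: cvgN. Qed.

Lemma cvg_below2 (R : realType) (F1 F2 : nat -> R) (e : R) : 0 < e ->
  F1 n @[n --> \oo] --> (0 : R) -> F2 n @[n --> \oo] --> (0 : R) ->
  exists n, F1 n + F2 n < e.
Proof.
move=> e0 c1 c2; have h : F1 n + F2 n @[n --> \oo] --> (0 : R).
  by rewrite -[X in _ --> X](addr0 0); exact: cvgD.
exact: cvg_below h.
Qed.

Lemma duality_alg (R : realType) (G e D P a b del : R) : 0 < G -> 0 <= e -> 0 <= D -> 0 < del ->
  G ^+ 2 = a + b -> a <= e * P -> b <= G * D -> P <= G + D ->
  D < G * (del / (G + e + 1)) -> G <= e + del.
Proof.
move=> G0 e0 D0 del0 I2 B1 B2 B3 hD.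
have s0 : 0 < G + e + 1 by lra.
have h : D * (G + e + 1) <= G * del.
  by rewrite -ler_pdivlMr// -mulrA ltW.
have h2 : G ^+ 2 <= G * (e + del).
  have : e * P <= e * (G + D) by rewrite ler_wpM2l.
  by move: I2 B1 B2 h; nra.
by move: h2; rewrite expr2 ler_pM2l.
Qed.

(** * Density of (1 - L) C_0^oo in L^1(mu) *)

Section CubeData.
Context {R : realType} {d : nat}.
Local Notation E := 'rV[R]_d.
Implicit Types (f u v phi : E -> R) (x : E) (i j l : 'I_d).
Variables (p : R) (lam mu : {measure set E -> \bar R}).
Variables (A C : E -> 'M[R]_d) (DA DC : 'I_d -> 'I_d -> 'I_d -> E -> R)
  (H : 'I_d -> E -> R) (rho : E -> R) (Drho : 'I_d -> E -> R).
Hypotheses (d2 : (2 <= d)%N) (dp : d%:R < p) (lamL : is_lebesgue lam).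
Let G := drift DA DC H.
Let B := divfree_drift A G DA rho Drho.
Hypotheses (aa : assumption_a lam A C DA DC H p)
  (inv : inf_invariant_density A G lam mu p rho Drho).
Local Notation K := (wcoef A rho).
Local Notation DK := (wcoefD A DA rho Drho).
Local Notation b := (wdrift A DA DC H rho Drho).

Let rc : continuous rho := rho_cont inv.
Let r0 x : 0 < rho x := rho_gt0 inv x.
Let rge0 x : 0 <= rho x := rho_ge0 inv x.
Let mrho : measurable_fun setT rho := rho_meas inv.
Let md : has_density lam mu rho := mu_density inv.

(** The density is positive everywhere, so a [mu]-null set is also [lam]-null. *)
Lemma ae_mu_lam (P : E -> Prop) : {ae mu, forall x, P x} -> {ae lam, forall x, P x}.
Proof.
move=> [N [mN N0 HN]].
have mre : measurable_fun N (EFin \o rho) by apply/measurable_EFinP; exact: measurable_funTS.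
have e0 : (\int[lam]_(x in N) `|(EFin \o rho) x| = 0)%E.
  rewrite -[RHS]N0 (md mN); apply: eq_integral => x _ /=; by rewrite ger0_norm.
have [N' [mN' N'0 HN']] := (ae_eq_integral_abs lam mN mre).1 e0.
exists N'; split => // x /= nP; apply: HN' => /= h.
have /h [rx] : N x by apply: HN.
by have := r0 x; rewrite rx ltxx.
Qed.

Variable r : R.
Let V : set E := cube r.
Let mV : measurable V. Proof. exact: meas_cube. Qed.

Lemma rho_lower : exists2 c, 0 < c & forall x, `|x| <= r -> c <= rho x.
Proof.
have ci : continuous (fun x => (rho x)^-1).
  by move=> x; apply: continuousV; [rewrite gt_eqF|exact: rc].
have [D D0 HD] := cont_ball_bounded r ci.
exists (D + 1)^-1; first by rewrite invr_gt0 ltr_wpDl.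
move=> x xr; rewrite -[leRHS]invrK lef_pV2 ?posrE ?invr_gt0 ?ltr_wpDl//.
apply: le_trans (ler_norm _) _; apply: le_trans (HD _ xr) _; by rewrite lerDl.
Qed.

Let in_V x : V x -> `|x| <= r. Proof. by move=> /ltW. Qed.

Lemma L2_lam_bound : exists2 c, 0 < c & forall f, measurable_fun V f ->
  (\int[lam]_x ((f x * \1_V x) ^+ 2)%:E <= c%:E * \int[mu]_(x in V) (f x ^+ 2)%:E)%E.
Proof.
have [c c0 Hc] := rho_lower; exists c^-1; first by rewrite invr_gt0.
move=> f mf; have mF := restr_meas mV mf.
have mF2 : measurable_fun setT (fun x => ((f x * \1_V x) ^+ 2)%:E).
  by apply/measurable_EFinP; exact: measurable_funX.
have -> : (\int[mu]_(x in V) (f x ^+ 2)%:E = \int[lam]_x (((f x * \1_V x) ^+ 2)%:E * (rho x)%:E))%E.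
  rewrite integral_mkcond -(ge0_integral_density mrho rge0 md)//.
  - apply: eq_integral => x _; rewrite patchE indicE; case: (_ \in _); rewrite ?mulr1 ?mulr0 ?expr0n//.
  - by move=> x; rewrite lee_fin sqr_ge0.
rewrite -ge0_integralZl//; last 3 first.
- by apply: emeasurable_funM => //; exact/measurable_EFinP.
- by move=> x _; rewrite mule_ge0// lee_fin ?sqr_ge0.
- by rewrite lee_fin invr_ge0 ltW.
apply: ge0_le_integral => //.
- by move=> x _; rewrite lee_fin sqr_ge0.
- by apply: measurable_funeM; apply: emeasurable_funM => //; exact/measurable_EFinP.
- move=> x _; rewrite -!EFinM lee_fin indicE; have [xV|xV] := boolP (x \in V); last first.
    by rewrite !mulr0 expr0n/= mul0r mulr0.
  rewrite mulr1 mulrCA -[leLHS]mulr1 ler_wpM2l ?sqr_ge0// ler_pdivlMl// mulr1.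
  by apply: Hc; apply: in_V; rewrite inE in xV.
Qed.

Lemma L2_lam f : L2 mu V f -> L2P lam (fun x => f x * \1_V x).
Proof.
move=> [mf f2]; have [c c0 Hc] := L2_lam_bound; have mF := restr_meas mV mf.
split => //; apply/integrableP; split; first by apply/measurable_EFinP; exact: measurable_funX.
apply: (@le_lt_trans _ _ (c%:E * \int[mu]_(x in V) (f x ^+ 2)%:E)%E).
  apply: le_trans (Hc f mf); apply: ge0_le_integral => //.
  - by apply/measurable_EFinP; apply: measurableT_comp => //; exact: measurable_funX.
  - by apply/measurable_EFinP; exact: measurable_funX.
  - by move=> x _; rewrite /= lee_fin ger0_norm// sqr_ge0.
by apply: lte_mul_pinfty => //; rewrite lee_fin ltW.
Qed.

Lemma L2_cvg_lam (fn : nat -> E -> R) f : (forall n, L2 mu V (fn n)) -> L2 mu V f ->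
  L2_cvg mu V fn f ->
  c2 lam (fun n x => fn n x * \1_V x) (fun x => f x * \1_V x).
Proof.
move=> Lfn Lf cf; split; [by move=> n; exact: L2_lam|exact: L2_lam|].
have [c c0 Hc] := L2_lam_bound.
apply/cvgr0Pnorm_le => e e0.
have ec : 0 < e ^+ 2 / c by rewrite divr_gt0// exprn_gt0.
have [h1 /cvgr0Pnorm_le h3] := (fine_cvgP _ _).1 cf.
near=> n; rewrite ger0_norm ?n2_ge0//.
have h : (\int[mu]_(x in V) ((fn n x - f x) ^+ 2)%:E <= (e ^+ 2 / c)%:E)%E.
  rewrite -[leLHS]fineK; last by near: n; exact: h1.
  by rewrite lee_fin; apply: le_trans (ler_norm _) _; near: n; exact: h3.
have mfn : measurable_fun V (fn n \- f).
  by apply: measurable_funB; [case: (Lfn n)|case: Lf].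
have Lq := L2B (L2_lam (Lfn n)) (L2_lam Lf).
rewrite -ler_sqr ?nnegrE ?n2_ge0 ?(ltW e0)// n2_sqr -lee_fin.
rewrite /Rintegral fineK; last by apply: integrable_fin_num => //; case: Lq.
apply: (@le_trans _ _ (c%:E * (e ^+ 2 / c)%:E)%E); last first.
  by rewrite -EFinM mulrCA divff ?mulr1// gt_eqF.
apply: le_trans (lee_wpmul2l _ h); last by rewrite lee_fin ltW.
apply: le_trans (Hc _ mfn); rewrite le_eqVlt; apply/orP; left; apply/eqP.
by apply: eq_integral => x _ /=; rewrite mulrBl.
Unshelve. all: by end_near. Qed.


(** Cutting off outside the cube makes the coefficients globally bounded; ellipticity is kept
    inside, and outside the quadratic form degenerates to 0. *)
Definition cubeK i j x := K i j x * \1_V x.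
Definition cubeb i x := b i x * \1_V x.

Let mI : measurable_fun setT (\1_V : E -> R). Proof. exact: measurable_indic. Qed.

Lemma wcoef_cont i j : continuous (K i j).
Proof. by move=> x; apply: continuousM; [exact: rc|exact: (A_cont aa)]. Qed.

Lemma cubeK_meas i j : measurable_fun setT (cubeK i j).
Proof. by apply: measurable_funM => //; apply: cont_meas; exact: wcoef_cont. Qed.

Lemma cubeK_bound : exists M, forall i j x, `|cubeK i j x| <= M.
Proof.
have H1 (ij : 'I_d * 'I_d) : exists D, 0 <= D /\ forall x, `|cubeK ij.1 ij.2 x| <= D.
  have [D D0 HD] := cont_ball_bounded r (@wcoef_cont ij.1 ij.2); exists D; split => // x.
  rewrite /cubeK indicE; have [xV|xV] := boolP (x \in V); last by rewrite mulr0 normr0.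
  by rewrite mulr1; apply: HD; apply: in_V; rewrite inE in xV.
have /choice[D HD] := H1; exists (\sum_ij D ij) => i j x.
apply: le_trans ((HD (i, j)).2 x) _; rewrite (bigD1 (i, j))//= lerDl.
by apply: sumr_ge0 => ij _; case: (HD ij).
Qed.

Lemma cubeK_elliptic : exists2 k, 0 < k & forall x (v : 'I_d -> R), V x ->
  k * \sum_i v i ^+ 2 <= \sum_i \sum_j cubeK i j x * v j * v i.
Proof.
have [c c0 Hc] := rho_lower.
have [[_ _ _ ell] _ _] := aa.
have [nu nu0 Hnu] := ell V (@cube_relatively_compact R d r).
exists (c * nu^-1); first by rewrite mulr_gt0 ?invr_gt0.
move=> x v Vx; have /andP[h _] := Hnu (\row_i v i) x Vx.
have e1 : enorm (\row_i v i : E) ^+ 2 = \sum_i v i ^+ 2.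
  rewrite /enorm sqr_sqrtr; last by apply: sumr_ge0 => i _; exact: sqr_ge0.
  by apply: eq_bigr => i _; rewrite mxE.
have -> : \sum_i \sum_j cubeK i j x * v j * v i =
    rho x * \sum_i \sum_j A x i j * (\row_i v i) 0 j * (\row_i v i) 0 i.
  rewrite mulr_sumr; apply: eq_bigr => i _; rewrite mulr_sumr; apply: eq_bigr => j _.
  by rewrite !mxE /cubeK /wcoef indicE mem_set// mulr1 (A_sym aa) !mulrA.
rewrite e1 in h; rewrite -mulrA; apply: ler_pM => //.
- exact: ltW.
- rewrite mulr_ge0 ?invr_ge0 ?(ltW nu0)//; apply: sumr_ge0 => i _; exact: sqr_ge0.
- by apply: Hc; exact: in_V.
Qed.

Lemma cubeK_pos x (v : 'I_d -> R) : 0 <= \sum_i \sum_j cubeK i j x * v j * v i.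
Proof.
have [xV|xV] := pselect (V x); last first.
  rewrite big1// => i _; rewrite big1// => j _.
  by rewrite /cubeK indicE memNset// mulr0 !mul0r.
have [k k0 Hk] := cubeK_elliptic; apply: le_trans (Hk x v xV).
by rewrite mulr_ge0 ?(ltW k0)//; apply: sumr_ge0 => i _; exact: sqr_ge0.
Qed.

Lemma cubeb_L2 i : L2P lam (cubeb i).
Proof. by case: (wdrift_L2l d2 dp lamL aa inv i) => _; exact. Qed.

Let cube_prod_ig i j u v : L2P lam u -> L2P lam v -> ig lam (fun x => cubeK i j x * u x * v x).
Proof.
move=> Lu Lv; have [M HM] := cubeK_bound; apply: L2_mul => //.
exact: (L2_mulb (cubeK_meas i j) (HM i j)).
Qed.

Lemma form0E u v : tst u -> tst v -> form0 mu A V u v =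
  2^-1 * \int[lam]_x (\sum_i \sum_j cubeK i j x * partial j u x * partial i v x).
Proof.
move=> tu tv; rewrite /form0 Rintegral_mkcond; congr (_ * _).
pose F x := \sum_i \sum_j cubeK i j x * partial j u x * partial i v x.
have Fi : ig lam F.
  apply: ig_sum => i; apply: ig_sum => j.
  exact: (cube_prod_ig i j (tst_L2 lamL (tst_partial j tu)) (tst_L2 lamL (tst_partial i tv))).
set g := _ \_ V.
rewrite -/F; have gE : F = (fun x => rho x * g x).
  apply/funext => x; rewrite /g patch_indic /F mulrA mulr_sumr mulr_suml.
  apply: eq_bigr => i _; rewrite mulr_sumr mulr_suml; apply: eq_bigr => j _.
  rewrite /cubeK /wcoef (A_sym aa).
  by move: (rho x) (A x i j) (\1_V x : R) (partial j u x) (partial i v x); clear; move=> *; ring.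
have mg : measurable_fun setT g.
  rewrite (_ : g = (fun x => (rho x)^-1 * F x)); last first.
    by apply/funext => x; rewrite gE mulKf// gt_eqF.
  apply: measurable_funM; last exact: ig_meas Fi.
  by apply: cont_meas => x; apply: continuousV; [rewrite gt_eqF|exact: rc].
rewrite (Rint_density mrho rge0 md); first by rewrite gE.
by apply/(ig_density mrho rge0 md mg); rewrite -gE.
Qed.

Let tstin_restr v : tstin r v -> (fun x => v x * \1_V x) = v.
Proof.
move=> [_ [s sr vv]]; apply/funext => x; rewrite indicE.
have [xV|xV] := boolP (x \in V); first by rewrite mulr1.
rewrite mulr0 vv//; apply: lt_le_trans sr _; rewrite leNgt; apply: contra xV => h.
exact/mem_set.
Qed.

Lemma tstin_L2 v : tstin r v -> L2 mu V v.
Proof.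
move=> tv; have tv' := tstin_tst tv; have mv := tst_meas tv'.
split; first exact: measurable_funTS.
have Lv := tst_L2 lamL tv'; have [C0 _ HC] := cont_ball_bounded r rc.
have i1 : ig lam (fun x => rho x * (v x ^+ 2)).
  have [D D0 HD] := tst_bounded tv'; have [sv [s vs]] := tv'.
  have := L2l_tst_ig lamL (L2l_cont lamL rc) (tstMr tv' sv).
  by under eq_fun do rewrite -expr2.
rewrite integral_mkcond; apply: (@le_lt_trans _ _ (\int[mu]_x (v x ^+ 2)%:E)%E).
  apply: ge0_le_integral => //.
  - by move=> x _; rewrite patchE; case: ifP => //; rewrite lee_fin sqr_ge0.
  - apply/(measurable_restrict _ mV measurableT); apply: measurable_funTS.
    by apply/measurable_EFinP; exact: measurable_funX.
  - by apply/measurable_EFinP; exact: measurable_funX.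
  - by move=> x _; rewrite patchE; case: ifP => // _; rewrite lee_fin sqr_ge0.
have m2 : measurable_fun setT (fun x => v x ^+ 2) by exact: measurable_funX.
have /integrableP[_] := (ig_density mrho rge0 md m2).2 i1.
by under eq_integral do rewrite /= ger0_norm ?sqr_ge0//.
Qed.

Lemma form_approx_cst v : tstin r v -> form_approx mu A V v (fun=> v).
Proof.
move=> tv; have [sv [s sr vs]] := tv; split.
- exact: tstin_L2.
- by move=> _; exact/tstin_test.
- rewrite /L2_cvg; under eq_fun do under eq_integral do rewrite subrr expr0n.
  by rewrite integral0; exact: cvg_cst.
- move=> e e0; exists 0%N => n m _ _.
  have -> : v \- v = (fun=> 0) by apply/funext => x /=; rewrite subrr.
  rewrite form0E; [|exact: tst0..].
  rewrite [X in _ * X](_ : _ = 0) ?mulr0//.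
  transitivity (\int[lam]_(x in setT) (0 : R)); last by rewrite Rintegral_cst// mul0r.
  by apply: eq_Rintegral => x _; rewrite big1// => i _; rewrite big1// => j _; rewrite !partial_cst !mulr0.
Qed.

(** Completeness of L^2 is avoided: the candidate [Dw] for the limit of the Cauchy sequence of
    derivatives is already there. Pairing with a test function passes to the limit in [m] after
    integration by parts, and the resulting bound of all pairings gives the bound of the norm, since
    test functions of the cube are dense. *)
Lemma weak_small i (w Dw : E -> R) (un : nat -> E -> R) (e : R) (N n : nat) :
  L2P lam Dw -> (forall x, ~ V x -> Dw x = 0) -> (forall n, tstin r (un n)) ->
  c2 lam un w -> 
  (forall phi, tstin r phi -> \int[lam]_x (w x * partial i phi x) = - \int[lam]_x (Dw x * phi x)) ->
  0 <= e -> (N <= n)%N ->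
  (forall m, (N <= m)%N -> n2 lam (partial i (un n) \- partial i (un m)) <= e) ->
  n2 lam (partial i (un n) \- Dw) <= e.
Proof.
move=> LD vD tu cu wk e0 Nn Hc.
have Lp m : L2P lam (partial i (un m)).
  by apply: (tst_L2 lamL); apply: tst_partial; exact: tstin_tst (tu m).
pose g := partial i (un n) \- Dw; have Lg : L2P lam g by exact: L2B.
have vg x : ~ cube r x -> g x = 0.
  move=> xV; rewrite /g/= vD// subr0; have [_ [s sr vs]] := tu n.
  by rewrite (vanish_partial i vs)//; apply: lt_le_trans sr _; rewrite leNgt; apply/negP.
have H1 phi : tstin r phi -> `|\int[lam]_x (g x * phi x)| <= e * n2 lam phi.
  move=> tp; have tp' := tstin_tst tp.
  have Lphi := tst_L2 lamL tp'; have Ldphi := tst_L2 lamL (tst_partial i tp').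
  have c1' := c1_int (c2_mul cu (c2_cst Ldphi)).
  have e1 m : \int[lam]_x (un m x * partial i phi x) = - \int[lam]_x (partial i (un m) x * phi x).
    by apply: (int_by_parts lamL) => //; case: (tu m).
  have c2' : \int[lam]_x (partial i (un m) x * phi x) @[m --> \oo] --> \int[lam]_x (Dw x * phi x).
    have := cvg_opp_seq c1'; rewrite wk// opprK.
    by under eq_fun do rewrite e1 opprK.
  have c3 : `|\int[lam]_x (partial i (un n) x * phi x) - \int[lam]_x (partial i (un m) x * phi x)| @[m --> \oo] -->
      `|\int[lam]_x (partial i (un n) x * phi x) - \int[lam]_x (Dw x * phi x)|.
    by apply: cvg_norm; apply: cvgB => //; exact: cvg_cst.
  have -> : \int[lam]_x (g x * phi x) =
      \int[lam]_x (partial i (un n) x * phi x) - \int[lam]_x (Dw x * phi x).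
    rewrite -RintegralB//; [|exact: L2_mul..].
    by apply: eq_Rintegral => x _; rewrite /g/= mulrBl.
  rewrite -(cvg_lim _ c3)//; apply: limr_le; first exact: cvgP c3.
  exists N => // m Nm; rewrite -RintegralB//; [|exact: L2_mul..].
  have := CS (L2B (Lp n) (Lp m)) Lphi.
  have -> : \int[lam]_x ((partial i (un n) \- partial i (un m)) x * phi x) =
      \int[lam]_x (partial i (un n) x * phi x - partial i (un m) x * phi x).
    by apply: eq_Rintegral => x _ /=; rewrite mulrBl.
  by move=> h; apply: le_trans h _; rewrite ler_wpM2r ?n2_ge0//; exact: Hc.
have [->|g0] := eqVneq (n2 lam g) 0; first exact: e0.
have gp : 0 < n2 lam g by rewrite lt_neqAle eq_sym g0 n2_ge0.
apply/ler_addgt0Pr => del del0.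
have D0 : 0 < n2 lam g + e + 1 by rewrite ltr_wpDl// addr_ge0 ?n2_ge0.
(* Duality with a test function so close to [g] that the pairing nearly equals the square of the
   norm of [g]. *)
have [phi tp hp] := dens_L2 lamL Lg vg (mulr_gt0 gp (divr_gt0 del0 D0)).
have Lphi := tst_L2 lamL (tstin_tst tp).
have I2 : n2 lam g ^+ 2 = \int[lam]_x (g x * phi x) + \int[lam]_x (g x * (g \- phi) x).
  rewrite n2_sqr -RintegralD//; [|exact: L2_mul|by apply: L2_mul => //; exact: L2B].
  by apply: eq_Rintegral => x _ /=; rewrite -mulrDr addrC subrK expr2.
have B1 := le_trans (ler_norm _) (H1 phi tp).
have B2 := le_trans (ler_norm _) (CS Lg (L2B Lg Lphi)).
have B3 : n2 lam phi <= n2 lam g + n2 lam (g \- phi).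
  have := n2B Lg (L2B Lg Lphi); congr (_ <= _); apply: n2_eq => x /=.
  by rewrite opprB addrC subrK.
exact: (duality_alg gp e0 (n2_ge0 _ _) del0 I2 B1 B2 B3 hp).
Qed.


(** Translates the local operator into data on the whole space with Lebesgue measure. Ellipticity
    turns a sequence that is Cauchy in energy into one with L^2-Cauchy gradients, and [weak_small]
    identifies the limit with the weak gradient that [local_op] supplies. *)
Lemma local_data u g : local_op lam mu A B V u g ->
  exists (wn : nat -> E -> R) (Dw : 'I_d -> E -> R) (f0 : E -> R),
  [/\ L2P lam f0, forall n, tstin r (wn n), c2 lam wn (fun x => u x * \1_V x),
      forall i, c2 lam (fun n => partial i (wn n)) (Dw i) &
      [/\ forall v, tstin r v ->
            2^-1 * \int[lam]_x (\sum_i \sum_j cubeK i j x * Dw j x * partial i v x) =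
            - \int[lam]_x (f0 x * v x),
          vanish r f0, forall i x, ~ V x -> Dw i x = 0,
          {ae lam, forall x, rho x * (g x * \1_V x) = f0 x + \sum_i cubeb i x * Dw i x} &
          L2P lam (fun x => u x * \1_V x)]].
Proof.
move=> [f [Du [[Lf [un [[Lu tun cun Cun] Hun]]] bu HDu ae]]].
have tn n : tstin r (un n) by apply/tstin_test.
have tn' n : tst (un n) := tstin_tst (tn n).
have offV (h : E -> R) x : ~ V x -> h x * \1_V x = 0 by move=> xV; rewrite indicE memNset// mulr0.
have notV x : r < `|x| -> ~ V x by move=> xr; rewrite /V /cube/= => /(lt_trans xr); rewrite ltxx.
pose Dw i x := Du i x * \1_V x.
pose f0 x := rho x * (f x * \1_V x).
have LDw i : L2P lam (Dw i) by apply: L2_lam; case: (HDu i).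
have Lf0 : L2P lam f0.
  have [C0 C00 HC] := cont_ball_bounded r rc.
  have := @L2_mulb _ _ _ lam (fun x => rho x * \1_V x) _ C0 _ _ (L2_lam Lf).
  rewrite (_ : (fun x => _ * _ * _) = f0).
    apply; first exact: measurable_funM.
    move=> x; rewrite indicE; have [xV|xV] := boolP (x \in V); last by rewrite mulr0 normr0.
    by rewrite mulr1; apply: HC; apply: in_V; rewrite inE in xV.
  apply/funext => x; rewrite /f0 indicE; case: (_ \in _); rewrite ?mulr1// !mulr0//.
have cw : c2 lam un (fun x => u x * \1_V x).
  have := L2_cvg_lam (fun n => tstin_L2 (tn n)) Lu cun.
  rewrite (_ : (fun (n : nat) x => un n x * \1_V x) = un)//.
  by apply/funext => n; exact: tstin_restr.
have wk i phi : tstin r phi -> \int[lam]_x (u x * \1_V x * partial i phi x) =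
    - \int[lam]_x (Dw i x * phi x).
  move=> /tstin_test tp; have [_ w] := HDu i; have := w _ tp.
  rewrite Rintegral_mkcond [X in _ = - X]Rintegral_mkcond => h.
  transitivity (\int[lam]_x ((fun x => u x * partial i phi x) \_ V) x).
    by apply: eq_Rintegral => x _; rewrite patch_indic mulrAC.
  rewrite h; congr (- _); apply: eq_Rintegral => x _.
  by rewrite patch_indic /Dw mulrAC.
have [k k0 Hk] := cubeK_elliptic.
have cauchy i (e : R) : 0 < e -> exists N : nat, forall n m : nat, (N <= n)%N -> (N <= m)%N ->
    n2 lam (partial i (un n) \- partial i (un m)) <= e.
  move=> e0; have ke : 0 < 2^-1 * (k * e ^+ 2) by rewrite mulr_gt0 ?invr_gt0// mulr_gt0 ?exprn_gt0.
  have [N HN] := Cun _ ke; exists N => n m Nn Nm; have := HN n m Nn Nm.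
  have tD := tstB (tn' n) (tn' m); rewrite form0E// ltr_pM2l ?invr_gt0// => h.
  have pE : partial i (un n) \- partial i (un m) = partial i (un n \- un m).
    apply/funext => x; rewrite partialB//.
      by apply: smooth_derivable; case: (tn' n).
    by apply: smooth_derivable; case: (tn' m).
  rewrite pE; have Lp l := tst_L2 lamL (tst_partial l tD).
  rewrite -ler_sqr ?nnegrE ?n2_ge0 ?(ltW e0)// n2_sqr -(ler_pM2l k0).
  apply: le_trans (ltW h); rewrite -RintegralZl//; last by case: (Lp i).
  apply: le_Rintegral => //; first by apply: igZ; case: (Lp i).
    by apply: ig_sum => i'; apply: ig_sum => j; exact: cube_prod_ig.
  move=> x _; have [xV|xV] := pselect (V x).
    apply: le_trans (Hk x (fun l => partial l (un n \- un m) x) xV).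
    rewrite ler_pM2l// (bigD1 i)//= lerDl; apply: sumr_ge0 => l _; exact: sqr_ge0.
  have -> : partial i (un n \- un m) x = 0.
    have [_ [s sr vs]] := tn n; have [_ [s' sr' vs']] := tn m.
    have rx : r <= `|x| by rewrite leNgt; apply/negP.
    rewrite -pE /= (vanish_partial i vs) ?(vanish_partial i vs') ?subr0//.
      exact: lt_le_trans sr' rx.
    exact: lt_le_trans sr rx.
  by rewrite expr0n mulr0; exact: cubeK_pos.
have cD i : c2 lam (fun n => partial i (un n)) (Dw i).
  split => //; first by move=> n; apply: (tst_L2 lamL); exact: tst_partial.
  apply/cvgr0Pnorm_le => e e0; have [N HN] := cauchy i e e0.
  exists N => // n Nn; rewrite ger0_norm ?n2_ge0//.
  apply: (weak_small (LDw i) _ tn cw (wk i) (ltW e0) Nn).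
    by move=> x xV; exact: offV.
  by move=> m Nm; exact: HN.
exists un, Dw, f0; split => //; split.
- move=> v tv; have tv' := tstin_tst tv.
  (* The constant sequence approximates a test function in the form domain, which makes the defining
     identity of the generator available for it. *)
  have h1 := Hun v (fun=> v) (form_approx_cst tv).
  have h2 : form0 mu A V (un n) v @[n --> \oo] -->
      2^-1 * \int[lam]_x (\sum_i \sum_j cubeK i j x * Dw j x * partial i v x).
    rewrite (_ : (fun n => _) = (fun n => 2^-1 * \int[lam]_x (\sum_i \sum_j
        cubeK i j x * partial j (un n) x * partial i v x))); last first.
      by apply/funext => n; rewrite form0E.
    apply: cvgMr; apply: c1_int; apply: c1_sum => i; apply: c1_sum => j.
    have [M HM] := cubeK_bound.
    apply: c2_mul; first exact: (c2_mulb (cubeK_meas i j) (HM i j)).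
    by apply: c2_cst; apply: (tst_L2 lamL); exact: tst_partial.
  rewrite -(cvg_lim _ h2)// (cvg_lim _ h1)//; congr (- _).
  rewrite Rintegral_mkcond.
  have -> : \int[lam]_x (f0 x * v x) = \int[lam]_x (rho x * (((fun x => f x * v x) \_ V) x)).
    apply: eq_Rintegral => x _; rewrite patch_indic /f0 -mulrA; congr (_ * _).
    by rewrite mulrAC.
  have Lv := tst_L2 lamL tv'.
  have i1 : ig lam (fun x => rho x * (((fun x => f x * v x) \_ V) x)).
    have := L2_mul Lf0 Lv; congr ig; apply/funext => x.
    by rewrite patch_indic /f0 -mulrA; congr (_ * _); rewrite mulrAC.
  have mfv : measurable_fun setT ((fun x => f x * v x) \_ V).
    rewrite (_ : _ \_ V = (fun x => f x * \1_V x * v x)); last first.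
      by apply/funext => x; rewrite patch_indic mulrAC.
    apply: measurable_funM; last exact: tst_meas.
    by apply: restr_meas => //; case: Lf.
  by rewrite (Rint_density mrho rge0 md)//; apply/(ig_density mrho rge0 md mfv).
- by move=> x xr; rewrite /f0 offV ?mulr0//; exact: notV.
- by move=> i x xV; exact: offV.
- have := ae_mu_lam ae; apply: filterS => x h.
  have [xV|xV] := pselect (V x); last first.
    rewrite offV// /f0 offV// !mulr0 add0r big1// => i _.
    by rewrite /Dw offV// mulr0.
  have e1 : \1_V x = 1 :> R by rewrite indicE mem_set.
  rewrite e1 mulr1 h// mulrDr /f0 e1 mulr1; congr (_ + _).
  rewrite mulr_sumr; apply: eq_bigr => i _.
  by rewrite /cubeb /Dw e1 !mulr1 mulrA (wdriftE inv).
- exact: L2_lam.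
Qed.


Lemma L1_restr f : L1 mu V f -> ig mu (fun x => f x * \1_V x).
Proof. by move=> /(integrable_mkcond _ mV); rewrite patch_indicE. Qed.

Lemma n1_alg (a b c e x y z w : R) : x <= y + (z + w) -> w <= a - b + c -> y <= e -> z <= e ->
  c <= e -> x <= a - b + 3 * e.
Proof. lra. Qed.

Lemma cube_step u g e : local_op lam mu A B V u g -> L1 mu V g -> 0 < e ->
  let W x := u x * \1_V x in let F x := (u x - g x) * \1_V x in
  exists2 phi, tst phi &
    n1 mu (fun x => phi x - Lop A G phi x - F x) <= n1 mu F - n1 mu W + e.
Proof.
move=> lo g1 e0 W F; have gi := L1_restr g1; have mgi := ig_meas gi.
have [wn [Dw [f0 [Lf0 tn cw cD [eqw vf0 vD ae LW]]]]] := local_data lo.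
have [eta etaM] := mollifier_exists lamL.
have [M HM] := cubeK_bound.
have notV x : r < `|x| -> ~ V x by move=> xr; rewrite /V /cube/= => /(lt_trans xr); rewrite ltxx.
have vD' i : vanish r (Dw i) by move=> x /notV; exact: vD.
have vW : vanish r W by move=> x /notV xV; rewrite /W indicE memNset// mulr0.
have LD i : L2P lam (Dw i) by case: (cD i).
have rl : L2l lam rho := L2l_cont lamL rc.
have eqb v : tstin r v -> \int[lam]_x (\sum_i cubeb i x * partial i v x) = 0.
  move=> tv; have [sv [s sr vs]] := tv.
  rewrite -[RHS](wdrift_divfree d2 dp lamL aa inv (tstin_tst tv)).
  apply: eq_Rintegral => x _; apply: eq_bigr => i _; rewrite /cubeb.
  have [xV|xV] := pselect (V x); first by rewrite indicE mem_set// mulr1.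
  rewrite (vanish_partial i vs) ?mulr0//; apply: lt_le_trans sr _.
  by rewrite leNgt; apply/negP.
have rr x (h : E -> R) : vanish r h -> rho x * h x = rho x * \1_(cube (r + 2)) x * h x.
  move=> vh; have [xr|xr] := leP `|x| r; last by rewrite vh// !mulr0.
  by rewrite indicE mem_set ?mulr1// /cube/=; apply: le_lt_trans xr _; rewrite ltrDl.
have wi : ig lam (fun x => rho x * W x).
  under eq_fun do rewrite (rr _ W vW).
  by apply: L2_mul => //; case: rl => _; exact.
have f0i : ig lam f0 := vanish_ig lamL Lf0 vf0.
pose g' x := f0 x + \sum_i cubeb i x * Dw i x.
have g'i : ig lam g' by apply: igD => //; apply: ig_sum => i; apply: L2_mul => //; exact: cubeb_L2.
pose q x := \sum_i \sum_j cubeK i j x * Dw j x * Dw i x.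
(* One third each for the remainder of the truncation, the mollified operator and the mollified
   function. *)
have e3 : 0 < e / 3 by rewrite divr_gt0.
have [n0 hn0] := cvg_below e3 (residual_remainder cw mrho wi).
set m := n0.+1%:R in hn0.
have m0 : 0 < m by [].
pose gm x := g' x * trunc' m (W x) + 2^-1 * (q x * trunc'' m (W x)).
have [gmi res] : ig lam gm /\ n1 lam (fun x => rho x * trunc m (W x) - gm x - (rho x * W x - g' x)) <=
    n1 lam (fun x => rho x * W x - g' x) - n1 lam (fun x => rho x * W x) +
    (n1 lam (fun x => rho x * trunc m (W x) - rho x * W x * trunc' m (W x)) +
    n1 lam (fun x => rho x * W x * (1 - trunc' m (W x)))).
  exact: (truncated_residual cubeK_meas HM cubeK_pos cubeb_L2 Lf0 tn cw cD eqw eqb mrho rge0 wi m0 f0i).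
pose z x := trunc m (W x).
have mW : measurable_fun setT W by case: LW.
have mz : measurable_fun setT z.
  apply: (measurableT_comp _ mW); apply: (@lip_meas R (trunc m) 1); exact: trunc_lip.
have Lz : L2P lam z by apply: (L2_le mz _ LW) => x; exact: norm_trunc_le.
have vz : vanish r z by move=> x xr; rewrite /z vW// /trunc mul0r.
pose Z i x := trunc' m (W x) * Dw i x.
have mt : measurable_fun setT (fun x => trunc' m (W x)).
  by have [D HD] := trunc'_lip m; exact: (measurableT_comp (lip_meas HD) mW).
have HZ i : L2P lam (Z i) /\ vanish r (Z i).
  split; last by move=> x xr; rewrite /Z vD'// mulr0.
  by apply: (L2_mulb mt _ (LD i)) => x; exact: norm_trunc'_le1.
have wz i : weak_partial lam setT i z (Z i).
  exact: (truncated_gradient lamL tn cw cD).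
have weq phi : tst phi ->
    2^-1 * \int[lam]_x (\sum_i \sum_j K i j x * Z j x * partial i phi x)
    - \int[lam]_x (\sum_i b i x * Z i x * phi x) = - \int[lam]_x (gm x * phi x).
  move=> tp; rewrite -(truncated_equation lamL cubeK_meas HM cubeb_L2 Lf0 tn cw cD eqw m tp).
  congr (2^-1 * _ - _); apply: eq_Rintegral => x _.
    apply: eq_bigr => i _; apply: eq_bigr => j _; congr (_ * _); rewrite /cubeK -[trunc' _ _ * _]/(Z j x).
    have [xV|xV] := pselect (V x); first by rewrite indicE mem_set// mulr1.
    by rewrite /Z vD// !mulr0.
  apply: eq_bigr => i _; congr (_ * _); rewrite /cubeb -[trunc' _ _ * _]/(Z i x).
  have [xV|xV] := pselect (V x); first by rewrite indicE mem_set// mulr1.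
  by rewrite /Z vD// !mulr0.
have cL := mollified_equation lamL etaM (wcoef_H1l d2 dp lamL aa inv) (wdrift_L2l d2 dp lamL aa inv)
  Lz vz HZ gmi wz weq.
have cz : c1 lam (fun n x => rho x * \1_(cube (r + 2)) x * mo lam eta (en n) z x)
    (fun x => rho x * \1_(cube (r + 2)) x * z x).
  by apply: c2_mul; [apply: c2_cst; case: rl => _; exact|exact: (mo_c2 lamL etaM Lz vz)].
have zi := vanish_ig lamL Lz vz.
have [_ _ cL'] := cL; have [_ _ cz'] := cz.
have [n hn] := cvg_below2 e3 cL' cz'.
have en0 := @en_gt0 R n.
pose phi := mo lam eta (en n) z.
have tphi : tst phi by exact: (mo_tst etaM en0 zi vz).
exists phi => //.
have vphi : vanish (r + 1) phi.
  by apply: vanishW (mo_vanish etaM en0 vz); rewrite lerD2l en_le1.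
have mLp : measurable_fun setT (Lop A G phi).
  exact: (ig_meas (Lop_ig d2 dp lamL aa inv tphi)).
have mphi := tst_meas tphi.
have mF : measurable_fun setT F.
  rewrite (_ : F = W \- (fun x => g x * \1_V x)); first exact: measurable_funB.
  by apply/funext => x; rewrite /F/= mulrBl.
rewrite !(n1_density mrho rge0 md)//; last first.
  by apply: measurable_funB => //; exact: measurable_funB.
have aeF : {ae lam, forall x, rho x * F x = rho x * W x - g' x}.
  apply: filterS ae => x h; rewrite /g' -h -mulrBr; congr (_ * _).
  by rewrite /F /W mulrBl.
have mrF : measurable_fun setT (fun x => rho x * F x) by exact: measurable_funM.
have mrW : measurable_fun setT (fun x => rho x * W x - g' x).
  by apply: measurable_funB; [exact: (ig_meas wi)|exact: (ig_meas g'i)].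
have -> : n1 lam (fun x => rho x * F x) = n1 lam (fun x => rho x * W x - g' x).
  exact: n1_ae.
have -> : n1 lam (fun x => rho x * (phi x - Lop A G phi x - F x)) =
   n1 lam (fun x => rho x * phi x - rho x * Lop A G phi x - (rho x * W x - g' x)).
  apply: n1_ae.
  - by apply: measurable_funM => //; apply: measurable_funB => //; exact: measurable_funB.
  - apply: measurable_funB => //; apply: measurable_funB; exact: measurable_funM.
  - by apply: filterS aeF => x <-; rewrite !mulrBr.
have rpE x : rho x * phi x = rho x * \1_(cube (r + 2)) x * phi x.
  have [xr|xr] := leP `|x| (r + 1); last by rewrite vphi// !mulr0.
  by rewrite indicE mem_set ?mulr1// /cube/=; apply: le_lt_trans xr _; rewrite ltrD2l ltrDl.
pose T1 x := rho x * phi x - rho x * z x.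
pose T2 x := rho x * Lop A G phi x - gm x.
pose T3 x := rho x * trunc m (W x) - gm x - (rho x * W x - g' x).
have [iL _ _] := cL; have [iz iz' _] := cz.
have E2 : T2 = ((fun x => 2^-1 * (\sum_i \sum_j K i j x * partial i (partial j phi) x) +
    \sum_j (2^-1 * (\sum_i DK i j i x) + b j x) * partial j phi x) \- gm).
  by apply/funext => x; rewrite /T2 (LopE rho Drho aa).
have E1 : T1 = ((fun x => rho x * \1_(cube (r + 2)) x * phi x) \-
    (fun x => rho x * \1_(cube (r + 2)) x * z x)).
  by apply/funext => x; rewrite /T1 rpE (rr x z vz).
have i1 : ig lam T1 by rewrite E1; exact: (igB (iz n) iz').
have i2 : ig lam T2 by rewrite E2; exact: (igB (iL n) gmi).
have i3 : ig lam T3.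
  apply: (igB (igB _ gmi) (igB wi g'i)).
  by have := iz'; congr ig; apply/funext => x; rewrite -rr.
have -> : (fun x => rho x * phi x - rho x * Lop A G phi x - (rho x * W x - g' x)) =
    T1 \+ ((fun x => - T2 x) \+ T3).
  apply/funext => x; rewrite /T1 /T2 /T3 /z /=.
  by move: (rho x * phi x) (rho x * Lop A G phi x) (rho x * W x) (g' x) (gm x)
    (rho x * trunc m (W x)); clear; move=> *; ring.
have B1 := le_trans (n1D i1 (igD (igN i2) i3)) (lerD (lexx _) (n1D (igN i2) i3)).
rewrite n1N in B1.
have h2 : n1 lam T2 + n1 lam T1 < e / 3 by rewrite E1 E2.
have p1 := n1_ge0 lam T1; have p2 := n1_ge0 lam T2.
have -> : e = 3 * (e / 3) by rewrite mulrC divfK.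
apply: (n1_alg B1 res).
- by apply: le_trans (ltW h2); rewrite lerDr.
- by apply: le_trans (ltW h2); rewrite lerDl.
- exact: ltW.
Qed.

End CubeData.

Lemma Lop_alg (R : realType) (a b c e : R) :
  2^-1 * (a - b) + (c - e) = 2^-1 * a + c - (2^-1 * b + e).
Proof. lra. Qed.

Section CoreDensity.
Context {R : realType} {d : nat}.
Local Notation E := 'rV[R]_d.
Implicit Types (f g u v phi : E -> R) (x : E) (i j l : 'I_d).
Variables (p : R) (lam mu : {measure set E -> \bar R}).
Variables (A C : E -> 'M[R]_d) (DA DC : 'I_d -> 'I_d -> 'I_d -> E -> R)
  (H : 'I_d -> E -> R) (rho : E -> R) (Drho : 'I_d -> E -> R).
Hypotheses (d2 : (2 <= d)%N) (dp : d%:R < p) (lamL : is_lebesgue lam).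
Let G := drift DA DC H.
Let B := divfree_drift A G DA rho Drho.
Let L := Lop A G.
Hypotheses (aa : assumption_a lam A C DA DC H p)
  (inv : inf_invariant_density A G lam mu p rho Drho).
Variable T : R -> (E -> R) -> E -> R.
Hypothesis HT : L1_semigroup_of lam mu A G B T.
Hypothesis HI : forall t f, 0 < t -> ig mu f -> \int[mu]_x T t f x = \int[mu]_x f x.

Lemma Lop_sub u v : tst u -> tst v -> L (u \- v) = L u \- L v.
Proof.
move=> [su _] [sv _]; apply/funext => x; rewrite /L /Lop /=.
have e1 i : partial i (u \- v) = partial i u \- partial i v.
  by apply/funext => y; apply: partialB; exact: smooth_derivable.
have e2 i j : partial i (partial j (u \- v)) x = partial i (partial j u) x - partial i (partial j v) x.
  by rewrite e1; apply: partialB; apply: smooth_derivable; exact: smooth_partial.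
pose a := \sum_i \sum_j A x i j * partial i (partial j u) x.
pose b := \sum_i \sum_j A x i j * partial i (partial j v) x.
pose c := \sum_i G i x * partial i u x; pose e := \sum_i G i x * partial i v x.
have S1 : \sum_i \sum_j A x i j * partial i (partial j (u \- v)) x = a - b.
  rewrite /a /b -sumrB; apply: eq_bigr => i _; rewrite -sumrB; apply: eq_bigr => j _.
  by rewrite e2 mulrBr.
have S2 : \sum_i G i x * partial i (u \- v) x = c - e.
  by rewrite /c /e -sumrB; apply: eq_bigr => i _; rewrite e1 mulrBr.
exact: (etrans (congr2 (fun s t => 2^-1 * s + t) S1 S2) (Lop_alg a b c e)).
Qed.

Lemma ereal_right_small (F : R -> \bar R) (e : R) : 0 < e ->
  F t @[t --> 0^'+] --> (0 : \bar R) -> \forall t \near 0^'+, (F t <= e%:E)%E.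
Proof.
move=> e0 h; have [h1 /cvgr0Pnorm_le h2] := (fine_cvgP _ _).1 h.
near=> t; rewrite -[leLHS]fineK; last by near: t; exact: h1.
by rewrite lee_fin; apply: le_trans (ler_norm _) _; near: t; exact: h2.
Unshelve. all: by end_near. Qed.

Let sg : subMarkov_C0_contraction_semigroup mu T. Proof. by case: HT. Qed.

Lemma T_ig t f : 0 < t -> ig mu f -> ig mu (T t f).
Proof. by case: sg => h *; exact: h. Qed.

Lemma T_contr t f : 0 < t -> ig mu f -> n1 mu (T t f) <= n1 mu f.
Proof.
move=> t0 fi; have [_ _ _ _ [h _ _]] := sg.
by rewrite -lee_fin !n1_E//; [exact: h|exact: T_ig].
Qed.

Let quot_ig t u g : 0 < t -> ig mu u -> ig mu g ->
  ig mu (fun x => t^-1 * (T t u x - u x) - g x).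
Proof. by move=> t0 ui gi; apply: igB => //; apply: igZ; apply: igB => //; exact: T_ig. Qed.

Lemma generator_near u g (e : R) : L1_generator mu T u g -> 0 < e ->
  \forall t \near 0^'+, n1 mu (fun x => t^-1 * (T t u x - u x) - g x) <= e.
Proof.
move=> [ui gi h] e0; near=> t; have t0 : 0 < t by near: t; exact: nbhs_right_gt.
rewrite -lee_fin n1_E; last exact: quot_ig.
by near: t; exact: ereal_right_small.
Unshelve. all: by end_near. Qed.

(** Conservation of mass: each difference quotient of the semigroup has mean 0. *)
Lemma generator_mean u g : L1_generator mu T u g -> \int[mu]_x g x = 0.
Proof.
move=> ug; have [ui gi _] := ug; apply/eqP; rewrite -normr_le0.
apply/ler_addgt0Pr => e e0; rewrite add0r.
have [t [t0 ht]] : exists t, 0 < t /\ n1 mu (fun x => t^-1 * (T t u x - u x) - g x) <= e.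
  apply: (@filter_ex _ (0^'+ : set_system R)); near=> t; split; near: t.
    exact: nbhs_right_gt.
  exact: generator_near.
apply: le_trans ht; apply: le_trans _ (norm_Rint_le (quot_ig t0 ui gi)).
rewrite RintegralB//; last by apply: igZ; apply: igB => //; exact: T_ig.
rewrite RintegralZl//; last by apply: igB => //; exact: T_ig.
rewrite RintegralB//; last exact: T_ig.
by rewrite HI// subrr mulr0 sub0r normrN.
Unshelve. all: by end_near. Qed.

(** Up to a small error, (1 + 1/t)(u - v) equals T_t(u - v)/t + ((u - v) - (g - k)) for small t.
    Contractivity bounds the first term by ||u - v||/t, which cancels against the left-hand side. *)
Lemma dissipative u g v k : L1_generator mu T u g -> L1_generator mu T v k ->
  n1 mu (u \- v) <= n1 mu ((u \- v) \- (g \- k)).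
Proof.
move=> ug vk; have [ui gi _] := ug; have [vi ki _] := vk.
apply/ler_addgt0Pr => e e0; have e2 : 0 < e / 2 by rewrite divr_gt0.
have [t [t0 [h1 h2]]] : exists t, 0 < t /\
    (n1 mu (fun x => t^-1 * (T t u x - u x) - g x) <= e / 2 /\
     n1 mu (fun x => t^-1 * (T t v x - v x) - k x) <= e / 2).
  apply: (@filter_ex _ (0^'+ : set_system R)); near=> t; split; [|split]; near: t.
  - exact: nbhs_right_gt.
  - exact: generator_near.
  - exact: generator_near.
have Tui := T_ig t0 ui; have Tvi := T_ig t0 vi.
have i1 := quot_ig t0 ui gi; have i2 := quot_ig t0 vi ki.
have wi := igB ui vi.
have Tw : n1 mu (T t u \- T t v) <= n1 mu (u \- v).
  have [_ lin _ _ _] := sg; have := lin t v u (-1) t0 vi ui.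
  have wi' : ig mu (fun y => -1 * v y + u y) by apply: igD => //; exact: igZ.
  move=> ae; have := T_contr t0 wi'.
  rewrite (@n1_ae _ _ _ mu (T t (fun y => -1 * v y + u y)) (T t u \- T t v)); last 3 first.
  - exact: (ig_meas (T_ig t0 wi')).
  - exact: (ig_meas (igB Tui Tvi)).
  - by apply: filterS ae => x ->; rewrite mulN1r addrC.
  by congr (_ <= n1 mu _); apply/funext => x /=; rewrite mulN1r addrC.
have key : (1 + t^-1) * n1 mu (u \- v) <= t^-1 * n1 mu (T t u \- T t v) +
   (n1 mu ((u \- v) \- (g \- k)) + e).
  have -> : (1 + t^-1) * n1 mu (u \- v) = n1 mu (fun x => (1 + t^-1) * (u \- v) x).
    by rewrite n1Z// ger0_norm// addr_ge0// invr_ge0 ltW.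
  have -> : t^-1 * n1 mu (T t u \- T t v) = n1 mu (fun x => t^-1 * (T t u \- T t v) x).
    by rewrite n1Z ?ger0_norm ?invr_ge0 ?(ltW t0)//; exact: igB.
  have -> : (fun x => (1 + t^-1) * (u \- v) x) = (fun x => t^-1 * (T t u \- T t v) x) \+
     (((u \- v) \- (g \- k)) \+ ((fun x => - (t^-1 * (T t u x - u x) - g x)) \+
      (fun x => t^-1 * (T t v x - v x) - k x))).
    by apply/funext => x /=; move: (t^-1) (T t u x) (T t v x) (u x) (v x) (g x) (k x);
      clear; move=> *; ring.
  have j1 := igZ t^-1 (igB Tui Tvi); have j2 := igB wi (igB gi ki).
  have j3 := igD (igN i1) i2.
  apply: le_trans (n1D j1 (igD j2 j3)) _; rewrite lerD2l.
  apply: le_trans (n1D j2 j3) _; rewrite lerD2l.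
  apply: le_trans (n1D (igN i1) i2) _; rewrite n1N.
  by rewrite [leRHS]splitr; exact: lerD.
have : t^-1 * n1 mu (T t u \- T t v) <= t^-1 * n1 mu (u \- v).
  by rewrite ler_wpM2l// invr_ge0 ltW.
by move: key; rewrite mulrDl mul1r; move: (t^-1 * _) (t^-1 * _) => a b; lra.
Unshelve. all: by end_near. Qed.

Lemma cube_exhaustion : exhaustion (fun n => cube n.+1%:R : set E).
Proof.
split.
- by move=> n; split; [exact: open_cube|exact: cube_relatively_compact].
- by move=> n x; rewrite /cube/= => /lt_trans; apply; rewrite ltr_nat.
- apply/seteqP; split => // x _; have [N HN] := cube_cover x.
  by exists N => //; exact: (HN N.+1).
Qed.

Lemma L1_cvg_restr (V : set E) (fn : nat -> E -> R) f : measurable V ->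
  (forall n, L1 mu V (fn n)) -> L1 mu V f -> L1_cvg mu V fn f ->
  n1 mu ((fun x => fn n x * \1_V x) \- (fun x => f x * \1_V x)) @[n --> \oo] --> (0 : R).
Proof.
move=> mV Lfn Lf h.
have mI : measurable_fun setT (\1_V : E -> R) by exact: measurable_indic.
have ri g : L1 mu V g -> ig mu (fun x => g x * \1_V x).
  by move=> /(integrable_mkcond _ mV); rewrite patch_indicE.
apply/n1_cvgP; first by move=> n; apply: igB; exact: ri.
rewrite (_ : (fun n => _) = (fun n => \int[mu]_(x in V) `|(fn n x - f x)%R|%:E)%E)//.
apply/funext => n; rewrite [RHS]integral_mkcond; apply: eq_integral => x _.
rewrite patchE /= -mulrBl normrM indicE; case: (_ \in _); first by rewrite normr1 mulr1.
by rewrite normr0 mulr0.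
Qed.

Lemma density_alg (e x a b c nF nW nf nu nun : R) : x <= a + (b + c) -> a <= nF - nW + e ->
  b <= 2 * e -> c <= e -> nF <= nf + 2 * e -> nun <= nW + e -> nu <= nun + e -> nf <= nu ->
  x <= 8 * e.
Proof. lra. Qed.

(** Let u be the resolvent of f >= 0. Then ||u|| >= int u = int f = ||f||. As the resolvents on the
    cubes converge to u, the defect of norms on a large cube is small, and it bounds the residual in
    [cube_step]. *)
Lemma core_density_nonneg f e : ig mu f -> (forall x, 0 <= f x) -> 0 < e ->
  exists2 phi, tst phi & n1 mu (fun x => phi x - L phi x - f x) < e.
Proof.
move=> fi f0 e0; have [_ hres _] := HT.
have [un [u [hun cun ug]]] := hres _ cube_exhaustion 1 f ltr01 fi.
have [ui gi _] := ug.
pose V n : set E := cube n.+1%:R.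
have mV n : measurable (V n) by exact: meas_cube.
have offE n (h : E -> R) : (forall x, ~ V n x -> h x = 0) -> (fun x => h x * \1_(V n) x) = h.
  move=> hV; apply/funext => x; have [xV|xV] := pselect (V n x).
    by rewrite indicE mem_set// mulr1.
  by rewrite hV// mul0r.
have uni n : ig mu (un n).
  have [un0 [g [[h _ _] _]]] := hun n.
  rewrite -(offE n (un n) un0).
  by have := (integrable_mkcond _ (mV n)).1 h; rewrite patch_indicE.
have cun' : n1 mu (un n \- u) @[n --> \oo] --> (0 : R).
  by apply/n1_cvgP => [n|]; [exact: igB|exact: cun].
have cf : n1 mu ((fun x => f x * \1_(V n) x) \- f) @[n --> \oo] --> (0 : R).
  have := n1_cube fi; rewrite -(@cvg_shiftS R^o) => h; exact: h.
(* The errors add up to eight times [dl]. *)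
pose dl := e / 9; have dl0 : 0 < dl by rewrite divr_gt0.
have [n hn] := cvg_below2 dl0 cun' cf.
(* The resolvent on the cube belongs only to the closure of the local operator. A pair of the
   operator itself is taken close to it, since [cube_step] works with bounded functions of the form
   domain. *)
have [un0 [g [[Lu Lg [wk [gk [Lwg lop cw cg]]]] aeq]]] := hun n.
have cw' := L1_cvg_restr (mV n) (fun k => (Lwg k).1) Lu cw.
have cg' := L1_cvg_restr (mV n) (fun k => (Lwg k).2) Lg cg.
have [k hk] := cvg_below2 dl0 cw' cg'.
have [phi tphi hphi] := cube_step d2 dp lamL aa inv (lop k) (Lwg k).2 dl0.
exists phi => //.
pose I1 : E -> R := \1_(V n).
pose W x := wk k x * I1 x; pose F x := (wk k x - gk k x) * I1 x.
have ri h : L1 mu (V n) h -> ig mu (fun x => h x * I1 x).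
  by move=> /(integrable_mkcond _ (mV n)); rewrite patch_indicE.
have Wi : ig mu W by apply: ri; case: (Lwg k).
have gki : ig mu (fun x => gk k x * I1 x) by apply: ri; case: (Lwg k).
have gi' : ig mu (fun x => g x * I1 x) by exact: ri.
have u1i : ig mu (fun x => un n x * I1 x) by exact: ri.
have FE : F = W \- (fun x => gk k x * I1 x) by apply/funext => x; rewrite /F/= mulrBl.
have Fi : ig mu F by rewrite FE; exact: igB.
have mI : measurable_fun setT I1 by exact: measurable_indic.
have I1b x : `|I1 x| <= 1 by rewrite /I1 indicE; case: (_ \in _); rewrite ?normr1 ?normr0.
have f1i : ig mu (fun x => f x * I1 x) by under eq_fun do rewrite mulrC; exact: ig_mulb I1b fi.
have p1 := n1_ge0 mu (un n \- u); have p2 := n1_ge0 mu ((fun x => f x * \1_(V n) x) \- f).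
have p3 := n1_ge0 mu ((fun x => wk k x * I1 x) \- (fun x => un n x * I1 x)).
have p4 := n1_ge0 mu ((fun x => gk k x * I1 x) \- (fun x => g x * I1 x)).
have b1 : n1 mu (F \- (fun x => f x * I1 x)) <= 2 * dl.
  rewrite (@n1_ae _ _ _ mu _ (((fun x => wk k x * I1 x) \- (fun x => un n x * I1 x)) \-
     ((fun x => gk k x * I1 x) \- (fun x => g x * I1 x)))); last 3 first.
  - exact: (ig_meas (igB Fi f1i)).
  - exact: (ig_meas (igB (igB Wi u1i) (igB gki gi'))).
  - apply: filterS aeq => x h; rewrite /F /=.
    have [xV|xV] := pselect (V n x); last by rewrite /I1 indicE memNset// !mulr0 !subr0.
    by rewrite -(h xV) /I1 indicE mem_set// !mulr1 mul1r; ring.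
  apply: le_trans (n1B (igB Wi u1i) (igB gki gi')) _; rewrite mulr_natl mulr2n.
  apply: lerD; apply: ltW; apply: le_lt_trans hk; by rewrite ?lerDl ?lerDr.
have Lphi := Lop_ig d2 dp lamL aa inv tphi.
have phii : ig mu phi.
  apply/(ig_density (rho_meas inv) (rho_ge0 inv) (mu_density inv)); first exact: tst_meas.
  exact: (L2l_tst_ig lamL (L2l_cont lamL (rho_cont inv)) tphi).
have ri1 : ig mu (fun x => phi x - L phi x - F x).
  by apply: igB => //; exact: igB.
have tri : n1 mu (fun x => phi x - L phi x - f x) <= n1 mu (fun x => phi x - L phi x - F x)
    + (n1 mu (F \- (fun x => f x * I1 x)) + n1 mu ((fun x => f x * I1 x) \- f)).
  have -> : (fun x => phi x - L phi x - f x) = (fun x => phi x - L phi x - F x) \+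
     ((F \- (fun x => f x * I1 x)) \+ ((fun x => f x * I1 x) \- f)).
    by apply/funext => x /=; move: (phi x) (L phi x) (f x) (F x) (I1 x); clear; move=> *; ring.
  have j1 := igB Fi f1i; have j2 := igB f1i fi.
  apply: le_trans (n1D ri1 (igD j1 j2)) _; rewrite lerD2l.
  exact: n1D.
have nF : n1 mu F <= n1 mu f + 2 * dl.
  have -> : F = (F \- (fun x => f x * I1 x)) \+ (fun x => f x * I1 x).
    by apply/funext => x /=; rewrite subrK.
  apply: le_trans (n1D (igB Fi f1i) f1i) _; rewrite addrC; apply: lerD => //.
  apply: n1_le => //; first exact: ig_meas f1i.
  by move=> x; rewrite normrM -[leRHS]mulr1 ler_wpM2l.
have nun : n1 mu (un n) <= n1 mu W + dl.
  have -> : un n = W \- ((fun x => wk k x * I1 x) \- (fun x => un n x * I1 x)).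
    rewrite -[LHS](offE n)//; apply/funext => x /=; rewrite /W /I1; ring.
  apply: le_trans (n1B Wi (igB Wi u1i)) _; rewrite lerD2l.
  by apply: ltW; apply: le_lt_trans hk; rewrite lerDl.
have nu : n1 mu u <= n1 mu (un n) + dl.
  have -> : u = un n \- (un n \- u) by apply/funext => x /=; rewrite opprB addrC subrK.
  apply: le_trans (n1B (uni n) (igB (uni n) ui)) _; rewrite lerD2l.
  by apply: ltW; apply: le_lt_trans hn; rewrite lerDl.
(* The only place where mass is conserved: u - f has mean 0, being in the range of the generator. *)
have nf : n1 mu f <= n1 mu u.
  have := generator_mean ug; rewrite (_ : (fun x => _) = u \- f); last first.
    by apply/funext => x; rewrite /= mul1r.
  rewrite RintegralB// => /eqP; rewrite subr_eq0 => /eqP uf.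
  have -> : n1 mu f = \int[mu]_x f x by apply: eq_Rintegral => x _; rewrite ger0_norm.
  by rewrite -uf; apply: le_trans (ler_norm _) (norm_Rint_le ui).
have b2 : n1 mu ((fun x => f x * I1 x) \- f) <= dl.
  by apply: ltW; apply: le_lt_trans hn; rewrite lerDr.
apply: le_lt_trans (density_alg tri hphi b1 b2 nF nun nu nf) _.
by rewrite /dl mulrCA mulrC gtr_pMl// ltr_pdivrMr// mul1r ltr_nat.
Qed.

Lemma core_density f e : ig mu f -> 0 < e ->
  exists2 phi, tst phi & n1 mu (fun x => phi x - L phi x - f x) < e.
Proof.
move=> fi e0; have e2 : 0 < e / 2 by rewrite divr_gt0.
pose fp x := Num.max (f x) 0; pose fm x := Num.max (- f x) 0.
have mf := ig_meas fi.
have fE x : f x = fp x - fm x.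
  by rewrite /fp /fm; have [h|h] := leP (f x) 0; have [h'|h'] := leP (- f x) 0; lra.
have mp : measurable_fun setT fp by apply: measurable_maxr.
have mq : measurable_fun setT fm by apply: measurable_maxr => //; exact: measurable_funN.
have p0 x : 0 <= fp x by rewrite /fp le_max lexx orbT.
have q0 x : 0 <= fm x by rewrite /fm le_max lexx orbT.
have ip : ig mu fp.
  by apply: (ig_le mp _ fi) => x; rewrite ger0_norm// ge_max ler_norm normr_ge0.
have iq : ig mu fm.
  by apply: (ig_le mq _ fi) => x; rewrite ger0_norm// ge_max normr_ge0 -normrN ler_norm.
have [u tu hu] := core_density_nonneg ip p0 e2.
have [v tv hv] := core_density_nonneg iq q0 e2.
have tstI w : tst w -> ig mu w.
  move=> tw; apply/(ig_density (rho_meas inv) (rho_ge0 inv) (mu_density inv)); first exact: tst_meas.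
  exact: (L2l_tst_ig lamL (L2l_cont lamL (rho_cont inv)) tw).
have LI w : tst w -> ig mu (L w) by move=> tw; exact: (Lop_ig d2 dp lamL aa inv tw).
exists (u \- v); first exact: tstB.
have i1 : ig mu (fun x => u x - L u x - fp x) by apply: igB => //; apply: igB; [exact: tstI|exact: LI].
have i2 : ig mu (fun x => v x - L v x - fm x) by apply: igB => //; apply: igB; [exact: tstI|exact: LI].
have -> : (fun x => (u \- v) x - L (u \- v) x - f x) =
    (fun x => u x - L u x - fp x) \- (fun x => v x - L v x - fm x).
  apply/funext => x; rewrite Lop_sub// fE /=.
  by move: (u x) (v x) (L u x) (L v x) (fp x) (fm x); clear; move=> *; ring.
apply: le_lt_trans (n1B i1 i2) _; rewrite [ltRHS]splitr; exact: ltrD.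
Qed.

(** Approximating g - h by (1 - L) phi is enough: dissipativity transfers the error to phi - g, and
    then L phi - h is a difference of two small functions. *)
Theorem generator_core g h e : L1_generator mu T g h -> 0 < e ->
  exists phi, [/\ tst phi, n1 mu (phi \- g) < e & n1 mu (L phi \- h) < e].
Proof.
move=> gh e0; have [gi hi _] := gh; have e2 : 0 < e / 2 by rewrite divr_gt0.
have [phi tphi hphi] := core_density (igB gi hi) e2.
have [_ _ hL] := HT.
have pL : L1_generator mu T phi (L phi) by apply: hL; apply/test_setTP.
have [pi Lpi _] := pL.
have e1 : (fun x => phi x - L phi x - (g \- h) x) = (phi \- g) \- (L phi \- h).
  by apply/funext => x /=; ring.
rewrite e1 in hphi.
have b1 : n1 mu (phi \- g) < e / 2 by apply: le_lt_trans (dissipative pL gh) _.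
exists phi; split => //; first by apply: lt_trans b1 _; rewrite ltr_pdivrMr// ltr_pMr// ltr1n.
have -> : L phi \- h = (phi \- g) \- ((phi \- g) \- (L phi \- h)).
  by apply/funext => x /=; ring.
have j1 := igB pi gi; have j2 := igB j1 (igB Lpi hi).
by apply: le_lt_trans (n1B j1 j2) _; rewrite [ltRHS]splitr; exact: ltrD.
Qed.

End CoreDensity.

(** * Comparison of integrals, and induction over integrable functions *)

Section SetIntegral.
Context dd (T : measurableType dd) (R : realType).
Implicit Types (mu nu : {measure set T -> \bar R}).
Import HBNNSimple.

(** The integral of a nonnegative function is a supremum over the simple functions below it, so
    monotonicity does not involve measurability. *)
Lemma le_integral_sup mu (f g : T -> \bar R) : (forall x, 0 <= f x)%E -> (forall x, f x <= g x)%E ->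
  (\int[mu]_x f x <= \int[mu]_x g x)%E.
Proof.
move=> f0 fg; have g0 x : (0 <= g x)%E by exact: le_trans (fg x).
rewrite !ge0_integralTE//; apply: le_ereal_sup => _ [h /= hf <-].
by exists h => //= x; exact: le_trans (hf x) (fg x).
Qed.

(** Here [f] may fail to be measurable: it will be a kernel x -> P_x(B), known to be only
    universally measurable. Both integrals are suprema over simple functions, which can be set to
    zero on the exceptional set. *)
Lemma ae_integral mu (f g : T -> \bar R) : measurable_fun setT g -> (forall x, 0 <= f x)%E ->
  (forall x, 0 <= g x)%E -> {ae mu, forall x, f x = g x} ->
  (\int[mu]_x f x = \int[mu]_x g x)%E.
Proof.
move=> mg f0 g0 [N [mN N0 HN]].
have fgN x : ~ N x -> f x = g x by move=> xN; apply: contrapT => h; apply: xN; exact: HN.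
have mCN : measurable (~` N) by exact: measurableC.
have offN (u : T -> \bar R) : measurable_fun setT u -> (forall x, 0 <= u x)%E ->
    (\int[mu]_x u x = \int[mu]_x ((u \_ (~` N)) x))%E.
  move=> mu' u0; apply: ae_eq_integral => //.
    by apply/(measurable_restrict _ mCN measurableT); exact: measurable_funTS.
  exists N; split => // x /= H; apply: contrapT => xN; apply: H => _.
  by rewrite patchE mem_set.
apply/eqP; rewrite eq_le; apply/andP; split.
- rewrite ge0_integralTE//; apply: ge_ereal_sup => _ [h /= hf <-].
  have -> : sintegral mu h = (\int[mu]_x (EFin \o h) x)%E by rewrite integralT_nnsfun.
  rewrite (offN (EFin \o h)); last 2 first.
  + exact/measurable_EFinP.
  + by move=> x; rewrite lee_fin.
  apply: le_integral_sup => x; rewrite patchE.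
    by case: ifP => // _; rewrite lee_fin.
  case: ifPn => [|_]; last exact: g0.
  by rewrite inE /= => xN; rewrite -fgN.
- rewrite (offN g)//; apply: le_integral_sup => x; rewrite patchE; first by case: ifP.
  by case: ifPn => [|_ //]; rewrite inE /= => xN; rewrite fgN.
Qed.

Lemma le_measure_integral mu nu (f : T -> \bar R) :
  (forall B, measurable B -> mu B <= nu B)%E ->
  (forall x, 0 <= f x)%E -> (\int[mu]_x f x <= \int[nu]_x f x)%E.
Proof.
move=> m12 f0; rewrite !ge0_integralTE//.
apply: ge_ereal_sup => _ [h /= hf <-].
apply: (@le_trans _ _ (sintegral nu h)).
  rewrite !sintegralE; apply: lee_fsum => // r rh.
  have r0 : 0 <= r by move: rh => -[x _ <-].
  by rewrite lee_wpmul2l ?lee_fin//; apply: m12; exact: measurable_sfunP.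
by apply: ereal_sup_ubound; exists h.
Qed.

Lemma L1_induction mu (P : (T -> R) -> Prop) :
  (forall B, measurable B -> (mu B < +oo)%E -> P \1_B) ->
  (forall c f g, ig mu f -> ig mu g -> P f -> P g -> P (fun x => c * f x + g x)) ->
  (forall (F : nat -> T -> R) f, (forall n, ig mu (F n)) -> ig mu f -> (forall n, P (F n)) ->
    n1 mu (F n \- f) @[n --> \oo] --> (0 : R) -> P f) ->
  forall f, ig mu f -> P f.
Proof.
move=> Pi Plin Plim.
have P0 : P (fun=> 0).
  have := Pi _ measurable0; rewrite measure0 => /(_ (ltry _)).
  by rewrite indic0.
have Psum (s : seq R) (F : R -> T -> R) : (forall y, ig mu (F y) /\ P (F y)) ->
    P (fun x => \sum_(y <- s) F y x).
  move=> HF; elim: s => [|y s IH].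
    by rewrite (_ : (fun=> _) = fun=> 0)//; apply/funext => x; rewrite big_nil.
  rewrite (_ : (fun=> _) = fun x => 1 * F y x + \sum_(z <- s) F z x).
    by apply: Plin => //; [case: (HF y)|apply: ig_sum => z; case: (HF z)|case: (HF y)].
  by apply/funext => x; rewrite big_cons mul1r.
have pos f : ig mu f -> (forall x, 0 <= f x) -> P f.
  move=> fi f0; have mf : measurable_fun setT (EFin \o f) by apply/measurable_EFinP; exact: ig_meas fi.
  pose F n := nnsfun_approx measurableT mf n : {nnsfun T >-> R}.
  have Fle n x : 0 <= F n x <= f x.
    rewrite fun_ge0/= /F nnsfun_approxE -lee_fin; apply: le_approx => //.
    by move=> y _; rewrite /= lee_fin.
  have Fc x : F n x @[n --> \oo] --> f x.
    have h : EFin (F k x) @[k --> \oo] --> (f x)%:E.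
      by apply: (@cvg_nnsfun_approx _ _ _ _ measurableT _ mf) => // y _; rewrite lee_fin.
    by have /fine_cvg := h.
  have mF n : measurable_fun setT (F n) by exact: measurable_funP.
  have Fi n : ig mu (F n).
    apply: (ig_le (mF n) _ fi) => x; have /andP[a b] := Fle n x.
    by rewrite !ger0_norm//; exact: f0.
  apply: (Plim (fun n => F n : T -> R)) => //; last first.
    apply: (@n1_dct _ _ _ _ (fun n => F n : T -> R) f (fun x => 2 * `|f x|)) => //.
    - exact: ig_meas fi.
    - move=> n x; apply: le_trans (ler_normB _ _) _; have /andP[a b] := Fle n x.
      rewrite !ger0_norm//; by lra.
    - by apply: igZ; exact: ig_norm.
  move=> n; have -> : (F n : T -> R) =
      (fun x => \sum_(y <- finmap.enum_fset (fset_set (range (F n)))) y * \1_(F n @^-1` [set y]) x).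
    by apply/funext => x; rewrite fimfunE fsbig_finite.
  apply: Psum => y; have mB : measurable (F n @^-1` [set y]) by exact: measurable_sfunP.
  have [->|y0] := eqVneq y 0.
    rewrite (_ : (fun x => _) = fun=> 0); last by apply/funext => x; rewrite mul0r.
    by split => //; exact: ig0.
  have ji : ig mu (\1_(F n @^-1` [set y]) : T -> R).
    apply: (ig_le _ _ (igZ y^-1 (Fi n))); first exact: measurable_indic.
    move=> x; rewrite indicE; case: (boolP (_ \in _)) => [|_]; last by rewrite normr0.
    by rewrite inE /= => ->; rewrite mulVf.
  have jfin : (mu (F n @^-1` [set y]) < +oo)%E.
    have /integrableP[_] := ji; rewrite (eq_integral (fun x => (\1_(F n @^-1` [set y]) x)%:E)).
      by rewrite integral_indic// setIT.
    by move=> x _; rewrite /= ger0_norm.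
  split; first exact: igZ.
  rewrite (_ : (fun x => _) = fun x => y * \1_(F n @^-1` [set y]) x + 0).
    by apply: Plin => //; [exact: ig0|exact: Pi].
  by apply/funext => x; rewrite addr0.
move=> f fi; have mf := ig_meas fi.
pose fp x := Num.max (f x) 0; pose fm x := Num.max (- f x) 0.
have mp : measurable_fun setT fp by apply: measurable_maxr.
have mq : measurable_fun setT fm by apply: measurable_maxr => //; exact: measurable_funN.
have p0 x : 0 <= fp x by rewrite /fp le_max lexx orbT.
have q0 x : 0 <= fm x by rewrite /fm le_max lexx orbT.
have ip : ig mu fp.
  by apply: (ig_le mp _ fi) => x; rewrite ger0_norm// ge_max ler_norm normr_ge0.
have iq : ig mu fm.
  by apply: (ig_le mq _ fi) => x; rewrite ger0_norm// ge_max normr_ge0 -normrN ler_norm.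
rewrite (_ : f = fun x => -1 * fm x + fp x); first by apply: Plin => //; exact: pos.
apply/funext => x; rewrite /fp /fm; have [h|h] := leP (f x) 0; have [h'|h'] := leP (- f x) 0; lra.
Qed.

End SetIntegral.

(** * Laws of a process at fixed times *)

Section Compactification.
Context {R : realType} {d : nat}.
Local Notation E := 'rV[R]_d.
Local Notation ED := (one_point_compactification 'rV[R]_d).
Implicit Types (f g h phi : E -> R) (x : E) (B : set E).

Lemma ext0_cont phi r : continuous phi -> vanish r phi -> continuous (ext0 phi : ED -> R).
Proof.
move=> cp vp [x|] U /=.
  by move=> /(cp x).
move=> nU; exists [set x : E | `|x| <= r].
  by split; [exact: compact_ball_E|exact: closed_ball_E].
have U0 := nbhs_singleton nU.
by move=> z [[x /= xr <-]|->//] /=; rewrite vp// ltNge; apply/negP.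
Qed.

Lemma open_meas_ED (U : set ED) : open U -> measurable U.
Proof. by move=> oU; apply: sub_sigma_algebra. Qed.

Lemma closed_some_ball (z : E) r : closed (Some @` [set y : E | `|y - z| <= r] : set ED).
Proof.
rewrite -openC openE => -[x|] H.
  have oV : open [set y : E | r < `|y - z|].
    rewrite (_ : [set y | _] = (fun y : E => `|y - z|) @^-1` [set s | s > r])//.
    apply: open_comp => [y _|]; last exact: open_gt.
    apply: (@lip_cont _ _ _ 1) => u h; rewrite mul1r.
    apply: le_trans (ler_dist_dist _ _) _.
    by rewrite opprB addrA subrK [u + h]addrC addrK.
  have xV : r < `|x - z| by rewrite ltNge; apply/negP => h; apply: H; exists x.
  have : nbhs x [set y : E | r < `|y - z|] by apply: open_nbhs_nbhs.
  by apply: filterS => y yr [y' y'r [yy']]; move: yr; rewrite -yy' /= ltNge => /negP; apply.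
exists [set y : E | `|y| <= r + `|z|].
  by split; [exact: compact_ball_E|exact: closed_ball_E].
move=> u [[y yr <-]|->] [y' y'r]; last by [].
case=> yy; apply: yr; rewrite -yy /= in y'r *.
by rewrite -[y'](subrK z); apply: le_trans (ler_normD _ _) _; rewrite lerD2r.
Qed.

Lemma meas_some B : measurable B -> measurable (Some @` B : set ED).
Proof.
have mT : measurable (Some @` [set: E] : set ED).
  by apply: open_meas_ED; apply: one_point_compactification_open_some; exact: openT.
pose S : set (set E) := [set B | measurable (Some @` B : set ED)].
suff : <<s (@open E) >> `<=` S by apply.
apply: smallest_sub => [|U oU]; last first.
  by apply: open_meas_ED; exact: one_point_compactification_open_some.
split.
- by rewrite /S/= image_set0.
- move=> A mA; rewrite /S/= (_ : Some @` (setT `\` A) = Some @` [set: E] `\` Some @` A); last first.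
    apply/seteqP; split => [_ [x [_ Ax] <-]|_ [[x _ <-] H]].
      by split; [exists x|move=> [y Ay [yx]]; apply: Ax; rewrite -yx].
    by exists x => //; split => // Ax; apply: H; exists x.
  exact: measurableD.
- by move=> F mF; rewrite /S/= image_bigcup; exact: bigcupT_measurable.
Qed.

Lemma meas_none : measurable ([set None] : set ED).
Proof.
rewrite (_ : [set None] = ~` (Some @` [set: E])); last first.
  by apply/seteqP; split => [_ -> [x _]//|[x|//] H]; exfalso; apply: H; exists x.
by apply: measurableC; exact: meas_some.
Qed.

Lemma meas_ext0 h : measurable_fun setT h -> measurable_fun setT (ext0 h : ED -> R).
Proof.
move=> mh _ Y mY; rewrite setTI.
have mB : measurable (Some @` (h @^-1` Y) : set ED).
  by apply: meas_some; rewrite -[X in measurable X]setTI; exact: mh.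
have [Y0|Y0] := pselect (Y 0).
  rewrite (_ : _ @^-1` _ = Some @` (h @^-1` Y) `|` [set None]).
    by apply: measurableU => //; exact: meas_none.
  apply/seteqP; split => [[x|] /= H|z].
  - by left; exists x.
  - by right.
  - by move=> [[x Yx <-]|->].
rewrite (_ : _ @^-1` _ = Some @` (h @^-1` Y))//.
by apply/seteqP; split => [[x|//] /= H|_ [x Yx <-]//]; exists x.
Qed.

Lemma meas_Some : measurable_fun setT (Some : E -> ED).
Proof.
apply: (measurability (@open ED)) => //  _ [U oU <-]; rewrite setTI.
by apply: open_measE; apply: open_comp => // x _; exact: one_point_compactification_some_continuous.
Qed.

End Compactification.

Section Law.
Context dd (T : measurableType dd) {R : realType} {d : nat}.
Local Notation E := 'rV[R]_d.
Local Notation ED := (one_point_compactification 'rV[R]_d).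
Variables (Q : {measure set T -> \bar R}) (X : T -> ED).
Hypothesis mX : measurable_fun setT X.

Let meas_pre (B : set E) : measurable B -> measurable (X @^-1` (Some @` B)).
Proof. by move=> mB; rewrite -[X in measurable X]setTI; apply: mX => //; exact: meas_some. Qed.

(* The law of X on E; the mass at the cemetery is dropped. *)
Definition law of measurable_fun setT X : set E -> \bar R := fun B => Q (X @^-1` (Some @` B)).

Let law0 : law mX set0 = 0%E.
Proof. by rewrite /law image_set0 preimage_set0 measure0. Qed.

Let law_ge0 B : (0 <= law mX B)%E. Proof. exact: measure_ge0. Qed.

Let law_sigma : semi_sigma_additive (law mX).
Proof.
move=> F mF tF mU; rewrite /law image_bigcup preimage_bigcup.
apply: measure_semi_sigma_additive.
- by move=> n; exact: meas_pre.
- apply/trivIsetP => i j _ _ ij; rewrite -preimage_setI.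
  rewrite (_ : _ `&` _ = set0) ?preimage_set0//.
  apply/seteqP; split => // _ [[x Fx <-] [y Fy [yx]]].
  have /trivIsetP/(_ i j Logic.I Logic.I ij) := tF.
  by rewrite -subset0 => /(_ x); apply; split => //; rewrite -yx.
- by apply: bigcupT_measurable => n; exact: meas_pre.
Qed.

HB.instance Definition _ := isMeasure.Build _ _ _ (law mX) law0 law_ge0 law_sigma.

Definition lawm : {measure set E -> \bar R} := law mX.

Lemma ge0_integral_law (f : ED -> \bar R) : measurable_fun setT f -> (forall z, 0 <= f z)%E ->
  f None = 0%E -> (\int[lawm]_x f (Some x) = \int[Q]_w f (X w))%E.
Proof.
move=> mf f0 fN.
pose phi : {mfun E >-> ED} := HB.pack (Some : E -> ED) (isMeasurableFun.Build _ _ _ _ _ meas_Some).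
pose psi : {mfun T >-> ED} := HB.pack X (isMeasurableFun.Build _ _ _ _ _ mX).
pose S : set ED := Some @` [set: E].
have mS : measurable S by exact: meas_some.
have e1 := @ge0_integral_pushforward _ _ _ _ _ phi meas_Some lawm setT f measurableT mf (fun x _ => f0 x).
have mfS : measurable_fun S f by exact: measurable_funTS.
have e2 := @ge0_integral_pushforward _ _ _ _ _ psi mX Q S f mS mfS (fun x _ => f0 x).
rewrite preimage_setT in e1; rewrite -[LHS]e1.
have -> : (\int[pushforward lawm phi]_y f y = \int[pushforward lawm phi]_(y in S) f y)%E.
  rewrite [RHS]integral_mkcond; apply: eq_integral => -[x|] _; rewrite patchE.
    by rewrite mem_set//; exists x.
  by rewrite fN; case: ifP.
transitivity (\int[pushforward Q psi]_(y in S) f y)%E.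
  apply: eq_measure_integral => A mA AS; rewrite /pushforward /= /law; congr (Q _).
  congr (X @^-1` _); apply/seteqP; split => [_ [x Ax <-]//|z Az].
  by have [x _ xz] := AS _ Az; exists x => //=; rewrite xz.
rewrite e2 integral_mkcond; apply: eq_integral => w _; rewrite patchE /=.
case: ifPn => //; rewrite notin_setE /= => H.
move: H; case: (X w) => [x|] H; last by rewrite fN.
by exfalso; apply: H; exists x.
Qed.

Lemma law_ig (h : E -> R) : measurable_fun setT h -> ig lawm h <-> ig Q (fun w => ext0 h (X w)).
Proof.
move=> mh; have me := meas_ext0 mh.
have mae : measurable_fun setT (fun z : ED => `|ext0 h z|%:E).
  by apply/measurable_EFinP; exact: measurableT_comp.
have e := ge0_integral_law mae (fun z => normr_ge0 _ : (0 <= `|ext0 h z|%:E)%E).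
have {}e : (\int[lawm]_x `|h x|%:E = \int[Q]_w `|ext0 h (X w)|%:E)%E by rewrite -e//= normr0.
split=> /integrableP[_ H]; apply/integrableP; split.
- by apply/measurable_EFinP; exact: (measurableT_comp me mX).
- by rewrite -[X in (X < _)%E]/(\int[Q]_w `|ext0 h (X w)|%:E)%E -e; exact: H.
- exact/measurable_EFinP.
- by rewrite -[X in (X < _)%E]/(\int[lawm]_x `|h x|%:E)%E e; exact: H.
Qed.

Lemma n1_law (h : E -> R) : measurable_fun setT h -> n1 lawm h = n1 Q (fun w => ext0 h (X w)).
Proof.
move=> mh; have me := meas_ext0 mh.
have mae : measurable_fun setT (fun z : ED => `|ext0 h z|%:E).
  by apply/measurable_EFinP; exact: measurableT_comp.
congr fine; have e := ge0_integral_law mae (fun z => normr_ge0 _ : (0 <= `|ext0 h z|%:E)%E).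
by rewrite -e//= normr0.
Qed.

Lemma Rint_law (h : E -> R) : ig lawm h -> \int[lawm]_x h x = \int[Q]_w ext0 h (X w).
Proof.
move=> hi; have mh := ig_meas hi.
have pos (g : E -> R) : measurable_fun setT g -> (forall x, 0 <= g x) ->
    \int[lawm]_x g x = \int[Q]_w ext0 g (X w).
  move=> mg g0; congr fine.
  have := @ge0_integral_law (fun z => (ext0 g z)%:E) _ _ _; apply => //.
  - by apply/measurable_EFinP; exact: meas_ext0.
  - by case=> [x|] //=; rewrite lee_fin.
pose fp x := Num.max (h x) 0; pose fm x := Num.max (- h x) 0.
have mp : measurable_fun setT fp by apply: measurable_maxr.
have mq : measurable_fun setT fm by apply: measurable_maxr => //; exact: measurable_funN.
have p0 x : 0 <= fp x by rewrite /fp le_max lexx orbT.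
have q0 x : 0 <= fm x by rewrite /fm le_max lexx orbT.
have ip : ig lawm fp.
  by apply: (ig_le mp _ hi) => x; rewrite ger0_norm// ge_max ler_norm normr_ge0.
have iq : ig lawm fm.
  by apply: (ig_le mq _ hi) => x; rewrite ger0_norm// ge_max normr_ge0 -normrN ler_norm.
have fE x : h x = fp x - fm x.
  by rewrite /fp /fm; have [h1|h1] := leP (h x) 0; have [h'|h'] := leP (- h x) 0; lra.
transitivity (\int[lawm]_x fp x - \int[lawm]_x fm x).
  by rewrite -RintegralB//; apply: eq_Rintegral => x _; exact: fE.
rewrite !pos// -RintegralB//; [|exact/law_ig..].
by apply: eq_Rintegral => w _; case: (X w) => [x|] /=; rewrite ?subr0// -fE.
Qed.

End Law.

Section FiniteMeasure.
Context dd (T : measurableType dd) (R : realType) (k : {measure set T -> \bar R}).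
Hypothesis k1 : (k setT <= 1)%E.
Implicit Types (f g : T -> R).

Lemma fin_mass B : measurable B -> k B \is a fin_num.
Proof.
move=> mB; rewrite ge0_fin_numE//; apply: le_lt_trans (ltry 1).
by apply: le_trans k1; apply: le_measure; rewrite ?inE.
Qed.

Lemma ig_bnd f c : measurable_fun setT f -> (forall x, `|f x| <= c) -> ig k f.
Proof.
move=> mf fc; have i1 : ig k (cst c).
  apply/integrableP; split; first exact/measurable_EFinP.
  rewrite (eq_integral (fun=> `|c|%:E))// lebesgue_integral_nonneg.integral_cstr//.
  by rewrite lte_mul_pinfty// -ge0_fin_numE//; exact: fin_mass.
apply: (ig_le mf _ i1) => x; apply: le_trans (fc x) _; exact: ler_norm.
Qed.

End FiniteMeasure.

Lemma Rint_indic dd (T : measurableType dd) (R : realType) (k : {measure set T -> \bar R}) B :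
  measurable B -> \int[k]_x (\1_B x : R) = fine (k B).
Proof. by move=> mB; rewrite /Rintegral integral_indic// setIT. Qed.

Section BoxDetermined.
Context {R : realType} {d : nat}.
Local Notation E := 'rV[R]_d.
Implicit Types (a b x : E).

Lemma boxf_tst a b n : tst (boxf a b n.+1%:R : E -> R).
Proof.
split; first exact: boxf_smooth.
pose r := Num.max `|a| `|b|; exists r => x; rewrite gt_max => /andP[h1 h2].
apply: boxf_out => // H.
have : `|x| <= r; last by rewrite leNgt /r gt_max h1 h2.
apply/norm_leP => [|i]; first by rewrite le_max normr_ge0.
 have /andP[h3 h4] := H i; rewrite ler_norml; apply/andP; split.
- apply: le_trans (ltW h3); rewrite lerNl; apply: (@le_trans _ _ `|a 0 i|).
    by rewrite -normrN ler_norm.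
  by apply: (le_trans (norm_coord a i)); rewrite /r le_max lexx.
- apply: (le_trans (ltW h4)); apply: (le_trans (ler_norm _)).
  by apply: (le_trans (norm_coord b i)); rewrite /r le_max lexx orbT.
Qed.

(* Both the measurability of a kernel and the equality of two measures follow
   from the corresponding property of test functions. *)
Lemma box_class (Y : Type) (K : (Y -> R) -> Prop) (k : Y -> {measure set E -> \bar R}) :
  (forall y, k y setT <= 1)%E ->
  (forall f g, K f -> K g -> K (f \- g)) ->
  (forall (F : nat -> Y -> R) f, (forall n, K (F n)) ->
     (forall y, F n y @[n --> \oo] --> f y) -> K f) ->
  (forall f : E -> R, tst f -> K (fun y => \int[k y]_x f x)) ->
  forall B, measurable B -> K (fun y => fine (k y B)).
Proof.
move=> k1 KB Kl Kt.
have K0 : K (fun=> 0).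
  have := Kt _ (@tst0 R d); congr K; apply/funext => y; by rewrite /Rintegral integral0.
have KN f : K f -> K (fun y => - f y).
  by move=> Kf; have := KB _ _ K0 Kf; congr K; apply/funext => y /=; rewrite sub0r.
have KD f g : K f -> K g -> K (f \+ g).
  by move=> Kf Kg; have := KB _ _ Kf (KN _ Kg); congr K; apply/funext => y /=; rewrite opprK.
have Kbox a b : K (fun y => fine (k y (obox a b))).
  apply: (Kl (fun n y => \int[k y]_x boxf a b n.+1%:R x)).
    by move=> n; apply: Kt; exact: boxf_tst.
  move=> y; rewrite -Rint_indic; last exact: obox_meas.
  have ib n : ig (k y) (boxf a b n.+1%:R).
    apply: (ig_bnd _ (c := 1)); [exact: k1|exact: (tst_meas (boxf_tst a b n))|move=> x].
    by have /andP[h1 h2] := boxf_bnd a b n.+1%:R x; rewrite ger0_norm.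
  have ii : ig (k y) (\1_(obox a b) : E -> R).
    apply: ig_indic; first exact: obox_meas.
    by rewrite -ge0_fin_numE//; apply: fin_mass; [exact: k1|exact: obox_meas].
  apply/(@cvgrPdist_le _ _ _ (nbhs \oo) _) => e e0.
  have : n1 (k y) (boxf a b n.+1%:R \- \1_(obox a b)) @[n --> \oo] --> (0 : R).
    apply: (@n1_dct _ _ _ _ (fun n => boxf a b n.+1%:R) _ (cst 1)).
    - by move=> n; exact: (tst_meas (boxf_tst a b n)).
    - by apply: measurable_indic; exact: obox_meas.
    - exact: boxf_cvg.
    - move=> n x; have /andP[h1 h2] := boxf_bnd a b n.+1%:R x.
      by rewrite indicE; case: (_ \in _); rewrite /= ler_norml; lra.
    - by apply: (ig_bnd _ (c := 1)) => // x; rewrite /cst normr1.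
  move/(@cvgrPdist_le _ _ _ (nbhs \oo) _)/(_ _ e0); apply: filterS => n.
  rewrite sub0r normrN ger0_norm ?n1_ge0// => h.
  rewrite -(RintegralB measurableT ii (ib n)).
  apply: (le_trans (norm_Rint_le (igB ii (ib n)))).
  by rewrite n1C.
have KT : K (fun y => fine (k y setT)).
  apply: (Kl (fun n y => fine (k y (cube n.+1%:R)))).
    by move=> n; rewrite cube_obox//; exact: Kbox.
  move=> y; have := @nondecreasing_cvg_mu _ _ _ (k y) (fun n => cube n.+1%:R) _ _ _.
  have -> : \bigcup_n (cube n.+1%:R : set E) = setT.
    apply/seteqP; split => // x _; have [N HN] := cube_cover x.
    by exists N => //; apply: HN.
  move=> h; apply: fine_cvg; rewrite fineK; last exact: fin_mass.
  apply: h => //; first by move=> n; exact: meas_cube.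
  move=> n m nm; apply/subsetPset => x; rewrite /cube/= => h; apply: lt_le_trans h _.
  by rewrite ler_nat.
move=> B; rewrite measE_obox; move: B.
apply: (@dynkin_induction _ E [set B | exists a b, B = obox a b]).
- exact: measE_obox.
- by move=> _ _ [a [b ->]] [a' [b' ->]]; exists (maxv a a'), (minv b b'); rewrite oboxI.
- exact: KT.
- by move=> _ [a [b ->]].
- move=> S mS KS; have := KB _ _ KT KS; congr K; apply/funext => y /=.
  rewrite -fineB; [|exact: fin_mass..]; congr fine; rewrite -setTD measureD// ?setTI//.
  by rewrite -ge0_fin_numE//; exact: fin_mass.
- move=> F mF tF KF.
  apply: (Kl (fun n y => \sum_(0 <= i < n) fine (k y (F i)))).
    elim=> [|n IH].
      by move: K0; congr K; apply/funext => y; rewrite big_nil.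
    by have := KD _ _ IH (KF n); congr K; apply/funext => y /=; rewrite big_nat_recr.
  move=> y; have mU := bigcupT_measurable F mF.
  suff h : (\sum_(0 <= i < n) fine (k y (F i)))%:E @[n --> \oo] -->
      (fine (k y (\bigcup_k F k)))%:E by have /fine_cvg := h.
  rewrite fineK; last exact: fin_mass.
  have := @measure_semi_sigma_additive _ _ _ (k y) F mF tF mU; apply: cvg_trans.
  apply: near_eq_cvg; apply: nearW => n; rewrite -sumEFin.
  by apply: eq_bigr => i _; rewrite fineK//; exact: fin_mass.
Qed.

End BoxDetermined.

(** * Mixtures of probability kernels *)

Section Mixture.
Context dd (T : measurableType dd) ds (S : measurableType ds) {R : realType}.
Variables (mu : {measure set T -> \bar R}) (v : T -> R) (k : T -> probability S R).
Hypotheses (mv : measurable_fun setT v) (v0 : forall x, 0 <= v x).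
Hypothesis v1 : (\int[mu]_x (v x)%:E = 1)%E.

(** A Borel version of x -> k x B up to a null set, weighted by [v]. The null set may depend on [B];
    for countable additivity only countably many sets matter at a time. *)
Definition mixable := forall B, measurable B -> exists g : T -> \bar R,
  [/\ measurable_fun setT g, forall x, (0 <= g x)%E &
      {ae mu, forall x, ((v x)%:E * k x B = (v x)%:E * g x)%E}].

Definition mix of mixable : set S -> \bar R := fun B => (\int[mu]_x ((v x)%:E * k x B))%E.

Section Mix.
Hypothesis H : mixable.

Let mix0 : mix H set0 = 0%E.
Proof. by rewrite /mix; under eq_integral do rewrite measure0 mule0; rewrite integral0. Qed.

Let mix_ge0 B : (0 <= mix H B)%E.
Proof. by apply: integral_ge0 => x _; rewrite mule_ge0// lee_fin. Qed.

Let mEv : measurable_fun setT (EFin \o v). Proof. exact/measurable_EFinP. Qed.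

Let mix_sigma : semi_sigma_additive (mix H).
Proof.
move=> F mF tF mU; have /choice [g Hg] := fun i => H (mF i).
have e i : mix H (F i) = (\int[mu]_x ((v x)%:E * g i x))%E.
  have [mg g0 h] := Hg i; apply: ae_integral => //.
  - exact: emeasurable_funM.
  - by move=> x; rewrite mule_ge0// lee_fin.
  - by move=> x; rewrite mule_ge0// lee_fin.
have -> : mix H (\bigcup_n F n) = (\sum_(0 <= i <oo) mix H (F i))%E.
  under eq_eseriesr do rewrite e.
  rewrite -integral_nneseries//; last 2 first.
  - by move=> i; have [mg _ _] := Hg i; exact: emeasurable_funM.
  - by move=> i x _; have [_ g0 _] := Hg i; rewrite mule_ge0// lee_fin.
  apply: ae_integral.
  - apply: ge0_emeasurable_sum => [i x _ _|i _].
      by have [_ g0 _] := Hg i; rewrite mule_ge0// lee_fin.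
    by have [mg _ _] := Hg i; exact: emeasurable_funM.
  - by move=> x; rewrite mule_ge0// lee_fin.
  - by move=> x; apply: nneseries_ge0 => i _ _; have [_ g0 _] := Hg i; rewrite mule_ge0// lee_fin.
  have : {ae mu, forall x, forall i, ((v x)%:E * k x (F i) = (v x)%:E * g i x)%E}.
    by apply/ae_foralln => i; have [] := Hg i.
  apply: filterS => x hx; under eq_eseriesr do rewrite -hx.
  rewrite nneseriesZl//; congr (_ * _)%E.
  by apply/esym/cvg_lim => //; exact: measure_semi_sigma_additive.
apply: is_cvg_nneseries => i _ _; exact: mix_ge0.
Qed.

HB.instance Definition _ := isMeasure.Build _ _ _ (mix H) mix0 mix_ge0 mix_sigma.

Let mix_setT : mix H setT = 1%E.
Proof. by rewrite /mix; under eq_integral do rewrite probability_setT mule1. Qed.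

HB.instance Definition _ := Measure_isProbability.Build _ _ _ (mix H) mix_setT.

(** The martingale problem speaks of every probability [Q] equal to P_{v mu} and gives information
    only once such a [Q] has been constructed. *)
Lemma mixture_exists : exists Q : probability S R, forall B, measurable B ->
  Q B = (\int[mu]_x ((v x)%:E * k x B))%E.
Proof. by exists (mix H : probability S R). Qed.

End Mix.
End Mixture.

Section ProcessLaw.
Context {R : realType} {d : nat} (N : process R d).
Local Notation E := 'rV[R]_d.
Local Notation ED := (one_point_compactification 'rV[R]_d).
Local Notation X := (@pr_X R d N).
Local Notation P := (@pr_P R d N).
Hypothesis fil : admissible_filtration N.

Lemma pr_meas t : 0 <= t -> measurable_fun setT (X t).
Proof.
have [h1 _ _ h4] := fil; move=> t0 _ B mB; rewrite setTI.
by have [_ sub] := h1 t t0; apply: sub; exact: h4.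
Qed.

Lemma lawm_le1 dd (T : measurableType dd) (Q : probability T R) (Y : T -> ED)
  (mY : measurable_fun setT Y) : (lawm Q mY setT <= 1)%E.
Proof.
apply: probability_le1; rewrite -[X in measurable X]setTI; apply: mY => //.
exact: meas_some.
Qed.

Lemma expect_law x t (t0 : 0 <= t) (f : E -> R) (c : R) : measurable_fun setT f ->
  (forall y, `|f y| <= c) -> expect N x t f = \int[lawm (P (Some x)) (pr_meas t0)]_y f y.
Proof. by move=> mf fc; rewrite Rint_law//; apply: (ig_bnd (lawm_le1 _ _) mf fc). Qed.

Lemma kernel_meas t : 0 <= t ->
  (forall f : E -> R, tst f -> measurable_fun setT (fun x => expect N x t f)) ->
  forall B : set E, measurable B ->
    measurable_fun setT (fun x : E => P (Some x) (X t @^-1` (Some @` B))).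
Proof.
move=> t0 Hf B mB; pose k x := lawm (P (Some x)) (pr_meas t0).
have k1 x : (k x setT <= 1)%E by exact: lawm_le1.
have -> : (fun x : E => P (Some x) (X t @^-1` (Some @` B))) = (fun x => (fine (k x B))%:E).
  by apply/funext => x; rewrite fineK//; exact: fin_mass.
apply/measurable_EFinP.
apply: (@box_class _ _ _ (fun f : E -> R => measurable_fun setT f) k) => //.
- by move=> f g mf mg; exact: measurable_funB.
- move=> F f mF Ff; apply: (measurable_fun_cvg (D := setT) mF) => x _; exact: Ff.
- move=> f tf; have [c _ fc] := tst_bounded tf.
  have := Hf _ tf; congr measurable_fun; apply/funext => x.
  by rewrite (expect_law _ t0 (tst_meas tf) fc).
Qed.

(** Makes the strong Markov property, which is formulated for mixtures, available under each single
    P_x. *)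
Lemma dirac_mixture (x : ED) :
  (forall B, measurable B -> universally_measurable (fun y => P y B)) ->
  is_mixture (dirac x) (P x).
Proof.
move=> um B mB; have [g [mg [Z [mZ Z0 HZ]]]] := um B mB (dirac x).
have mag : measurable_fun setT (fun y => `|g y|%E) by exact: measurableT_comp.
have gx : P x B = `|g x|%E.
  have -> : g x = P x B.
    apply: contrapT => h; have : Z x by apply: HZ => /= h'; apply: h.
    move=> Zx; move: (Z0 : \d_x Z = 0%E); rewrite diracE mem_set// => /eqP.
    by rewrite eqe oner_eq0.
  by rewrite gee0_abs.
rewrite (@ae_integral _ _ _ _ _ (fun y => `|g y|%E))//.
  by rewrite integral_dirac// diracT mul1e.
exists Z; split => // y /= H; apply: HZ => /= h; apply: H; rewrite -h.
by rewrite gee0_abs.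
Qed.

(** Universal measurability is applied to the image of v mu in the compactification, itself obtained
    as a mixture of Dirac measures. *)
Lemma mixable_process (mu : {measure set E -> \bar R}) (v : E -> R) :
  measurable_fun setT v -> (forall x, 0 <= v x) -> (\int[mu]_x (v x)%:E = 1)%E ->
  (forall B, measurable B -> universally_measurable (fun y => P y B)) ->
  mixable mu v (fun x => P (Some x)).
Proof.
move=> mv v0 v1 um.
have mEv : measurable_fun setT (EFin \o v) by exact/measurable_EFinP.
have mSome := @meas_Some R d.
have mSB (B : set ED) : measurable B -> measurable_fun setT (fun x : E => (\1_B (Some x : ED) : R)%:E).
  move=> mB; apply/measurable_EFinP.
  rewrite (_ : (fun x => _) = (\1_((Some : E -> ED) @^-1` B) : E -> R))//.
  by apply: measurable_indic; rewrite -[X in measurable X]setTI; exact: mSome.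
have [|nu Hnu] := @mixture_exists _ _ _ ED R mu v (fun x => dirac (Some x : ED)) mv v0 v1.
  move=> B mB; exists (fun x => (\1_B (Some x))%:E); split.
  - exact: mSB.
  - by move=> x; rewrite lee_fin.
  - by apply: aeW => x; congr (_ * _)%E; rewrite indicE.
move=> B mB; have [g [mg [Z [mZ Z0 HZ]]]] := um B mB nu.
have mag : measurable_fun setT (fun y => `|g y|%E) by exact: measurableT_comp.
exists (fun x => `|g (Some x)|%E); split => //.
- by apply: (measurableT_comp mag mSome).
have mZv : measurable_fun setT (fun x => (v x)%:E * (\1_Z (Some x))%:E)%E.
  by apply: emeasurable_funM => //; exact: mSB.
have : ae_eq mu setT (fun x => (v x)%:E * (\1_Z (Some x))%:E)%E (cst 0%E).
  apply/(ae_eq_integral_abs mu measurableT mZv); rewrite -Z0 Hnu//.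
  apply: eq_integral => x _; rewrite gee0_abs; last by rewrite mule_ge0// lee_fin.
  by congr (_ * _)%E; rewrite indicE.
apply: filterS => x /(_ Logic.I) /eqP; rewrite mule_eq0 => /orP[/eqP ->|]; first by rewrite !mul0e.
rewrite indicE; case: (boolP (_ \in Z)) => [_|]; first by rewrite eqe oner_eq0.
rewrite notin_setE => nZ _; congr (_ * _)%E.
have -> : g (Some x) = P (Some x) B by apply: contrapT => h; apply: nZ; apply: HZ => /= h'; apply: h.
by rewrite gee0_abs.
Qed.

End ProcessLaw.

(** * The semigroup, its continuous version and conservation of mass *)

Section SemigroupVersion.
Context {R : realType} {d : nat}.
Local Notation E := 'rV[R]_d.
Implicit Types (f g h : E -> R).
Variables (lam mu : {measure set E -> \bar R}).
Variables (A : E -> 'M[R]_d) (G B : 'I_d -> E -> R).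
Variable T : R -> (E -> R) -> E -> R.
Hypothesis sg : subMarkov_C0_contraction_semigroup mu T.

Lemma sg_ig t f : 0 < t -> ig mu f -> ig mu (T t f).
Proof. by case: sg => h _ _ _ _; exact: h. Qed.

Lemma sg_contr t f : 0 < t -> ig mu f -> n1 mu (T t f) <= n1 mu f.
Proof.
move=> t0 fi; case: sg => _ _ _ _ [h _ _].
by rewrite -lee_fin !n1_E//; [exact: h|exact: sg_ig].
Qed.

Lemma sg_lin t c f g : 0 < t -> ig mu f -> ig mu g ->
  {ae mu, forall x, T t (fun y => c * f y + g y) x = c * T t f x + T t g x}.
Proof. by case: sg => _ h _ _ _ *; exact: h. Qed.

Lemma sg_sub t f g : 0 < t -> ig mu f -> ig mu g ->
  n1 mu (T t f \- T t g) <= n1 mu (f \- g).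
Proof.
move=> t0 fi gi; have := sg_lin (-1) t0 gi fi.
rewrite (_ : (fun y => -1 * g y + f y) = f \- g); last first.
  by apply/funext => y /=; rewrite mulN1r addrC.
move=> h; have i3 := sg_ig t0 (igB fi gi).
have i1 := sg_ig t0 fi; have i2 := sg_ig t0 gi.
rewrite (@n1_ae _ _ _ mu (T t f \- T t g) (T t (f \- g))).
- exact: sg_contr (igB fi gi).
- exact: ig_meas (igB i1 i2).
- exact: ig_meas i3.
- by apply: filterS h => x /= ->; rewrite mulN1r addrC.
Qed.

Lemma n1_0_ae dd (S : measurableType dd) (m : {measure set S -> \bar R}) (f g : S -> R) :
  ig m f -> ig m g -> n1 m (f \- g) = 0 -> {ae m, forall x, f x = g x}.
Proof.
move=> fi gi h; have i := igB fi gi.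
have e : (\int[m]_x `|((f \- g) x)%:E| = 0)%E.
  by rewrite -[RHS]/(0%R%:E) -h n1_E.
have := (ae_eq_integral_abs m measurableT (measurable_int _ i)).1 e.
by apply: filterS => x /(_ Logic.I) /= [] /eqP; rewrite subr_eq0 => /eqP.
Qed.

Variables (P : R -> (E -> R) -> E -> R).
Hypothesis cv : continuous_version mu T P.

Lemma Ls1P f : Ls mu 1%E f <-> ig mu f.
Proof. exact: Lfun1_integrable. Qed.

Lemma version_cont t f : 0 < t -> ig mu f -> continuous (P t f).
Proof. by move=> t0 /Ls1P fi; have [_ /(_ t 1%E f t0 (lexx _) fi)[]] := cv. Qed.

Lemma version_ig t f : 0 < t -> ig mu f -> ig mu (P t f).
Proof.
move=> t0 /Ls1P fi; have [_ /(_ t 1%E f t0 (lexx _) fi)[_]] := cv.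
by rewrite /extends_to /= => -[/Ls1P].
Qed.

(** By definition [P t f] is the limit of [T t] along some approximation of [f] in L^1;
    contractivity makes [T t f] a limit of the same sequence. *)
Lemma version_ae t f : 0 < t -> ig mu f -> {ae mu, forall x, T t f x = P t f x}.
Proof.
move=> t0 fi; apply: n1_0_ae; [exact: sg_ig|exact: version_ig|].
have Lf := (Ls1P f).2 fi.
have Pi := version_ig t0 fi; have Ti := sg_ig t0 fi.
have [_ /(_ t 1%E f t0 (lexx _) Lf)[_]] := cv.
rewrite /extends_to /= => -[_ [fn [Lfn c1 c2]]].
have fni n : ig mu (fn n) by apply/Ls1P; have [] := Lfn n.
have Tni n : ig mu (T t (fn n)) by exact: sg_ig.
have {}c1 : n1 mu (fn n \- f) @[n --> \oo] --> (0 : R).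
  apply/(@n1_cvgP _ _ _ _ (fun n => fn n \- f)); first by move=> n; exact: igB.
  by move: c1; rewrite /Ls_cvg; under eq_fun do rewrite Lnorm1.
have {}c2 : n1 mu (T t (fn n) \- P t f) @[n --> \oo] --> (0 : R).
  apply/(@n1_cvgP _ _ _ _ (fun n => T t (fn n) \- P t f)); first by move=> n; exact: igB.
  by move: c2; rewrite /Ls_cvg; under eq_fun do rewrite Lnorm1.
apply/eqP; rewrite eq_le n1_ge0 andbT; apply/ler_addgt0Pl => e e0; rewrite addr0.
have e2 : 0 < e / 2 by rewrite divr_gt0.
move/(@cvgrPdist_le _ _ _ (nbhs \oo) _)/(_ _ e2) : c1.
move/(@cvgrPdist_le _ _ _ (nbhs \oo) _)/(_ _ e2) : c2.
move=> h2 h1; have [n [/= a b]] := filter_ex (filterI h1 h2).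
move: a b; rewrite !sub0r !normrN !ger0_norm ?n1_ge0// => a b.
apply: (le_trans (n1_sub Ti (Tni n) Pi)); rewrite [leRHS]splitr lerD//.
by apply: le_trans (sg_sub t0 fi (fni n)) _; rewrite n1C.
Qed.

Variable M : process R d.
Hypotheses (ht : has_transition M P) (fil : admissible_filtration M) (inv : invariant_measure M mu).

(** For indicators of finite measure this is the invariance of [mu], read through the transition
    function; linearity and L^1 continuity do the rest. *)
Lemma sg_invariant t f : 0 < t -> ig mu f -> \int[mu]_x T t f x = \int[mu]_x f x.
Proof.
move=> t0; move: f; apply: L1_induction.
- move=> S mS Sf.
  have ii : ig mu (\1_S : E -> R) by exact: ig_indic.
  rewrite Rint_indic//.
  rewrite (@Rint_ae _ _ _ mu _ (P t \1_S)); last 3 first.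
  + exact: ig_meas (sg_ig t0 ii).
  + exact: ig_meas (version_ig t0 ii).
  + exact: version_ae.
  have [_ /(_ t S (ltW t0) mS) <-] := inv.
  congr fine; apply: eq_integral => x _.
  have mI : measurable_fun setT (\1_S : E -> R) by exact: measurable_indic.
  have I1 y : `|\1_S y : R| <= 1 by rewrite indicE; case: (_ \in _); rewrite /= ?normr0 ?normr1.
  rewrite (ht x (ltW t0) mI); last by exists 1.
  rewrite (expect_law fil x (ltW t0) mI I1) Rint_indic// fineK//.
  by apply: fin_mass => //; exact: lawm_le1.
- move=> c f g fi gi hf hg.
  have Ti := sg_ig t0 fi; have Tg := sg_ig t0 gi.
  have ii := igD (igZ c fi) gi; have iT := igD (igZ c Ti) Tg.
  rewrite (@Rint_ae _ _ _ mu _ (fun x => c * T t f x + T t g x)); last 3 first.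
  + exact: ig_meas (sg_ig t0 ii).
  + exact: ig_meas iT.
  + exact: sg_lin.
  rewrite (RintegralD measurableT (igZ c Ti) Tg) (RintegralD measurableT (igZ c fi) gi).
  by rewrite !RintegralZl// hf hg.
- move=> F f Fi fi hF Fc; apply/eqP; rewrite -subr_eq0 -normr_le0.
  apply/ler_addgt0Pl => e e0; rewrite addr0.
  have e2 : 0 < e / 2 by rewrite divr_gt0.
  move/(@cvgrPdist_le _ _ _ (nbhs \oo) _)/(_ _ e2) : Fc => h.
  have [n /=] := filter_ex h; rewrite sub0r normrN ger0_norm ?n1_ge0// => hn.
  have Ti := sg_ig t0 fi; have Tn := sg_ig t0 (Fi n).
  rewrite [leRHS]splitr; apply: le_trans (ler_distD (\int[mu]_x T t (F n) x) _ _) _.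
  apply: lerD.
    rewrite -(RintegralB measurableT Ti Tn).
    apply: le_trans (norm_Rint_le (igB Ti Tn)) _.
    by apply: le_trans (sg_sub t0 fi (Fi n)) _; rewrite n1C.
  rewrite hF -(RintegralB measurableT (Fi n) fi).
  exact: le_trans (norm_Rint_le (igB (Fi n) fi)) _.
Qed.

End SemigroupVersion.

Lemma maxr_sub_maxr (R : realDomainType) (z : R) : z = Num.max z 0 - Num.max (- z) 0.
Proof.
case: (leP z 0) => h; first by rewrite max_l ?oppr_ge0// sub0r opprK.
by rewrite max_r ?subr0// oppr_le0 ltW.
Qed.

Section MixtureIntegral.
Context dd (T : measurableType dd) ds (S : measurableType ds) {R : realType}.
Variables (mu : {measure set T -> \bar R}) (m : {measure set S -> \bar R}).
Variables (v : T -> R) (k : T -> {measure set S -> \bar R}).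
Hypotheses (mv : measurable_fun setT v) (v0 : forall x, 0 <= v x).
Hypothesis mk : forall B, measurable B -> measurable_fun setT (fun x => k x B).
Hypothesis mE : forall B, measurable B -> (m B = \int[mu]_x ((v x)%:E * k x B))%E.
Import HBNNSimple.

Let mEv : measurable_fun setT (EFin \o v). Proof. exact/measurable_EFinP. Qed.

Let sintE (l : {measure set S -> \bar R}) (h : {nnsfun S >-> R}) :
  (\int[l]_x (h x)%:E = \sum_(y <- finmap.enum_fset (fset_set (range h)))
     (y%:E * l (h @^-1` [set y])))%E.
Proof. by rewrite integralT_nnsfun sintegralE fsbig_finite. Qed.

Let term_ge0 (h : {nnsfun S >-> R}) (l : {measure set S -> \bar R}) y :
  (0 <= y%:E * l (h @^-1` [set y]))%E.
Proof.
have [[w wy]|H] := pselect (exists w, h w = y).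
  by rewrite mule_ge0// lee_fin -wy.
by rewrite preimage10 ?measure0 ?mule0// => -[w _ wy]; apply: H; exists w.
Qed.

Let mterm (h : {nnsfun S >-> R}) y : measurable_fun setT (fun x => y%:E * k x (h @^-1` [set y]))%E.
Proof. by apply: emeasurable_funM => //; apply: mk; exact: measurable_sfunP. Qed.

Let apx (f : S -> \bar R) (mf : measurable_fun setT f) := nnsfun_approx (@measurableT _ S) mf.

Let nd_apx (f : S -> \bar R) (mf : measurable_fun setT f) y : nondecreasing_seq (fun n => (apx mf n y)%:E).
Proof. by move=> a b ab; rewrite lee_fin; exact/lefP/nd_nnsfun_approx. Qed.

Let lim_apx (f : S -> \bar R) (mf : measurable_fun setT f) (l : {measure set S -> \bar R}) :
  (forall y, 0 <= f y)%E ->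
  (\int[l]_y (apx mf n y)%:E)%E @[n --> \oo] --> (\int[l]_y f y)%E.
Proof.
move=> f0; have -> : (\int[l]_y f y = \int[l]_y limn (fun n => (apx mf n y)%:E))%E.
  apply: eq_integral => y _; apply/esym/cvg_lim => //; exact: cvg_nnsfun_approx.
apply: cvg_monotone_convergence => //.
- by move=> n; exact/measurable_EFinP.
- by move=> n y _; rewrite lee_fin; exact: fun_ge0.
Qed.

Let meas_apx (h : {nnsfun S >-> R}) : measurable_fun setT (fun x => \int[k x]_y (h y)%:E)%E.
Proof.
rewrite (_ : (fun x => _) = fun x =>
    (\sum_(y <- finmap.enum_fset (fset_set (range h))) (y%:E * k x (h @^-1` [set y])))%E).
  by apply: emeasurable_sum => y; exact: mterm.
by apply/funext => x; rewrite sintE.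
Qed.

Lemma meas_kernel_integral f : measurable_fun setT f -> (forall y, 0 <= f y)%E ->
  measurable_fun setT (fun x => \int[k x]_y f y)%E.
Proof.
move=> mf f0; apply: (emeasurable_fun_cvg (fun n x => \int[k x]_y (apx mf n y)%:E)%E).
  by move=> n; exact: meas_apx.
by move=> x _; exact: lim_apx.
Qed.

Lemma integral_mix f : measurable_fun setT f -> (forall y, 0 <= f y)%E ->
  (\int[m]_y f y = \int[mu]_x ((v x)%:E * \int[k x]_y f y))%E.
Proof.
move=> mf f0; pose h := apx mf.
have h0 n y : (0 <= (h n y)%:E)%E by rewrite lee_fin.
have lim_h (l : {measure set S -> \bar R}) :
    (\int[l]_y (h n y)%:E)%E @[n --> \oo] --> (\int[l]_y f y)%E by exact: lim_apx.
pose I n x : \bar R := ((v x)%:E * \int[k x]_y (h n y)%:E)%E.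
have mI n : measurable_fun setT (I n) by apply: emeasurable_funM => //; exact: meas_apx.
have I0 n x : (0 <= I n x)%E by rewrite /I mule_ge0 ?lee_fin// integral_ge0.
have ndI x : nondecreasing_seq (I ^~ x).
  move=> a b ab; rewrite /I lee_wpmul2l ?lee_fin//; apply: ge0_le_integral => //.
  - exact/measurable_EFinP.
  - exact/measurable_EFinP.
  - by move=> y _; exact: nd_apx.
have cI x : I n x @[n --> \oo] --> ((v x)%:E * \int[k x]_y f y)%E.
  by apply: cvgeZl => //; exact: lim_h.
have e n : (\int[m]_y (h n y)%:E = \int[mu]_x I n x)%E.
  rewrite sintE; under eq_bigr => y _ do rewrite mE//.
  rewrite /I; under [RHS]eq_integral => x _ do rewrite sintE ge0_sume_distrr//.
  rewrite ge0_integral_sum//; last 2 first.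
  - by move=> y; apply: emeasurable_funM => //; exact: mterm.
  - by move=> y x _; rewrite mule_ge0 ?lee_fin.
  apply: eq_bigr => y _.
  under [RHS]eq_integral => x _ do rewrite muleCA.
  have [[w wy]|H] := pselect (exists w, h n w = y).
    rewrite ge0_integralZl_EFin//.
    - by move=> x _; rewrite mule_ge0 ?lee_fin.
    - by apply: emeasurable_funM => //; apply: mk; exact: measurable_sfunP.
    - by rewrite -wy.
  have -> : h n @^-1` [set y] = set0 by apply: preimage10 => -[w _ wy]; apply: H; exists w.
  under eq_integral do rewrite measure0 mule0.
  by under [RHS]eq_integral do rewrite measure0 !mule0; rewrite !integral0 mule0.
have c1 := lim_h m.
rewrite (_ : (fun n => (\int[m]_y (h n y)%:E)%E) = (fun n => (\int[mu]_x I n x)%E)) in c1; last first.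
  by apply/funext => n; exact: e.
apply: (cvg_unique _ c1) => //.
have -> : (\int[mu]_x ((v x)%:E * \int[k x]_y f y) = \int[mu]_x limn (I ^~ x))%E.
  by apply: eq_integral => x _; apply/esym/cvg_lim.
by apply: cvg_monotone_convergence.
Qed.

Lemma Rint_mix (f : S -> R) : ig m f -> (forall x, ig (k x) f) ->
  \int[m]_y f y = \int[mu]_x (v x * \int[k x]_y f y).
Proof.
move=> fm fk; have mf := ig_meas fm.
have pos (g : S -> R) : measurable_fun setT g -> (forall y, 0 <= g y) ->
    (forall y, `|g y| <= `|f y|) ->
    [/\ \int[m]_y g y = \int[mu]_x (v x * \int[k x]_y g y),
        ig m g, forall x, ig (k x) g & ig mu (fun x => v x * \int[k x]_y g y)].
  move=> mg g0 gf; have im := ig_le mg gf fm; have ik x := ig_le mg gf (fk x).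
  have mEg : measurable_fun setT (EFin \o g) by exact/measurable_EFinP.
  have g0' y : (0 <= (EFin \o g) y)%E by rewrite lee_fin.
  have H := integral_mix mEg g0'.
  have kE x : (\int[k x]_y (g y)%:E)%E = (\int[k x]_y g y)%:E.
    by rewrite /Rintegral fineK//; exact: (integrable_fin_num measurableT (ik x)).
  have H2 : (\int[m]_y (g y)%:E = \int[mu]_x (v x * \int[k x]_y g y)%:E)%E.
    by rewrite H; apply: eq_integral => x _; rewrite EFinM -kE.
  have mk' : measurable_fun setT (fun x => \int[k x]_y g y).
    apply/measurable_EFinP; have := meas_kernel_integral mEg g0'; congr measurable_fun.
    by apply/funext => x; exact: kE.
  have vk0 x : 0 <= v x * \int[k x]_y g y by rewrite mulr_ge0//; apply: Rintegral_ge0.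
  split => //; first by congr fine.
  apply/integrableP; split; first by apply/measurable_EFinP; exact: measurable_funM.
  rewrite (eq_integral (fun x => (v x * \int[k x]_y g y)%:E)).
    rewrite -H2; have := integrable_fin_num measurableT im.
    by rewrite ge0_fin_numE ?integral_ge0//.
  by move=> x _; rewrite /= ger0_norm.
pose fp x := Num.max (f x) 0; pose fn x := Num.max (- f x) 0.
have [e1 a1 b1 c1] : [/\ \int[m]_y fp y = \int[mu]_x (v x * \int[k x]_y fp y),
        ig m fp, forall x, ig (k x) fp & ig mu (fun x => v x * \int[k x]_y fp y)].
  apply: pos => [|y|y]; first exact: measurable_maxr.
    by rewrite /fp le_max lexx orbT.
  by rewrite ger0_norm ?ge_max ?ler_norm ?normr_ge0// /fp le_max lexx orbT.
have [e2 a2 b2 c2] : [/\ \int[m]_y fn y = \int[mu]_x (v x * \int[k x]_y fn y),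
        ig m fn, forall x, ig (k x) fn & ig mu (fun x => v x * \int[k x]_y fn y)].
  apply: pos => [|y|y]; first by apply: measurable_maxr => //; exact: measurable_funN.
    by rewrite /fn le_max lexx orbT.
  by rewrite ger0_norm ?ge_max ?normr_ge0 -?[`|f y|]normrN ?ler_norm// /fn le_max lexx orbT.
have fE x : f x = fp x - fn x.
  exact: maxr_sub_maxr.
have iE (l : {measure set S -> \bar R}) : ig l fp -> ig l fn ->
    \int[l]_y f y = \int[l]_y fp y - \int[l]_y fn y.
  by move=> i1 i2; rewrite -(RintegralB measurableT i1 i2); apply: eq_Rintegral => x _; exact: fE.
rewrite (iE m a1 a2) e1 e2 -(RintegralB measurableT c1 c2).
by apply: eq_Rintegral => x _ /=; rewrite iE// mulrBr.
Qed.

End MixtureIntegral.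

(** * Joint measurability of right-continuous processes in time and chance *)

Section Joint.
Context {R : realType} {d : nat}.
Local Notation E := 'rV[R]_d.
Local Notation ED := (one_point_compactification 'rV[R]_d).

Section Compose.
Context dd (Y : measurableType dd) (Z : Y -> ED).
Hypothesis tZ : forall f : E -> R, tst f -> measurable_fun setT (fun y => ext0 f (Z y)).

(** A point as a measure on [E], the cemetery giving the zero measure. In this guise [box_class]
    extends measurability from test functions to all Borel sets. *)
Let k (y : Y) : {measure set E -> \bar R} :=
  if Z y is Some x then dirac x else mzero.

Let kE y (f : E -> R) : measurable_fun setT f -> \int[k y]_x f x = ext0 f (Z y).
Proof.
move=> mf; rewrite /k /Rintegral; case: (Z y) => [x|]; last by rewrite integral_measure_zero.
rewrite integral_dirac//; last exact/measurable_EFinP.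
by rewrite diracT mul1e.
Qed.

Let meas_Z B : measurable B -> measurable (Z @^-1` (Some @` B)).
Proof.
move=> mB.
have k1 y : (k y setT <= 1)%E.
  rewrite /k; case: (Z y) => [x|]; last exact: lee01.
  rewrite -[X in (X <= _)%E]/(\d_x setT) diracT; exact: lexx.
have := @box_class _ _ _ (fun f : Y -> R => measurable_fun setT f) k k1 _ _ _ _ mB.
have -> : (fun y => fine (k y B)) = \1_(Z @^-1` (Some @` B)).
  apply/funext => y; rewrite indicE /k.
  case: (pselect ((Z @^-1` (Some @` B)) y)) => h.
    rewrite [in RHS]mem_set//; case: h => x Bx /= <-.
    by rewrite -[X in fine X]/(\d_x B) diracE mem_set.
  rewrite [in RHS]memNset//; move: h; rewrite /preimage/=; case: (Z y) => [x|//] h.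
  by rewrite -[X in fine X]/(\d_x B) diracE memNset// => Bx; apply: h; exists x.
move=> H; rewrite -[X in measurable X]setTI.
have -> : Z @^-1` (Some @` B) = (\1_(Z @^-1` (Some @` B)) : Y -> R) @^-1` [set 1].
  apply/seteqP; split => y /=; first by move=> h; rewrite indicE mem_set.
  rewrite indicE; case: (boolP (_ \in _)) => [|_ /eqP]; first by rewrite inE.
  by rewrite eq_sym oner_eq0.
apply: H => //.
- by move=> f g mf mg; exact: measurable_funB.
- move=> F f mF Ff; apply: (measurable_fun_cvg (D := setT) mF) => y _; exact: Ff.
- move=> f tf; have := tZ tf; congr measurable_fun; apply/funext => y.
  by rewrite kE//; exact: tst_meas.
Qed.

Lemma meas_comp_ext0 h : measurable_fun setT h -> measurable_fun setT (fun y => ext0 h (Z y)).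
Proof.
move=> mh _ B mB; rewrite setTI.
have mC : measurable (h @^-1` B) by rewrite -[X in measurable X]setTI; exact: mh.
have [B0|B0] := pselect (B 0).
  rewrite (_ : _ @^-1` _ = Z @^-1` (Some @` (h @^-1` B)) `|` ~` (Z @^-1` (Some @` [set: E]))).
    by apply: measurableU; [exact: meas_Z|apply: measurableC; exact: meas_Z].
  apply/seteqP; split => y /=; case: (Z y) => [x|] /=.
  - by move=> h1; left; exists x.
  - by move=> _; right => -[].
  - by case=> [[z Bz [<-]]//|[]]; exists x.
  - by [].
rewrite (_ : _ @^-1` _ = Z @^-1` (Some @` (h @^-1` B))); first exact: meas_Z.
apply/seteqP; split => y /=; case: (Z y) => [x|] //=.
- by move=> h1; exists x.
- by move=> [z Bz [<-]].
- by move=> [].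
Qed.

End Compose.

Variable N : process R d.
Local Notation X := (@pr_X R d N).
Hypothesis fil : admissible_filtration N.
Hypothesis rc : forall w (t : R), 0 <= t -> X s w @[s --> t^'+] --> X t w.

Let level n k : set (measurableTypeR R * pr_Omega N) :=
  [set y | k%:R <= n.+1%:R * Num.max y.1 0 < k.+1%:R].

(** The value at time s is the limit of the values at the next point of finer and finer grids, and
    for a grid the time variable takes countably many values. Times are clipped at 0 because the
    axioms of the process concern nonnegative times only. *)
Lemma joint_meas h : measurable_fun setT h ->
  measurable_fun setT (fun y : measurableTypeR R * pr_Omega N => ext0 h (X (Num.max y.1 0) y.2)).
Proof.
move: h; apply: meas_comp_ext0 => f tf; have [sf [r vf]] := tf.
pose tk n k : R := k.+1%:R / n.+1%:R.
(* The grid time is strictly later than s, as required by a limit along the right punctured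
   neighbourhoods. *)
pose tn n (s : R) := tk n (Num.truncn (n.+1%:R * Num.max s 0)).
have m0 (s : R) : 0 <= Num.max s 0 by rewrite le_max lexx orbT.
have lvl n (s : R) : (Num.truncn (n.+1%:R * Num.max s 0))%:R <= n.+1%:R * Num.max s 0 <
    (Num.truncn (n.+1%:R * Num.max s 0)).+1%:R.
  by apply: truncn_itv; rewrite mulr_ge0.
apply: (measurable_fun_cvg (D := setT) (h := fun n y => ext0 f (X (tn n y.1) y.2))).
  move=> n; have mL k : measurable (level n k).
    rewrite (_ : level n k = (fun y => n.+1%:R * Num.max y.1 0) @^-1` `[k%:R, k.+1%:R[%classic).
      rewrite -[X in measurable X]setTI; apply: measurable_funM => //.
      by apply: measurable_maxr => //; exact: measurable_fst.
    by apply/seteqP; split => y /=; rewrite in_itv.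
  have -> : [set: measurableTypeR R * pr_Omega N] = \bigcup_k level n k.
    apply/seteqP; split => // y _.
    by exists (Num.truncn (n.+1%:R * Num.max y.1 0)) => //; exact: lvl.
  apply/(measurable_fun_bigcup _ mL) => k.
  apply: (eq_measurable_fun (fun y => ext0 f (X (tk n k) y.2))).
    move=> y; rewrite inE /level /= => H; rewrite /tn.
    have /eqP -> // : Num.truncn (n.+1%:R * Num.max y.1 0) == k by rewrite truncn_eq ?mulr_ge0.
  apply: measurable_funTS.
  have t0 : 0 <= tk n k by rewrite divr_ge0.
  have := measurableT_comp (meas_ext0 (tst_meas tf)) (pr_meas fil t0).
  by move=> h1; apply: (measurableT_comp h1) => //; exact: measurable_snd.
move=> y _; have cf := ext0_cont (smooth_cont sf) vf.
set s := Num.max y.1 0.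
apply: (@cvg_comp _ _ _ (fun n => X (tn n y.1) y.2) (ext0 f) _ (nbhs (X s y.2))); last exact: cf.
have lt n : s < tn n y.1 by have /andP[_] := lvl n y.1; rewrite -ltr_pdivlMl// mulrC.
have tc : tn n y.1 @[n --> \oo] --> s.
  apply/(@cvgrPdist_le _ _ _ (nbhs \oo) _) => e e0.
  have [m _ Hm] := (near_infty_natSinv_lt (PosNum e0)); exists m => // n /= mn.
  rewrite distrC ger0_norm ?subr_ge0 ?(ltW (lt n))//.
  have := Hm n mn; rewrite /= => /ltW he; apply: (le_trans _ he); rewrite /tn /tk -addn1 natrD mulrDl.
  rewrite -[leRHS]add0r mul1r addrAC lerD2r subr_le0.
  by rewrite ler_pdivrMr// [leRHS]mulrC; have /andP[] := lvl n y.1.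
move=> U /(rc (m0 y.1)) HU.
have [m _ Hm] := tc _ HU; exists m => // n mn.
by apply: (Hm n mn); exact: lt.
Qed.

End Joint.

(** * One-dimensional marginals of a solution of the martingale problem *)

Section MartingaleFlow.
Context {R : realType} {d : nat} (N : process R d).
Local Notation E := 'rV[R]_d.
Local Notation X := (@pr_X R d N).
Local Notation P := (@pr_P R d N).
Local Notation leb := (@lebesgue_measure R).
Implicit Types (h f g k u : E -> R) (s t a b r : R).
Hypothesis fil : admissible_filtration N.
Hypothesis rc : forall w t, 0 <= t -> X s w @[s --> t^'+] --> X t w.
Variables (mu : {measure set E -> \bar R}) (v : E -> R) (c : R).
Hypotheses (mv : measurable_fun setT v) (v0 : forall x, 0 <= v x) (vc : forall x, v x <= c).
Hypothesis c0 : 0 < c.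
Hypothesis kmeas : forall t, 0 <= t -> forall B, measurable B ->
  measurable_fun setT (fun x => P (Some x) (X t @^-1` (Some @` B))).
Hypothesis sub : sub_invariant_measure N mu.
Variable Q : probability (pr_Omega N) R.
Hypothesis QE : forall B, measurable B -> Q B = (\int[mu]_x ((v x)%:E * P (Some x) B))%E.

Let cmu := mscale (NngNum (ltW c0)) mu.

Let law_le t (t0 : 0 <= t) B : measurable B -> (lawm Q (pr_meas fil t0) B <= cmu B)%E.
Proof.
move=> mB; have mXB : measurable (X t @^-1` (Some @` B)).
  by rewrite -[X in measurable X]setTI; apply: (pr_meas fil t0) => //; exact: meas_some.
rewrite /lawm /= /law QE//.
apply: (@le_trans _ _ (\int[mu]_x (c%:E * P (Some x) (X t @^-1` (Some @` B))))%E).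
  apply: le_integral_sup => x; first by rewrite mule_ge0 ?lee_fin.
  by rewrite lee_wpmul2r ?lee_fin.
rewrite ge0_integralZl_EFin//; [|exact: kmeas|exact: ltW].
rewrite -[cmu B]/(c%:E * mu B)%E; apply: lee_wpmul2l; first by rewrite lee_fin ltW.
by have [_ H] := sub; exact: H.
Qed.

(** The functional h -> E[h(X_s)] under P_{v mu}, with h = 0 at the cemetery; sub-invariance makes
    it bounded on L^1(mu), with the bound [c] of [v]. *)
Definition flow s h : R := \int[Q]_w ext0 h (X s w).

Let norm_le s (s0 : 0 <= s) h : measurable_fun setT h ->
  (\int[lawm Q (pr_meas fil s0)]_x `|h x|%:E <= c%:E * \int[mu]_x `|h x|%:E)%E.
Proof.
move=> mh; apply: (@le_trans _ _ (\int[cmu]_x `|h x|%:E)%E).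
  by apply: le_measure_integral => [B|x]; [exact: law_le|rewrite lee_fin].
rewrite ge0_integral_mscale//.
by apply/measurable_EFinP; exact: measurableT_comp.
Qed.

Let ig_law s (s0 : 0 <= s) h : ig mu h -> ig (lawm Q (pr_meas fil s0)) h.
Proof.
move=> hi; have mh := ig_meas hi; apply/integrableP; split; first exact/measurable_EFinP.
apply: le_lt_trans (norm_le s0 mh) _; have /integrableP[_ h1] := hi.
by rewrite lte_mul_pinfty// lee_fin ltW.
Qed.

Lemma flow_ig s h : 0 <= s -> ig mu h -> ig Q (fun w => ext0 h (X s w)).
Proof. by move=> s0 hi; exact: ((@law_ig _ _ _ _ Q _ (pr_meas fil s0) h (ig_meas hi)).1 (ig_law s0 hi)). Qed.

Lemma flow_n1 s h : 0 <= s -> ig mu h -> n1 Q (fun w => ext0 h (X s w)) <= c * n1 mu h.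
Proof.
move=> s0 hi; have mh := ig_meas hi; rewrite -(n1_law _ (pr_meas fil s0) mh).
by rewrite -lee_fin EFinM !n1_E//; [exact: norm_le|exact: ig_law].
Qed.

Lemma flow_bound s h : 0 <= s -> ig mu h -> `|flow s h| <= c * n1 mu h.
Proof. by move=> s0 hi; apply: le_trans (norm_Rint_le (flow_ig s0 hi)) _; exact: flow_n1. Qed.

Lemma flowB s f g : 0 <= s -> ig mu f -> ig mu g -> flow s (f \- g) = flow s f - flow s g.
Proof.
move=> s0 fi gi; rewrite /flow -(RintegralB measurableT (flow_ig s0 fi) (flow_ig s0 gi)).
by apply: eq_Rintegral => w _; case: (X s w) => [x|] /=; rewrite ?subr0.
Qed.

Lemma flow_dist s f g : 0 <= s -> ig mu f -> ig mu g ->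
  `|flow s f - flow s g| <= c * n1 mu (f \- g).
Proof. by move=> s0 fi gi; rewrite -flowB//; apply: flow_bound => //; exact: igB. Qed.

Lemma flowZ s x h : 0 <= s -> ig mu h -> flow s (fun y => x * h y) = x * flow s h.
Proof.
move=> s0 hi; rewrite /flow -RintegralZl//; last exact: flow_ig.
by apply: eq_Rintegral => w _; case: (X s w) => [y|] /=; rewrite ?mulr0.
Qed.

Section Fubini.
Variables (a b : R) (h : E -> R).
Hypotheses (a0 : 0 <= a) (ab : a <= b) (hi : ig mu h).
Let I (s : R) : R := \1_(`]a, b]%classic) s.
Let J (y : measurableTypeR R * pr_Omega N) : R := I y.1 * ext0 h (X (Num.max y.1 0) y.2).

Let m0 (s : R) : 0 <= Num.max s 0. Proof. by rewrite le_max lexx orbT. Qed.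
Let mI : measurable_fun setT (I : measurableTypeR R -> R).
Proof. exact: measurable_indic. Qed.
Let lebI : leb `]a, b]%classic = (b - a)%:E.
Proof. by rewrite lebesgue_measure_itv/= lte_fin; case: ltgtP ab => // -> _; rewrite subrr. Qed.
Let igI : ig leb I.
Proof. by apply: ig_indic => //; have /(congr1 (fun z => (z < +oo)%E)) := lebI; rewrite ltry => h1; exact: h1. Qed.

Let mJ : measurable_fun setT J.
Proof.
apply: measurable_funM; last exact: (joint_meas fil rc (ig_meas hi)).
exact: (measurableT_comp mI measurable_fst).
Qed.

Let igJ : (leb \x Q)%E.-integrable setT (EFin \o J).
Proof.
apply/integrable12ltyP; first exact/measurable_EFinP.
apply: (@le_lt_trans _ _ (\int[leb]_s ((c * n1 mu h) * I s)%:E)%E).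
  apply: le_integral_sup => s; first by apply: integral_ge0.
  rewrite /J /=; under eq_integral do rewrite normrM EFinM.
  have hs := flow_ig (m0 s) hi.
  rewrite ge0_integralZl_EFin//; last first.
    by apply/measurable_EFinP; exact: (ig_meas (ig_norm hs)).
  rewrite -n1_E// -EFinM lee_fin mulrC ger0_norm ?indicE//.
  by rewrite ler_wpM2r//; exact: flow_n1.
have /integrableP[_ hh] := igZ (c * n1 mu h) igI.
apply: le_lt_trans hh; apply: le_integral_sup => s; last by rewrite lee_fin ler_norm.
by rewrite lee_fin mulr_ge0// ?mulr_ge0 ?n1_ge0 ?ltW// /I indicE.
Qed.

Let FJ s : \int[Q]_w J (s, w) = I s * flow (Num.max s 0) h.
Proof. by rewrite /J /= RintegralZl//; exact: flow_ig. Qed.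

Lemma flow_time_ig : ig leb (fun s => I s * flow (Num.max s 0) h).
Proof.
have := integrable_fubini_F igJ; apply: eq_integrable => // s _.
rewrite /fubini_F /= -FJ /Rintegral fineK//.
apply: integrable_fin_num => //; rewrite /J /=.
exact: (igZ (I s) (flow_ig (m0 s) hi)).
Qed.

Lemma flow_fubini :
  [/\ {ae Q, forall w, leb.-integrable `]a, b]%classic (fun s => (ext0 h (X s w))%:E)},
  measurable_fun setT (fun w => \int[leb]_(s in `]a, b]) ext0 h (X s w)) &
  \int[Q]_w (\int[leb]_(s in `]a, b]) ext0 h (X s w)) =
  \int[leb]_s (I s * flow (Num.max s 0) h)].
Proof.
have JE w s : (J (s, w))%:E = ((fun s => (ext0 h (X s w))%:E) \_ `]a, b]%classic) s.
  rewrite patchE /J /I /= indicE; case: ifPn => [|_]; last by rewrite mul0r.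
  rewrite inE /= in_itv /= => /andP[as_ _].
  by rewrite mul1r (max_l (le_trans a0 (ltW as_))).
have ae1 : {ae Q, forall w, leb.-integrable `]a, b]%classic (fun s => (ext0 h (X s w))%:E)}.
  apply: filterS (ae_integrable2 igJ) => w.
  have mab : measurable (`]a, b]%classic : set (measurableTypeR R)) by exact: measurable_itv.
  move=> h1; apply/(@integrable_mkcond _ _ _ leb _ _ mab).
  by apply: eq_integrable h1 => // s _; exact: JE.
have e w : \int[leb]_(s in `]a, b]) ext0 h (X s w) = fine (\int[leb]_s (J (s, w))%:E)%E.
  rewrite /Rintegral integral_mkcond; congr fine.
  by apply: eq_integral => s _; rewrite JE.
have mG : measurable_fun setT (fun w => fine (\int[leb]_s (J (s, w))%:E)%E).
  by apply: measurableT_comp => //; exact: measurable_fubini_G igJ.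
have eF : (fun w => \int[leb]_(s in `]a, b]) ext0 h (X s w)) =
    (fun w => fine (\int[leb]_s (J (s, w))%:E)%E) by apply/funext.
split=> //; first by rewrite eF.
transitivity (\int[Q]_w fine (\int[leb]_s (J (s, w))%:E)%E).
  by apply: eq_Rintegral => w _; exact: e.
have FF := Fubini igJ.
transitivity (fine (\int[Q]_w (\int[leb]_s (J (s, w))%:E))%E).
  congr fine; apply: ae_eq_integral => //.
  - exact/measurable_EFinP.
  - exact: measurable_fubini_G igJ.
  - apply: filterS (ae_integrable2 igJ) => w h1 _; rewrite fineK//.
    exact: integrable_fin_num.
rewrite -FF; congr fine; apply: eq_integral => s _.
rewrite -FJ /Rintegral fineK//; apply: integrable_fin_num => //; rewrite /J /=.
exact: (igZ (I s) (flow_ig (m0 s) hi)).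
Qed.

Lemma flow_time_bound e : (forall s, a < s <= b -> `|flow s h - flow a h| <= e) ->
  `|\int[leb]_s (I s * flow (Num.max s 0) h) - (b - a) * flow a h| <= (b - a) * e.
Proof.
move=> He.
have II : \int[leb]_s I s = b - a by rewrite /I Rint_indic//; have /(congr1 fine) := lebI.
have ii := flow_time_ig; have i2 := igZ (flow a h) igI.
have -> : (b - a) * flow a h = \int[leb]_s (flow a h * I s).
  by rewrite RintegralZl// II mulrC.
rewrite -(RintegralB measurableT ii i2); apply: le_trans (norm_Rint_le (igB ii i2)) _.
apply: (@le_trans _ _ (n1 leb (fun s => e * I s))).
  apply: n1_le; [exact: ig_meas (igB ii i2)| |exact: igZ].
  move=> s /=; rewrite /I indicE; case: (boolP (_ \in _)) => [|_]; last first.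
    by rewrite mul0r !mulr0 subrr normr0.
  rewrite inE /= in_itv /= => h1; rewrite mul1r !mulr1.
  have s0 : 0 <= s by have /andP[h2 _] := h1; apply: le_trans a0 (ltW h2).
  by rewrite (max_l s0); apply: le_trans (He _ h1) _; exact: ler_norm.
have e0 : a < b -> 0 <= e.
  by move=> h1; apply: le_trans (normr_ge0 _) (He b _); rewrite h1 lexx.
have nI : n1 leb I = b - a.
  by rewrite -II; apply: eq_Rintegral => s _; rewrite ger0_norm// /I indicE.
rewrite (n1Z e igI) nI mulrC; have [h1|h1] := ltP a b; first by rewrite ger0_norm// e0.
by rewrite (le_anti (introT andP (conj ab h1))) subrr !mul0r.
Qed.

End Fubini.

Variable L : (E -> R) -> E -> R.
Hypothesis L_ig : forall u, tst u -> ig mu (L u).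
Hypothesis t_ig : forall u, tst u -> ig mu u.
Hypothesis MP : forall u, tst u -> continuous_martingale Q (fun t w =>
  ext0 u (X t w) - ext0 u (X 0 w) - \int[leb]_(s in `[0, t]) ext0 (L u) (X s w)).

(** The expectations of the martingale at [a] and [b] agree, the whole space belonging to the
    sigma-algebra at time [a]. The half-open interval makes the difference of the two time integrals
    exact. *)
Lemma flow_martingale u a b : 0 <= a -> a <= b -> tst u -> flow b u - flow a u =
  \int[leb]_s (\1_(`]a, b]%classic) s * flow (Num.max s 0) (L u)).
Proof.
move=> a0 ab tu; have b0 := le_trans a0 ab; have ui := t_ig tu; have Li := L_ig tu.
have [_ Ni Nm _] := MP tu.
pose I t w := \int[leb]_(s in `[0, t]) ext0 (L u) (X s w).
have Ii t : 0 <= t -> ig Q (I t).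
  move=> t0; have j := igB (igB (flow_ig t0 ui) (flow_ig (lexx 0) ui)) (Ni t t0).
  by apply: eq_integrable j => // w _ /=; rewrite opprB addrC subrK.
have FT : @pr_filt R d N a setT.
  have [h1 _ _ _] := fil; have [[g0 gC _] _] := h1 a a0.
  by have := gC _ g0; rewrite setD0.
have IB : \int[Q]_w I b w - \int[Q]_w I a w = flow b u - flow a u.
  have NE t (t0 : 0 <= t) : \int[Q]_w (ext0 u (X t w) - ext0 u (X 0 w) - I t w) =
      flow t u - flow 0 u - \int[Q]_w I t w.
    have i1 := flow_ig t0 ui; have i2 := flow_ig (lexx 0) ui; have i3 := igB i1 i2.
    by rewrite (RintegralB measurableT i3 (Ii t t0)) (RintegralB measurableT i1 i2).
  have := Nm a b setT a0 ab FT; rewrite -/(I a) -/(I b) (NE a a0) (NE b b0).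
  by move: (flow a u) (flow b u) (flow 0 u) (\int[Q]_w I a w) (\int[Q]_w I b w) => *; lra.
have [ae0 _ _] := flow_fubini (lexx 0) b0 Li.
have [_ mab <-] := flow_fubini a0 ab Li.
rewrite -IB -(RintegralB measurableT (Ii b b0) (Ii a a0)); apply: Rint_ae => //.
  exact: ig_meas (igB (Ii b b0) (Ii a a0)).
apply: filterS ae0 => w h1; rewrite /I.
(* The martingale is written with closed intervals; the end point 0 is a null set. *)
have h0 : leb.-integrable `[0, b]%classic (EFin \o (fun s => ext0 (L u) (X s w))).
  have m1 := measurable_int _ h1; apply/integrableP; split.
    by apply/emeasurable_fun_itv_obnd_cbndP.
  by rewrite -integral_itv_obnd_cbnd; [case/integrableP: h1|exact: measurableT_comp].
by rewrite Rintegral_itvB// bnd_simp.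
Qed.

Lemma flow_tst u a b e : 0 <= a -> a <= b -> tst u ->
  (forall s, a < s <= b -> `|flow s (L u) - flow a (L u)| <= e) ->
  `|flow b u - flow a u - (b - a) * flow a (L u)| <= (b - a) * e.
Proof.
by move=> a0 ab tu He; rewrite flow_martingale//; apply: flow_time_bound => //; exact: L_ig.
Qed.

End MartingaleFlow.

Lemma affine_alg (R : realType) (a f g k : R) : a * (f - g) - k = -1 * k + ((a - 1) * (f - g) + (f - g)).
Proof. by ring. Qed.

Lemma triangle3 (R : realType) (x y z x1 y1 e1 e2 e3 : R) :
  `|x - x1| <= e1 -> `|y - y1| <= e2 -> `|z| <= e3 -> x1 - y1 = z ->
  `|x - y| <= e1 + e2 + e3.
Proof.
move=> h1 h2 h3 e; have -> : x - y = (x - x1) + (y1 - y) + z by rewrite -e; ring.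
apply: le_trans (ler_normD _ _) _; apply: lerD => //.
by apply: le_trans (ler_normD _ _) _; apply: lerD; rewrite // distrC.
Qed.

(** * Identification of the transition kernels *)

Section FlowUniqueness.
Context {R : realType} {d : nat}.
Local Notation E := 'rV[R]_d.
Implicit Types (f g k h u : E -> R) (s t a b e : R).
Variables (mu : {measure set E -> \bar R}) (T : R -> (E -> R) -> E -> R).
(** [m s] stands for the flow of marginals. Only its linearity, its uniform bound on L^1(mu) and the
    first-order estimate [m_tst] on test functions enter. *)
Variables (L : (E -> R) -> E -> R) (m : R -> (E -> R) -> R) (c : R).
Hypothesis sg : subMarkov_C0_contraction_semigroup mu T.
Hypothesis genL : forall u, tst u -> L1_generator mu T u (L u).
Hypothesis core : forall g k e, L1_generator mu T g k -> 0 < e ->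
  exists u, [/\ tst u, n1 mu (u \- g) < e & n1 mu (L u \- k) < e].
Hypothesis dens : forall g e, ig mu g -> 0 < e -> exists2 u, tst u & n1 mu (g \- u) < e.
Hypothesis c0 : 0 < c.
Hypothesis mB : forall s f g, 0 <= s -> ig mu f -> ig mu g -> m s (f \- g) = m s f - m s g.
Hypothesis mZ : forall s x f, 0 <= s -> ig mu f -> m s (fun y => x * f y) = x * m s f.
Hypothesis m_bound : forall s f, 0 <= s -> ig mu f -> `|m s f| <= c * n1 mu f.
Hypothesis m_tst : forall u a b e, 0 <= a -> a <= b -> tst u ->
  (forall s, a < s <= b -> `|m s (L u) - m a (L u)| <= e) ->
  `|m b u - m a u - (b - a) * m a (L u)| <= (b - a) * e.

Let m_dist s f g : 0 <= s -> ig mu f -> ig mu g -> `|m s f - m s g| <= c * n1 mu (f \- g).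
Proof. by move=> s0 fi gi; rewrite -mB//; apply: m_bound => //; exact: igB. Qed.

(** The pair (g, k) is replaced by a pair (u, L u) with [core]; as all functionals share the bound
    [c], the estimate is stable under such approximations. *)
Lemma generator_step g k a b e : L1_generator mu T g k -> 0 <= a -> a <= b ->
  (forall s, a < s <= b -> `|m s k - m a k| <= e) ->
  `|m b g - m a g - (b - a) * m a k| <= (b - a) * e.
Proof.
move=> gk a0 ab He; have [gi ki _] := gk; have b0 := le_trans a0 ab.
have ba : 0 <= b - a by rewrite subr_ge0.
(* The total cost of an approximation by [y], in units of [y]. *)
pose K := 2 * c + 3 * c * (b - a).
have K0 : 0 < K + 1 by rewrite ltr_wpDl// addr_ge0// !mulr_ge0// ltW.
apply/ler_addgt0Pl => x x0; pose y := x / (K + 1).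
have y0 : 0 < y by rewrite divr_gt0.
have [u [tu h1 h2]] := core gk y0.
have [ui Lui _] := genL tu.
have dg s : 0 <= s -> `|m s u - m s g| <= c * y.
  by move=> s0; apply: le_trans (m_dist s0 ui gi) _; rewrite ler_wpM2l ?ltW.
have dk s : 0 <= s -> `|m s (L u) - m s k| <= c * y.
  by move=> s0; apply: le_trans (m_dist s0 Lui ki) _; rewrite ler_wpM2l ?ltW.
have Hu s : a < s <= b -> `|m s (L u) - m a (L u)| <= c * y + c * y + e.
  move=> h; apply: (triangle3 (dk s _) (dk a a0) (He s h)) => //.
  by have /andP[h3 _] := h; apply: le_trans a0 (ltW h3).
have h3 := m_tst a0 ab tu Hu.
have h4 : `|(b - a) * m a k - (b - a) * m a (L u)| <= (b - a) * (c * y).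
  by rewrite -mulrBr normrM ger0_norm// ler_wpM2l// distrC; exact: dk.
have -> : m b g - m a g - (b - a) * m a k = - (m b u - m b g) + (m a u - m a g)
    - ((b - a) * m a k - (b - a) * m a (L u)) + (m b u - m a u - (b - a) * m a (L u)).
  by ring.
have e1 := dg b b0; have e2 := dg a a0.
have xE : x = (K + 1) * y by rewrite /y mulrCA mulfV ?mulr1// gt_eqF.
apply: le_trans (ler_normD _ _) _.
apply: (@le_trans _ _ (c * y + c * y + (b - a) * (c * y) + (b - a) * (c * y + c * y + e))).
  apply: lerD => //; apply: le_trans (ler_normB _ _) _; apply: lerD => //.
  by apply: le_trans (ler_normD _ _) _; apply: lerD => //; rewrite normrN.
rewrite xE /K; have -> : c * y + c * y + (b - a) * (c * y) + (b - a) * (c * y + c * y + e) =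
  (2 * c + 3 * c * (b - a)) * y + (b - a) * e by ring.
by rewrite lerD2r ler_wpM2r ?ltW// ltrDl.
Qed.

(** The factor 3 adds the oscillation of s -> m_s k, at most twice c ||k||, to the value at [a], at
    most c ||k||. *)
Lemma generator_lip g k a b : L1_generator mu T g k -> 0 <= a -> a <= b ->
  `|m b g - m a g| <= (b - a) * (3 * c * n1 mu k).
Proof.
move=> gk a0 ab; have [gi ki _] := gk.
have B s : 0 <= s -> `|m s k| <= c * n1 mu k by move=> s0; exact: m_bound.
have := @generator_step g k a b (2 * c * n1 mu k) gk a0 ab _ => H.
have {H} h1 : `|m b g - m a g - (b - a) * m a k| <= (b - a) * (2 * c * n1 mu k).
  apply: H => s /andP[h _]; apply: le_trans (ler_normB _ _) _.
  rewrite -mulrA mulrDl mul1r; apply: lerD; apply: B => //.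
  exact: le_trans a0 (ltW h).
rewrite -[m b g - m a g](subrK ((b - a) * m a k)).
apply: le_trans (ler_normD _ _) _.
have -> : (b - a) * (3 * c * n1 mu k) = (b - a) * (2 * c * n1 mu k) + (b - a) * (c * n1 mu k) by ring.
apply: lerD => //; rewrite normrM ger0_norm ?subr_ge0//.
by rewrite ler_wpM2l ?subr_ge0//; exact: B.
Qed.

(** The semigroup completed by the identity at time 0, where [T] is left unspecified. *)
Definition T0 s f := if s == 0 then f else T s f.

Lemma T0_ig s f : 0 <= s -> ig mu f -> ig mu (T0 s f).
Proof.
rewrite le_eqVlt /T0 eq_sym => /orP[-> //|s0]; rewrite gt_eqF//; exact: (sg_ig sg).
Qed.

Lemma T0_sub s f g : 0 <= s -> ig mu f -> ig mu g -> n1 mu (T0 s f \- T0 s g) <= n1 mu (f \- g).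
Proof.
rewrite le_eqVlt /T0 eq_sym => /orP[-> //|s0]; rewrite gt_eqF//; exact: (sg_sub sg).
Qed.

Lemma T0_contr s f : 0 <= s -> ig mu f -> n1 mu (T0 s f) <= n1 mu f.
Proof.
rewrite le_eqVlt /T0 eq_sym => /orP[-> //|s0]; rewrite gt_eqF//; exact: (sg_contr sg).
Qed.

(** T_s commutes with T_r and contracts L^1, so the difference quotient at T_s f converges at least
    as fast as at [f]. This uniformity in [s] is what allows the steps to be summed. *)
Lemma T0_quot s r f k : 0 <= s -> 0 < r -> ig mu f -> ig mu k ->
  n1 mu (fun x => r^-1 * (T r (T0 s f) x - T0 s f x) - T0 s k x) <=
  n1 mu (fun x => r^-1 * (T r f x - f x) - k x).
Proof.
rewrite le_eqVlt /T0 eq_sym => /orP[-> //|s0] r0 fi ki; rewrite gt_eqF//.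
have Ti := sg_ig sg r0 fi; have Si := sg_ig sg s0 fi; have Ki := sg_ig sg s0 ki.
have STi := sg_ig sg s0 Ti; have TSi := sg_ig sg r0 Si.
pose D x := -1 * f x + T r f x.
have di : ig mu D by exact: igD (igZ _ fi) Ti.
have DE x : D x = T r f x - f x by rewrite /D mulN1r addrC.
pose g x := (r^-1 - 1) * D x + D x.
have gi : ig mu g by exact: igD (igZ _ di) di.
have -> : (fun x => r^-1 * (T r f x - f x) - k x) = (fun x => -1 * k x + g x).
  by apply/funext => x; rewrite affine_alg /g DE.
have Fi : ig mu (fun x => -1 * k x + g x) by exact: igD (igZ _ ki) gi.
apply: le_trans (sg_contr sg s0 Fi).
rewrite le_eqVlt; apply/orP; left; apply/eqP; apply: n1_ae.
- exact: ig_meas (igB (igZ _ (igB TSi Si)) Ki).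
- exact: ig_meas (sg_ig sg s0 Fi).
have A1 := sg_lin sg (-1) s0 ki gi; have A2 := sg_lin sg (r^-1 - 1) s0 di di.
have A3 : {ae mu, forall x, T s D x = -1 * T s f x + T s (T r f) x} := sg_lin sg (-1) s0 fi Ti.
have [_ _ _ semi _] := sg.
have A4 := semi s r f s0 r0 fi; have := semi r s f r0 s0 fi; rewrite [r + s]addrC => A5.
have B1 : {ae mu, forall x, T s (fun y => -1 * k y + g y) x = -1 * T s k x +
    ((r^-1 - 1) * (T s (T r f) x - T s f x) + (T s (T r f) x - T s f x))}.
  by apply: filterS3 A1 A2 A3 => x -> -> ->; rewrite mulN1r [- T s f x + _]addrC.
by apply: filterS3 B1 A4 A5 => x -> <- <-; exact: affine_alg.
Qed.

Lemma T0_add s r f : 0 <= s -> 0 < r -> ig mu f ->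
  {ae mu, forall x, T0 (r + s) f x = T r (T0 s f) x}.
Proof.
rewrite le_eqVlt /T0 eq_sym => /orP[/eqP -> r0 fi|s0 r0 fi].
  by rewrite addr0 eqxx gt_eqF//; apply: aeW.
by rewrite !gt_eqF ?addr_gt0//; have [_ _ _ semi _] := sg; exact: semi.
Qed.

Lemma T0_gen s f k : 0 <= s -> L1_generator mu T f k -> L1_generator mu T (T0 s f) (T0 s k).
Proof.
move=> s0 [fi ki h]; split; [exact: T0_ig|exact: T0_ig|].
have Fi := T0_ig s0 fi; have Ki := T0_ig s0 ki.
apply: (squeeze_cvge _ (cvg_cst _) h); near=> r; have r0 : 0 < r by near: r; exact: nbhs_right_gt.
apply/andP; split; first by apply: integral_ge0.
have i1 := igB (igZ r^-1 (igB (sg_ig sg r0 fi) fi)) ki.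
have i2 := igB (igZ r^-1 (igB (sg_ig sg r0 Fi) Fi)) Ki.
by have := T0_quot s0 r0 fi ki; rewrite -lee_fin (n1_E i1) (n1_E i2).
Unshelve. all: by end_near. Qed.

(** With g = T_s f and k = T_s (L f), both m_a(T_r g) and m_{r+a}(g) are m_a(g) + r m_a(k) up to a
    small multiple of [r]. To control m_q(k) for q between a and r + a uniformly in [s], L f is
    replaced by a test function [u]: along T_s u the flow is Lipschitz with constant 3 c ||L u||,
    whatever [s]. *)
Lemma telescoping_step f u s r a e : tst f -> tst u -> 0 <= s -> 0 < r -> 0 <= a -> 0 <= e ->
  n1 mu (L f \- u) <= e -> n1 mu (fun x => r^-1 * (T r f x - f x) - L f x) <= e ->
  r * (3 * c * n1 mu (L u)) <= e ->
  `|m a (T0 (r + s) f) - m (r + a) (T0 s f)| <= r * ((3 * c + 1) * e).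
Proof.
move=> tf tu s0 r0 a0 e0 h1 h2 h3.
have [fi ki _] := genL tf; have [ui Lui _] := genL tu.
have rs0 : 0 <= r + s by rewrite addr_ge0// ltW.
have ra0 : 0 <= r + a by rewrite addr_ge0// ltW.
have gk := T0_gen s0 (genL tf); have Ugen := T0_gen s0 (genL tu).
set g := T0 s f in gk *; set k := T0 s (L f) in gk *.
have gi : ig mu g by exact: T0_ig.
have kki : ig mu k by exact: T0_ig.
have Tgi := sg_ig sg r0 gi.
have -> : m a (T0 (r + s) f) = m a (T r g).
  apply/eqP; rewrite -subr_eq0 -normr_le0; apply: le_trans (m_dist a0 (T0_ig rs0 fi) Tgi) _.
  rewrite (@n1_ae _ _ _ mu _ (fun=> 0)).
  - rewrite (_ : n1 mu (fun=> 0) = 0) ?mulr0// /n1 /Rintegral.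
    by under eq_integral do rewrite normr0; rewrite integral0.
  - exact: ig_meas (igB (T0_ig rs0 fi) Tgi).
  - exact: measurable_cst.
  - by apply: filterS (T0_add s0 r0 fi) => x /= ->; rewrite subrr.
have Qi := igB (igZ r^-1 (igB Tgi gi)) kki.
have e1 : `|m a (T r g) - m a g - r * m a k| <= r * (c * e).
  have -> : m a (T r g) - m a g - r * m a k = r * m a (fun x => r^-1 * (T r g x - g x) - k x).
    have -> : m a (fun x => r^-1 * (T r g x - g x) - k x) = r^-1 * (m a (T r g) - m a g) - m a k.
      by rewrite -mB// -mZ//; [exact: (mB a0 (igZ r^-1 (igB Tgi gi)) kki)|exact: igB].
    by rewrite mulrBr mulrA mulfV ?mul1r// gt_eqF.
  rewrite normrM gtr0_norm// ler_wpM2l ?(ltW r0)//.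
  apply: le_trans (m_bound a0 Qi) _; apply: ler_wpM2l; first exact: ltW.
  exact: le_trans (T0_quot s0 r0 fi ki) h2.
have Uk : n1 mu (k \- T0 s u) <= e by apply: le_trans (T0_sub s0 ki ui) h1.
have Ui := T0_ig s0 ui.
have e2 : `|m (r + a) g - m a g - (r + a - a) * m a k| <= (r + a - a) * (c * e + c * e + e).
  apply: (generator_step gk a0); first by rewrite lerDr ltW.
  move=> q /andP[aq qa]; have q0 : 0 <= q by exact: le_trans (ltW aq).
  have dk p : 0 <= p -> `|m p k - m p (T0 s u)| <= c * e.
    by move=> p0; apply: le_trans (m_dist p0 kki Ui) _; apply: ler_wpM2l; first exact: ltW.
  apply: (triangle3 (dk q q0) (dk a a0) _ erefl).
  apply: le_trans (generator_lip Ugen a0 (ltW aq)) _; apply: le_trans h3.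
  apply: ler_pM; rewrite ?subr_ge0 ?(ltW aq)//.
  - by rewrite !mulr_ge0 ?n1_ge0// ltW.
  - by rewrite lerBlDr.
  - by rewrite ler_wpM2l ?mulr_ge0 ?(ltW c0)//; exact: T0_contr.
rewrite addrK in e2.
have -> : m a (T r g) - m (r + a) g = (m a (T r g) - m a g - r * m a k)
   - (m (r + a) g - m a g - r * m a k) by ring.
apply: le_trans (ler_normB _ _) _.
have -> : r * ((3 * c + 1) * e) = r * (c * e) + r * (c * e + c * e + e) by ring.
exact: lerD.
Qed.

Theorem flow_unique f t : tst f -> 0 < t -> m t f = m 0 (T t f).
Proof.
move=> tf t0; have [fi ki _] := genL tf.
apply/eqP; rewrite -subr_eq0 -normr_le0; apply/ler_addgt0Pl => e e0; rewrite addr0.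
(* Summed over all steps, the errors amount to K y = e. *)
pose K := t * (3 * c + 1).
have K0 : 0 < K by rewrite mulr_gt0// ltr_wpDl// mulr_ge0// ltW.
pose y := e / K; have y0 : 0 < y by rewrite divr_gt0.
have [u tu hu] := dens ki y0.
have gn : \forall r \near 0^'+, n1 mu (fun x => r^-1 * (T r f x - f x) - L f x) <= y.
  have [_ _ hlim] := genL tf; have H := ereal_right_small y0 hlim.
  near=> r; have r0 : 0 < r by near: r; exact: nbhs_right_gt.
  rewrite -lee_fin n1_E; first by near: r; exact: H.
  exact: igB (igZ r^-1 (igB (sg_ig sg r0 fi) fi)) ki.
have : \forall r \near 0^'+, r * (3 * c * n1 mu (L u)) <= y.
  pose Z := 3 * c * n1 mu (L u); have Z0 : 0 <= Z by rewrite !mulr_ge0 ?n1_ge0// ltW.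
  near=> r; apply: (@le_trans _ _ (r * (Z + 1))).
    by rewrite ler_wpM2l ?lerDl//; near: r; exact: nbhs_right_ge.
  rewrite -ler_pdivlMr ?ltr_wpDl//; near: r; apply: nbhs_right_le.
  by rewrite divr_gt0 ?ltr_wpDl.
move=> gn2; have [z /= z0 Hz] := filterI gn gn2.
pose n := Num.bound (t / z).
have n0 : 0 < n%:R :> R.
  by apply: lt_trans (archi_boundP (ltW (divr_gt0 t0 z0))); rewrite divr_gt0.
pose r := t / n%:R; have r0 : 0 < r by rewrite divr_gt0.
have rz : r < z.
  by rewrite ltr_pdivrMr// mulrC -ltr_pdivrMr//; apply: archi_boundP; rewrite ltW ?divr_gt0.
have nr : n%:R * r = t by rewrite /r mulrCA mulfV ?mulr1// gt_eqF.
have [s1 s2] : n1 mu (fun x => r^-1 * (T r f x - f x) - L f x) <= y /\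
    r * (3 * c * n1 mu (L u)) <= y.
  by apply: Hz => //=; rewrite sub0r normrN ger0_norm// ltW.
have ind i : (i <= n)%N ->
    `|m (t - i%:R * r) (T0 (i%:R * r) f) - m t f| <= (i%:R * r) * ((3 * c + 1) * y).
  elim: i => [_|i IH iN]; first by rewrite !mul0r subr0 /T0 eqxx subrr normr0.
  have i0 : 0 <= i%:R * r by rewrite mulr_ge0// ltW.
  have a0 : 0 <= t - i.+1%:R * r.
    by rewrite subr_ge0 -nr; apply: ler_wpM2r; [exact: ltW|rewrite ler_nat].
  have st := telescoping_step tf tu i0 r0 a0 (ltW y0) (ltW hu) s1 s2.
  have E1 : r + (t - i.+1%:R * r) = t - i%:R * r by rewrite -natr1; ring.
  have E2 : r + i%:R * r = i.+1%:R * r by rewrite -natr1; ring.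
  rewrite E1 E2 in st.
  have -> : (i.+1%:R * r) * ((3 * c + 1) * y) =
     r * ((3 * c + 1) * y) + (i%:R * r) * ((3 * c + 1) * y) by rewrite -natr1; ring.
  apply: le_trans (ler_distD (m (t - i%:R * r) (T0 (i%:R * r) f)) _ _) _.
  apply: lerD; first exact: st.
  exact: IH (ltnW iN).
have := ind n (leqnn n); rewrite nr subrr /T0 gt_eqF// distrC => h.
by apply: le_trans h _; rewrite mulrA -/K /y mulrCA mulfV ?mulr1// gt_eqF.
Unshelve. all: by end_near. Qed.

End FlowUniqueness.

(** After truncation in space and in height, density for Lebesgue measure on a cube applies; there
    [rho] is bounded, so the L^1 norms for [mu] are controlled by those for [lam]. *)
Lemma tst_dense_density (R : realType) (d : nat) (lam mu : {measure set 'rV[R]_d -> \bar R})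
  (rho g : 'rV[R]_d -> R) (e : R) :
  is_lebesgue lam -> continuous rho -> (forall x, 0 <= rho x) -> has_density lam mu rho ->
  ig mu g -> 0 < e -> exists2 u, tst u & n1 mu (g \- u) < e.
Proof.
move=> lamL crho rho0 dens gi e0.
have mrho : measurable_fun setT rho by exact: cont_meas.
have mg := ig_meas gi; have e2 : 0 < e / 2 by rewrite divr_gt0.
have e4 : 0 < e / 2 / 2 by rewrite divr_gt0.
have [n hn] := cvg_below e4 (n1_cube gi).
pose f x := g x * \1_(cube n%:R) x.
have fi : ig mu f.
  apply: (ig_le _ (norm_restr g _) gi).
  by apply: measurable_funM mg _; exact: measurable_indic (meas_cube _).
have mf := ig_meas fi.
have [k hk] := cvg_below e4 (n1_clamp fi).
pose h x := clamp k%:R (f x).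
have h0 x : ~ cube n%:R x -> h x = 0.
  by move=> nx; rewrite /h /f indicE memNset// mulr0 clamp_id// normr0.
have vh : vanish n%:R h by move=> x xr; apply: h0; rewrite /cube/= => /ltW; rewrite leNgt xr.
have Lh : L2P lam h.
  by apply: (bounded_vanish_L2 lamL (clamp_meas _ mf) _ vh) => x; exact: clamp_le.
have hl := vanish_ig lamL Lh vh; have mh := ig_meas hl.
have hmu : ig mu h by apply: (ig_le mh _ fi) => x; exact: clamp_norm.
have [eta he] := mollifier_exists lamL.
have [chi [tc hc]] := cutoff lamL he (n%:R : R); have [sc [r vc]] := tc.
have [C C0 hC] : exists2 C, 0 <= C & forall x, `|rho x * chi x| <= C.
  apply: (@cont_vanish_bounded _ _ r) => [x|x xr]; last by rewrite vc ?mulr0.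
  by apply: continuousM; [exact: crho|exact: (smooth_cont sc)].
have C1 : 0 < C + 1 by rewrite ltr_wpDl.
have [u tu hu] := dens1 lamL (divr_gt0 e2 C1) hl h0.
have tsu := tstin_tst tu; exists u => //.
have ul := tst_ig lamL tsu; have mu' := ig_meas ul.
have bnd x : `|rho x * (h \- u) x| <= `|(C + 1) * (h \- u) x|.
  have [xn|xn] := leP `|x| n%:R.
    rewrite !normrM ler_wpM2r// (le_trans _ (ler_norm _))//.
    by have := hC x; rewrite hc// mulr1 => h1; apply: le_trans h1 _; rewrite lerDl.
  case: tu => _ [r' r'n v] /=; rewrite vh// v ?subrr ?mulr0 ?normr0//.
  exact: lt_trans xn.
have mhu : measurable_fun setT (h \- u) by exact: measurable_funB.
have ui : ig mu (h \- u).
  apply/(ig_density mrho rho0 dens mhu); apply: (ig_le _ bnd (igZ _ (igB hl ul))).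
  exact: measurable_funM.
have uE : ig mu u.
  by have := igB hmu ui; apply: eq_integrable => // x _ /=; rewrite opprB addrC subrK.
have b3 : n1 mu (h \- u) < e / 2.
  rewrite (n1_density mrho rho0 dens mhu).
  apply: (@le_lt_trans _ _ (n1 lam (fun x => (C + 1) * (h \- u) x))).
    by apply: n1_le => //; [exact: measurable_funM|exact: igZ (igB hl ul)].
  rewrite (n1Z _ (igB hl ul)) gtr0_norm// mulrC -ltr_pdivlMr//.
apply: le_lt_trans (n1_sub gi hmu uE) _; rewrite [ltRHS]splitr ltrD//.
apply: le_lt_trans (n1_sub gi fi hmu) _; rewrite [ltRHS]splitr ltrD//; first by rewrite n1C.
by rewrite n1C.
Qed.


Section Normality.
Context {R : realType} {d : nat} (N : process R d).
Local Notation E := 'rV[R]_d.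
Hypothesis fil : admissible_filtration N.
Hypothesis nrm : forall x, pr_P N x [set w | pr_X 0 w = x] = 1%E.

(** Writing the starting point as a ball of radius 0, which is closed in the compactification, makes
    the event measurable. *)
Lemma start_set (x : E) :
  [set w | @pr_X R d N 0 w = Some x] = @pr_X R d N 0 @^-1` (Some @` [set z : E | `|z - x| <= 0]).
Proof.
apply/seteqP; split => w /=; first by move=> ->; exists x => //; rewrite /= subrr normr0.
by case=> z /=; rewrite normr_le0 subr_eq0 => /eqP -> <-.
Qed.

Lemma start_meas (x : E) : measurable [set w | @pr_X R d N 0 w = Some x].
Proof.
rewrite start_set -[X in measurable X]setTI; apply: (pr_meas fil (lexx 0)) => //.
rewrite -[X in measurable X]setCK; apply: measurableC; apply: open_meas_ED.
by rewrite openC; exact: closed_some_ball.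
Qed.

Lemma start_ae (x : E) : {ae pr_P N (Some x), forall w, @pr_X R d N 0 w = Some x}.
Proof.
exists (~` [set w | @pr_X R d N 0 w = Some x]); split => //; first exact: measurableC (start_meas x).
by rewrite probability_setC ?nrm ?subee//; exact: start_meas.
Qed.

Lemma expect0 (x : E) (f : E -> R) : measurable_fun setT f -> expect N x 0 f = f x.
Proof.
move=> mf; rewrite /expect (@Rint_ae _ _ _ (pr_P N (Some x)) _ (cst (f x))).
- have h := congr1 fine (probability_setT (pr_P N (Some x))).
  by rewrite Rintegral_cst//; transitivity (f x * 1); [congr (_ * _)|rewrite mulr1].
- exact: (measurableT_comp (meas_ext0 mf) (pr_meas fil (lexx 0))).
- exact: measurable_cst.
- by apply: filterS (start_ae x) => w ->.
Qed.

End Normality.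

Section Positivity.
Context {R : realType} {d : nat}.
Local Notation E := 'rV[R]_d.
Variables (mu : {measure set E -> \bar R}).
Hypothesis mu_pos : forall (x : E) (e : R), 0 < e -> (0 < mu [set y | (`|y - x| < e)%R])%E.
Hypothesis mu_fin : forall (x : E) (e : R), (mu [set y | (`|y - x| < e)%R] < +oo)%E.

(** If f(x) and g(x) were different, averaging over a small ball around [x], with its normalised
    indicator as density, would tell them apart. *)
Lemma cont_eq_of_averages (f g : E -> R) : continuous f -> continuous g ->
  (forall (v : E -> R) (c : R), measurable_fun setT v -> (forall x, 0 <= v x) -> (forall x, v x <= c) ->
     (\int[mu]_x (v x)%:E = 1)%E -> 
     [/\ ig mu (fun x => v x * f x), ig mu (fun x => v x * g x) &
      \int[mu]_x (v x * f x) = \int[mu]_x (v x * g x)]) ->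
  forall x, f x = g x.
Proof.
move=> cf cg Hv x; pose D y := f y - g y.
have cD : continuous D by move=> y; exact: (cvgB (cf y) (cg y)).
apply/eqP; rewrite -subr_eq0 -/(D x); apply/negPn/negP => Dx.
have e0 : 0 < `|D x| / 2 by rewrite divr_gt0// normr_gt0.
have /(@cvgrPdist_lt _ _ _ (nbhs x) _)/(_ _ e0) := cD x.
move=> /nbhs_ballP[r /= r0 Hr].
pose S := [set y : E | `|y - x| < r].
have mS : measurable S.
  apply: open_measE; rewrite (_ : S = ball x r); first exact: ball_open.
  by apply/seteqP; split => y; rewrite -ball_normE /S/= distrC.
have S0 := mu_pos x r0; have Sf := mu_fin x r.
have Sn : mu S \is a fin_num by rewrite ge0_fin_numE.
pose q := fine (mu S); have q0 : 0 < q by rewrite fine_gt0// S0 Sf.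
pose v y : R := q^-1 * \1_S y.
have mI : measurable_fun setT (\1_S : E -> R) by exact: measurable_indic.
have iI : ig mu (\1_S : E -> R) by exact: ig_indic.
have mv : measurable_fun setT v by exact: measurable_funM.
have v0 y : 0 <= v y by rewrite mulr_ge0// ?invr_ge0 ?ltW// indicE.
have vq y : v y <= q^-1.
  by rewrite /v indicE; case: (_ \in _); rewrite ?mulr1// mulr0 invr_ge0 ltW.
have v1 : (\int[mu]_y (v y)%:E = 1)%E.
  under eq_integral do rewrite EFinM.
  rewrite ge0_integralZl_EFin ?invr_ge0 ?(ltW q0)//; last exact/measurable_EFinP.
  by rewrite integral_indic// setIT -(fineK Sn) -/q -EFinM mulVf// gt_eqF.
have [fi gi fg] := Hv v q^-1 mv v0 vq v1.
have vi : ig mu v by exact: igZ.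
have DI : \int[mu]_y (v y * D y) = 0.
  transitivity (\int[mu]_y (v y * f y - v y * g y)).
    by apply: eq_Rintegral => y _; rewrite mulrBr.
  by rewrite (RintegralB measurableT fi gi) fg subrr.
have vD : ig mu (fun y => v y * D y).
  by have := igB fi gi; apply: eq_integrable => // y _ /=; rewrite mulrBr.
have Rv : \int[mu]_y v y = 1 by rewrite /Rintegral v1.
have h : `|D x| <= `|D x| / 2.
  rewrite [leLHS](_ : _ = `|\int[mu]_y (v y * D y) - \int[mu]_y (D x * v y)|); last first.
    by rewrite DI sub0r normrN RintegralZl// Rv mulr1.
  have iD : ig mu (fun y => D x * v y) by exact: igZ.
  rewrite -(RintegralB measurableT vD iD); apply: le_trans (norm_Rint_le (igB vD iD)) _.
  apply: (@le_trans _ _ (n1 mu (fun y => `|D x| / 2 * v y))).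
    apply: n1_le; [exact: ig_meas (igB vD iD)| |exact: igZ].
    move=> y /=; rewrite [D x * _]mulrC -mulrBr normrM [leRHS]normrM mulrC.
    rewrite [`|_ / 2|]ger0_norm ?(ltW e0)//.
    have [Sy|Sy] := pselect (S y); last by rewrite /v indicE memNset// !mulr0 normr0 !mulr0.
    rewrite ler_wpM2r// distrC ltW//; apply: Hr.
    by rewrite -ball_normE /= distrC.
  rewrite (n1Z _ vi) ger0_norm ?(ltW e0)// -[leRHS]mulr1 ler_wpM2l ?(ltW e0)//.
  by rewrite -Rv; apply: le_Rintegral => //; [exact: ig_norm|move=> y _; rewrite ger0_norm].
move: h; rewrite leNgt => /negP; apply.
by rewrite ltr_pdivrMr// ltr_pMr ?normr_gt0// ltr1n.
Qed.

End Positivity.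

Lemma n1_bnd dd (T : measurableType dd) (R : realType) (k : {measure set T -> \bar R})
  (f : T -> R) (c : R) : (k setT <= 1)%E -> measurable_fun setT f -> 0 <= c ->
  (forall x, `|f x| <= c) -> n1 k f <= c.
Proof.
move=> k1 mf c0 fc; have i1 : ig k (cst c).
  by apply: (ig_bnd k1 (c := c)) => // x; rewrite /cst ger0_norm.
apply: (@le_trans _ _ (n1 k (cst c))).
  by apply: n1_le => // x; rewrite /cst [leRHS]ger0_norm.
rewrite /n1 /cst Rintegral_cst// ger0_norm// -[leRHS]mulr1 ler_wpM2l//.
by rewrite -lee_fin fineK//; exact: fin_mass.
Qed.

Section Identification.
Context {R : realType} {d : nat}.
Local Notation E := 'rV[R]_d.
Variables (p : R) (lam mu : {measure set E -> \bar R}).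
Variables (A C : E -> 'M[R]_d) (DA DC : 'I_d -> 'I_d -> 'I_d -> E -> R)
  (H : 'I_d -> E -> R) (rho : E -> R) (Drho : 'I_d -> E -> R).
Hypotheses (d2 : (2 <= d)%N) (dp : d%:R < p) (lamL : is_lebesgue lam).
Let G := drift DA DC H.
Let B := divfree_drift A G DA rho Drho.
Let L := Lop A G.
Hypotheses (aa : assumption_a lam A C DA DC H p)
  (inv : inf_invariant_density A G lam mu p rho Drho).
Variables (T P : R -> (E -> R) -> E -> R).
Hypothesis HT : L1_semigroup_of lam mu A G B T.
Hypothesis cv : continuous_version mu T P.
Variables (M Mt : process R d).
Hypotheses (Mr : right_process M) (ht : has_transition M P) (Minv : invariant_measure M mu).
Hypotheses (Mtr : right_process Mt) (MP : solves_martingale_problem Mt L mu)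
  (Mts : sub_invariant_measure Mt mu).
Hypothesis feller : forall (f : E -> R) (t : R), tst f -> 0 < t -> continuous (fun x => expect Mt x t f).

Let sg : subMarkov_C0_contraction_semigroup mu T. Proof. by case: HT. Qed.
Let Mfil : admissible_filtration M. Proof. by case: Mr. Qed.
Let fil : admissible_filtration Mt. Proof. by case: Mtr. Qed.
Let Mnrm x : pr_P M x [set w | pr_X 0 w = x] = 1%E. Proof. by case: Mr => _ _ _ h _; exact: h. Qed.
Let nrm x : pr_P Mt x [set w | pr_X 0 w = x] = 1%E. Proof. by case: Mtr => _ _ _ h _; exact: h. Qed.
Let HI t f : 0 < t -> ig mu f -> \int[mu]_x T t f x = \int[mu]_x f x.
Proof. exact: (sg_invariant sg cv ht Mfil Minv). Qed.

Let t_ig f : tst f -> ig mu f.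
Proof.
move=> tf; apply/(ig_density (rho_meas inv) (rho_ge0 inv) (mu_density inv)); first exact: tst_meas.
exact: (L2l_tst_ig lamL (L2l_cont lamL (rho_cont inv)) tf).
Qed.

Let L_ig f : tst f -> ig mu (L f).
Proof. exact: (Lop_ig d2 dp lamL aa inv). Qed.

Let mu_fin (x : E) (e : R) : (mu [set y | (`|y - x| < e)%R] < +oo)%E.
Proof.
have [eta he] := mollifier_exists lamL.
have [chi [tc hc]] := cutoff lamL he (e + `|x|).
have mS : measurable [set y : E | `|y - x| < e].
  apply: open_measE; rewrite (_ : [set y | _] = ball x e); first exact: ball_open.
  by apply/seteqP; split => y; rewrite -ball_normE /= distrC.
have : ig mu (\1_[set y : E | `|y - x| < e] : E -> R).
  apply: (ig_le _ _ (t_ig tc)); first exact: measurable_indic.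
  move=> y; rewrite indicE; case: (boolP (_ \in _)) => [|_]; last by rewrite normr0.
  rewrite inE /= => yx; rewrite hc ?normr1//.
  by rewrite -[y](subrK x); apply: le_trans (ler_normD _ _) _; rewrite lerD2r ltW.
move=> /integrableP[_]; rewrite (eq_integral (fun y => (\1_[set y : E | `|y - x| < e] y)%:E)).
  by rewrite integral_indic// setIT.
by move=> y _; rewrite /= ger0_norm.
Qed.

Let mu_pos (x : E) (e : R) : 0 < e -> (0 < mu [set y | (`|y - x| < e)%R])%E.
Proof.
move=> e0; set S := [set y | _].
have mS : measurable S.
  apply: open_measE; rewrite (_ : S = ball x e); first exact: ball_open.
  by apply/seteqP; split => y; rewrite -ball_normE /= distrC.
rewrite lt0e measure_ge0 andbT; apply/negP => /eqP S0.
have : {ae mu, forall y, ~ S y}.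
  by exists S; split => // y /= h; apply: contrapT => h'; apply: h.
move=> /(ae_mu_lam inv) [Z [mZ Z0 HZ]].
have := lam_obox_gt0 lamL (a := x - const_mx e) (b := x + const_mx e) _.
set O := obox _ _ => h; have : (0 < lam O)%E.
  by apply: h => i; rewrite !mxE; lra.
apply/negP; rewrite -leNgt -Z0; apply: le_measure; rewrite ?inE//; first exact: obox_meas.
move=> y Oy; apply: HZ => /=; apply; rewrite /S /=; apply/norm_ltP => // i.
by have := Oy i; rewrite !mxE ltr_norml => /andP[h1 h2]; apply/andP; split; lra.
Qed.

Let um : forall S, measurable S -> universally_measurable (fun y => pr_P Mt y S).
Proof. by case: Mtr. Qed.

Let rc : forall w (t : R), 0 <= t -> pr_X s w @[s --> t^'+] --> @pr_X R d Mt t w.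
Proof. by case: Mtr => _ _ _ _ [_ h _] w t; exact: h. Qed.

(** Continuity of E.[f(X_t)] for test functions upgrades universal measurability of these kernels to
    Borel measurability. *)
Let kmeas t : 0 <= t -> forall S, measurable S ->
  measurable_fun setT (fun x : E => pr_P Mt (Some x) (@pr_X R d Mt t @^-1` (Some @` S))).
Proof.
move=> t0; apply: kernel_meas => // f tf; move: t0; rewrite le_eqVlt => /orP[/eqP <-|t0].
  rewrite (_ : (fun x => _) = f); first exact: tst_meas.
  by apply/funext => x; rewrite (expect0 fil nrm)//; exact: tst_meas.
by apply: cont_meas; exact: feller.
Qed.

Let expect_bnd (N : process R d) (f : E -> R) (t : R) (x : E) (c : R) : admissible_filtration N -> 0 <= t -> 0 <= c ->
  measurable_fun setT f -> (forall y : E, `|f y| <= c) -> `|expect N x t f| <= c.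
Proof.
move=> Nf t0 c0 mf fc; rewrite (expect_law Nf x t0 mf fc).
have l1 := lawm_le1 (pr_P N (Some x)) (pr_meas Nf t0).
exact: le_trans (norm_Rint_le (ig_bnd l1 mf fc)) (n1_bnd l1 mf c0 fc).
Qed.

(** Both sides are continuous, so it suffices to compare their averages against a bounded density
    [v]. Under P_{v mu} the uniqueness of the flow applies; the law at time 0 being absolutely
    continuous, T_t f may then be replaced by its continuous version. *)
Lemma expect_agree f t x : tst f -> 0 < t -> expect Mt x t f = expect M x t f.
Proof.
move=> tf t0; have [cb cb0 fc] := tst_bounded tf; have mf := tst_meas tf.
have fi := t_ig tf.
have Pc := version_cont cv t0 fi; have mP := cont_meas Pc.
have PE y : P t f y = expect M y t f by apply: ht => //; [exact: ltW|exists cb].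
have Pb y : `|P t f y| <= cb by rewrite PE; apply: expect_bnd => //; exact: ltW.
rewrite -PE; move: x; apply: (cont_eq_of_averages mu_pos mu_fin) => [||v c mv v0 vc v1].
- exact: feller.
- exact: Pc.
have vi : ig mu v.
  apply/integrableP; split; first exact/measurable_EFinP.
  rewrite (eq_integral (fun x => (v x)%:E)) ?v1 ?ltry// => x _.
  by rewrite /= ger0_norm.
have vh (h : E -> R) : measurable_fun setT h -> (forall y, `|h y| <= cb) -> ig mu (fun x => v x * h x).
  by move=> mh hb; under eq_fun do rewrite mulrC; exact: ig_mulb hb vi.
have mexp : measurable_fun setT (fun x => expect Mt x t f) by apply: cont_meas; exact: feller.
split; [by apply: vh => // y; apply: expect_bnd => //; exact: ltW|exact: vh|].
have [Q HQ] := mixture_exists mv v0 v1 (mixable_process mv v0 v1 um).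
have fmix (s : R) (s0 : 0 <= s) (h : E -> R) : measurable_fun setT h -> (forall y, `|h y| <= cb) ->
    flow Q s h = \int[mu]_x (v x * expect Mt x s h).
  move=> mh hb; have l1 (K : probability (pr_Omega Mt) R) := lawm_le1 K (pr_meas fil s0).
  rewrite /flow -(Rint_law (mX := pr_meas fil s0)); last exact: (ig_bnd (l1 Q) mh hb).
  rewrite (Rint_mix mv v0 (k := fun x => lawm (pr_P Mt (Some x)) (pr_meas fil s0)) (mu := mu)).
  - by apply: eq_Rintegral => x _; rewrite (expect_law fil x s0 mh hb).
  - by move=> S mS; exact: kmeas.
  - move=> S mS; rewrite /lawm /= /law HQ//.
    by rewrite -[X in measurable X]setTI; apply: (pr_meas fil s0) => //; exact: meas_some.
  - exact: (ig_bnd (l1 Q) mh hb).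
  - by move=> x; exact: (ig_bnd (l1 _) mh hb).
have c1 : 0 < `|c| + 1 by rewrite ltr_wpDl.
have vc1 x : v x <= `|c| + 1.
  by apply: le_trans (vc x) _; apply: le_trans (ler_norm _) _; rewrite lerDl.
have genL u : tst u -> L1_generator mu T u (L u).
  by move=> tu; case: HT => _ _; apply; apply/test_setTP.
have mart u : tst u -> continuous_martingale Q (fun t w =>
    ext0 u (pr_X t w) - ext0 u (pr_X 0 w) -
    \int[@lebesgue_measure R]_(s in `[0, t]) ext0 (L u) (pr_X s w)).
  move=> tu; apply: (MP _ mv v0 _ v1 HQ); first exact/test_setTP.
  by exists c.
have key := @flow_unique R d mu T L (flow Q) (`|c| + 1) sg genL
  (fun g k e => generator_core d2 dp lamL aa inv HT HI (g := g) (h := k) (e := e))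
  (fun g e gi e0 => tst_dense_density lamL (rho_cont inv) (rho_ge0 inv) (mu_density inv) gi e0)
  c1 (fun s f g s0 => flowB fil v0 vc1 c1 kmeas Mts HQ s0)
  (fun s x f s0 => flowZ fil v0 vc1 c1 kmeas Mts HQ x s0)
  (fun s f s0 => flow_bound fil v0 vc1 c1 kmeas Mts HQ s0)
  (fun u a b e a0 => flow_tst fil rc v0 vc1 c1 kmeas Mts HQ L_ig t_ig mart a0)
  f t tf t0.
rewrite -(fmix t (ltW t0) f mf fc) key.
have Ti := sg_ig sg t0 fi; have Pi := version_ig cv t0 fi.
transitivity (flow Q 0 (P t f)); last first.
  rewrite (fmix 0 (lexx 0) _ mP Pb); apply: eq_Rintegral => x _.
  by rewrite (expect0 fil nrm).
apply/eqP; rewrite -subr_eq0 -normr_le0.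
apply: le_trans (flow_dist fil v0 vc1 c1 kmeas Mts HQ (lexx 0) Ti Pi) _.
rewrite (@n1_ae _ _ _ mu _ (fun=> 0)).
- rewrite (_ : n1 mu (fun=> 0) = 0) ?mulr0// /n1 /Rintegral.
  by under eq_integral do rewrite normr0; rewrite integral0.
- exact: ig_meas (igB Ti Pi).
- exact: measurable_cst.
- by apply: filterS (version_ae sg cv t0 fi) => x /= ->; rewrite subrr.
Qed.

Lemma kernel_agree t x S : 0 <= t -> measurable S ->
  pr_P Mt (Some x) (@pr_X R d Mt t @^-1` (Some @` S)) =
  pr_P M (Some x) (@pr_X R d M t @^-1` (Some @` S)).
Proof.
move=> t0 mS.
(* The two measures form a kernel on [bool], and the class of functions with equal values at [true]
   and [false] is closed under the operations that [box_class] requires. *)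
pose k (b : bool) := if b then lawm (pr_P Mt (Some x)) (pr_meas fil t0)
  else lawm (pr_P M (Some x)) (pr_meas Mfil t0).
have k1 b : (k b setT <= 1)%E by case: b; exact: lawm_le1.
have := @box_class _ _ _ (fun f : bool -> R => f true = f false) k k1 _ _ _ S mS.
have e b : (fine (k b S))%:E = k b S by apply: fineK; exact: fin_mass.
move=> h; rewrite -[LHS]/(k true S) -[RHS]/(k false S) -(e true) -(e false).
congr (_%:E); apply: h.
- by move=> f g fE gE /=; rewrite fE gE.
- move=> F f FE Ff; have h := Ff true; rewrite (_ : F^~ true = F^~ false) in h.
    exact: (cvg_unique _ h (Ff false)).
  by apply/funext => n; exact: FE.
- move=> f tf; have [cb cb0 fc] := tst_bounded tf; have mf := tst_meas tf.
  rewrite -(expect_law fil x t0 mf fc) -(expect_law Mfil x t0 mf fc).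
  move: (t0); rewrite le_eqVlt => /orP[/eqP <-|t1]; last exact: expect_agree.
  by rewrite (expect0 fil nrm)// (expect0 Mfil Mnrm).
Qed.

Lemma invariant_agree : invariant_measure Mt mu.
Proof.
case: Minv => sf h; split => // t S t0 mS; rewrite -(h t S t0 mS).
by apply: eq_integral => x _; exact: kernel_agree.
Qed.

End Identification.

(** * Finite-dimensional distributions *)

Section RestrictedLaw.
Context {R : realType} {d : nat}.
Local Notation ED := (one_point_compactification 'rV[R]_d).

Lemma restricted_law d1 (T1 : measurableType d1) d2 (T2 : measurableType d2)
    (Q1 : {measure set T1 -> \bar R}) (Q2 : {measure set T2 -> \bar R})
    (X1 : T1 -> ED) (X2 : T2 -> ED) (L1 : set T1) (L2 : set T2) (f : ED -> \bar R) :
  measurable_fun setT X1 -> measurable_fun setT X2 -> measurable L1 -> measurable L2 ->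
  (forall D, measurable D -> Q1 (X1 @^-1` D `&` L1) = Q2 (X2 @^-1` D `&` L2)) ->
  measurable_fun setT f -> (forall z, 0 <= f z)%E ->
  (\int[Q1]_(w in L1) f (X1 w) = \int[Q2]_(w in L2) f (X2 w))%E.
Proof.
move=> mX1 mX2 mL1 mL2 e mf f0.
have key d0 (T : measurableType d0) (Q : {measure set T -> \bar R}) (X : T -> ED) (L : set T)
    (mX : measurable_fun setT X) (mL : measurable L) (m : {measure set ED -> \bar R}) :
    (forall D, measurable D -> m D = Q (X @^-1` D `&` L)) ->
    (\int[Q]_(w in L) f (X w) = \int[m]_z f z)%E.
  move=> mE; have mI : measurable_fun setT (\1_L : T -> R) by exact: measurable_indic.
  have mp D : measurable D -> measurable (X @^-1` D).
    by move=> mD; rewrite -[Y in measurable Y]setTI; exact: mX.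
  rewrite (@integral_mix _ _ _ _ _ Q m (\1_L : T -> R) (fun w => dirac (X w)) mI)//.
  - rewrite integral_mkcond; apply: eq_integral => w _; rewrite patchE integral_dirac//.
    rewrite diracT mul1e indicE.
    by case: ifP => _; rewrite ?mul1e ?mul0e.
  - move=> D mD; rewrite (_ : (fun x => _) = (fun w => (\1_(X @^-1` D) w)%:E)).
      by apply/measurable_EFinP; apply: measurable_indic; exact: mp.
    by apply/funext => w; rewrite indicE.
  - move=> D mD; rewrite mE//.
    have mXL : measurable (X @^-1` D `&` L) by apply: measurableI => //; exact: mp.
    rewrite -[LHS]/(Q (X @^-1` D `&` L)) -(setIT (X @^-1` D `&` L)) -integral_indic//.
    apply: eq_integral => w _; rewrite !indicE in_setI.
    rewrite -[X in _ = (_ * X)%E]/((X w \in D)%:R%:E) (_ : (w \in X @^-1` D) = (X w \in D)).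
      by case: (X w \in D); case: (w \in L); rewrite /= ?mul1e ?mul0e ?mule0.
    by apply/idP/idP; rewrite !inE.
pose psi : {mfun T1 >-> ED} := HB.pack X1 (isMeasurableFun.Build _ _ _ _ _ mX1).
pose m : {measure set ED -> \bar R} := pushforward (mrestr Q1 mL1) psi.
have -> := key _ _ Q1 X1 L1 mX1 mL1 (m mX1) (fun D mD => erefl).
by have -> := key _ _ Q2 X2 L2 mX2 mL2 (m mX1) e.
Qed.

Lemma meas_from_ED dd (S : measurableType dd) (g : ED -> S) :
  measurable_fun setT (g \o Some) -> measurable_fun setT g.
Proof.
move=> mg _ Y mY; rewrite setTI.
have mB : measurable (Some @` ((g \o Some) @^-1` Y) : set ED).
  by apply: meas_some; rewrite -[X in measurable X]setTI; exact: mg.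
have [Y0|Y0] := pselect (Y (g None)).
  rewrite (_ : _ @^-1` _ = Some @` ((g \o Some) @^-1` Y) `|` [set None]).
    by apply: measurableU => //; exact: meas_none.
  apply/seteqP; split => [[x|] /= H|z].
  - by left; exists x.
  - by right.
  - by move=> [[x Yx <-]|->].
rewrite (_ : _ @^-1` _ = Some @` ((g \o Some) @^-1` Y))//.
by apply/seteqP; split => [[x|//] /= H|_ [x Yx <-]//]; exists x.
Qed.

End RestrictedLaw.

Section Markov.
Context {R : realType} {d : nat} (N : process R d).
Local Notation E := 'rV[R]_d.
Local Notation ED := (one_point_compactification 'rV[R]_d).
Local Notation X := (@pr_X R d N).
Local Notation P := (@pr_P R d N).
Local Notation F := (@pr_filt R d N).
Hypothesis rp : right_process N.
Hypothesis kmeas : forall t, 0 <= t -> forall S, measurable S ->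
  measurable_fun setT (fun x : E => P (Some x) (X t @^-1` (Some @` S))).

Let fil : admissible_filtration N. Proof. by case: rp. Qed.
Let nrm x : P x [set w | X 0 w = x] = 1%E. Proof. by case: rp => _ _ _ h _; exact: h. Qed.

Lemma pre_meas t D : 0 <= t -> measurable D -> measurable (X t @^-1` D).
Proof. by move=> t0 mD; rewrite -[Y in measurable Y]setTI; exact: (pr_meas fil t0). Qed.

(** A path at the cemetery at time 0 has lifetime 0 and therefore stays there. *)
Lemma cemetery t D : 0 <= t -> measurable D -> P None (X t @^-1` D) = (\1_D None)%:E.
Proof.
move=> t0 mD; have [_ [_ _ life] _ _ _] := rp.
pose A := [set w | X 0 w = None].
have mA : measurable A by exact: (pre_meas (lexx 0) meas_none).
have A1 : P None A = 1%E by exact: nrm.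
have At w : A w -> X t w = None.
  by move=> /(life 0 w (lexx 0)) h; apply/(life t w t0); apply: le_trans h _; rewrite lee_fin.
have mD' := pre_meas t0 mD.
rewrite indicE; have [D0|D0] := pselect (D None).
  rewrite mem_set//; apply/eqP; rewrite eq_le probability_le1//= -A1.
  by apply: le_measure; rewrite ?inE// => w Aw; rewrite /preimage/= At.
rewrite memNset//; apply/eqP; rewrite eq_le measure_ge0 andbT.
apply: (@le_trans _ _ (P None (~` A))); last by rewrite probability_setC// A1 subee.
apply: le_measure; rewrite ?inE//; first exact: measurableC.
by move=> w /= Dw Aw; apply: D0; rewrite -(At w Aw).
Qed.

(** The kernel on the compactification is determined by its part on [E], the missing mass sitting at
    the cemetery. *)
Lemma kernel_some t (x : E) D : 0 <= t -> measurable D -> P (Some x) (X t @^-1` D) =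
  (P (Some x) (X t @^-1` (Some @` (Some @^-1` D))) +
   (\1_D None)%:E * (1 - P (Some x) (X t @^-1` (Some @` [set: E]))))%E.
Proof.
move=> t0 mD; pose A := Some @` [set: E] : set ED.
have mA : measurable A by exact: meas_some.
have mDA : measurable (D `&` A) by exact: measurableI.
have e1 : Some @` (Some @^-1` D) = D `&` A.
  apply/seteqP; split => [_ [y Dy <-]|z [Dz [y _ yE]]]; first by split => //; exists y.
  by exists y => //; rewrite /preimage /= yE.
have mXA := pre_meas t0 mA; have mXD := pre_meas t0 mD.
rewrite e1 -(probability_setC _ mXA) (_ : X t @^-1` D = X t @^-1` (D `&` A) `|` X t @^-1` (D `&` ~` A)).
  rewrite measureU; [|exact: pre_meas|by apply: pre_meas => //; apply: measurableI => //; exact: measurableC|].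
    congr (_ + _)%E; rewrite indicE; have [D0|D0] := pselect (D None).
      rewrite mem_set// mul1e; congr (P _ _); apply/seteqP; split => w /=; first by case.
      by case: (X t w) => [y|] // H; exfalso; apply: H; exists y.
    rewrite memNset// mul0e (_ : _ @^-1` _ = set0) ?measure0//.
    apply/seteqP; split => // w /= [Dw H]; case: (X t w) Dw H => [y|//] _; apply; exists y => //.
  by apply/seteqP; split => // w /= [[_ ?] [_ ?]].
apply/seteqP; split => w /=; last by case=> -[].
by move=> Dw; have [h|h] := pselect (A (X t w)); [left|right].
Qed.

Lemma kernel_meas_ED t D : 0 <= t -> measurable D ->
  measurable_fun setT (fun z : ED => P z (X t @^-1` D)).
Proof.
move=> t0 mD; apply: meas_from_ED.
rewrite (_ : _ \o _ = fun x : E => (P (Some x) (X t @^-1` (Some @` (Some @^-1` D))) +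
   (\1_D None)%:E * (1 - P (Some x) (X t @^-1` (Some @` [set: E]))))%E); last first.
  by apply/funext => x; exact: kernel_some.
have mS : measurable (Some @^-1` D : set E).
  by rewrite -[Y in measurable Y]setTI; exact: meas_Some.
apply: emeasurable_funD; first exact: kmeas.
by apply: emeasurable_funM => //; apply: emeasurable_funB => //; exact: kmeas.
Qed.

Let F_setT s : 0 <= s -> F s setT.
Proof.
move=> s0; have [h1 _ _ _] := fil; have [[g0 gC _] _] := h1 s s0.
by have := gC _ g0; rewrite setD0.
Qed.

(** The strong Markov property at the constant time [s], under the mixture given by the Dirac
    measure at [x]. Being Borel in the starting point, the kernel can be integrated in place of the
    version of the conditional probability. *)
Lemma markov x s t L D : 0 <= s -> 0 <= t -> F s L -> measurable D ->
  P x (L `&` X (s + t) @^-1` D) = (\int[P x]_(w in L) P (X s w) (X t @^-1` D))%E.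
Proof.
move=> s0 t0 FL mD; have [_ _ um _ [_ _ sm]] := rp.
have [h1 h2 _ _] := fil; have [[f0 _ _] Fm] := h1 s s0.
have st : stopping_time (fun _ : pr_Omega N => s%:E).
  split=> [w|r r0]; first by rewrite lee_fin.
  have [sr|sr] := leP s r.
    rewrite (_ : [set w | _] = setT); first exact: F_setT.
    by apply/seteqP; split => // w _ /=; rewrite lee_fin.
  rewrite (_ : [set w | _] = set0); first by have [[]] := h1 r r0.
  by apply/seteqP; split => // w /=; rewrite lee_fin leNgt sr.
have [g [mg ae int]] := sm _ _ (dirac_mixture x um) _ t D st t0 mD.
have GL : stopped_sigma_algebra (fun _ : pr_Omega N => s%:E) L.
  split; first exact: Fm.
  move=> r r0; have [sr|sr] := leP s r.
    rewrite (_ : _ `&` _ = L); first exact: (h2 s r s0 sr).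
    by apply/seteqP; split => [w []//|w Lw]; split => //=; rewrite lee_fin.
  rewrite (_ : _ `&` _ = set0); first by have [[]] := h1 r r0.
  by apply/seteqP; split => // w [_ /=]; rewrite lee_fin leNgt sr.
rewrite -[LHS](int L GL); have mL := Fm _ FL.
have mK : measurable_fun setT (fun w => P (X s w) (X t @^-1` D)).
  exact: (measurableT_comp (kernel_meas_ED t0 mD) (pr_meas fil s0)).
apply: ae_eq_integral => //.
- move=> _ Y mY; apply: measurableI => //; have [] := mg Y mY; by [].
- exact: measurable_funTS.
- by apply: filterS ae => w h _.
Qed.

Variables (B : nat -> set ED) (tm : nat -> R).
Hypotheses (mB : forall k, measurable (B k)) (tm0 : forall k, 0 <= tm k).

Definition event (s : seq nat) : set (pr_Omega N) :=
  [set w | forall k, k \in s -> B k (X (tm k) w)].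

Lemma event_cons k s : event (k :: s) = X (tm k) @^-1` (B k) `&` event s.
Proof.
apply/seteqP; split => [w h|w [h1 h2] j]; last first.
  by rewrite inE => /orP[/eqP ->//|]; exact: h2.
by split => [|j js]; apply: h; rewrite inE ?eqxx// js orbT.
Qed.

Lemma event_filt r s : 0 <= r -> (forall k, k \in s -> tm k <= r) -> F r (event s).
Proof.
move=> r0; have [h1 h2 _ h4] := fil; have [Fr _] := h1 r r0.
elim: s => [_|k s IH H].
  by rewrite (_ : event [::] = setT); [exact: F_setT|apply/seteqP; split].
rewrite event_cons -(sigma_algebra_id Fr).
apply: (@measurableI _ (g_sigma_algebraType (F r))).
  apply: sub_sigma_algebra; apply: (h2 (tm k) r (tm0 k)); first by apply: H; rewrite inE eqxx.
  exact: h4.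
by apply: sub_sigma_algebra; apply: IH => j js; apply: H; rewrite inE js orbT.
Qed.

End Markov.

Section FiniteDimensional.
Context {R : realType} {d : nat} (M N : process R d).
Local Notation E := 'rV[R]_d.
Local Notation ED := (one_point_compactification 'rV[R]_d).
Hypotheses (Mr : right_process M) (Nr : right_process N).
Hypothesis kmeas : forall t, 0 <= t -> forall S, measurable S ->
  measurable_fun setT (fun x : E => pr_P N (Some x) (@pr_X R d N t @^-1` (Some @` S))).
Hypothesis agree : forall t (x : E) S, 0 <= t -> measurable S ->
  pr_P N (Some x) (@pr_X R d N t @^-1` (Some @` S)) =
  pr_P M (Some x) (@pr_X R d M t @^-1` (Some @` S)).

Let Mkmeas t : 0 <= t -> forall S, measurable S ->
  measurable_fun setT (fun x : E => pr_P M (Some x) (@pr_X R d M t @^-1` (Some @` S))).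
Proof.
by move=> t0 S mS; have := kmeas t0 mS; congr measurable_fun; apply/funext => x; exact: agree.
Qed.

Lemma kernel_ED t z D : 0 <= t -> measurable D ->
  pr_P N z (@pr_X R d N t @^-1` D) = pr_P M z (@pr_X R d M t @^-1` D).
Proof.
move=> t0 mD; case: z => [x|]; last by rewrite !cemetery.
have mS : measurable (Some @^-1` D : set E) by rewrite -[Y in measurable Y]setTI; exact: meas_Some.
rewrite (kernel_some Nr x t0 mD) (kernel_some Mr x t0 mD).
by rewrite (agree x t0 mS) (agree x t0 measurableT).
Qed.

Variables (B : nat -> set ED) (tm : nat -> R).
Hypotheses (mB : forall k, measurable (B k)) (tm0 : forall k, 0 <= tm k).

(** The list runs backwards in time, so its head is the latest observation. The Markov property at
    the preceding time turns it into a kernel integrated over the earlier event; the extra set [D]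
    in the statement lets the induction hypothesis identify the law of X at that time restricted to
    the event. *)
Lemma fdd_sorted z s k D : path (fun i j => tm j <= tm i) k s -> measurable D ->
  pr_P N z (@pr_X R d N (tm k) @^-1` D `&` event B tm s) =
  pr_P M z (@pr_X R d M (tm k) @^-1` D `&` event B tm s).
Proof.
elim: s k D => [|l s IH] k D /= => [_|/andP[lk ps]] mD.
  have e (K : process R d) : event (N := K) B tm [::] = setT by apply/seteqP; split.
  by rewrite !e !setIT; exact: kernel_ED.
have kl0 : 0 <= tm k - tm l by rewrite subr_ge0.
have tr : transitive (fun i j => tm j <= tm i) by move=> a b c /= h1 h2; exact: le_trans h1.
have Hs j : j \in l :: s -> tm j <= tm l.
  rewrite inE => /orP[/eqP ->//|js]; have := order_path_min tr ps.
  by move=> /allP; apply.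
have evF (K : process R d) (Kr : right_process K) :
    pr_filt (tm l) (event (N := K) B tm (l :: s)) by apply: event_filt.
have mk (K : process R d) (Kr : right_process K) :
    (forall t, 0 <= t -> forall S, measurable S ->
      measurable_fun setT (fun x : E => pr_P K (Some x) (@pr_X R d K t @^-1` (Some @` S)))) ->
    pr_P K z (@pr_X R d K (tm k) @^-1` D `&` event B tm (l :: s)) =
    (\int[pr_P K z]_(w in event B tm (l :: s))
       pr_P K (@pr_X R d K (tm l) w) (@pr_X R d K (tm k - tm l) @^-1` D))%E.
  by move=> kk; rewrite setIC -{1}(subrK (tm l) (tm k)) addrC; apply: markov => //; exact: evF.
rewrite (mk N Nr kmeas) (mk M Mr Mkmeas).
have fil (K : process R d) (Kr : right_process K) : admissible_filtration K by case: Kr.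
have mev (K : process R d) (Kr : right_process K) : measurable (event (N := K) B tm (l :: s)).
  by have [h1 _ _ _] := fil K Kr; have [_ Fm] := h1 (tm l) (tm0 l); apply: Fm; exact: evF.
rewrite (@restricted_law R d _ _ _ _ (pr_P N z) (pr_P M z) (@pr_X R d N (tm l)) (@pr_X R d M (tm l))
  _ (event B tm (l :: s)) (fun u => pr_P N u (@pr_X R d N (tm k - tm l) @^-1` D))).
- by apply: eq_integral => w _; exact: kernel_ED.
- exact: (pr_meas (fil N Nr) (tm0 l)).
- exact: (pr_meas (fil M Mr) (tm0 l)).
- exact: mev.
- exact: mev.
- move=> D' mD'; have ev (K : process R d) :
      @pr_X R d K (tm l) @^-1` D' `&` event (N := K) B tm (l :: s) =
      @pr_X R d K (tm l) @^-1` (D' `&` B l) `&` event B tm s.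
    by rewrite event_cons setIA -preimage_setI.
  rewrite (ev N) (ev M); apply: IH => //; exact: measurableI.
- exact: kernel_meas_ED.
- by [].
Qed.

Lemma fdd z s : measurable (event (N := N) B tm s) /\ measurable (event (N := M) B tm s) /\
  pr_P N z (event B tm s) = pr_P M z (event B tm s).
Proof.
pose s' := sort (fun i j => tm j <= tm i) s.
have es (K : process R d) : event (N := K) B tm s = event B tm s'.
  by apply/seteqP; split => w h j; [rewrite mem_sort|rewrite -(mem_sort (fun i j => tm j <= tm i))] => /h.
have mev (K : process R d) (Kr : right_process K) s0 : measurable (event (N := K) B tm s0).
  elim: s0 => [|k s0 IH]; first by rewrite (_ : event _ _ _ = setT)//; apply/seteqP; split.
  by rewrite event_cons; apply: measurableI => //; exact: pre_meas.
do 2 (split; first exact: mev).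
have srt : sorted (fun i j => tm j <= tm i) s' by apply: sort_sorted => i j; exact: le_total.
rewrite (es N) (es M); case: (s') srt => [_|k s1 /= ps].
  have e (K : process R d) : event (N := K) B tm [::] = setT by apply/seteqP; split.
  by rewrite (e N) (e M) !probability_setT.
by rewrite (event_cons N) (event_cons M); exact: fdd_sorted.
Qed.

End FiniteDimensional.

(** * Sampling the paths at rational times *)

Section Cylinders.
Context {R : realType} {d : nat}.
Local Notation E := 'rV[R]_d.
Local Notation ED := (one_point_compactification 'rV[R]_d).

(** An enumeration of the nonnegative rationals with repetitions; indices that do not encode a pair
    give time 0. *)
Definition qtime (k : nat) : R :=
  if (unpickle k : option (nat * nat)) is Some ab then ab.1%:R / ab.2.+1%:R else 0.

Lemma qtime_ge0 k : 0 <= qtime k.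
Proof. by rewrite /qtime; case: unpickle => // ab; rewrite divr_ge0. Qed.

Lemma qtime_frac a b : exists k, qtime k = a%:R / b.+1%:R.
Proof. by exists (pickle (a, b)); rewrite /qtime pickleK. Qed.

Lemma qtime_dense (s t : R) : 0 <= s -> s < t -> exists k, s < qtime k < t.
Proof.
move=> s0 st; have e0 : 0 < t - s by rewrite subr_gt0.
pose b := Num.bound (t - s)^-1.
have hb : (b.+1%:R : R)^-1 < t - s.
  rewrite invf_plt ?posrE//; apply: lt_trans (archi_boundP _) _; first by rewrite invr_ge0 ltW.
  by rewrite ltr_nat.
have := @truncn_itv R (s * b.+1%:R) (mulr_ge0 s0 (ler0n _ _)).
set a := Num.truncn _ => /andP[h1 h2].
have [k kE] := qtime_frac a.+1 b; exists k; rewrite kE ltr_pdivlMr// h2/=.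
rewrite -natr1 mulrDl mul1r; apply: (@le_lt_trans _ _ (s + b.+1%:R^-1)).
  by rewrite lerD2r ler_pdivrMr.
by rewrite -ltrBrDl.
Qed.

Definition cyl : set (set (nat -> ED)) := [set S | exists (B : nat -> set ED) (n : nat),
  [/\ forall k, measurable (B k), forall k, (n <= k)%N -> B k = setT &
      S = [set c | forall k, B k (c k)]]].

Definition seqs := g_sigma_algebraType cyl.
HB.instance Definition _ := Measurable.on seqs.

Lemma cyl_coord k (D : set ED) : measurable D -> measurable ([set c | D (c k)] : set seqs).
Proof.
move=> mD; apply: sub_sigma_algebra.
exists (fun j => if j == k then D else setT), k.+1; split.
- by move=> j; case: ifP.
- by move=> j; case: eqP => // ->; rewrite ltnn.
- apply/seteqP; split => c /= h; last by have := h k; rewrite eqxx.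
  by move=> j; case: eqP => // ->.
Qed.

Definition sample (N : process R d) (w : pr_Omega N) : seqs := fun k => pr_X (qtime k) w.

Section SampleLaw.
Variables (M N : process R d).
Hypotheses (Mr : right_process M) (Nr : right_process N).
Hypothesis kmeas : forall t, 0 <= t -> forall S, measurable S ->
  measurable_fun setT (fun x : E => pr_P N (Some x) (@pr_X R d N t @^-1` (Some @` S))).
Hypothesis agree : forall t (x : E) S, 0 <= t -> measurable S ->
  pr_P N (Some x) (@pr_X R d N t @^-1` (Some @` S)) =
  pr_P M (Some x) (@pr_X R d M t @^-1` (Some @` S)).

Lemma sample_law z (S : set seqs) : measurable S ->
  [/\ measurable (@sample N @^-1` S), measurable (@sample M @^-1` S) &
      pr_P N z (@sample N @^-1` S) = pr_P M z (@sample M @^-1` S)].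
Proof.
move: S; apply: (@dynkin_induction _ seqs cyl (fun S =>
  [/\ measurable (@sample N @^-1` S), measurable (@sample M @^-1` S) &
      pr_P N z (@sample N @^-1` S) = pr_P M z (@sample M @^-1` S)])).
- by [].
- move=> _ _ [B [n [mB BT ->]]] [B' [n' [mB' BT' ->]]].
  exists (fun k => B k `&` B' k), (maxn n n'); split.
  + by move=> k; exact: measurableI.
  + by move=> k; rewrite geq_max => /andP[h1 h2]; rewrite BT// BT'// setTI.
  + by apply/seteqP; split => [c [h1 h2] k|c h]; [split|split=> k; have [] := h k].
- by rewrite !preimage_setT !probability_setT; split.
- move=> _ [B [n [mB BT ->]]].
  have e (K : process R d) : @sample K @^-1` [set c | forall k, B k (c k)] =
      event (N := K) B qtime (iota 0 n).
    apply/seteqP; split => w h k; first by move=> _; exact: h.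
    have [nk|kn] := leqP n k; first by rewrite BT.
    by apply: h; rewrite mem_iota.
  rewrite (e N) (e M).
  by have [h1 [h2 h3]] := fdd Mr Nr kmeas agree mB qtime_ge0 z (iota 0 n); split.
- move=> S mS [h1 h2 h3].
  have e (K : process R d) : @sample K @^-1` (~` S) = ~` (@sample K @^-1` S) by [].
  rewrite (e N) (e M); split; [exact: measurableC|exact: measurableC|].
  by rewrite (probability_setC _ h1) (probability_setC _ h2) h3.
- move=> F mF tF h.
  have h1 n : measurable (@sample N @^-1` F n) by have [] := h n.
  have h2 n : measurable (@sample M @^-1` F n) by have [] := h n.
  have e (K : process R d) : @sample K @^-1` (\bigcup_k F k) = \bigcup_k (@sample K @^-1` F k).
    exact: preimage_bigcup.
  have tr (K : process R d) : trivIset setT (fun k => @sample K @^-1` F k).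
    by move/trivIsetP: tF => tF; apply/trivIsetP => i j _ _ ij; rewrite -preimage_setI tF// preimage_set0.
  rewrite (e N) (e M); split; [exact: bigcupT_measurable|exact: bigcupT_measurable|].
  have sum (K : process R d) : (forall n, measurable (@sample K @^-1` F n)) ->
      pr_P K z (\bigcup_k (@sample K @^-1` F k)) = (\sum_(0 <= k <oo) pr_P K z (@sample K @^-1` F k))%E.
    move=> hK; apply/esym/cvg_lim => //; apply: measure_semi_sigma_additive => //; [exact: tr|exact: bigcupT_measurable].
  rewrite (sum N h1) (sum M h2).
  by apply: eq_eseriesr => n _; have [] := h n.
Qed.

End SampleLaw.
End Cylinders.

(** * Path laws *)

Section PathSets.
Context {R : realType} {d : nat}.
Local Notation E := 'rV[R]_d.
Local Notation ED := (one_point_compactification 'rV[R]_d).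
Local Notation nneg := (@nneg_time R).
Local Notation cp := (@cpath R d).
Local Notation qt := (@qtime R).
Implicit Types (x : R -> ED) (q : 'rV[rat]_d) (r s t : R) (i m n j N : nat).

(** Countably many balls that are closed in the compactification, so that a right limit cannot leave
    them. *)
Definition rball (q : 'rV[rat]_d) (j : nat) : set ED :=
  Some @` [set y : E | `|y - ratv q| <= j.+1%:R^-1].

Definition incell (i m : nat) (t : R) := m%:R / i.+1%:R <= t <= m.+1%:R / i.+1%:R.

Definition cell i m q j : set (@seqs R d) :=
  [set c | forall k, incell i m (qt k) -> rball q j (c k)].

Lemma rball_meas q j : measurable (rball q j).
Proof.
rewrite -[X in measurable X]setCK; apply: measurableC; apply: open_meas_ED.
by rewrite openC; exact: closed_some_ball.
Qed.

Lemma cell_meas i m q j : measurable (cell i m q j).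
Proof.
rewrite (_ : cell i m q j = \bigcap_k (if incell i m (qt k) then [set c | rball q j (c k)] else setT)).
  by apply: bigcapT_measurable => k; case: ifP => // _; apply: cyl_coord; exact: rball_meas.
apply/seteqP; split => c /= h k.
  by move=> _; case: ifP => // ik; exact: h.
by move=> ik; have := h k Logic.I; rewrite ik.
Qed.

Lemma cell_time i t : 0 <= t -> incell i (Num.truncn (t * i.+1%:R)) t.
Proof.
move=> t0; have /andP[h1 h2] := @truncn_itv R (t * i.+1%:R) (mulr_ge0 t0 (ler0n _ _)).
by rewrite /incell ler_pdivrMr// h1/= ler_pdivlMr// ltW.
Qed.

Lemma cell_bound i N t : 0 <= t -> t < N%:R -> (Num.truncn (t * i.+1%:R) < N * i.+1)%N.
Proof.
move=> t0 tN; have /andP[h1 _] := @truncn_itv R (t * i.+1%:R) (mulr_ge0 t0 (ler0n _ _)).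
rewrite -(ltr_nat R); apply: le_lt_trans h1 _.
by rewrite natrM ltr_pM2r.
Qed.

(** If x(t) were outside the closed ball, so would be x at the rational times shortly after t, which
    still belong to the cell. The right end point of the cell has no later times in the cell, but it
    is rational itself. *)
Lemma cell_all x i m q j t : (forall s, 0 <= s -> x u @[u --> s^'+] --> x s) ->
  cell i m q j (fun k => x (qt k)) -> incell i m t -> rball q j (x t).
Proof.
move=> rc H /andP[mt tm]; have i0 : 0 < i.+1%:R :> R by [].
have t0 : 0 <= t by apply: le_trans mt; rewrite divr_ge0.
have [tb|tb] := eqVneq t (m.+1%:R / i.+1%:R).
  have [k kE] := @qtime_frac R m.+1 i; rewrite tb -kE; apply: H.
  by rewrite kE /incell lexx andbT ler_pM2r ?invr_gt0// ler_nat.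
have {}tb : t < m.+1%:R / i.+1%:R by rewrite lt_neqAle tb.
apply: contrapT => nb; have oC : open (~` rball q j : set ED).
  by rewrite openC; exact: closed_some_ball.
have : nbhs (x t) (~` rball q j) by apply: open_nbhs_nbhs.
move=> /(rc t t0) => Ht.
have H2 : \forall u \near t^'+, ~ rball q j (x u) /\ u < m.+1%:R / i.+1%:R.
  by near=> u; split; near: u => //; exact: nbhs_right_lt.
have [e /= e0 He] := H2.
have [k /andP[k1 k2]] : exists k, t < qt k < t + e by apply: qtime_dense => //; rewrite ltrDl.
have [] := He (qt k) _ k1; last first.
  by move=> h1 h2; apply: h1; apply: H; rewrite /incell (le_trans mt (ltW k1)) ltW.
by rewrite /= distrC ger0_norm ?subr_ge0 ?(ltW k1)// ltrBlDl.
Unshelve. all: by end_near. Qed.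


Lemma inv_lt (e : R) : 0 < e -> exists n : nat, n.+1%:R^-1 < e.
Proof.
move=> e0; exists (Num.bound e^-1); rewrite invf_plt ?posrE//.
by apply: lt_trans (archi_boundP _) _; rewrite ?invr_ge0 ?ltr_nat// ltW.
Qed.

(** Continuity of an [E]-valued path, expressed by countably many conditions at rational times: for
    every horizon N and every precision there is a mesh, all of whose cells up to N are mapped into
    small balls of [E]. *)
Definition regular : set (@seqs R d) := [set c | forall j N, exists i, forall m,
  (m < N * i.+1)%N -> exists q, cell i m q j c].

Lemma countable_bigcup (I : countType) (F : I -> set (@seqs R d)) :
  (forall k, measurable (F k)) -> measurable (\bigcup_k F k).
Proof.
move=> mF; rewrite (_ : \bigcup_k F k =
    \bigcup_n (if (unpickle n : option I) is Some k then F k else set0)).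
  by apply: bigcupT_measurable => n; case: unpickle.
apply/seteqP; split => c [k _ Fk]; first by exists (pickle k) => //; rewrite pickleK.
by move: Fk; case: unpickle => // a Fa; exists a.
Qed.

Lemma regular_meas : measurable regular.
Proof.
rewrite (_ : regular = \bigcap_j \bigcap_N \bigcup_i \bigcap_m
    (if (m < N * i.+1)%N then \bigcup_q cell i m q j else setT)).
  apply: bigcapT_measurable => j; apply: bigcapT_measurable => N.
  apply: bigcupT_measurable => i; apply: bigcapT_measurable => m; case: ifP => // _.
  by apply: countable_bigcup => q; exact: cell_meas.
apply/seteqP; split => c h.
  move=> j _ N _; have [i Hi] := h j N; exists i => // m _; case: ifP => // /Hi [q Hq].
  by exists q.
move=> j N; have [i _ Hi] := h j Logic.I N Logic.I; exists i => m mN.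
by have := Hi m Logic.I; rewrite mN => -[q _ Hq]; exists q.
Qed.

(** Tubes with rational centres. There are countably many of them, and they serve as a base of the
    locally uniform topology. *)
Definition grid N i j (qs : seq 'rV[rat]_d) : set (@seqs R d) :=
  [set c | forall m, (m < N * i.+1)%N -> cell i m (nth 0 qs m) j c].

Lemma grid_meas N i j qs : measurable (grid N i j qs).
Proof.
rewrite (_ : grid N i j qs = \bigcap_m (if (m < N * i.+1)%N then cell i m (nth 0 qs m) j else setT)).
  by apply: bigcapT_measurable => m; case: ifP => // _; exact: cell_meas.
apply/seteqP; split => c h m; first by move=> _; case: ifP => // mN; exact: h.
by move=> mN; have := h m Logic.I; rewrite mN.
Qed.

Definition toE (z : ED) : E := if z is Some y then y else 0.

Lemma rball_dist q j (y z : ED) : rball q j y -> rball q j z -> `|toE y - toE z| <= 2 * j.+1%:R^-1.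
Proof.
move=> [u hu <-] [v hv <-] /=; have -> : u - v = (u - ratv q) - (v - ratv q).
  by rewrite opprB addrA subrK.
by apply: le_trans (ler_normB _ _) _; rewrite mulrDl mul1r; exact: lerD.
Qed.

Section RegularPath.
Variable x : R -> ED.
Hypothesis rc : forall s, 0 <= s -> x u @[u --> s^'+] --> x s.
Hypothesis reg : regular (fun k => x (qt k)).

Let some_x t : 0 <= t -> x t = Some (toE (x t)).
Proof.
move=> t0; have [i Hi] := reg 0%N (Num.bound t).
have [q Hq] := Hi _ (cell_bound i t0 (archi_boundP t0)).
by have [y _ <-] := cell_all rc Hq (cell_time i t0).
Qed.

(** Times closer than the mesh lie in one cell or in two adjacent ones. In the second case the
    common end point [g] belongs to both, and the estimate passes through x(g) at the cost of two
    diameters. *)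
Let osc i j N s t : (forall m, (m < N * i.+1)%N -> exists q, cell i m q j (fun k => x (qt k))) ->
  0 <= s -> s <= t -> t < N%:R -> t - s < i.+1%:R^-1 ->
  `|toE (x s) - toE (x t)| <= 4 * j.+1%:R^-1.
Proof.
move=> H s0 st tN ts; have t0 := le_trans s0 st.
have sN := le_lt_trans st tN; pose m := Num.truncn (s * i.+1%:R).
have [q Hq] := H _ (cell_bound i s0 sN).
have sm := cell_time i s0; have bs := cell_all rc Hq sm.
have j0 : 0 <= 2 * j.+1%:R^-1 :> R by rewrite mulr_ge0.
have -> : 4 * j.+1%:R^-1 = 2 * j.+1%:R^-1 + 2 * j.+1%:R^-1 :> R by ring.
have [tm|tm] := leP t (m.+1%:R / i.+1%:R).
  have bt : rball q j (x t).
    by apply: (cell_all rc Hq); rewrite /incell tm andbT; case/andP: sm => h _; exact: le_trans st.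
  by apply: le_trans (rball_dist bs bt) _; rewrite lerDl.
pose g : R := m.+1%:R / i.+1%:R.
have bg : rball q j (x g).
  by apply: (cell_all rc Hq); rewrite /incell lexx andbT ler_pM2r ?invr_gt0// ler_nat.
have mN : (m.+1 < N * i.+1)%N.
  by rewrite -(ltr_nat R) natrM -ltr_pdivrMr//; exact: lt_trans tN.
have [q' Hq'] := H _ mN.
have bg' : rball q' j (x g).
  by apply: (cell_all rc Hq'); rewrite /incell lexx/= ler_pM2r ?invr_gt0// ler_nat.
have bt : rball q' j (x t).
  apply: (cell_all rc Hq'); rewrite /incell (ltW tm)/=.
  rewrite -natr1 mulrDl mul1r -/g; case/andP: sm => _; rewrite -/m -/g => h.
  by rewrite -lerBlDr; apply: le_trans h; rewrite lerBlDr -lerBlDl ltW.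
apply: le_trans (ler_distD (toE (x g)) _ _) _; apply: lerD.
  exact: rball_dist bs bg.
exact: rball_dist bg' bt.
Qed.

Lemma regular_path : exists c : cp, forall t : nneg, x (set_val t) = Some (path_fun c t).
Proof.
have v0 (t : nneg) : 0 <= set_val t by exact: (set_valP t).
pose f : {family compact, nneg -> E} := (fun t : nneg => toE (x (set_val t))).
have cf : continuous (f : nneg -> E).
  move=> t0; apply/(@cvgrPdist_le _ _ _ (nbhs t0) _) => e e0.
  have [j hj] := inv_lt (divr_gt0 e0 (ltr0n _ 4) : 0 < e / 4).
  have hj4 : 4 * j.+1%:R^-1 <= e by rewrite mulrC -ler_pdivlMr// ltW.
  (* One unit beyond [t0], so that nearby times stay within the range covered by the mesh. *)
  pose N := Num.bound (set_val t0 + 1).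
  have tN : set_val t0 + 1 < N%:R by apply: archi_boundP; rewrite addr_ge0.
  have [i Hi] := reg j N.
  have r0 : 0 < Num.min 1 (i.+1%:R^-1 : R) by rewrite lt_min ltr01 invr_gt0 ltr0n.
  have : nbhs (set_val t0) (ball (set_val t0) (Num.min 1 (i.+1%:R^-1 : R))) by exact: nbhsx_ballx.
  move=> hb; have hb' : \forall t \near t0, ball (set_val t0) (Num.min 1 (i.+1%:R^-1 : R)) (set_val t).
    exact: (@initial_continuous nneg R set_val t0 _ hb).
  near=> t; have : ball (set_val t0) (Num.min 1 (i.+1%:R^-1 : R)) (set_val t) by near: t.
  rewrite -ball_normE /= lt_min => /andP[h1 h2].
  have [h|h] := leP (set_val t) (set_val t0).
    rewrite ger0_norm ?subr_ge0// in h2; rewrite distrC.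
    by apply: le_trans (osc Hi (v0 t) h _ h2) hj4; apply: lt_trans tN; rewrite ltrDl.
  rewrite distrC ger0_norm ?subr_ge0 ?ltW// in h1; rewrite distrC ger0_norm ?subr_ge0 ?(ltW h)// in h2.
  apply: le_trans (osc Hi (v0 t0) (ltW h) _ h2) hj4; apply: lt_trans tN.
  by rewrite -ltrBlDl.
exists (exist _ f (mem_set cf)) => t; rewrite some_x//.
Unshelve. all: by end_near. Qed.

End RegularPath.

End PathSets.

Section PathBorel.
Context {R : realType} {d : nat}.
Local Notation E := 'rV[R]_d.
Local Notation ED := (one_point_compactification 'rV[R]_d).
Local Notation nneg := (@nneg_time R).
Local Notation cp := (@cpath R d).
Local Notation qt := (@qtime R).
Implicit Types (c : cp).

Let max_ge0 (t : R) : 0 <= Num.max t 0. Proof. by rewrite le_max lexx orbT. Qed.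

(** Clipping negative times turns a path into a continuous function on the whole line. *)
Definition to_nneg (t : R) : nneg := exist _ (Num.max t 0) (mem_set (max_ge0 t)).

Definition pfun c (t : R) : E := path_fun c (to_nneg t).

Lemma to_nnegK (t : nneg) : to_nneg (set_val t) = t.
Proof. by apply: val_inj => /=; rewrite max_l//; exact: (set_valP t). Qed.

Lemma pfun_cont c : continuous (pfun c).
Proof.
have ct : continuous to_nneg.
  apply: (@continuous_comp_initial _ _ _ (set_val : nneg -> R)) => t.
  rewrite (_ : _ \o _ = fun s : R => Num.max s 0)//.
  by apply: continuous_max; [exact: cvg_id|exact: cvg_cst].
by move=> t; apply: (continuous_comp (ct t)); exact: (set_valP c).
Qed.

Lemma rat_approx (y : E) (e : R) : 0 < e -> exists q : 'rV[rat]_d, `|y - ratv q| <= e.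
Proof.
move=> e0; have oB : open (ball y e) by exact: ball_open.
have [q [h1 h2]] := rat_box oB (ballxx y e0); exists q.1; apply: ltW.
have : ball y e (ratv q.1).
  by apply: h2 => i; rewrite lexx/=; have /andP[a b] := h1 i; exact: ltW (lt_trans a b).
by rewrite -ball_normE.
Qed.

Lemma unif_cont (f : R -> E) (b e : R) : continuous f -> 0 < e ->
  exists2 dl, 0 < dl & forall s u, 0 <= s <= b -> `|s - u| < dl -> `|f s - f u| <= e.
Proof.
move=> cf e0; have K := @segment_compact R 0 b.
have nc := (compact_near_coveringP _).1 K R 0^'+
  (fun dl s => forall u, `|s - u| < dl -> `|f s - f u| <= e) _ _.
have [z /= z0 Hz] : \forall dl \near 0^'+, `[0, b]%classic `<=`
    (fun s => forall u, `|s - u| < dl -> `|f s - f u| <= e).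
  apply: nc => s _; have e2 : 0 < e / 2 by rewrite divr_gt0.
  have /(@cvgrPdist_le _ _ _ (nbhs s) _)/(_ _ e2) := cf s.
  move=> /nbhs_ballP[h /= h0 Hh]; have h2 : 0 < h / 2 by rewrite divr_gt0.
  exists (ball s (h / 2), [set dl : R | dl < h / 2]).
    by split => /=; [exact: nbhsx_ballx|exact: nbhs_right_lt].
  move=> [s' dl] /= [bs dh] u su; rewrite -ball_normE /= in bs.
  have b1 : ball s h s'.
    by rewrite -ball_normE /=; apply: lt_trans bs _; rewrite ltr_pdivrMr// ltr_pMr// ltr1n.
  have b2 : ball s h u.
    rewrite -ball_normE /=; apply: le_lt_trans (ler_distD s' _ _) _.
    by rewrite [ltRHS]splitr; apply: ltrD => //; exact: lt_trans dh.
  apply: le_trans (ler_distD (f s) _ _) _; rewrite [leRHS]splitr; apply: lerD; last exact: Hh.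
  by rewrite distrC; exact: Hh.
exists (z / 2); first by rewrite divr_gt0.
move=> s u sb su; apply: (Hz (z / 2) _ _ s) => //=.
- by rewrite sub0r normrN ger0_norm ?divr_ge0 ?ltW// ltr_pdivrMr// ltr_pMr// ltr1n.
- by rewrite divr_gt0.
Qed.

Definition samples c : @seqs R d := fun k => Some (pfun c (qt k)).

Lemma grid_exists c N j : exists i qs, grid N i j qs (samples c).
Proof.
(* Half of the radius is for the oscillation over a cell, the other half for the choice of a
   rational centre. *)
have r0 : 0 < (j.+1%:R : R)^-1 / 2 by rewrite divr_gt0// invr_gt0.
have [dl dl0 Hdl] := unif_cont N%:R (@pfun_cont c) r0.
have [i hi] := inv_lt dl0; have i0 : 0 < i.+1%:R :> R by [].
have /choice[q Hq] := fun m : nat => rat_approx (pfun c (m%:R / i.+1%:R)) r0.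
exists i, (mkseq q (N * i.+1)) => m mN k /andP[k1 k2]; rewrite nth_mkseq//.
exists (pfun c (qt k)) => //=.
apply: le_trans (ler_distD (pfun c (m%:R / i.+1%:R)) _ _) _; rewrite [leRHS]splitr.
apply: lerD; last exact: Hq.
rewrite distrC; apply: Hdl.
  rewrite divr_ge0//= ler_pdivrMr// -natrM ler_nat; exact: ltnW.
rewrite distrC ger0_norm ?subr_ge0//; apply: le_lt_trans hi.
by rewrite lerBlDr -[leRHS]mul1r; apply: le_trans k2 _; rewrite -natr1 mulrDl mul1r addrC mul1r.
Qed.

Lemma samples_regular c : regular (samples c).
Proof.
move=> j N; have [i [qs H]] := grid_exists c N j; exists i => m mN.
by exists (nth 0 qs m); exact: H.
Qed.

(** A compact set of times is bounded, so the conditions of closeness 1/(n + 1) on [0, n] form a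
    base of neighbourhoods for uniform convergence on compact sets. *)
Lemma open_cpath (O : set cp) c : open O -> O c -> exists n : nat, forall c',
  (forall t : R, 0 <= t <= n%:R -> `|pfun c t - pfun c' t| <= n.+1%:R^-1) -> O c'.
Proof.
case=> O' oO' <- /= Oc.
pose U (n : nat) : set (nneg -> E) := [set g | forall t : nneg, set_val t <= n%:R ->
  `|path_fun c t - g t| <= n.+1%:R^-1].
have FF : Filter (filter_from setT U).
  apply: filter_from_filter; first by exists 0%N.
  move=> n m _ _; exists (maxn n m) => // g Hg; split => t tn.
    apply: le_trans (Hg t _) _; first by apply: le_trans tn _; rewrite ler_nat leq_maxl.
    by rewrite lef_pV2 ?posrE// ler_nat ltnS leq_maxl.
  apply: le_trans (Hg t _) _; first by apply: le_trans tn _; rewrite ler_nat leq_maxr.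
  by rewrite lef_pV2 ?posrE// ler_nat ltnS leq_maxr.
have cvF : {family compact, (filter_from setT U) --> (path_fun c : nneg -> E)}.
  apply/fam_cvgP => A cA P /uniform_nbhs[W [entW WP]].
  have [e /= e0 eW] : exists2 e : R, 0 < e & forall y z : E, ball y e z -> W (y, z).
    move: entW; rewrite -entourage_ballE => -[e /= e0 H]; exists e => // y z yz.
    exact: (H (y, z)).
  have [b Hb] : exists b : nat, forall t, A t -> set_val t <= b%:R.
    have : compact (set_val @` A : set R).
      apply: continuous_compact => //; apply: continuous_subspaceT.
      exact: (@initial_continuous nneg R set_val).
    move=> /compact_bounded[M [_ HM]].
    have h1 : M < `|M| + 1 by rewrite (le_lt_trans (ler_norm _))// ltrDl.
    exists (Num.bound (`|M| + 1)) => t At.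
    have : `|set_val t| <= `|M| + 1 by apply: (HM _ h1); exists t.
    move=> h2; apply: le_trans (ler_norm _) _; apply: le_trans h2 _.
    by apply: ltW; apply: archi_boundP; rewrite addr_ge0.
  have [n Hn] := inv_lt e0; exists (maxn b n) => // g Hg; apply: WP => t At; apply: eW.
  rewrite -ball_normE /=; apply: le_lt_trans (Hg t _) _.
    by apply: le_trans (Hb t At) _; rewrite ler_nat leq_maxl.
  by apply: le_lt_trans Hn; rewrite lef_pV2 ?posrE// ler_nat ltnS leq_maxr.
have /cvF[n _ Hn] : nbhs (set_val c : {family compact, nneg -> E}) O' by exact: open_nbhs_nbhs.
exists n => c' Hc'; apply: Hn => t tn.
by have := Hc' (set_val t); rewrite /pfun to_nnegK; apply; rewrite tn andbT; exact: (set_valP t).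
Qed.

Let rc_pfun c : forall s, 0 <= s -> (Some (pfun c u) : ED) @[u --> s^'+] --> (Some (pfun c s) : ED).
Proof.
move=> s _; apply: cvg_within_filter.
apply: (@cvg_comp _ _ _ (pfun c) (Some : E -> ED) _ (nbhs (pfun c s))).
  exact: pfun_cont.
exact: one_point_compactification_some_continuous.
Qed.

Lemma open_grid (O : set cp) c : open O -> O c -> exists N i j qs,
  grid N i j qs (samples c) /\ forall c', grid N i j qs (samples c') -> O c'.
Proof.
move=> oO Oc; have [n Hn] := open_cpath oO Oc.
(* Balls of radius 1/(2n + 2) have diameter at most 1/(n + 1); the horizon n + 1 makes the cells
   cover the time [n]. *)
have [i [qs H]] := grid_exists c n.+1 n.*2.+1.
exists n.+1, i, n.*2.+1, qs; split => // c' H'; apply: Hn => t /andP[t0 tn].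
have mN : (Num.truncn (t * i.+1%:R) < n.+1 * i.+1)%N.
  by apply: cell_bound => //; apply: le_lt_trans tn _; rewrite ltr_nat.
have ct := cell_time i t0.
have b1 := cell_all (@rc_pfun c) (H _ mN) ct; have b2 := cell_all (@rc_pfun c') (H' _ mN) ct.
apply: le_trans (rball_dist b1 b2) _.
have -> : (n.*2.+2%:R : R) = 2 * n.+1%:R by rewrite -doubleS -muln2 natrM mulrC.
by rewrite invfM mulrA mulfV// mul1r.
Qed.

Section Event.
Variable N : process R d.
Hypothesis rc : forall w (t : R), 0 <= t -> pr_X s w @[s --> t^'+] --> @pr_X R d N t w.

Lemma path_eventE w c : (forall t : nneg, pr_X (set_val t) w = Some (path_fun c t)) <->
  (forall t, 0 <= t -> @pr_X R d N t w = Some (pfun c t)).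
Proof.
split=> H t.
  by move=> t0; rewrite /pfun -H /=; congr (pr_X _ _); rewrite set_valE /= max_l.
by rewrite H ?/pfun ?to_nnegK//; exact: (set_valP t).
Qed.

Lemma path_event_sample (B : set cp) w : path_event N B w <->
  exists c, [/\ B c, regular (sample w) & forall t, 0 <= t -> @pr_X R d N t w = Some (pfun c t)].
Proof.
split=> [[c [Bc /path_eventE H]]|[c [Bc _ /path_eventE H]]]; last by exists c.
exists c; split => //; rewrite (_ : sample w = samples c); first exact: samples_regular.
by apply/funext => k; rewrite /sample H//; exact: qtime_ge0.
Qed.

Lemma path_unique w c c' : (forall t, 0 <= t -> @pr_X R d N t w = Some (pfun c t)) ->
  (forall t, 0 <= t -> @pr_X R d N t w = Some (pfun c' t)) -> c = c'.
Proof.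
move=> H H'; apply: val_inj; apply/funext => t.
have t0 : 0 <= set_val t by exact: (set_valP t).
have := H _ t0; rewrite (H' _ t0) /pfun to_nnegK => -[e].
exact: esym.
Qed.

End Event.

Definition good (O : set cp) (p : nat * nat * nat * seq 'rV[rat]_d) : Prop :=
  forall c, grid p.1.1.1 p.1.1.2 p.1.2 p.2 (samples c) -> O c.

(** Reads off the rational samples whether the path is continuous and belongs to [O]: some tube
    contained in [O] must contain the sample. Regularity guarantees that there is a path at all. *)
Definition open_code (O : set cp) : set (@seqs R d) := regular `&`
  \bigcup_p (if `[< good O p >] then grid p.1.1.1 p.1.1.2 p.1.2 p.2 else set0).

Lemma open_code_meas O : measurable (open_code O).
Proof.
apply: measurableI; first exact: regular_meas.
by apply: countable_bigcup => p; case: ifP => // _; exact: grid_meas.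
Qed.

Lemma open_codeE (N : process R d) (O : set cp) :
  (forall w (t : R), 0 <= t -> pr_X s w @[s --> t^'+] --> @pr_X R d N t w) ->
  open O -> path_event N O = @sample R d N @^-1` open_code O.
Proof.
move=> rc oO; apply/seteqP; split => w.
  move=> /path_event_sample[c [Oc reg H]]; split => //.
  have [n [i [j [qs [h1 h2]]]]] := open_grid oO Oc; exists (n, i, j, qs) => //.
  have -> : `[< good O (n, i, j, qs) >] by apply/asboolP.
  rewrite (_ : sample w = samples c)//.
  by apply/funext => k; rewrite /sample H//; exact: qtime_ge0.
move=> [reg [p _]]; case: asboolP => // gp H.
have [c Hc] := regular_path (rc w) reg.
exists c; split => //; apply: gp; rewrite (_ : samples c = sample w)//.
have Hc' := (path_eventE w c).1 Hc.
by apply/funext => k; rewrite /sample Hc'//; exact: qtime_ge0.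
Qed.

(** The set [S] of sample sequences does not depend on the process, so processes with the same
    sample law have the same path law. *)
Lemma path_event_code (B : set cp) : path_borel B -> exists2 S : set (@seqs R d), measurable S &
  forall N : process R d,
    (forall w (t : R), 0 <= t -> pr_X s w @[s --> t^'+] --> @pr_X R d N t w) ->
    path_event N B = @sample R d N @^-1` S.
Proof.
move: B; apply: smallest_sub; last first.
  move=> O oO; exists (open_code O); first exact: open_code_meas.
  by move=> N rc; exact: open_codeE.
split.
- exists set0 => // N rc; rewrite preimage_set0.
  by apply/seteqP; split => // w [c []].
(* A path event presupposes a continuous path in [E], so the complement is taken inside the code of
   the whole path space; uniqueness of the path of an outcome separates [B] from its complement. *)
- move=> B [S mS HS]; exists (open_code setT `\` S).
    by apply: measurableD => //; exact: open_code_meas.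
  move=> N rc; rewrite (_ : @sample R d N @^-1` _ =
    @sample R d N @^-1` open_code setT `\` @sample R d N @^-1` S)// -(open_codeE rc openT) -(HS N rc).
  apply/seteqP; split => w.
    move=> [c [[_ nB] H]]; split; first by exists c.
    move=> [c' [Bc' H']]; apply: nB; rewrite (_ : c = c')//.
    by apply: (@path_unique N w); apply/path_eventE.
  by move=> [[c [_ H]] nB]; exists c; split => //; split => // Bc; apply: nB; exists c.
- move=> F HF; have /choice[S HS] : forall n, exists S : set (@seqs R d), measurable S /\
      forall N : process R d,
      (forall w (t : R), 0 <= t -> pr_X s w @[s --> t^'+] --> @pr_X R d N t w) ->
      path_event N (F n) = @sample R d N @^-1` S.
    by move=> n; have [S mS h] := HF n; exists S.
  exists (\bigcup_n S n); first by apply: bigcupT_measurable => n; have [] := HS n.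
  move=> N rc; rewrite preimage_bigcup; apply/seteqP; split => w.
    move=> [c [[n _ Fc] H]]; exists n => //; have [_ h] := HS n; rewrite -(h N rc).
    by exists c.
  move=> [n _]; have [_ h] := HS n; rewrite -(h N rc) => -[c [Fc H]].
  by exists c; split => //; exists n.
Qed.

End PathBorel.

Theorem proposition3p58 (R : realType) (d : nat) (p : R)
  (lam mu : {measure set 'rV[R]_d -> \bar R})
  (A C : 'rV[R]_d -> 'M[R]_d) (DA DC : 'I_d -> 'I_d -> 'I_d -> 'rV[R]_d -> R)
  (H : 'I_d -> 'rV[R]_d -> R)
  (rho : 'rV[R]_d -> R) (Drho : 'I_d -> 'rV[R]_d -> R)
  (T P : R -> ('rV[R]_d -> R) -> 'rV[R]_d -> R)
  (M Mt : process R d) :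
  (2 <= d)%N -> d%:R < p ->
  is_lebesgue lam ->
  let G := drift DA DC H in
  let L := Lop A G in
  let B := divfree_drift A G DA rho Drho in
  let q := p * d%:R / (p + d%:R) in
  assumption_a lam A C DA DC H p ->
  assumption_b lam DA DC H q ->
  inf_invariant_density A G lam mu p rho Drho ->
  L1_semigroup_of lam mu A G B T ->
  continuous_version mu T P ->
  hunt_process M -> continuous_paths M -> has_transition M P ->
  locally_hoelder A ->
  invariant_measure M mu ->
  right_process Mt ->
  solves_martingale_problem Mt L mu ->
  sub_invariant_measure Mt mu ->
  (forall (f : 'rV[R]_d -> R) (t : R), test_function setT f -> 0 < t ->
    continuous (fun x => expect Mt x t f)) ->
  [/\ invariant_measure Mt mu,
      forall B : set (@cpath R d), path_borel B ->
        measurable (path_event M B) /\ measurable (path_event Mt B),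
      forall x, path_law Mt x = path_law M x &
      (* every property of the family of laws is inherited *)
      forall Pr : ('rV[R]_d -> {B : set (@cpath R d) | path_borel B} -> \bar R) -> Prop,
        Pr (path_law M) -> Pr (path_law Mt)].
Proof.
move=> d2 dp lamL G L B q aa _ inv HT cv hunt _ ht _ Minv Mtr MP Mts feller.
have Mr : right_process M by case: hunt.
have fel (f : 'rV[R]_d -> R) (t : R) : tst f -> 0 < t -> continuous (fun x => expect Mt x t f).
  by move=> tf; apply: feller; apply/test_setTP.
have agree t x S : 0 <= t -> measurable S ->
    pr_P Mt (Some x) (@pr_X R d Mt t @^-1` (Some @` S)) =
    pr_P M (Some x) (@pr_X R d M t @^-1` (Some @` S)).
  exact: (kernel_agree d2 dp lamL aa inv HT cv Mr ht Minv Mtr MP Mts fel).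
have fil : admissible_filtration Mt by case: Mtr.
have kmeas t : 0 <= t -> forall S, measurable S ->
    measurable_fun setT (fun x : 'rV[R]_d => pr_P Mt (Some x) (@pr_X R d Mt t @^-1` (Some @` S))).
  move=> t0; apply: kernel_meas => // f tf; move: t0; rewrite le_eqVlt => /orP[/eqP <-|t0].
    rewrite (_ : (fun x => _) = f); first exact: tst_meas.
    by apply/funext => x; rewrite (expect0 fil)//; [case: Mtr|exact: tst_meas].
  by apply: cont_meas; exact: fel.
have rc (K : process R d) : right_process K -> forall w (t : R), 0 <= t ->
    pr_X s w @[s --> t^'+] --> @pr_X R d K t w.
  by case=> _ _ _ _ [_ h _] w t; exact: h.
have ev (S : set (@cpath R d)) : path_borel S ->
    [/\ measurable (path_event Mt S), measurable (path_event M S) &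
        forall x, pr_P Mt (Some x) (path_event Mt S) = pr_P M (Some x) (path_event M S)].
  move=> /path_event_code[U mU HU]; rewrite (HU Mt (rc Mt Mtr)) (HU M (rc M Mr)).
  have h z := sample_law Mr Mtr kmeas agree z mU.
  by split=> [||x]; [have [] := h None|have [] := h None|have [] := h (Some x)].
have law x : path_law Mt x = path_law M x.
  by apply/funext => -[S bS]; have [_ _] := ev S bS; exact.
split.
- exact: (invariant_agree d2 dp lamL aa inv HT cv Mr ht Minv Mtr MP Mts fel).
- by move=> S /ev[].
- exact: law.
- by move=> Pr; rewrite (_ : path_law Mt = path_law M)//; apply/funext => x; exact: law.
Qed.
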